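(* In the setting of the context, with $z=Z_K(g)$ and $z_{cy(m)}=Z_K(g^{(m)})$ where $g^{(m)}$ is $g$ with $v$-component replaced by $\tau^m$: we have $z_{cy(0)}=z$; for every $m>0$ the element $z_{cy(m)}$ is fixed by $\mathrm{Gal}(\overline{\mathbb{Q}}/\widetilde{E}(cg(m)))$; and for every $m>0$, \[\sum_iC_iA_i\,Tr_{\widetilde{E}(cg(m+i))/\widetilde{E}(cg(m))}\big(z_{cy(m+i)}\big)=0\quad\text{in }R[Z_K(\mathbf{G},\mathbf{H})],\] where $C_i=q_v^{\,i\left(\sum_{j=1}^n(2n-2j+1)s_{n+1-j}-s_1\right)}$ and $Hep_{\mu_v}=\sum_iA_iX^i$.
   Context: Global setting: $F$ totally real with real place $f$, $E$ totally imaginary quadratic over $F$ (identified with its image under a fixed $f^+:E\to\mathbb{C}$ extending $f$); $(V,\phi)$ quadratic $F$-space of dimension $2n+1$, signature $(2n-1,2)$ at $f$ and $(2n+1,0)$ elsewhere; $(W,\psi)\subset V$ an $F$-hyperplane with compatible $E$-hermitian structure; $\mathbf{G}=\mathrm{Res}_{F/\mathbb{Q}}SO(V)$, $\mathbf{H}=\mathrm{Res}_{F/\mathbb{Q}}U(W)$. $X$ = oriented negative planes in $V\otimes_{F,f}\mathbb{R}$, $Y$ = negative $\mathbb{C}$-lines in $W\otimes_{F,f}\mathbb{R}$; for small compact open $K\subset\mathbf{G}(\mathbb{A}_f)$, $Z_K(g)$ is the image of $Y\times\{gK\}$ in $Sh_{\mathbf{G}}(K)=\mathbf{G}(\mathbb{Q})\backslash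 X\times\mathbf{G}(\mathbb{A}_f)/K$ and $Z_K(\mathbf{G},\mathbf{H})=\mathbf{H}(\mathbb{Q})\backslash\mathbf{G}(\mathbb{A}_f)/K$. Galois action: $\mathbf{T}^1=\ker(\mathrm{Res}_{E/\mathbb{Q}}\mathbb{G}_m\to\mathrm{Res}_{F/\mathbb{Q}}\mathbb{G}_m)$, $\det:\mathbf{H}\to\mathbf{T}^1$, $E[\infty]$ the union of ring class fields, $\mathrm{Art}^1_E:\mathbf{T}^1(\mathbb{A}_f)/\mathbf{T}^1(\mathbb{Q})\cong\mathrm{Gal}(E[\infty]/E)$ with $\mathrm{Art}^1_E(x/\bar x)=\mathrm{Art}_E(x)|_{E[\infty]}$ ($\mathrm{Art}_E$ sends uniformizers to geometric Frobenius); $\rho\in\mathrm{Gal}_E$ acts by $\rho Z_K(h)=Z_K(sh)$ when $\mathrm{Art}^1_E(\det s)=\rho|_{E[\infty]}$. Bad primes $S_1$ (finite, containing $2$ and a prime $\ell$) such that outside $S_1$, $E$, $\mathbf{G}$, $\mathbf{H}$ are unramified, $K=K_{S_1}\times\prod K_q$ with $K_q$ hyperspecial, $K_q\cap\mathbf{H}(\mathbb{Q}_q)$ hyperspecial, $g_q\in K_q$; $S$ = places of $F$ above $S_1$; $U^1_w(c)=\{a/\bar a:a\in(\mathcal{O}_{F,w}+\mathfrak{m}_w^c\mathcal{O}_{E,w})^\times\}$ for $w\notin S$; $U^1_S$ compact open in $\mathbf{T}^1(\prod_{t\in S_1}\mathbb{Q}_t)$ with $\mathbf{T}^1(\mathbb{Q})\cap(U^1_S\times\prod_{w\notin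 S}U^1_w(0))=1$ and $U^1_S\times\prod_{w\notin S}U^1_w(0)\subset\det(gKg^{-1}\cap\mathbf{H}(\mathbb{A}_f))$. Local data at $v$: $v$ is a place of $F$ not in $S$, inert in $E$, not dividing the discriminants of $W$ and $V$; $\pi_v$ a uniformizer, $q_v$ the residue cardinality. Choose $\eta\in\mathcal{O}_{E_v}^\times$ with $\eta+\bar\eta=0$, an orthogonal $E_v$-basis $w_1,\dots,w_n$ of $W_v$ and $v_n\perp W_v$ with $\phi(w_i,w_i),\phi(v_n,v_n)\in\mathcal{O}_{F_v}^\times$, normalized so that, with $v_{i-1}=\eta w_i$, $\phi(w_i,w_i)+\phi(v_i,v_i)=0$ for $1\le i\le n$; put $e_{\pm i}=\frac12(v_i\pm w_i)$, $e_0=v_0$. The $\mathcal{O}_{F_v}$-lattice $L_v$ spanned by $(e_n,\dots,e_1,e_0,e_{-1},\dots,e_{-n})$ defines the model $SO(L_v)$; the $v$-component of $K$ is $K_v=SO(L_v)(\mathcal{O}_{F_v})$ and $g_v=1$. $\mu_v$ is the cocharacter $t\mapsto\mathrm{diag}(t^{s_n},\dots,t^{s_1},1,t^{-s_1},\dots,t^{-s_n})$ in this ordered basis, with integers $0<s_1<\dots<s_n$; $\tau=\mu_v(\pi_v)$. $Hep_{\mu_v}$ is the Hecke polynomial of $(SO(V_v),K_v,\mu_v)$: $\det(X-q_v^{\langle\rho,\mu_v\rangle}r_{\mu_v}(\hat g))$, $r_{\mu_v}$ the irreducible representation of the dual group of highest weight $\mu_v$, coefficients viewed in $R[K_v\backslash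 SO(V_v)(F_v)/K_v]$ via the usual Satake isomorphism, acting on the right on $R[Z_K(\mathbf{G},\mathbf{H})]$ through the $v$-component ($Z_K(h)\cdot[K_vxK_v]=\sum_jZ_K(hx_j)$ for $K_vxK_v=\bigsqcup x_jK_v$); $R$ is the ring of integers of a finite extension of $\mathbb{Q}_\ell$ containing $q_v^{\pm1/2}$. Fields: $\widetilde{E}(cg(m))\subset E[\infty]$ is the fixed field of $\mathrm{Art}^1_E\big(U^1_S\times U^1_v(ms_1)\times\prod_{w\notin S\cup\{v\}}U^1_w(0)\big)$. $Tr_{L'/L}=\sum_{\sigma\in\mathrm{Gal}(L'/L)}\sigma$. *)

(* Defs.v *)
From HB Require Import structures.
From mathcomp Require Import all_boot all_order all_algebra all_field.
From mathcomp Require Import ring.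
From mathcomp Require Import all_classical.
From mathcomp Require Import finmap monalg.
Set Implicit Arguments. Unset Strict Implicit. Unset Printing Implicit Defensive.
Import Order.TTheory GRing.Theory Num.Theory.
Local Open Scope classical_set_scope.
Local Open Scope ring_scope.

(* [quad D] is K[t]/(t^2 - D); [Quad a b] stands for a + b t.  When K is a
   number field F and D is not a square this is the quadratic extension
   E = F(sqrt D), and over a completion F_w it is E_w = E (x)_F F_w, whether
   or not w splits in E. *)
Record quad (K : fieldType) (D : K) := Quad { qre : K; qim : K }.

Section QuadRing.
Variables (K : fieldType) (D : K).
Local Notation Q := (quad D).

Definition quad_pair (x : Q) := (qre x, qim x).
Definition pair_quad (p : K * K) : Q := Quad D p.1 p.2.
Lemma quad_pairK : cancel quad_pair pair_quad. Proof. by case. Qed.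
HB.instance Definition _ := Choice.copy Q (can_type quad_pairK).

Definition qadd (x y : Q) := Quad D (qre x + qre y) (qim x + qim y).
Definition qopp (x : Q) := Quad D (- qre x) (- qim x).
Definition qmul (x y : Q) :=
  Quad D (qre x * qre y + D * (qim x * qim y)) (qre x * qim y + qim x * qre y).

Lemma qaddA : associative qadd.
Proof. by move=> [a b] [c d] [e f]; rewrite /qadd /= !addrA. Qed.
Lemma qaddC : commutative qadd.
Proof. by move=> [a b] [c d]; rewrite /qadd /= addrC [b + d]addrC. Qed.
Lemma qadd0 : left_id (Quad D 0 0) qadd.
Proof. by move=> [a b]; rewrite /qadd /= !add0r. Qed.
Lemma qaddN : left_inverse (Quad D 0 0) qopp qadd.
Proof. by move=> [a b]; rewrite /qadd /= !addNr. Qed.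
HB.instance Definition _ := GRing.isZmodule.Build Q qaddA qaddC qadd0 qaddN.

Lemma qmulA : associative qmul.
Proof. by move=> [a b] [c d] [e f]; rewrite /qmul /=; congr Quad; ring. Qed.
Lemma qmulC : commutative qmul.
Proof. by move=> [a b] [c d]; rewrite /qmul /=; congr Quad; ring. Qed.
Lemma qmul1 : left_id (Quad D 1 0) qmul.
Proof. by move=> [a b]; rewrite /qmul /=; congr Quad; ring. Qed.
Lemma qmulD : left_distributive qmul +%R.
Proof. by move=> [a b] [c d] [e f]; rewrite /qmul /=; congr Quad => /=; ring. Qed.
Lemma qone_neq0 : Quad D 1 0 != 0.
Proof. by apply/eqP => -[] /eqP; rewrite oner_eq0. Qed.
HB.instance Definition _ :=
  GRing.Zmodule_isComNzRing.Build Q qmulA qmulC qmul1 qmulD qone_neq0.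

Definition qconj (x : Q) : Q := Quad D (qre x) (- qim x).
Definition qtr (x : Q) : K := qre x + qre x.
Definition qnorm (x : Q) : K := qre x ^+ 2 - D * qim x ^+ 2.
Definition qunit : {pred Q} := fun x => qnorm x != 0.
Definition qinv (x : Q) : Q :=
  if qunit x then Quad D (qre x / qnorm x) (- qim x / qnorm x) else x.

Lemma qmulV : {in qunit, left_inverse 1 qinv *%R}.
Proof.
move=> [a b] ux; rewrite /qinv (_ : qunit _ = true) //.
have {ux} : qnorm (Quad D a b) != 0 by [].
rewrite /qnorm /= => nz.
by congr Quad => /=; field.
Qed.
Lemma qunitP (x y : Q) : y * x = 1 -> qunit x.
Proof.
move=> yx1; apply/negP => /eqP x0.
have : qnorm y * qnorm x = qnorm (y * x).
  by case: x y {yx1 x0} => [a b] [c d]; rewrite /qnorm /=; ring.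
rewrite yx1 x0 mulr0 /qnorm /= expr1n expr0n mulr0 subr0 => /eqP.
by rewrite eq_sym oner_eq0.
Qed.
Lemma qinv_out : {in [predC qunit], qinv =1 id}.
Proof. by move=> x /negbTE nx; rewrite /qinv (_ : qunit x = false). Qed.
HB.instance Definition _ :=
  GRing.ComNzRing_hasMulInverse.Build Q qmulV qunitP qinv_out.

Definition qin (a : K) : Q := Quad D a 0.

End QuadRing.

Definition qmap (K L : fieldType) (phi : K -> L) (D : K) (x : quad D) :
  quad (phi D) := Quad (phi D) (phi (qre x)) (phi (qim x)).

(* A normalized discrete valuation.  When K is a number field (presented as a
   field or as [quad D]) these are exactly its finite places.  Only values at
   nonzero elements matter; [place_val 0] is pinned so that a place is
   determined by its valuation. *)
Record place (K : comNzRingType) := Place {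
  place_val :> K -> int;
  place_val0 : place_val 0 = 0;
  place_valM : forall x y, x != 0 -> y != 0 ->
    place_val (x * y) = place_val x + place_val y;
  place_valD : forall x y, x != 0 -> y != 0 -> x + y != 0 ->
    Num.min (place_val x) (place_val y) <= place_val (x + y);
  place_unif : exists2 x, x != 0 & place_val x = 1 }.

HB.instance Definition _ (K : comNzRingType) := gen_eqMixin (place K).

(* x lies in the k-th power of the maximal ideal *)
Definition vge (K : comNzRingType) (u : place K) (k : int) (x : K) : Prop :=
  x = 0 \/ k <= u x.

Definition vunit (K : comNzRingType) (u : place K) (x : K) : Prop :=
  x != 0 /\ u x = 0.

Definition residue_card (K : comNzRingType) (u : place K) (q : nat) : Prop :=
  exists r : 'I_q -> K,
    [/\ forall i, vge u 0 (r i),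
        forall i j, vge u 1 (r i - r j) -> i = j &
        forall x, vge u 0 x -> exists i, vge u 1 (x - r i)].

Record completion (K : fieldType) (w : place K) := Completion {
  comp_sort :> fieldType;
  comp_val : place comp_sort;
  comp_inj : {rmorphism K -> comp_sort};
  comp_valE : forall x, comp_val (comp_inj x) = w x;
  comp_dense : forall (x : comp_sort) (k : int),
    exists a, vge comp_val k (x - comp_inj a);
  comp_complete : forall x : nat -> comp_sort,
    (forall k : int, exists N, forall i j, (N <= i)%N -> (N <= j)%N ->
       vge comp_val k (x i - x j)) ->
    exists l, forall k : int, exists N, forall i, (N <= i)%N ->
       vge comp_val k (x i - l) }.

Definition completions (F : fieldType) := forall w : place F, completion w.

Record conductor (F : fieldType) := Conductor {
  cond_exp :> place F -> nat;
  cond_fin : finite_set [set w | cond_exp w <> 0%N] }.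

(* [ldiv x y] is x^-1 y and [nbhd] is a basis of neighbourhoods of 1 consisting
   of open subgroups of a complete group: a subgroup is open iff it contains
   some [nbhd i]; it is then closed, hence compact iff totally bounded. *)
Definition compact_open_subgroup (T I : Type) (one : T) (ldiv : T -> T -> T)
    (nbhd : I -> set T) (A : set T) : Prop :=
  [/\ A one,
      forall x y, A x -> A y -> A (ldiv x y),
      exists i, nbhd i `<=` A &
      forall i, exists B : set T, [/\ finite_set B, B `<=` A &
        forall x, A x -> exists2 b, B b & nbhd i (ldiv b x)]].

Section Forms.
Variables (K : fieldType) (D : K).

Definition bil m (Phi : 'M[K]_m) (x y : 'cV[K]_m) : K :=
  (x^T *m Phi *m y) 0 0.
Definition conjmx m k (M : 'M[quad D]_(m, k)) := map_mx (@qconj K D) M.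
Definition herm m (Psi : 'M[quad D]_m) (x y : 'cV[quad D]_m) : quad D :=
  ((conjmx x)^T *m Psi *m y) 0 0.
Definition qinmx m k (M : 'M[K]_(m, k)) : 'M[quad D]_(m, k) := map_mx (qin D) M.
End Forms.

Definition signature (F : fieldType) (f : F -> algC) m (Phi : 'M[F]_m)
    (a b : nat) : Prop :=
  [/\ (a + b)%N = m &
      exists P : 'M[algC]_m,
        [/\ forall i j, P i j \is Num.real, P \in unitmx &
            P^T *m map_mx f Phi *m P
              = diag_mx (\row_(i < m) if (i < a)%N then 1 else -1)]].

(* An E-hermitian hyperplane (W, psi) of V = F^(2n+1).  W is the orthogonal of
   the anisotropic vector [perp]; [coordW] is the F-linear map V -> E^n that
   kills [perp] and on W gives the coordinates of an E-basis of W (injective on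
   W by [hcompat] and nondegeneracy of Phi, hence bijective by dimension).
   [Psi] is the Gram matrix of psi in that basis, antilinear in its first
   variable, and phi = Tr_{E/F} psi on W. *)
Record hermitian_hyperplane (F : fieldType) (D : F) (n : nat)
    (Phi : 'M[F]_n.*2.+1) := HermitianHyperplane {
  perp : 'cV[F]_n.*2.+1;
  coordW : 'M[quad D]_(n, n.*2.+1);
  Psi : 'M[quad D]_n;
  perp_aniso : bil Phi perp perp != 0;
  coordW_perp : coordW *m qinmx D perp = 0;
  Psi_herm : (conjmx Psi)^T = Psi;
  Psi_nondeg : Psi \in unitmx;
  hcompat : forall x y, bil Phi x perp = 0 -> bil Phi y perp = 0 ->
    bil Phi x y
      = qtr (herm Psi (coordW *m qinmx D x) (coordW *m qinmx D y)) }.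

(* Points of SO(V) and U(W) over an extension phi : F -> L.  [Upt x h]: the
   matrix x over L is the image in SO(V) of the unitary matrix h over E (x) L,
   i.e. x fixes W^perp and acts on W through h. *)
Section Points.
Variables (F : fieldType) (D : F) (n : nat) (Phi : 'M[F]_n.*2.+1).
Variable (W : hermitian_hyperplane D Phi).
Variables (L : fieldType) (phi : F -> L).

Definition SOpt (x : 'M[L]_n.*2.+1) : Prop :=
  x^T *m map_mx phi Phi *m x = map_mx phi Phi /\ \det x = 1.

Definition PhiL : 'M[L]_n.*2.+1 := map_mx phi Phi.
Definition perpL : 'cV[L]_n.*2.+1 := map_mx phi (perp W).
Definition PsiL : 'M[quad (phi D)]_n := map_mx (qmap phi (D:=D)) (Psi W).
Definition coordL : 'M[quad (phi D)]_(n, n.*2.+1) :=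
  map_mx (qmap phi (D:=D)) (coordW W).

Definition Upt (x : 'M[L]_n.*2.+1) (h : 'M[quad (phi D)]_n) : Prop :=
  [/\ SOpt x, (conjmx h)^T *m PsiL *m h = PsiL,
      x *m perpL = perpL & coordL *m qinmx (phi D) x = h *m coordL].
End Points.

(* Points over the finite adeles are families indexed by the places of F;
   elements of E (x) A_f are families of elements of E_w = E (x)_F F_w. *)
Notation Ew Fw D w := (quad (comp_inj (Fw w) D)).
Notation Efam Fw D := (forall w, Ew Fw D w).

Section Adelic.
Variables (F : fieldExtType rat) (D : F) (Fw : completions F).

(* O_{E,w}: integral closure of O_{F,w} in E_w *)
Definition OE w (x : Ew Fw D w) : Prop :=
  vge (comp_val (Fw w)) 0 (qtr x) /\ vge (comp_val (Fw w)) 0 (qnorm x).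
Definition OEunit w (x : Ew Fw D w) : Prop :=
  [/\ x \is a GRing.unit, OE x & OE x^-1].

(* m_w^c O_{E,w} *)
Definition OEge w (c : nat) (x : Ew Fw D w) : Prop :=
  exists a y, [/\ vge (comp_val (Fw w)) c%:Z a, OE y & x = qin _ a * y].

(* the order O_{F,w} + m_w^c O_{E,w} and its unit group *)
Definition Eorder w (c : nat) (x : Ew Fw D w) : Prop :=
  exists b y, [/\ vge (comp_val (Fw w)) 0 b, OEge c y & x = qin _ b + y].
Definition Eorder_unit w (c : nat) (x : Ew Fw D w) : Prop :=
  [/\ x \is a GRing.unit, Eorder c x & Eorder c x^-1].

Definition U1 w (c : nat) (t : Ew Fw D w) : Prop :=
  exists2 a, Eorder_unit c a & t = a / qconj a.

Definition Eidele (x : Efam Fw D) : Prop :=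
  (forall w, x w \is a GRing.unit) /\ finite_set [set w | ~ OEunit (x w)].
Definition Fidele (y : forall w, Fw w) : Prop :=
  (forall w, y w != 0)
  /\ finite_set [set w | ~ vunit (comp_val (Fw w)) (y w)].
Definition T1ad (t : Efam Fw D) : Prop :=
  (forall w, t w * qconj (t w) = 1) /\ finite_set [set w | ~ OE (t w)].

Definition Emul (x y : Efam Fw D) : Efam Fw D := fun w => x w * y w.
Definition Eone : Efam Fw D := fun _ => 1.
Definition Eldiv (x y : Efam Fw D) : Efam Fw D := fun w => (x w)^-1 * y w.
Definition Ediag (e : quad D) : Efam Fw D := fun w => qmap (comp_inj (Fw w)) e.
Definition FtoE (y : forall w, Fw w) : Efam Fw D := fun w => qin _ (y w).

(* ring endomorphisms of algC, all of which are bijective *)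
Definition autC := {rmorphism algC -> algC}.
HB.instance Definition _ := gen_eqMixin autC.
HB.instance Definition _ := gen_choiceMixin autC.

Definition galfix (L : set algC) : set autC :=
  [set r : {rmorphism algC -> algC} | forall a, L a -> r a = a].

Variable fplus : {rmorphism quad D -> algC}.

Definition GalE : set autC := galfix (range fplus).

(* maximal abelian extension: fixed field of the commutator subgroup *)
Definition Eab : set algC :=
  [set a | forall r t : {rmorphism algC -> algC}, GalE r -> GalE t ->
     r (t a) = t (r a)].

Definition above (u : place (quad D)) (w : place F) : Prop :=
  forall a : F, a != 0 -> (0 < u (qin D a)) = (0 < w a).

(* an idele that is a uniformizer at u and 1 at all other places of E; being a
   uniformizer at u and 1 at the other places above w is tested on
   approximations of the component at w by elements of E *)
Definition uniformizer_idele (u : place (quad D)) (x : Efam Fw D) : Prop :=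
  exists w, [/\ above u w, forall w', w' <> w -> x w' = 1,
    x w \is a GRing.unit &
    forall N : nat, exists y : quad D,
      [/\ OEge N (x w - Ediag y w), y != 0, u y = 1 &
          forall u', above u' w -> u' <> u -> vge u' N%:Z (y - 1)]].

(* primes of the ring of algebraic integers above u *)
Definition prime_above (u : place (quad D)) (P : set algC) : Prop :=
  [/\ [/\ forall a, P a -> a \in Aint,
          forall a b, P a -> P b -> P (a + b) &
          forall a b, a \in Aint -> P b -> P (a * b)],
      ~ P 1,
      forall a b, a \in Aint -> b \in Aint -> P (a * b) -> P a \/ P b &
      forall e, fplus e \in Aint -> (P (fplus e) <-> vge u 1 e)].

Definition inertia (P : set algC) : set autC :=
  [set r : {rmorphism algC -> algC} | GalE r /\
     forall b, b \in Aint -> P (r b - b)].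
(* arithmetic Frobenius elements at P *)
Definition frobenius (P : set algC) (q : nat) : set autC :=
  [set r : {rmorphism algC -> algC} | GalE r /\
     forall b, b \in Aint -> P (r b - b ^+ q)].

Definition congruent1 (c : place F -> nat) (x : Efam Fw D) : Prop :=
  forall w, OEunit (x w) /\ OEge (c w) (x w - 1).

(* Art_E on finite ideles (E is totally imaginary).  [art x] is any lift of
   Art_E(x) to algC, so that only its restriction to [Eab] is meaningful.
   [artin_frob]: uniformizers at u act as geometric Frobenius on the elements
   of [Eab] that are fixed by inertia above u. *)
Record artin_map (art : Efam Fw D -> autC) : Prop := {
  artin_gal : forall x, Eidele x -> GalE (art x);
  artin_mul : forall x y a, Eidele x -> Eidele y -> Eab a ->
    art (Emul x y) a = art x (art y a);
  artin_principal : forall (e : quad D) a, e != 0 -> Eab a ->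
    art (Ediag e) a = a;
  artin_cont : forall a, Eab a -> exists c : conductor F,
    forall x, congruent1 c x -> art x a = a;
  artin_frob : forall u q P x a (r : {rmorphism algC -> algC}),
    residue_card u q -> prime_above u P -> uniformizer_idele u x ->
    Eab a -> (forall t : {rmorphism algC -> algC}, inertia P t -> t a = a) ->
    frobenius P q r -> r (art x a) = a }.

(* The ring class field of conductor c is cut out by
   A_{F,f}^x prod_w (O_{F,w} + m_w^(c_w) O_{E,w})^x; it has to be fixed by
   Art_E(A_{F,f}^x) for Art^1_E(x / xbar) = Art_E(x) to make sense. *)
Definition ring_class_field (art : Efam Fw D -> autC) (c : conductor F) :
    set algC :=
  [set a | [/\ Eab a,
     forall z, (forall w, Eorder_unit (c w) (z w)) -> art z a = a &
     forall y, Fidele y -> art (FtoE y) a = a]].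

Definition Einfty (art : Efam Fw D -> autC) : set algC :=
  [set a | exists c, ring_class_field art c a].

(* Art^1_E : T^1(A_f)/T^1(Q) -> Gal(E[oo]/E), again through lifts to algC *)
Record artin1_map (art art1 : Efam Fw D -> autC) : Prop := {
  artin1_gal : forall t, T1ad t -> GalE (art1 t);
  artin1_mul : forall t t' a, T1ad t -> T1ad t' -> Einfty art a ->
    art1 (Emul t t') a = art1 t (art1 t' a);
  artin1_ker : forall t, T1ad t ->
    ((forall a, Einfty art a -> art1 t a = a) <->
     exists2 e : quad D, e * qconj e = 1 & t = Ediag e);
  artin1_surj : forall r : {rmorphism algC -> algC}, GalE r ->
    exists2 t, T1ad t & forall a, Einfty art a -> art1 t a = r a;
  artin1_art : forall x a, Eidele x -> Einfty art a ->
    art1 (fun w => x w / qconj (x w)) a = art x a }.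

Definition fixed_field (art art1 : Efam Fw D -> autC) (U : set (Efam Fw D)) :
    set algC :=
  [set a | Einfty art a /\ forall t, U t -> art1 t a = a].

Variables (n : nat) (Phi : 'M[F]_n.*2.+1) (W : hermitian_hyperplane D Phi).

Definition Gfam := forall w, 'M[Fw w]_n.*2.+1.

Definition mxint w (M : 'M[Fw w]_n.*2.+1) : Prop :=
  forall i j, vge (comp_val (Fw w)) 0 (M i j).
Definition mxge w (c : nat) (M : 'M[Fw w]_n.*2.+1) : Prop :=
  forall i j, vge (comp_val (Fw w)) c%:Z (M i j).
Definition mxOE w (M : 'M[Ew Fw D w]_n) : Prop := forall i j, OE (M i j).

Definition SOw w : set 'M[Fw w]_n.*2.+1 := SOpt Phi (comp_inj (Fw w)).

Definition Gad : set Gfam :=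
  [set g | (forall w, SOw (g w)) /\ finite_set [set w | ~ mxint (g w)]].

Definition Gone : Gfam := fun _ => 1%:M.
Definition Gmul (x y : Gfam) : Gfam := fun w => x w *m y w.
Definition Gldiv (x y : Gfam) : Gfam := fun w => invmx (x w) *m y w.

(* s in H(A_f), seen in G(A_f), with determinant t in T^1(A_f) *)
Definition Hdet (s : Gfam) (t : Efam Fw D) : Prop :=
  Gad s /\ forall w, exists2 h, Upt W (s w) h & t w = \det h.

Definition HQ : set Gfam :=
  [set x | exists gamma : 'M[F]_n.*2.+1,
     (exists h, Upt W (phi := idfun) gamma h)
     /\ x = fun w => map_mx (comp_inj (Fw w)) gamma].

Definition Gnbhd (c : conductor F) : set Gfam :=
  [set x | Gad x /\ forall w, mxge (c w) (x w - 1%:M)].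

Definition compact_open_G (K : set Gfam) : Prop :=
  K `<=` Gad /\ compact_open_subgroup Gone Gldiv Gnbhd K.

(* Hyperspecial subgroups of SO(V_w) and U(W_w) for w prime to 2 and unramified
   in E: stabilizers of lattices on which a multiple of the form is perfect.
   Their existence contains the unramifiedness of the group at w. *)
Definition hyperspecialG w (Kw : set 'M[Fw w]_n.*2.+1) : Prop :=
  exists (B : 'M[Fw w]_n.*2.+1) (c : Fw w),
    let M := c *: (B^T *m PhiL Phi (comp_inj (Fw w)) *m B) in
    [/\ B \in unitmx, c != 0, mxint M, vunit (comp_val (Fw w)) (\det M) &
        forall x, Kw x <-> SOw x /\ mxint (invmx B *m x *m B)].

(* the subgroup of U(W_w) cut out by Kw is hyperspecial *)
Definition hyperspecialH w (Kw : set 'M[Fw w]_n.*2.+1) : Prop :=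
  exists (B : 'M[Ew Fw D w]_n) (c : Fw w),
    let M := qin _ c *: ((conjmx B)^T *m PsiL W (comp_inj (Fw w)) *m B) in
    [/\ B \in unitmx, c != 0, mxOE M, OEunit (\det M) &
        forall x h, Upt W x h -> (Kw x <-> mxOE (invmx B *m h *m B))].

Variable K : set Gfam.

Definition Zclass (g : Gfam) : set Gfam :=
  [set x | exists gamma k, [/\ HQ gamma, K k & x = Gmul (Gmul gamma g) k]].

(* Z_K(G,H) = H(Q) \ G(A_f) / K *)
Record ZK := ZKset {
  Zset :> set Gfam;
  Zset_class : exists2 g, Gad g & Zset = Zclass g }.
HB.instance Definition _ := gen_eqMixin ZK.
HB.instance Definition _ := gen_choiceMixin ZK.

Lemma Gad_one : Gad Gone.
Proof.
split=> [w|]; first by split; rewrite ?det1 // /Gone trmx1 mul1mx mulmx1.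
rewrite (_ : [set w | _] = set0) //.
apply/seteqP; split=> w //=; apply => i j.
rewrite /Gone mxE; case: eqP => _ /=; last by left.
have one_nz := oner_neq0 (Fw w).
right; have := place_valM (comp_val (Fw w)) one_nz one_nz.
by rewrite mulr1 => /eqP; rewrite -subr_eq0 opprD addrA subrr add0r oppr_eq0 => /eqP->.
Qed.

(* Z_K(g); the value at a family outside G(A_f) is irrelevant *)
Definition Zcyc (g : Gfam) : ZK :=
  match pselect (Gad g) with
  | left gad => ZKset (ex_intro2 _ _ g gad erefl)
  | right _ => ZKset (ex_intro2 _ _ Gone Gad_one erefl)
  end.

Definition Zrep (z : ZK) : Gfam := xget Gone [set g | Gad g /\ Zset z = Zclass g].

(* "gact" is only constrained on Gal_E; the relation determines it there, as
   Art^1_E is onto and det : H(A_f) -> T^1(A_f) is onto. *)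
Definition galois_action (art art1 : Efam Fw D -> autC)
    (gact : autC -> ZK -> ZK) : Prop :=
  forall (r : {rmorphism algC -> algC}) s t h,
    GalE r -> Hdet s t -> Gad h ->
    (forall a, Einfty art a -> art1 t a = r a) ->
    gact r (Zcyc h) = Zcyc (Gmul s h).

(* Gal(L'/L): the restrictions to L' of the automorphisms fixing L, each
   represented by the set of its extensions to algC *)
Definition gal_rel (L' L : set algC) : set (set autC) :=
  [set [set r' : {rmorphism algC -> algC} |
          galfix L r' /\ forall a, L' a -> r' a = (r : {rmorphism algC -> algC}) a]
  | r in galfix L].

Variable R : comUnitRingType.

Definition idC : autC := idfun : {rmorphism algC -> algC}.

Definition Zbasis (z : ZK) : {malg R[ZK]} := << z >>.

(* Tr_{L'/L} of a cycle z fixed by the automorphisms trivial on L' *)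
Definition gal_trace (gact : autC -> ZK -> ZK) (L' L : set algC) (z : ZK) :
    {malg R[ZK]} :=
  \sum_(c \in gal_rel L' L) Zbasis (gact (xget idC c) z).

Variables (v : place F) (Kv : set 'M[Fw v]_n.*2.+1).

Definition lcoset (x : 'M[Fw v]_n.*2.+1) : set 'M[Fw v]_n.*2.+1 :=
  [set y | exists2 k, Kv k & y = x *m k].

Record dcoset := DCoset {
  dcset :> set 'M[Fw v]_n.*2.+1;
  dcset_class : exists2 x, SOw x &
    dcset = [set y | exists k1 k2, [/\ Kv k1, Kv k2 & y = k1 *m x *m k2]] }.
HB.instance Definition _ := gen_eqMixin dcoset.
HB.instance Definition _ := gen_choiceMixin dcoset.

Definition lcosets (A : set 'M[Fw v]_n.*2.+1) := [set lcoset x | x in A].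

Definition updv (g : Gfam) (x : 'M[Fw v]_n.*2.+1) : Gfam := dfwith g v x.

Definition hecke_basis (z : ZK) (C : dcoset) : {malg R[ZK]} :=
  let h := Zrep z in
  \sum_(c \in lcosets C) Zbasis (Zcyc (updv h (h v *m xget 1%:M c))).

Definition hecke (x : {malg R[ZK]}) (A : {malg R[dcoset]}) : {malg R[ZK]} :=
  \sum_(z <- enum_fset (msupp x)) \sum_(C <- enum_fset (msupp A))
     (x@_z * A@_C) *: hecke_basis z C.

End Adelic.

(* A cocharacter t |-> diag(t^(l_0), .., t^(l_(n-1)), 1, t^(- l_(n-1)), ..,
   t^(- l_0)) of the diagonal torus is recorded by (l_0, .., l_(n-1)); l_k is
   the exponent on e_(n-k). *)
Definition cochar_exp n (l : {ffun 'I_n -> int}) (k : nat) : int :=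
  if insub k is Some i then l i
  else if insub (n.*2 - k)%N is Some i then - l i else 0.

Definition cochar_mx (K : fieldType) n (x : K) (l : {ffun 'I_n -> int}) :
    'M[K]_n.*2.+1 :=
  diag_mx (\row_(k < n.*2.+1) x ^ (cochar_exp l k)).

(* <2 rho, l>, for the upper triangular Borel subgroup *)
Definition two_rho n (l : {ffun 'I_n -> int}) : int :=
  \sum_(k < n) ((n - k).*2.-1)%:Z * l k.

Definition unitriangular (K : fieldType) m (M : 'M[K]_m) : Prop :=
  (forall i j : 'I_m, (j < i)%N -> M i j = 0) /\ forall i, M i i = 1.

Section Dual.
Variables (Om : closedFieldType) (n : nat).

Definition sp_form : 'M[Om]_n.*2 :=
  \matrix_(i, j) if (i + j == n.*2.-1)%N then (if (i < n)%N then 1 else -1)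
                 else 0.
Definition Sp : set 'M[Om]_n.*2 := [set x | x^T *m sp_form *m x = sp_form].

Definition dual_torus (t : 'I_n -> Om) : 'M[Om]_n.*2 :=
  diag_mx (\row_(k < n.*2)
    if insub (k : nat) is Some i then t i
    else if insub (n.*2.-1 - k)%N is Some i then (t i)^-1 else 1).

Inductive polyfun : ('M[Om]_n.*2 -> Om) -> Prop :=
| polyfun_const c : polyfun (fun _ => c)
| polyfun_entry i j : polyfun (fun x => x i j)
| polyfun_add f g : polyfun f -> polyfun g -> polyfun (fun x => f x + g x)
| polyfun_mul f g : polyfun f -> polyfun g -> polyfun (fun x => f x * g x).

(* r is an irreducible rational representation of Sp_2n on column vectors, of
   highest weight l for the upper triangular Borel subgroup; the rows of the
   matrix U span (the transpose of) an invariant subspace *)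
Record irrep_highest_weight N (r : 'M[Om]_n.*2 -> 'M[Om]_N)
    (l : {ffun 'I_n -> int}) : Prop := {
  rep_one : r 1%:M = 1%:M;
  rep_mul : forall x y, Sp x -> Sp y -> r (x *m y) = r x *m r y;
  rep_rational : forall i j, exists2 f, polyfun f &
    forall x, Sp x -> r x i j = f x;
  rep_irr : forall U : 'M[Om]_N,
    (forall x, Sp x -> stablemx U (r x)^T) -> U = 0 \/ row_full U;
  rep_hw : exists2 u : 'cV[Om]_N, u != 0 &
    (forall x, Sp x -> unitriangular x -> r x *m u = u)
    /\ (forall t, (forall k, t k != 0) ->
          r (dual_torus t) *m u = (\prod_(k < n) t k ^ l k) *: u) }.
End Dual.

Section Satake.
Variables (F : fieldExtType rat) (Fw : completions F) (n : nat).
Variables (Phi : 'M[F]_n.*2.+1) (v : place F) (Kv : set 'M[Fw v]_n.*2.+1).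
(* [B] is the matrix of the ordered basis (e_n, .., e_(-n)) *)
Variables (B : 'M[Fw v]_n.*2.+1) (pi : Fw v).
Variables (R : comUnitRingType) (Om : closedFieldType).
Variables (iota : {rmorphism R -> Om}) (sq : R).

Definition cocharV (l : {ffun 'I_n -> int}) : 'M[Fw v]_n.*2.+1 :=
  B *m cochar_mx pi l *m invmx B.

(* the Iwasawa cell N l(pi) K_v *)
Definition iwasawa (l : {ffun 'I_n -> int}) : set 'M[Fw v]_n.*2.+1 :=
  [set x | exists u k, [/\ SOw Phi u, unitriangular (invmx B *m u *m B), Kv k &
     x = u *m cocharV l *m k]].

(* Coefficient at l of the Satake transform delta^(1/2)(t) int_N f(t u) du of
   the characteristic function of C, in the form delta^(1/2)(l(pi)) times the
   number of left cosets x K_v of C with x in N l(pi) K_v, where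
   delta^(1/2)(l(pi)) = q^(- <rho, l>) and sq = q^(1/2). *)
Definition satake_dc (C : dcoset Phi Kv) (l : {ffun 'I_n -> int}) : Om :=
  (iota sq) ^ (- two_rho l)
  * \sum_(c \in lcosets Kv (dcset C `&` iwasawa l)) (1 : Om).

Definition satake (A : {malg R[dcoset Phi Kv]}) (l : {ffun 'I_n -> int}) : Om :=
  \sum_(C <- enum_fset (msupp A)) iota A@_C * satake_dc C l.

(* Satake transform as a function on the dual torus *)
Definition satake_torus (A : {malg R[dcoset Phi Kv]}) (t : 'I_n -> Om) : Om :=
  \sum_(l \in [set: {ffun 'I_n -> int}]) satake A l * \prod_(k < n) t k ^ l k.

(* sum_i A_i X^i = det(X - q^(<rho, l>) r(g^)) as functions on the dual torus *)
Definition hecke_polynomial (l : {ffun 'I_n -> int}) N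
    (r : 'M[Om]_n.*2 -> 'M[Om]_N) (A : nat -> {malg R[dcoset Phi Kv]}) : Prop :=
  forall t, (forall k, t k != 0) -> forall i,
    satake_torus (A i) t
      = (char_poly ((iota sq) ^ (two_rho l) *: r (dual_torus t)))`_i.
End Satake.

Section Local.
Variables (F : fieldExtType rat) (D : F) (Fw : completions F) (n : nat).
Variables (Phi : 'M[F]_n.*2.+1) (W : hermitian_hyperplane D Phi) (v : place F).

Definition inert : Prop :=
  exists2 u : place (quad D), (forall a, u (qin D a) = v a) &
    forall u', above u' v -> u' = u.

(* disc V is a class modulo squares, disc W a class modulo norms from E *)
Definition prime_to_discV : Prop :=
  exists2 c : F, c != 0 & vunit v (c ^+ 2 * \det Phi).
Definition prime_to_discW : Prop :=
  exists2 e : quad D, e != 0 & vunit v (qnorm e * qre (\det (Psi W))).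

Let phi := comp_inj (Fw v).
Let b := bil (PhiL Phi phi).
Let cW (x : 'cV[Fw v]_n.*2.+1) := coordL W phi *m qinmx (phi D) x.

(* w_1, .., w_n and v_0, .., v_n are the values of [ws] and [vs] *)
Record local_basis (eta : Ew Fw D v) (ws vs : nat -> 'cV[Fw v]_n.*2.+1) :
    Prop := {
  lb_eta : OEunit eta /\ eta + qconj eta = 0;
  lb_inW : forall i, (0 < i <= n)%N -> b (ws i) (perpL W phi) = 0;
  lb_basis : (\matrix_(a < n, j < n) cW (ws j.+1) a 0) \in unitmx;
  lb_orth : forall i j, (0 < i <= n)%N -> (0 < j <= n)%N -> i <> j ->
    herm (PsiL W phi) (cW (ws i)) (cW (ws j)) = 0;
  lb_unit : forall i, (0 < i <= n)%N ->
    vunit (comp_val (Fw v)) (b (ws i) (ws i));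
  lb_vn : (forall x, b x (perpL W phi) = 0 -> b (vs n) x = 0)
    /\ vunit (comp_val (Fw v)) (b (vs n) (vs n));
  lb_vs : forall i, (0 < i <= n)%N ->
    b (vs i.-1) (perpL W phi) = 0 /\ cW (vs i.-1) = eta *: cW (ws i);
  lb_norm : forall i, (0 < i <= n)%N ->
    b (ws i) (ws i) + b (vs i) (vs i) = 0 }.

(* columns e_n, .., e_1, e_0, e_(-1), .., e_(-n) *)
Definition frame (ws vs : nat -> 'cV[Fw v]_n.*2.+1) : 'M[Fw v]_n.*2.+1 :=
  \matrix_(i, k)
    (if (k < n)%N then 2%:R^-1 *: (vs (n - k)%N + ws (n - k)%N)
     else if (k == n :> nat)%N then vs 0%N
     else 2%:R^-1 *: (vs (k - n)%N - ws (k - n)%N)) i 0.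

(* SO(L)(O_{F_v}), L the lattice spanned by the columns of B *)
Definition stab_lattice (B : 'M[Fw v]_n.*2.+1) : set 'M[Fw v]_n.*2.+1 :=
  [set x | SOw Phi x /\ mxint (invmx B *m x *m B)].
End Local.

Section Levels.
Variables (F : fieldExtType rat) (D : F) (Fw : completions F) (n : nat).
Variable S1 : seq nat.

Definition Sabove (w : place F) : Prop := exists2 t, t \in S1 & 0 < w t%:R.

Definition Etrunc (t : Efam Fw D) : Efam Fw D :=
  fun w => if pselect (Sabove w) then t w else 1.
Definition Gtrunc (x : Gfam Fw n) : Gfam Fw n :=
  fun w => if pselect (Sabove w) then x w else 1%:M.

(* T^1(prod_{t in S1} Q_t), embedded in T^1(A_f) by 1 outside S *)
Definition T1S : set (Efam Fw D) :=
  [set t | T1ad t /\ forall w, ~ Sabove w -> t w = 1].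
Definition T1Snbhd (c : conductor F) : set (Efam Fw D) :=
  [set t | T1S t /\ forall w, Sabove w -> OEge (c w) (t w - 1)].
Definition compact_open_T1S (US : set (Efam Fw D)) : Prop :=
  US `<=` T1S /\ compact_open_subgroup (@Eone _ _ _) (@Eldiv _ _ _) T1Snbhd US.

(* U^1_S x prod_{w notin S} U^1_w(c_w) *)
Definition Ulevel (US : set (Efam Fw D)) (c : place F -> nat) :
    set (Efam Fw D) :=
  [set t | [/\ T1ad t, US (Etrunc t) & forall w, ~ Sabove w -> U1 (c w) (t w)]].

(* K = K_S x prod_{w notin S} Kloc w *)
Definition level_product (Phi : 'M[F]_n.*2.+1) (K : set (Gfam Fw n))
    (Kloc : forall w, set 'M[Fw w]_n.*2.+1) : Prop :=
  forall x, Gad Phi x ->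
    (K x <-> K (Gtrunc x) /\ forall w, ~ Sabove w -> Kloc w (x w)).
End Levels.

(* R is the ring of integers of the finite extension L of the l-adic field Ql *)
Definition is_integer_ring (lam : place rat) (Ql : completion lam)
    (L : fieldExtType Ql) (R : comUnitRingType) (inc : {rmorphism R -> L}) :
    Prop :=
  injective inc /\ forall x : L,
    (exists y, x = inc y) <->
    exists2 p : {poly Ql}, p \is monic &
      (forall i, vge (comp_val Ql) 0 p`_i) /\ root (map_poly (in_alg L) p) x.

(* Main.v *)
(* At v, write G = SO(J) with J the antidiagonal Gram matrix of the frame, I for
   the Iwahori subgroup and tau = mu(pi).  By the Satake isomorphism the highest
   weight q^<rho, mu> mu is a root of the Hecke polynomial on the unipotent
   coinvariants N \ G / K.  Hence sum_i A_i applied to I tau^i K / K, an element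
   of R[I \ G / K], has zero image there; as I l K meets N l' K only if l <= l'
   in the partial-sum order, with equality only for l = l', it vanishes already
   in R[G / K].

   Translating by tau^m turns I tau^i K / K into a sum of cycles Z(tau^m a).  A
   Gram-Schmidt process over E replaces a unipotent u in tau^m I tau^-m by a
   unitary element whose determinant lies in U^1_v(m s_1), up to a factor that
   tau^(m + i) conjugates into K; averaging over the rotations of the line of w_1
   then identifies the sum with C_i times the trace of z_cy(m + i), as Z(h y)
   depends only on det h for unitary h.  On the Galois side a compactness argument
   shows that an automorphism fixing the field of level U is given on E[oo] by an
   element of U, so that traces become sums over quotients of levels. *)
Require Import Defs.
From HB Require Import structures.
From mathcomp Require Import all_boot all_order all_algebra all_field.
From mathcomp Require Import all_classical.
From mathcomp Require Import monalg.
From mathcomp Require Import finmap ring zify.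
Set Implicit Arguments. Unset Strict Implicit. Unset Printing Implicit Defensive.
Import Order.TTheory GRing.Theory Num.Theory.
Local Open Scope classical_set_scope.
Local Open Scope ring_scope.

(** The constant [C_i] is a ratio of two counts. The set I tau^i K / K has q^(i <2 rho, mu>)
    elements, and the same power appears on the spectral side, half of it from the factor q^<rho,
    mu> in the Hecke polynomial and half from delta^(1/2) in the Satake transform. Between the
    levels m s_1 and (m + i) s_1 the norm-one group at v has q^(i s_1) classes. As q is a unit of R,
    the averaged identity can be divided by this number. The condition m > 0 is what starts the
    Gram-Schmidt process: it makes tau^m u tau^-m congruent to 1 modulo pi for every integral
    unitriangular u, because the exponents of mu strictly decrease along the frame, and then every
    pivot is a unit. Since E_w may be split at places w other than v, integrality in E_w is
    expressed by trace and norm and not by a valuation. Galois elements are automorphisms of [algC],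
    of which only the restriction to E[oo] is meaningful, so that equalities of Galois elements are
    always tested on [Einfty]. *)

Local Notation conjmx := Defs.conjmx.

(** * Valuations *)

(* The same valuation may occur with two convertible but syntactically distinct
   ring structures in its argument, which [lia] would treat as two atoms. *)
Ltac vlia := intros;
  repeat match goal with H : context [place_val _ _] |- _ => revert H end;
  repeat match goal with
  | |- context [place_val ?w ?x] => let a := fresh "a" in pose (a := place_val w x);
      change (place_val w x) with a;
      repeat match goal with
      | |- context [place_val ?w' ?y] => change (place_val w' y) with a end;
      clearbody a
  end; intros; lia.

Section Valuation.
Variables (k : comNzRingType) (w : place k).

Lemma place1 : w 1 = 0.
Proof.
have e : w 1 = w 1 + w 1 by rewrite -place_valM ?oner_neq0 // mulr1.
by vlia.
Qed.

Lemma placeN1 : w (-1) = 0.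
Proof.
have n1 : (-1 : k) != 0 by rewrite oppr_eq0 oner_eq0.
by have := place_valM w n1 n1; rewrite mulrNN mulr1 place1; vlia.
Qed.

Lemma placeN x : w (- x) = w x.
Proof.
have [->|x0] := eqVneq x 0; first by rewrite oppr0.
by rewrite -mulN1r place_valM ?oppr_eq0 ?oner_eq0 // placeN1 add0r.
Qed.

(** Boolean form of [vge w j]: as a predicate it can carry the closure structures behind [rpredB],
    [rpredM] and [rpred_sum]. *)
Definition vpow (j : int) : {pred k} := [pred x | (x == 0) || (j <= w x)].

Lemma vpowP j x : reflect (vge w j x) (x \in vpow j).
Proof.
rewrite inE; apply: (iffP orP) => -[] h; [left | right | left | right] => //.
  exact/eqP.
by rewrite h eqxx.
Qed.

Lemma vpow_val j x : x != 0 -> (x \in vpow j) = (j <= w x).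
Proof. by rewrite inE => /negbTE ->. Qed.

Lemma vpow_zmod j : zmod_closed (vpow j).
Proof.
split=> [|x y]; first by rewrite inE eqxx.
have [->|x0] := eqVneq x 0; first by rewrite sub0r !inE oppr_eq0 placeN.
have [->|y0] := eqVneq y 0; first by rewrite subr0.
rewrite (vpow_val _ x0) (vpow_val _ y0) => hx hy.
have [d0|d0] := eqVneq (x - y) 0; first by rewrite d0 inE eqxx.
have ny0 : - y != 0 by rewrite oppr_eq0.
rewrite vpow_val //; have := place_valD w x0 ny0 d0.
rewrite placeN; vlia.
Qed.
HB.instance Definition _ j := GRing.isZmodClosed.Build k (vpow j) (vpow_zmod j).

Lemma vpow_le i j x : i <= j -> x \in vpow j -> x \in vpow i.
Proof. by move=> ij /orP[/eqP->|h]; rewrite inE ?eqxx //; apply/orP; right; vlia. Qed.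

Definition vint : {pred k} := vpow 0.

Lemma vint1 : 1 \in vint.
Proof. by rewrite inE place1 lexx orbT. Qed.

End Valuation.
Arguments vpow {k} w j.
Arguments vint {k} w.

Section Local.
Variables (k : fieldType) (w : place k).

Lemma vpowM i j x y : x \in vpow w i -> y \in vpow w j -> x * y \in vpow w (i + j).
Proof.
have [->|x0] := eqVneq x 0; first by rewrite mul0r !rpred0.
have [->|y0] := eqVneq y 0; first by rewrite mulr0 !rpred0.
have xy0 : x * y != 0 by rewrite mulf_neq0.
by rewrite !vpow_val // place_valM //; vlia.
Qed.

Lemma vint_subring : subring_closed (vint w).
Proof.
split; first exact: vint1.
  by move=> x y; apply: rpredB.
by move=> x y hx hy; have := vpowM hx hy; rewrite addr0.
Qed.
HB.instance Definition _ := GRing.isSubringClosed.Build k (vint w) vint_subring.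

Lemma vpowMl j x y : x \in vint w -> y \in vpow w j -> x * y \in vpow w j.
Proof. by move=> hx hy; have := vpowM hx hy; rewrite add0r. Qed.
Lemma vpowMr j x y : x \in vpow w j -> y \in vint w -> x * y \in vpow w j.
Proof. by move=> hx hy; have := vpowM hx hy; rewrite addr0. Qed.
Lemma vpow_vint j x : 0 <= j -> x \in vpow w j -> x \in vint w.
Proof. exact: vpow_le. Qed.

Lemma placeV x : w x^-1 = - w x.
Proof.
have [->|x0] := eqVneq x 0; first by rewrite invr0 place_val0.
have := place_valM w x0 (invr_neq0 x0); rewrite divff // place1; vlia.
Qed.

Lemma placeX x n : w (x ^+ n) = w x *+ n.
Proof.
have [->|x0] := eqVneq x 0.
  by rewrite place_val0 mul0rn; case: n => [|n]; rewrite ?place1 // exprS mul0r place_val0.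
elim: n => [|n IH]; first by rewrite place1.
by rewrite exprS place_valM ?expf_neq0 // IH mulrS.
Qed.

Lemma placeXz x (j : int) : w (x ^ j) = w x * j.
Proof.
case: j => n; first by rewrite -exprnP placeX -mulr_natr natz.
by rewrite NegzE -exprnN placeV placeX -mulr_natr natz mulrN.
Qed.

Definition vunt (x : k) := (x != 0) && (w x == 0).

Lemma vunt_neq0 x : vunt x -> x != 0. Proof. by case/andP. Qed.
Lemma vunt_int x : vunt x -> x \in vint w.
Proof. by case/andP => x0 /eqP h; rewrite vpow_val // h. Qed.
Lemma vuntV x : vunt x -> vunt x^-1.
Proof. by case/andP => x0 /eqP h; rewrite /vunt invr_eq0 x0 placeV h. Qed.
Lemma vuntM x y : vunt x -> vunt y -> vunt (x * y).
Proof.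
by case/andP => x0 /eqP hx /andP[y0 /eqP hy]; rewrite /vunt mulf_neq0 //= place_valM // hx hy.
Qed.
Lemma vuntN x : vunt x -> vunt (- x).
Proof. by rewrite /vunt oppr_eq0 placeN. Qed.
Lemma vuntX x n : vunt x -> vunt (x ^+ n).
Proof. by case/andP => x0 /eqP hx; rewrite /vunt expf_neq0 //= placeX hx mul0rn. Qed.
Lemma vunt1 : vunt 1.
Proof. by rewrite /vunt oner_eq0 place1. Qed.
Lemma vunt_prod (I : Type) (r : seq I) (P : pred I) F :
  (forall i, P i -> vunt (F i)) -> vunt (\prod_(i <- r | P i) F i).
Proof. by move=> h; elim/big_ind: _ => //; [exact: vunt1 | exact: vuntM]. Qed.
Lemma vintV x : vunt x -> x^-1 \in vint w.
Proof. by move/vuntV/vunt_int. Qed.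
Lemma vpowMVl j x y : vunt x -> (x * y \in vpow w j) = (y \in vpow w j).
Proof.
move=> ux; apply/idP/idP => [h|]; last by apply: vpowMl; apply: vunt_int.
by rewrite -(mulKf (vunt_neq0 ux) y) vpowMl // vintV.
Qed.

Lemma vunt_add x y : vunt x -> y \in vpow w 1 -> vunt (x + y).
Proof.
case/andP=> x0 /eqP hx; have [->|y0] := eqVneq y 0.
  by rewrite addr0 /vunt x0 hx eqxx.
rewrite vpow_val // => hy.
have s0 : x + y != 0.
  by apply/eqP => /eqP; rewrite addr_eq0 => /eqP h; move: hy; rewrite -placeN -h hx.
have ny0 : - y != 0 by rewrite oppr_eq0.
have xe : x + y + - y = x by rewrite addrK.
have := place_valD w x0 y0 s0; have := place_valD w s0 ny0; rewrite xe placeN => /(_ x0).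
rewrite /vunt s0 /= hx; vlia.
Qed.

Lemma vunt_cong x y : vunt x -> y - x \in vpow w 1 -> vunt y.
Proof. by move=> ux h; rewrite -(subrK x y) addrC; apply: vunt_add. Qed.

Lemma vint_vunt x y : x * y = 1 -> x \in vint w -> y \in vint w -> vunt x.
Proof.
move=> e; have x0 : x != 0 by apply/eqP => x0; move/eqP: e; rewrite x0 mul0r eq_sym oner_eq0.
have y0 : y != 0 by apply/eqP => y0; move/eqP: e; rewrite y0 mulr0 eq_sym oner_eq0.
have := place_valM w x0 y0; rewrite e place1 /vunt x0 !vpow_val //=; vlia.
Qed.

Lemma vpow_sqr x j : x ^+ 2 \in vpow w (j *+ 2) -> x \in vpow w j.
Proof.
have [->|x0] := eqVneq x 0; first by rewrite !rpred0.
rewrite !vpow_val ?expf_neq0 // placeX; vlia.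
Qed.
Variable pi : k.
Hypothesis pi1 : w pi = 1.

Lemma pi_neq0 : pi != 0.
Proof. by apply/eqP => p0; move: pi1; rewrite p0 place_val0. Qed.
Lemma pi_val (j : int) : w (pi ^ j) = j.
Proof. by rewrite placeXz pi1 mul1r. Qed.
Lemma piz_neq0 (j : int) : pi ^ j != 0.
Proof. by rewrite expfz_neq0 // pi_neq0. Qed.
Lemma vpow_pi (j : int) : pi ^ j \in vpow w j.
Proof. by rewrite vpow_val ?piz_neq0 // pi_val. Qed.
Lemma vpowE (i j : int) x : (pi ^ i * x \in vpow w j) = (x \in vpow w (j - i)).
Proof.
have [->|x0] := eqVneq x 0; first by rewrite mulr0 !rpred0.
rewrite !vpow_val ?mulf_neq0 ?piz_neq0 // place_valM ?piz_neq0 // pi_val; vlia.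
Qed.
Lemma vpow_vintE (j : int) x : (x \in vpow w j) = (pi ^ (- j) * x \in vint w).
Proof. by rewrite vpowE; congr (_ \in vpow w _); vlia. Qed.

(** Digit expansion: representatives modulo pi^(j + 1) are r + pi^j s with r a representative modulo
    pi^j and s a residue digit. *)
Lemma residue_reps q (q_w : residue_card w q) (j : nat) :
  exists (T : finType) (r : T -> k), [/\ #|T| = (q ^ j)%N,
    forall a, r a \in vint w, forall a b, r a - r b \in vpow w j%:Z -> a = b &
    forall x, x \in vint w -> exists a, x - r a \in vpow w j%:Z].
Proof.
have [s [s_int s_inj s_cov]] := q_w.
have pj (i : nat) : pi ^ i%:Z = pi ^+ i by [].
elim: j => [|j [T [r [cT ri rj rc]]]].
  exists unit, (fun=> 0); split=> [|a|[] []|x hx] //.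
  - by rewrite card_unit.
  - exact: rpred0.
  by exists tt; rewrite subr0.
exists (T * 'I_q)%type, (fun p => r p.1 + pi ^ j%:Z * s p.2); split.
- by rewrite card_prod cT card_ord expnSr.
- move=> a; rewrite rpredD ?ri // rpredM //; first by rewrite (vpow_le _ (vpow_pi j%:Z)).
  exact/vpowP/s_int.
- case=> a b [a' b'] /= h.
  have aa : a = a'.
    apply: rj; rewrite (_ : r a - r a' = (r a + pi ^ j%:Z * s b - (r a' + pi ^ j%:Z * s b'))
       - pi ^ j%:Z * (s b - s b')); last by ring.
    apply: rpredB; first by apply: vpow_le h; vlia.
    rewrite vpowE subrr rpredB //; exact/vpowP/s_int.
  subst a'; congr (_, _); apply/s_inj/vpowP.
  move: h; rewrite (_ : _ - _ = pi ^ j%:Z * (s b - s b')); last by ring.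
  by rewrite vpowE; congr (_ \in vpow w _); vlia.
move=> x hx; have [a ha] := rc x hx.
have hy : pi ^ (- j%:Z) * (x - r a) \in vint w by rewrite -vpow_vintE.
have [b /vpowP hb] := s_cov _ (elimT (vpowP _ _ _) hy).
exists (a, b) => /=.
rewrite (_ : _ - _ = pi ^ j%:Z * (pi ^ (- j%:Z) * (x - r a) - s b)).
  by rewrite vpowE; apply: vpow_le hb; vlia.
rewrite mulrBr mulrA -expfzDr ?pi_neq0 // subrr expr0z mul1r; ring.
Qed.

Lemma residue_card_gt1 q (q_w : residue_card w q) : (1 < q)%N.
Proof.
have [s [s_int s_inj s_cov]] := q_w.
have [a ha] := s_cov 0 (or_introl erefl).
have [b hb] := s_cov 1 (elimT (vpowP _ _ _) (vint1 w)).
have ab : a <> b.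
  move=> ab; subst b; move/vpowP: hb; move/vpowP: ha => ha hb.
  have := rpredB hb ha; rewrite (_ : 1 - s a - (0 - s a) = 1); last by ring.
  by rewrite vpow_val ?oner_eq0 // place1.
case: q a b ab {q_w s s_int s_inj s_cov ha hb} => [[]//|[|q]] //.
by move=> a b []; apply/val_inj; case: a b => [[]//] ? [[]//].
Qed.

(** Multiplication by pi^j, followed by reduction modulo pi^c, is a bijection from the classes
    modulo pi^(c - j) onto those classes modulo pi^c that lie in pi^j. *)
Lemma card_reps_vpow q (q_w : residue_card w q) (c : nat) (T : finType) (r : T -> k) (j : nat) :
  (j <= c)%N -> (forall a, r a \in vint w) -> (forall a b, r a - r b \in vpow w c%:Z -> a = b) ->
  (forall x, x \in vint w -> exists a, x - r a \in vpow w c%:Z) ->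
  #|[pred a | r a \in vpow w j%:Z]| = (q ^ (c - j))%N.
Proof.
move=> jc ri rj rc; have [T' [r' [<- ri' rj' rc']]] := residue_reps q_w (c - j).
have ex (a' : T') : exists a, pi ^ j%:Z * r' a' - r a \in vpow w c%:Z.
  by apply: rc; rewrite rpredM // ?ri' // (vpow_le _ (vpow_pi j%:Z)).
have {ex}[f fP] := choice ex.
have f_inj : injective f.
  move=> a b fab; apply: rj'; have := rpredB (fP a) (fP b); rewrite fab.
  rewrite (_ : _ - _ = pi ^ j%:Z * (r' a - r' b)); last by ring.
  by rewrite vpowE; congr (_ \in vpow w _); vlia.
rewrite -(card_codom f_inj); apply: eq_card => a; rewrite inE /=.
apply/idP/idP => [ha|/codomP[b ->]].
  have hy : pi ^ (- j%:Z) * r a \in vint w by rewrite -vpow_vintE.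
  have [b hb] := rc' _ hy; apply/codomP; exists b; apply: rj.
  have hb' : pi ^ j%:Z * (pi ^ (- j%:Z) * r a - r' b) \in vpow w c%:Z.
    by rewrite vpowE; apply: vpow_le hb; vlia.
  rewrite (_ : _ - _ = pi ^ j%:Z * (pi ^ (- j%:Z) * r a - r' b) + (pi ^ j%:Z * r' b - r (f b))).
    by rewrite rpredD.
  rewrite mulrBr mulrA -expfzDr ?pi_neq0 // subrr expr0z mul1r; ring.
have hb := fP b.
rewrite (_ : r (f b) = pi ^ j%:Z * r' b - (pi ^ j%:Z * r' b - r (f b))); last by ring.
apply: rpredB; last by apply: vpow_le hb; vlia.
by rewrite vpowE subrr ri'.
Qed.

End Local.

(** * Antidiagonal quadratic forms *)

Section CocharExp.
Variables (n : nat).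
Implicit Types l : {ffun 'I_n -> int}.

Lemma cochar_exp_lt l (i : 'I_n) : cochar_exp l i = l i.
Proof.
rewrite /cochar_exp; case: insubP => [j _ e|]; last by rewrite ltn_ord.
by congr (l _); apply: val_inj.
Qed.

Lemma cochar_exp_gt l (i : 'I_n) : cochar_exp l (n.*2 - i) = - l i.
Proof.
rewrite /cochar_exp; case: insubP => [j jn e|_]; first by have := ltn_ord i; lia.
case: insubP => [j _ e|]; last by have := ltn_ord i; lia.
by congr (- l _); apply: val_inj; move: e => /= ->; have := ltn_ord i; lia.
Qed.

Lemma cochar_exp_mid l : cochar_exp l n = 0.
Proof.
rewrite /cochar_exp; case: insubP => [j /=|_]; first by rewrite ltnn.
by case: insubP => [j /=|_] //; lia.
Qed.

Lemma ord_half (a : 'I_n.*2.+1) :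
  [\/ exists i : 'I_n, a = i :> nat, a = n :> nat |
      exists i : 'I_n, a = (n.*2 - i)%N :> nat].
Proof.
have := ltn_ord a => h; case: (ltngtP a n) => an.
- by constructor 1; exists (Ordinal an).
- have an' : (n.*2 - a < n)%N by lia.
  by constructor 3; exists (Ordinal an'); rewrite /=; lia.
- by constructor 2.
Qed.

Lemma cochar_exp_rev l (a : 'I_n.*2.+1) : cochar_exp l (rev_ord a) = - cochar_exp l a.
Proof.
have e : rev_ord a = (n.*2 - a)%N :> nat by rewrite /=; lia.
rewrite e; case: (ord_half a) => [[i ->]|->|[i ->]].
- by rewrite cochar_exp_gt cochar_exp_lt.
- by rewrite (_ : n.*2 - n = n)%N ?cochar_exp_mid ?oppr0 //; lia.
rewrite (_ : n.*2 - (n.*2 - i) = i)%N ?cochar_exp_gt ?cochar_exp_lt ?opprK //.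
by have := ltn_ord i; lia.
Qed.

Lemma cochar_expD l l' (a : nat) : cochar_exp (l + l') a = cochar_exp l a + cochar_exp l' a.
Proof.
rewrite /cochar_exp; case: insubP => [i _ _|_]; first by rewrite ffunE.
by case: insubP => [i _ _|_]; rewrite ?ffunE ?opprD ?addr0.
Qed.

Lemma cochar_exp0 (a : nat) : cochar_exp (0 : {ffun 'I_n -> int}) a = 0.
Proof.
by rewrite /cochar_exp; do 2?[case: insubP => [i _ _|_]]; rewrite ?ffunE ?oppr0.
Qed.

Lemma cochar_expN l (a : nat) : cochar_exp (- l) a = - cochar_exp l a.
Proof. by apply: (addrI (cochar_exp l a)); rewrite -cochar_expD !subrr cochar_exp0. Qed.

End CocharExp.

Lemma rev_ord_eqC m (i j : 'I_m) : (i == rev_ord j) = (j == rev_ord i).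
Proof. by rewrite -(inv_eq (@rev_ordK m)) eq_sym. Qed.

Lemma col_mulmx (R : comNzRingType) p q r (A : 'M[R]_(p, q)) (B : 'M[R]_(q, r)) j :
  col j (A *m B) = A *m col j B.
Proof. by rewrite !colE mulmxA. Qed.

Section Antidiagonal.
Variables (k : fieldType) (n : nat).
Local Notation d := n.*2.+1.
Variable c : 'I_d -> k.
Hypothesis c_neq0 : forall i, c i != 0.
Hypothesis c_rev : forall i, c (rev_ord i) = c i.

Definition antidiag : 'M[k]_d := \matrix_(i, j) if j == rev_ord i then c i else 0.

Definition orth (x : 'M[k]_d) := x^T *m antidiag *m x = antidiag.

(** Stated for coordinate functions so that it applies both to the columns of an orthogonal matrix,
    with weights [c], and to its rows, with the inverse weights. *)
Definition bform (x y : 'I_d -> k) := \sum_a x a * c a * y (rev_ord a).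

Lemma antidiag_sym : antidiag^T = antidiag.
Proof.
apply/matrixP => i j; rewrite !mxE rev_ord_eqC.
by have [->|] := eqVneq; rewrite ?c_rev.
Qed.

Lemma mul_antidiag m (A : 'M[k]_(m, d)) i j : (A *m antidiag) i j = A i (rev_ord j) * c j.
Proof.
rewrite mxE (bigD1 (rev_ord j)) //= big1 => [|a ha].
  by rewrite !mxE rev_ordK eqxx addr0 c_rev.
by rewrite mxE rev_ord_eqC (negbTE ha) mulr0.
Qed.

Lemma antidiag_mul m (A : 'M[k]_(d, m)) i j : (antidiag *m A) i j = c i * A (rev_ord i) j.
Proof.
rewrite mxE (bigD1 (rev_ord i)) //= big1 => [|a ha]; first by rewrite !mxE eqxx addr0.
by rewrite mxE (negbTE ha) mul0r.
Qed.

Lemma gram_entry m m' (x : 'M[k]_(d, m)) (y : 'M[k]_(d, m')) i j :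
  (x^T *m antidiag *m y) i j = bform (x^~ i) (y^~ j).
Proof.
rewrite mxE (reindex_inj rev_ord_inj) /=; apply: eq_bigr => a _.
by rewrite mul_antidiag mxE rev_ordK c_rev.
Qed.

Lemma orthP x : orth x <->
  forall i j, bform (x^~ i) (x^~ j) = if j == rev_ord i then c i else 0.
Proof.
split=> [h i j|h]; first by rewrite -gram_entry h mxE.
by apply/matrixP => i j; rewrite gram_entry h mxE.
Qed.

Lemma bformC x y : bform x y = bform y x.
Proof.
rewrite /bform (reindex_inj rev_ord_inj) /=; apply: eq_bigr => a _.
by rewrite rev_ordK c_rev; ring.
Qed.

Lemma bform_delta (y : 'I_d -> k) i (t : k) : bform (fun a => (a == i)%:R * t) y = t * c i * y (rev_ord i).
Proof.
rewrite /bform (bigD1 i) //= eqxx mul1r big1 ?addr0 // => a /negbTE ->.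
by rewrite !mul0r.
Qed.

Lemma bformDl x x' y : bform (fun a => x a + x' a) y = bform x y + bform x' y.
Proof. by rewrite /bform -big_split; apply: eq_bigr => a _; rewrite !mulrDl. Qed.

(** Eichler transformation: for isotropic u with u_p = 1 it sends e_p to u, fixes the isotropic
    partner e_(rev p), and corrects every other e_b by the multiple of e_(rev p) that restores
    orthogonality to u. *)
Definition eichler (p : 'I_d) (u : 'I_d -> k) : 'M[k]_d :=
  \matrix_(a, b) if b == p then u a else
    (a == b)%:R - (if (a == rev_ord p) && (b != rev_ord p)
                   then (c p)^-1 * c b * u (rev_ord b) else 0).

Lemma eichler_orth p u : p != rev_ord p -> u p = 1 -> bform u u = 0 -> orth (eichler p u).
Proof.
move=> p_rev up uu; apply/orthP.
pose t b : k := if b != rev_ord p then (c p)^-1 * c b * u (rev_ord b) else 0.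
have colp : (eichler p u)^~ p =1 u by move=> a; rewrite mxE eqxx.
have colE b : b != p -> (eichler p u)^~ b =1
    fun a => (a == b)%:R * 1 + (a == rev_ord p)%:R * - t b.
  move=> /negbTE bp a; rewrite mxE bp mulr1 /t mulrN.
  by case: (a == rev_ord p) => /=; case: (b != rev_ord p); rewrite ?mul1r ?mul0r ?mulr0.
have bE x x' y y' : x =1 x' -> y =1 y' -> bform x y = bform x' y'.
  by move=> ex ey; apply: eq_bigr => a _; rewrite ex ey.
have main j : j != p -> bform u ((eichler p u)^~ j) = if j == rev_ord p then c p else 0.
  move=> jp; rewrite (bE _ _ _ _ (frefl u) (colE j jp)) bformC bformDl !bform_delta rev_ordK c_rev up.
  rewrite /t; have [->|jr] := eqVneq; rewrite ?rev_ordK ?c_rev ?up /=; first by ring.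
  by field.
move=> i j; have [->|ip] := eqVneq i p; have [->|jp] := eqVneq j p.
- by rewrite (bE _ _ _ _ colp colp) uu (negbTE p_rev).
- by rewrite (bE _ _ _ _ colp (frefl _)) main.
- rewrite bformC (bE _ _ _ _ colp (frefl _)) main // rev_ord_eqC.
  by have [->|//] := eqVneq; rewrite c_rev.
rewrite (bE _ _ _ _ (colE i ip) (frefl _)) bformDl !bform_delta rev_ordK mul1r.
rewrite (colE j jp) (colE j jp) [p == j]eq_sym (negbTE jp) (negbTE p_rev).
rewrite [rev_ord i == rev_ord p](inj_eq rev_ord_inj) (negbTE ip).
by rewrite [rev_ord i == j]eq_sym; case: eqP => _; rewrite /= !(mulr1, mul0r, mulr0, addr0).
Qed.

Lemma eichler_rowp p u b : p != rev_ord p -> u p = 1 -> eichler p u p b = (p == b)%:R.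
Proof.
move=> pr up; rewrite mxE (negbTE pr) subr0 [p == b]eq_sym; by case: eqP; rewrite ?up.
Qed.

Lemma eichler_row p u a b : a != p -> a != rev_ord p -> u a = 0 ->
  eichler p u a b = (a == b)%:R.
Proof.
move=> ap ar ua; rewrite mxE (negbTE ar) subr0; case: (eqVneq b p) => // ->.
by rewrite ua (negbTE ap).
Qed.

Lemma eichler_colE p u a b : b != p -> u (rev_ord b) = 0 ->
  eichler p u a b = (a == b)%:R.
Proof. by move=> bp ub; rewrite mxE (negbTE bp) ub mulr0 if_same subr0. Qed.

End Antidiagonal.

Section OrthInverse.
Variables (k : fieldType) (n : nat).
Local Notation d := n.*2.+1.
Variable c : 'I_d -> k.
Hypothesis c_neq0 : forall i, c i != 0.
Hypothesis c_rev : forall i, c (rev_ord i) = c i.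
Local Notation ci := (fun i => (c i)^-1).
Local Notation J := (antidiag c).
Local Notation J' := (antidiag ci).

Lemma ci_rev i : ci (rev_ord i) = ci i. Proof. by rewrite /= c_rev. Qed.

Lemma antidiagV : J' *m J = 1%:M.
Proof.
apply/matrixP => i j; rewrite antidiag_mul !mxE /=.
by rewrite rev_ordK c_rev [j == i]eq_sym; case: eqP => _; rewrite ?mulr0 ?mulVf.
Qed.

Lemma antidiagVr : J *m J' = 1%:M. Proof. exact: mulmx1C antidiagV. Qed.

Lemma orth_inv x : orth c x -> invmx x = J' *m x^T *m J.
Proof.
move=> ox; have h : (J' *m x^T *m J) *m x = 1%:M by rewrite -antidiagV -[in RHS]ox !mulmxA.
have ux : x \in unitmx by case: (mulmx1_unit h).
by rewrite -[RHS]mulmx1 -(mulmxV ux) mulmxA h mul1mx.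
Qed.

Lemma orth_unit x : orth c x -> x \in unitmx.
Proof.
move=> ox; have h : (J' *m x^T *m J) *m x = 1%:M by rewrite -antidiagV -[in RHS]ox !mulmxA.
by case: (mulmx1_unit h).
Qed.

(** Inversion is reflection in the antidiagonal up to the weights. With unit weights, integrality,
    the Iwahori condition and triangularity thus pass to the inverse. *)
Lemma orth_inv_entry x i j : orth c x ->
  invmx x i j = ci i * x (rev_ord j) (rev_ord i) * c j.
Proof.
move=> ox; rewrite orth_inv // mul_antidiag // antidiag_mul ?mxE //.
Qed.

Lemma orth1 : orth c 1%:M. Proof. by rewrite /orth trmx1 mul1mx mulmx1. Qed.

Lemma orthM x y : orth c x -> orth c y -> orth c (x *m y).
Proof. by rewrite /orth => ox oy; rewrite trmx_mul -[RHS]oy -[in RHS]ox !mulmxA. Qed.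

Lemma orthV x : orth c x -> orth c (invmx x).
Proof.
move=> ox; have ux := orth_unit ox; rewrite /orth -{1}ox trmx_inv !mulmxA.
by rewrite mulVmx ?unitmx_tr // mul1mx -mulmxA mulmxV // mulmx1.
Qed.

Lemma orthN x : orth c x -> orth c (- x).
Proof.
move=> /(orthP c_rev) ox; apply/(orthP c_rev) => i j; rewrite -ox.
by apply: eq_bigr => a _; rewrite !mxE; ring.
Qed.

(** Turns the relations between columns into relations between rows, at the price of inverting the
    weights. *)
Lemma orth_tr x : orth c x -> orth ci x^T.
Proof.
move=> ox; rewrite /orth trmxK; have := mulmxV (orth_unit ox).
rewrite orth_inv // => /(congr1 (mulmx^~ J')).
by rewrite mul1mx -!mulmxA antidiagVr mulmx1 !mulmxA.
Qed.

Lemma orth_det x : orth c x -> \det x = 1 \/ \det x = -1.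
Proof.
move=> ox; have : \det x * \det J * \det x = \det J by rewrite -{2}ox !det_mulmx det_tr.
have Jn0 : \det J != 0 by have [_] := mulmx1_unit antidiagV; rewrite unitmxE unitfE.
rewrite mulrAC => /(canRL (mulfK Jn0)); rewrite divff // => h.
have /eqP : (\det x) ^+ 2 = 1 by [].
by rewrite sqrf_eq1 => /orP[/eqP|/eqP]; [left|right].
Qed.

End OrthInverse.

(** * Iwahori-Cartan decomposition *)

Section Elimination.
Variables (k : fieldType) (w : place k) (n : nat).
Local Notation d := n.*2.+1.
Variable c : 'I_d -> k.
Hypothesis c_unit : forall i, vunt w (c i).
Hypothesis c_rev : forall i, c (rev_ord i) = c i.
Local Notation ci := (fun i => (c i)^-1).
Let c_neq0 i : c i != 0 := vunt_neq0 (c_unit i).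
Let ci_neq0 i : (c i)^-1 != 0. Proof. by rewrite invr_eq0. Qed.
Let ci_rev i : (c (rev_ord i))^-1 = (c i)^-1. Proof. by rewrite c_rev. Qed.

Fact mid_lt : (n < d)%N. Proof. by lia. Qed.
Definition mid : 'I_d := Ordinal mid_lt.

Lemma rev_mid : rev_ord mid = mid.
Proof. by apply: val_inj => /=; lia. Qed.

Lemma rev_ord_fix (p : 'I_d) : (p == rev_ord p) = (p == mid).
Proof.
apply/eqP/eqP => [/(congr1 val) /= h|->]; last by rewrite rev_mid.
by apply: val_inj => /=; have := ltn_ord p; lia.
Qed.

Lemma orth_row x i j : orth c x ->
  bform ci (x i) (x j) = if j == rev_ord i then (c i)^-1 else 0.
Proof.
move=> /(orth_tr c_neq0 c_rev)/(orthP ci_rev)/(_ i j) <-.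
by apply: eq_bigr => a _; rewrite !mxE.
Qed.

Definition mxint d' (x : 'M[k]_d') := forall i j, x i j \in vint w.
Definition iwahori (x : 'M[k]_d) :=
  mxint x /\ forall i j : 'I_d, (j < i)%N -> x i j \in vpow w 1.

Lemma rev_ord_lt (i j : 'I_d) : (rev_ord i < rev_ord j)%N = (j < i)%N.
Proof. by rewrite /=; have := ltn_ord i; have := ltn_ord j; lia. Qed.

Lemma mxint1 : mxint (1%:M : 'M[k]_d).
Proof. by move=> i j; rewrite mxE; case: eqP => _; rewrite ?rpred0 ?rpred1. Qed.
Lemma mxintM x y : mxint x -> mxint y -> mxint (x *m y : 'M[k]_d).
Proof. by move=> hx hy i j; rewrite mxE rpred_sum // => a _; rewrite rpredM. Qed.
Lemma mxintV x : orth c x -> mxint x -> mxint (invmx x).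
Proof.
move=> ox hx i j; rewrite (orth_inv_entry c_neq0 c_rev) // !rpredM ?hx ?vintV //.
exact: vunt_int.
Qed.
Lemma iwahori1 : iwahori 1%:M.
Proof.
split=> [|i j ji]; first exact: mxint1.
by rewrite mxE (_ : i == j = false) ?rpred0 //; apply/eqP => ij; move: ji; rewrite ij ltnn.
Qed.
Lemma iwahoriM x y : iwahori x -> iwahori y -> iwahori (x *m y).
Proof.
move=> [hx lx] [hy ly]; split=> [|i j ji]; first exact: mxintM.
rewrite mxE rpred_sum // => a _; case: (ltnP a i) => ai.
  by rewrite vpowMr ?lx.
by rewrite vpowMl // ly //; lia.
Qed.
Lemma iwahoriV x : orth c x -> iwahori x -> iwahori (invmx x).
Proof.
move=> ox [hx lx]; split=> [|i j ji]; first exact: mxintV.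
rewrite (orth_inv_entry c_neq0 c_rev) // vpowMr ?vunt_int // vpowMl ?vintV //.
by rewrite lx // rev_ord_lt.
Qed.

Definition mono (y : 'M[k]_d) p :=
  exists j, (forall j', j' != j -> y p j' = 0) /\ (forall p', p' != p -> y p' j = 0).

Lemma row_neq0 y p : orth c y -> exists j, y p j != 0.
Proof.
move=> oy; apply/existsP; apply: contraT; rewrite negb_exists => /forallP h.
have := orth_row p (rev_ord p) oy; rewrite eqxx /bform big1 => [e|a _].
  by have := ci_neq0 p; rewrite -e eqxx.
by have := h a; rewrite negbK => /eqP ->; rewrite !mul0r.
Qed.

(** Isotropy expresses b_mid u_mid^2 through the products u_a u_(rev a). This bounds the middle
    coordinate, which the choice of pivots does not control. *)
Lemma sum_isotropic (b : 'I_d -> k) (u : 'I_d -> k) (j : int) :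
  (forall i, vunt w (b i)) -> bform b u u = 0 ->
  (forall a, a != mid -> u a * u (rev_ord a) \in vpow w j) ->
  u mid ^+ 2 \in vpow w j.
Proof.
move=> bu; rewrite /bform (bigD1 mid) //= rev_mid => /eqP; rewrite addr_eq0 => /eqP e h.
rewrite -(vpowMVl _ _ (bu mid)) (_ : _ * _ = u mid * b mid * u mid); last by ring.
rewrite e rpredN rpred_sum // => a am.
by rewrite mulrAC vpowMr ?h // vunt_int.
Qed.

Lemma eichler_int (b : 'I_d -> k) p u : (forall i, vunt w (b i)) ->
  (forall a, u a \in vint w) -> mxint (eichler b p u).
Proof.
move=> bu hu i j; rewrite mxE; case: eqP => // _; rewrite rpredB //.
  by case: (_ == _); rewrite ?rpred0 ?rpred1.
by case: ifP => _; rewrite ?rpred0 // !rpredM // ?vintV // vunt_int.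
Qed.

Lemma eichler_iwahori p u : p != mid ->
  (forall a, u a \in vint w) -> (forall a : 'I_d, (p < a)%N -> u a \in vpow w 1) ->
  iwahori (eichler c p u).
Proof.
move=> pm hu lu; split=> [|i j ji]; first exact: eichler_int.
rewrite mxE; case: (eqVneq j p) => [jp|jp]; first by rewrite lu // -jp.
rewrite (_ : i == j = false) ?sub0r ?rpredN; last by apply/eqP => e; move: ji; rewrite e ltnn.
case: ifP => [/andP[/eqP ip jr]|_]; last by rewrite rpred0.
rewrite vpowMl // ?rpredM ?vintV ?vunt_int // lu //.
move: ji; rewrite ip -{1}[j]rev_ordK rev_ord_lt //.
Qed.

(* One elimination step: the pivot has minimal valuation among the rows not yet
   monomial and is lowest possible in its column, so that the column can be
   cleared by the Iwahori subgroup and the row by the maximal compact one. *)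
Lemma elim_step (P : {set 'I_d}) (y : 'M[k]_d) (p0 : 'I_d) :
  (forall p, p \in P -> rev_ord p \in P) -> mid \notin P -> orth c y ->
  (forall p, p \in P -> mono y p) -> p0 \notin P -> p0 != mid ->
  exists a b p, [/\ [/\ orth c a, iwahori a, orth c b & mxint b], p \notin P, p != mid &
    forall p', p' \in p |: (rev_ord p |: P) -> mono (a *m y *m b) p'].
Proof.
move=> revP midP oy monoP p0P p0m.
(* Pivots avoid the middle row and column: the index [mid] is its own reverse, and an Eichler
   transformation needs an isotropic partner. *)
pose Q := [pred pj : 'I_d * 'I_d | [&& pj.1 \notin P, pj.1 != mid, pj.2 != mid & y pj.1 pj.2 != 0]].
(* The row [p0] is nonzero and isotropic, so its support is not the middle column alone. *)
have [j0 Qj0] : exists j0, Q (p0, j0).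
  have [j hj] := row_neq0 p0 oy; have [jm|jm] := eqVneq j mid; last first.
    by exists j; rewrite /Q /= p0P p0m jm hj.
  subst j; apply/existsP; apply: contraT; rewrite negb_exists => /forallP h.
  have := orth_row p0 p0 oy; rewrite rev_ord_fix (negbTE p0m) /bform (bigD1 mid) //= big1.
    move/eqP; rewrite addr0 rev_mid !mulf_eq0 (negbTE hj) /= orbF => /eqP e.
    by have := ci_neq0 mid; rewrite e eqxx.
  move=> a am; have := h a; rewrite /Q /= p0P p0m am /= negbK => /eqP ->.
  by rewrite !mul0r.
have [[p1 j] Qpj min_pj] :=
  @Order.TotalTheory.arg_minP _ _ _ (p0, j0) Q (fun pj => w (y pj.1 pj.2)) Qj0.
have /and4P[/= p1P p1m jm yp1] := Qpj.
set v0 := w (y p1 j) in min_pj.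
have minE p j' : p \notin P -> p != mid -> j' != mid -> y p j' \in vpow w v0.
  move=> pP pm jm'; have [->|yn] := eqVneq (y p j') 0; first by rewrite rpred0.
  by rewrite vpow_val //; apply: (min_pj (p, j')); rewrite /Q /= pP pm jm' yn.
pose Q' := [pred p : 'I_d | [&& p \notin P, p != mid, y p j != 0 & w (y p j) == v0]].
have Q'p1 : Q' p1 by rewrite /Q' /= p1P p1m yp1 /v0 eqxx.
case: (arg_maxnP (fun p : 'I_d => p : nat) Q'p1) => p /and4P[pP pm ypj /eqP ypv] max_p.
have rpP : rev_ord p \notin P by apply/negP => /revP; rewrite rev_ordK; apply/negP.
have pr : p != rev_ord p by rewrite rev_ord_fix.
have jr : j != rev_ord j by rewrite rev_ord_fix.
have colP a : a \in P -> y a j = 0.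
  move=> aP; have [ja [rowa cola]] := monoP a aP.
  have [e|ne] := eqVneq j ja; last exact: rowa.
  have pa : p != a by apply/eqP => e'; move: pP; rewrite e' aP.
  by move: ypj; rewrite e cola ?eqxx.
have colj_min a : a != mid -> y a j \in vpow w v0.
  by move=> am; case: (boolP (a \in P)) => [/colP->|aP]; rewrite ?rpred0 ?minE.
have colj_max (a : 'I_d) : a != mid -> (p < a)%N -> y a j \in vpow w (v0 + 1).
  move=> am pa; case: (boolP (a \in P)) => [/colP->|aP]; first by rewrite rpred0.
  have [->|yn] := eqVneq (y a j) 0; first by rewrite rpred0.
  have := minE _ _ aP am jm; rewrite !vpow_val //.
  have : ~~ Q' a by apply/negP => /max_p; rewrite /= leqNgt pa.
  by rewrite /Q' /= aP am yn /= => /negbTE h1 h2; move: h1 h2; clear; vlia.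
have colj_iso : bform c (y^~ j) (y^~ j) = 0.
  by move/(orthP c_rev): oy => ->; rewrite (negbTE jr).
have rowp_iso : bform ci (y p) (y p) = 0 by rewrite orth_row // (negbTE pr).
have rev_neq_mid a : a != mid -> rev_ord a != mid.
  by apply: contra => /eqP h; rewrite -[a]rev_ordK h rev_mid.
have colj_mid : y mid j \in vpow w v0.
  apply: vpow_sqr; apply: (sum_isotropic c_unit colj_iso) => a am.
  by rewrite mulr2n vpowM ?colj_min ?rev_neq_mid.
(* Of [a] and [rev_ord a] one lies below the middle, hence below [p], so each product gains a factor
   pi. The square then has valuation at least 2 v0 + 1, and parity improves the bound on the entry
   to v0 + 1. *)
have colj_mid' : (p < mid)%N -> y mid j \in vpow w (v0 + 1).
  move=> pmid; have: y mid j ^+ 2 \in vpow w (v0 + v0 + 1).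
    apply: (sum_isotropic c_unit colj_iso) => a am.
    case: (ltnP mid a) => ha.
      rewrite (_ : v0 + v0 + 1 = (v0 + 1) + v0); last by rewrite addrAC.
      apply: vpowM; last by rewrite colj_min ?rev_neq_mid.
      by rewrite colj_max //; apply: ltn_trans ha.
    rewrite -addrA; apply: vpowM; first exact: colj_min.
    apply: colj_max; first exact: rev_neq_mid.
    have am' : (a != mid :> nat) by []; move: am' ha pmid (ltn_ord a); clear => /=; lia.
  have [->|yn] := eqVneq (y mid j) 0; first by rewrite rpred0.
  by rewrite !vpow_val ?expf_neq0 // placeX; clear; vlia.
have rowp_min b : y p b \in vpow w v0.
  have [->|bm] := eqVneq b mid; last exact: minE.
  apply: vpow_sqr; apply: (@sum_isotropic ci (y p)) => // [i|a am]; first exact: vuntV.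
  by rewrite mulr2n vpowM ?minE ?rev_neq_mid.
have divE (e : int) x : x \in vpow w (v0 + e) -> x / y p j \in vpow w e.
  have [->|xn] := eqVneq x 0; first by rewrite mul0r !rpred0.
  rewrite !vpow_val ?mulf_neq0 ?invr_eq0 // place_valM ?invr_eq0 // placeV ypv; clear; vlia.
pose u a := y a j / y p j.
have u_int a : u a \in vint w.
  apply: divE; rewrite addr0; have [->|am] := eqVneq a mid; [exact: colj_mid | exact: colj_min].
have u_low (a : 'I_d) : (p < a)%N -> u a \in vpow w 1.
  move=> pa; apply: divE; have [e|am] := eqVneq a mid; last exact: colj_max.
  by rewrite e; apply: colj_mid'; rewrite -e.
have up : u p = 1 by rewrite /u divff.
have u_iso : bform c u u = 0.
  transitivity (bform c (y^~ j) (y^~ j) / y p j ^+ 2); last by rewrite colj_iso mul0r.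
  rewrite /bform mulr_suml; apply: eq_bigr => a _; rewrite /u; field; exact: ypj.
have uP a : a \in P -> u a = 0 by move=> /colP h; rewrite /u h mul0r.
set E := eichler c p u.
have oE : orth c E by apply: eichler_orth.
have iE : iwahori E by apply: eichler_iwahori.
pose r b := y p b / y p j.
have r_int b : r b \in vint w by apply: divE; rewrite addr0.
have rj : r j = 1 by rewrite /r divff.
have r_iso : bform ci r r = 0.
  transitivity (bform ci (y p) (y p) / y p j ^+ 2); last by rewrite rowp_iso mul0r.
  rewrite /bform mulr_suml; apply: eq_bigr => a _; rewrite /r; field; by rewrite ypj c_neq0.
set E' := eichler ci j r.
have oE' : orth ci E' by exact: (eichler_orth ci_neq0 ci_rev jr rj r_iso).
have iE' : mxint E' by apply: eichler_int => // i; apply: vuntV.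
have ciV i : ((c i)^-1)^-1 = c i by rewrite invrK.
have oE't : orth c E'^T.
  have := orth_tr ci_neq0 ci_rev oE'; rewrite /orth.
  by rewrite (_ : antidiag (fun i => ((c i)^-1)^-1) = antidiag c) //; apply/matrixP => a b; rewrite !mxE invrK.
have uE := orth_unit c_neq0 c_rev oE; have uE' := orth_unit c_neq0 c_rev oE't.
set z := invmx E *m y *m invmx E'^T.
have oz : orth c z by do !apply: orthM => //; exact: orthV.
have zE : y *m invmx E'^T = E *m z by rewrite /z !mulmxA mulmxV // mul1mx.
have zE' : E *m z *m E'^T = y by rewrite -zE mulmxKV.
pose y1 := invmx E *m y.
have y1E : E *m y1 = y by rewrite /y1 mulKVmx.
have y1z : z *m E'^T = y1 by rewrite /z mulmxKV.
have y1col a : y1 a j = if a == p then y p j else 0.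
  have yE : col j y = y p j *: col p E.
    by apply/matrixP => i ?; rewrite !mxE eqxx /u mulrC divfK.
  have h : col j y1 = y p j *: col p 1%:M.
    by rewrite /y1 col_mulmx yE -scalemxAr -col_mulmx mulVmx.
  have := congr1 (fun M : 'cV_d => M a 0) h; rewrite !mxE => ->.
  by case: eqP => _; rewrite ?mulr1 ?mulr0.
have neqP a : a \in P -> (a != p) * (a != rev_ord p).
  by move=> aP; split; apply/eqP => e; [move: pP | move: rpP]; rewrite -e aP.
have Ep b : E p b = (p == b)%:R by apply: eichler_rowp.
have EP a b : a \in P -> E a b = (a == b)%:R.
  by move=> aP; apply: eichler_row; rewrite ?(neqP _ aP) ?uP.
have EPc a b : b \in P -> E a b = (a == b)%:R.
  by move=> bP; apply: eichler_colE; rewrite ?(neqP _ bP) // uP // revP.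
have E'c a b : b != j -> r (rev_ord b) = 0 -> E' a b = (a == b)%:R by apply: eichler_colE.
have y1row b : y1 p b = y p b.
  rewrite -[in RHS]y1E [RHS]mxE (bigD1 p) //= big1 => [|a ap]; rewrite Ep.
    by rewrite eqxx mul1r addr0.
  by rewrite eq_sym (negbTE ap) mul0r.
have y1P a b : a \in P -> y1 a b = y a b.
  move=> aP; rewrite -[in RHS]y1E [RHS]mxE (bigD1 a) //= big1 => [|a' aa]; rewrite EP //.
    by rewrite eqxx mul1r addr0.
  by rewrite eq_sym (negbTE aa) mul0r.
(* Pairing the rows [a] and [rev_ord a] forces a nonzero entry of the latter in the column
   [rev_ord ja], which is therefore its monomial column. *)
have mono_rev a ja : a \in P -> (forall j', j' != ja -> y a j' = 0) ->
    forall a', a' != rev_ord a -> y a' (rev_ord ja) = 0.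
  move=> aP rowa a' aa'; have [jb [rowb colb]] := monoP _ (revP _ aP).
  have [<-|ne] := eqVneq jb (rev_ord ja); first exact: colb.
  have := orth_row a (rev_ord a) oy; rewrite eqxx /bform (bigD1 ja) //= big1 => [|b bj]; last first.
    by rewrite rowa ?mul0r.
  rewrite addr0 [y (rev_ord a) _]rowb 1?eq_sym // mulr0 => e.
  by have := ci_neq0 a; rewrite -e eqxx.
have invE_col a a' : a \in P -> invmx E a' a = (a' == a)%:R.
  move=> aP; have h : col a E = col a 1%:M.
    by apply/matrixP => i ?; rewrite mxE EPc // !mxE.
  have : col a (invmx E) = col a 1%:M.
    by rewrite -{1}[invmx E]mulmx1 col_mulmx -h -col_mulmx mulVmx.
  by move=> /(congr1 (fun M : 'cV_d => M a' 0)); rewrite !mxE.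
have monoP1 a ja : a \in P -> (forall j', j' != ja -> y a j' = 0) ->
    (forall p', p' != a -> y p' ja = 0) ->
    (forall j', j' != ja -> y1 a j' = 0) /\ (forall p', p' != a -> y1 p' ja = 0).
  move=> aP rowa cola; split=> [j' jj|p' pa]; first by rewrite y1P ?rowa.
  rewrite mxE (bigD1 a) //= big1 => [|b ba]; last by rewrite cola ?mulr0.
  by rewrite invE_col // (negbTE pa) mul0r addr0.
have invE'_row b b' : b != j -> r (rev_ord b) = 0 -> invmx E'^T b b' = (b == b')%:R.
  move=> bj rb; have h : row b E'^T = row b 1%:M.
    by apply/matrixP => ? i; rewrite mxE [LHS]mxE E'c // !mxE eq_sym.
  have : row b (invmx E'^T) = row b 1%:M.
    by rewrite -{1}[invmx _]mul1mx row_mul -h -row_mul mulmxV.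
  by move=> /(congr1 (fun M : 'rV_d => M 0 b')); rewrite !mxE.
have invE'_col b b' : (forall i, E' b i = (b == i)%:R) -> invmx E'^T b' b = (b' == b)%:R.
  move=> rb; have h : col b E'^T = col b 1%:M.
    by apply/matrixP => i ?; rewrite mxE [LHS]mxE rb !mxE eq_sym.
  have : col b (invmx E'^T) = col b 1%:M.
    by rewrite -{1}[invmx _]mulmx1 col_mulmx -h -col_mulmx mulVmx.
  by move=> /(congr1 (fun M : 'cV_d => M b' 0)); rewrite !mxE.
have zE1 : z = y1 *m invmx E'^T by [].
have zcol a : z a j = y1 a j.
  rewrite zE1 mxE (bigD1 j) //= big1 => [|b bj]; rewrite invE'_col ?(negbTE bj) ?mulr0 //.
  - by rewrite eqxx mulr1 addr0.
  - by move=> i; apply: eichler_rowp.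
  - by move=> i; apply: eichler_rowp.
have zrow b : z p b = if b == j then y p j else 0.
  have h : row p y1 = y p j *: row j E'^T.
    by apply/matrixP => ? i; rewrite [LHS]mxE y1row !mxE eqxx /r mulrC divfK.
  have h' : row p z = y p j *: row j 1%:M.
    by rewrite zE1 row_mul h -scalemxAl -row_mul mulmxV.
  have := congr1 (fun M : 'rV_d => M 0 b) h'; rewrite !mxE => ->.
  by rewrite eq_sym; case: eqP => _; rewrite ?mulr1 ?mulr0.
exists (invmx E), (invmx E'^T), p; split=> //.
  split; first exact: (orthV c_neq0 c_rev oE).
  - exact: iwahoriV.
  - exact: (orthV c_neq0 c_rev oE't).
  - by apply: mxintV => // i i'; rewrite mxE.
rewrite -/z => a; rewrite !inE => /or3P[/eqP->|/eqP->|aP].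
- exists j; split=> [b bj|a' ap]; first by rewrite zrow (negbTE bj).
  by rewrite zcol y1col (negbTE ap).
(* The row and the column of the partner [rev_ord p] need no elimination of their own: orthogonality
   to the cleared row and column empties them. *)
- exists (rev_ord j); split=> [b bj|a' ap].
    move/(orthP c_rev): (oz) => /(_ j b); rewrite (negbTE bj) /bform (bigD1 p) //= big1 => [|a' ap].
      by rewrite addr0 zcol y1col eqxx => /eqP; rewrite !mulf_eq0 (negbTE ypj) (negbTE (c_neq0 _)) => /eqP.
    by rewrite zcol y1col (negbTE ap) !mul0r.
  have := orth_row p a' oz; rewrite (negbTE ap) /bform (bigD1 j) //= big1 => [|b bj].
    by rewrite addr0 zrow eqxx => /eqP; rewrite !mulf_eq0 (negbTE ypj) (negbTE (ci_neq0 _)) => /eqP.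
  by rewrite zrow (negbTE bj) !mul0r.
have [ja [rowa cola]] := monoP a aP; have [rowa1 cola1] := monoP1 a ja aP rowa cola.
have jaj : ja != j by apply/eqP => e; move: ypj; rewrite -e cola ?eqxx // eq_sym neqP.
have jar : rev_ord ja != j.
  apply/eqP => e; move: ypj; rewrite -e (mono_rev a) ?eqxx //.
  by rewrite rev_ord_eqC; have [_] := neqP _ aP.
have rja : r (rev_ord ja) = 0.
  by rewrite /r (mono_rev a) ?mul0r // rev_ord_eqC; have [_] := neqP _ aP.
have rja' : r ja = 0 by rewrite /r cola ?mul0r // eq_sym neqP.
have rowE' i : E' ja i = (ja == i)%:R.
  by apply: eichler_row => //; rewrite rev_ord_eqC eq_sym.
exists ja; split=> [b bj|a' aa].
  rewrite zE1 mxE (bigD1 ja) //= big1 => [|b' bb]; last by rewrite rowa1 ?mul0r.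
  by rewrite invE'_row // eq_sym (negbTE bj) mulr0 addr0.
rewrite zE1 mxE (bigD1 ja) //= big1 => [|b bb]; last by rewrite invE'_col // (negbTE bb) mulr0.
by rewrite cola1 // mul0r addr0.
Qed.

Lemma elim_all (y : 'M[k]_d) : orth c y ->
  exists a b, [/\ orth c a, iwahori a, orth c b, mxint b &
    forall p, p != mid -> mono (a *m y *m b) p].
Proof.
have gen m (P : {set 'I_d}) : (#|~: P| <= m)%N -> (forall p, p \in P -> rev_ord p \in P) ->
    mid \notin P -> forall x, orth c x -> (forall p, p \in P -> mono x p) ->
  exists a b, [/\ orth c a, iwahori a, orth c b, mxint b &
    forall p, p != mid -> mono (a *m x *m b) p].
  elim: m P => [|m IH] P cP revP midP x ox monoP.
    move: cP; rewrite leqn0 cards_eq0 => /eqP e.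
    by have : mid \in ~: P; [rewrite inE | rewrite e inE].
  case: (boolP [exists p0, (p0 \notin P) && (p0 != mid)]); last first.
    rewrite negb_exists => /forallP h; exists 1%:M, 1%:M; split.
    - exact: orth1.
    - exact: iwahori1.
    - exact: orth1.
    - exact: mxint1.
    move=> p pm; rewrite mul1mx mulmx1; apply: monoP.
    by have := h p; rewrite pm andbT negbK.
  case/existsP=> p0 /andP[p0P p0m].
  have [a [b [p [[oa ia ob ib] pP pm mp]]]] := elim_step revP midP ox monoP p0P p0m.
  have ox' : orth c (a *m x *m b) by do !apply: orthM.
  have [|||a' [b' [oa' ia' ob' ib' h]]] := IH (p |: (rev_ord p |: P)) _ _ _ _ ox' mp.
  - have : ~: (p |: (rev_ord p |: P)) \proper ~: P.
      rewrite properE; apply/andP; split; first by rewrite finset.setCS; apply/fintype.subsetP => i; rewrite !inE => ->; rewrite !orbT.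
      by apply/subsetPn; exists p; rewrite !inE ?eqxx.
    by move/proper_card => lt; rewrite -ltnS; apply: leq_trans cP.
  - move=> i; rewrite !inE => /or3P[/eqP->|/eqP->|/revP->]; rewrite ?rev_ordK ?eqxx ?orbT //.
  - rewrite !inE !negb_or midP andbT eq_sym pm /= rev_ord_eqC rev_mid //.
  exists (a' *m a), (b *m b'); split.
  - exact: orthM.
  - exact: iwahoriM.
  - exact: orthM.
  - exact: mxintM.
  by move=> i /h; rewrite !mulmxA.
move=> oy; have [|||a [b h]] := gen _ finset.set0 (leqnn _) _ _ y oy.
- by move=> p; rewrite inE.
- by rewrite inE.
- by move=> p; rewrite inE.
by exists a, b.
Qed.

Variable pi : k.
Hypothesis pi1 : w pi = 1.
Let pi0 : pi != 0 := pi_neq0 pi1.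
Implicit Types l : {ffun 'I_n -> int}.

Lemma cochar_mxE l i j (m : nat) (A : 'M[k]_d) :
  (cochar_mx pi l *m A) i j = pi ^ cochar_exp l i * A i j.
Proof. by rewrite mul_diag_mx !mxE. Qed.

Lemma cochar_mxEr l i j (A : 'M[k]_d) :
  (A *m cochar_mx pi l) i j = A i j * pi ^ cochar_exp l j.
Proof. by rewrite mul_mx_diag !mxE. Qed.

Lemma cochar_mx0 : cochar_mx pi (0 : {ffun 'I_n -> int}) = 1%:M.
Proof.
apply/matrixP => i j; rewrite !mxE.
by rewrite cochar_exp0 expr0z.
Qed.

Lemma cochar_mxD l l' : cochar_mx pi (l + l') = cochar_mx pi l *m cochar_mx pi l'.
Proof.
apply/matrixP => i j; rewrite cochar_mxE // !mxE cochar_expD expfzDr //.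
by case: (i == j); rewrite ?mulr1n ?mulr0n ?mulr0.
Qed.

Lemma cochar_mxV l : cochar_mx pi (- l) *m cochar_mx pi l = 1%:M.
Proof. by rewrite -cochar_mxD addNr cochar_mx0. Qed.

Lemma cochar_orth l : orth c (cochar_mx pi l).
Proof.
apply/matrixP => i j; rewrite -mulmxA (_ : (cochar_mx pi l)^T = cochar_mx pi l) ?tr_diag_mx //.
rewrite cochar_mxE // cochar_mxEr !mxE; case: eqP => [->|_]; last by rewrite mul0r mulr0.
by rewrite cochar_exp_rev mulrCA -expfzDr // subrr expr0z mulr1.
Qed.

Lemma cochar_det l : \det (cochar_mx pi l) = 1.
Proof.
rewrite det_diag; have -> : \prod_i (\row_(a < d) pi ^ cochar_exp l a) 0 i = pi ^ (\sum_(i < d) cochar_exp l i).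
  elim/big_rec2: _ => [|i x y _ ->]; first by rewrite expr0z.
  by rewrite mxE expfzDr.
have : \sum_(i < d) cochar_exp l i = - \sum_(i < d) cochar_exp l i.
  rewrite {1}(reindex_inj rev_ord_inj) /= -sumrN; apply: eq_bigr => i _; exact: (cochar_exp_rev l i).
move=> e; rewrite (_ : \sum_(i < d) _ = 0) ?expr0z //.
by move: (\sum_(i < d) _) e; clear; lia.
Qed.

(** The nonzero entries in the rows [p] and [rev_ord p] have opposite valuations, because their
    product is a unit. The valuations therefore form a cocharacter, and dividing it out leaves an
    integral monomial matrix, in which the Weyl group element is absorbed. *)
Lemma mono_cartan y : orth c y -> (forall p, p != mid -> mono y p) ->
  exists l b, [/\ orth c b, mxint b & y = cochar_mx pi l *m b].
Proof.
move=> oy mon.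
have rown p : p != mid -> y p mid = 0.
  move=> pm; have [j [rowp colp]] := mon p pm.
  have [e|ne] := eqVneq mid j; last exact: rowp.
  have := orth_row p p oy; rewrite rev_ord_fix (negbTE pm) /bform (bigD1 mid) //= big1 => [|b bm].
    by rewrite addr0 rev_mid => /eqP; rewrite !mulf_eq0 (negbTE (ci_neq0 _)) orbF orbb => /eqP.
  by rewrite rowp -?e // !mul0r.
have ymm : y mid mid != 0.
  move/(orthP c_rev): (oy) => /(_ mid mid); rewrite rev_mid eqxx /bform (bigD1 mid) //= big1 => [e|a am].
    by apply/eqP => y0; move: e; rewrite y0 !mul0r addr0 => e; have := c_neq0 mid; rewrite -e eqxx.
  by rewrite rown // !mul0r.
have monmid : mono y mid.
  exists mid; split=> [b bm|p pm]; last exact: rown.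
  move/(orthP c_rev): (oy) => /(_ mid b); rewrite rev_mid (negbTE bm) /bform (bigD1 mid) //= big1 => [|a am].
    by rewrite addr0 rev_mid => /eqP; rewrite !mulf_eq0 (negbTE ymm) (negbTE (c_neq0 _)) => /eqP.
  by rewrite rown // !mul0r.
have mon' p : exists j, y p j != 0 /\ forall j', j' != j -> y p j' = 0.
  have [j [rowp _]] : mono y p by have [->|/mon] := eqVneq p mid.
  have [j' hj'] := row_neq0 p oy; exists j; split=> //.
  by have [<-//|ne] := eqVneq j' j; move: hj'; rewrite rowp ?eqxx.
have [s sP] := choice mon'.
have spos p : y (rev_ord p) (rev_ord (s p)) != 0 /\
    y p (s p) * (c (s p))^-1 * y (rev_ord p) (rev_ord (s p)) = (c p)^-1.
  have := orth_row p (rev_ord p) oy; rewrite eqxx /bform (bigD1 (s p)) //= big1 => [|b bs].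
    rewrite addr0 => e; split=> //; apply/eqP => y0; move: e; rewrite y0 mulr0 => e.
    by have := ci_neq0 p; rewrite -e eqxx.
  by have [_ ->] := sP p; rewrite ?mul0r.
have s_rev p : s (rev_ord p) = rev_ord (s p).
  have [h _] := spos p; have [_ h'] := sP (rev_ord p).
  by apply/eqP; apply: contraT => ne; move: h; rewrite h' ?eqxx // eq_sym.
pose v p := w (y p (s p)).
have v_rev p : v (rev_ord p) = - v p.
  have [h1 h2] := spos p; have [h3 _] := sP p.
  have := congr1 w h2; rewrite !place_valM ?mulf_neq0 ?ci_neq0 // !placeV /v s_rev.
  have /andP[_ /eqP->] := c_unit (s p); have /andP[_ /eqP->] := c_unit p; clear; vlia.
have dlt (i : 'I_n) : (i < d)%N by have := ltn_ord i; lia.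
pose l := [ffun i : 'I_n => v (Ordinal (dlt i))].
have lE (p : 'I_d) : cochar_exp l p = v p.
  case: (ord_half p) => [[i e]|e|[i e]].
  - by rewrite e cochar_exp_lt ffunE; congr v; apply: val_inj.
  - have -> : p = mid by apply: val_inj.
    by rewrite cochar_exp_mid; have := v_rev mid; rewrite rev_mid; move: (v mid); clear; lia.
  rewrite e cochar_exp_gt ffunE -v_rev; congr v; apply: val_inj => /=; rewrite e; have := ltn_ord i; lia.
exists l, (cochar_mx pi (- l) *m y); split.
- by apply: orthM => //; exact: cochar_orth.
- move=> p j; rewrite cochar_mxE //.
  rewrite cochar_expN -vpow_vintE // lE; have [->|ne] := eqVneq j (s p).
    by rewrite vpow_val ?lexx //; have [] := sP p.
  by have [_ ->] := sP p; rewrite ?rpred0.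
by rewrite mulmxA -[l in cochar_mx pi l]opprK cochar_mxV mul1mx.
Qed.

Definition SOJ (x : 'M[k]_d) := orth c x /\ \det x = 1.

Lemma SOJ1 : SOJ 1%:M. Proof. by split; [exact: orth1 | rewrite det1]. Qed.
Lemma SOJM x y : SOJ x -> SOJ y -> SOJ (x *m y).
Proof. by move=> [ox dx] [oy dy]; split; [exact: orthM | rewrite det_mulmx dx dy mulr1]. Qed.
Lemma SOJV x : SOJ x -> SOJ (invmx x).
Proof. by move=> [ox dx]; split; [exact: orthV | rewrite det_inv dx invr1]. Qed.
Lemma cochar_SOJ l : SOJ (cochar_mx pi l).
Proof. by split; [exact: cochar_orth | exact: cochar_det]. Qed.

Lemma iwahori_cartan y : SOJ y ->
  exists l a b, [/\ SOJ a, iwahori a, SOJ b, mxint b & y = a *m cochar_mx pi l *m b].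
Proof.
move=> [oy dy]; have [a [b [oa ia ob ib mon]]] := elim_all oy.
have oz : orth c (a *m y *m b) by do !apply: orthM.
have [l [b' [ob' ib' e]]] := mono_cartan oz mon.
have ua := orth_unit c_neq0 c_rev oa; have ub := orth_unit c_neq0 c_rev ob.
have yE : y = invmx a *m cochar_mx pi l *m (b' *m invmx b).
  by rewrite mulmxA -(mulmxA _ _ b') -e !mulmxA mulVmx // mul1mx mulmxK.
have o1 : orth c (invmx a) by apply: orthV.
have o2 : orth c (b' *m invmx b) by apply: orthM => //; apply: orthV.
have i1 : iwahori (invmx a) by apply: iwahoriV.
have i2 : mxint (b' *m invmx b) by apply: mxintM => //; apply: mxintV.
have dd : \det (invmx a) * \det (b' *m invmx b) = 1.
  by rewrite -dy [in RHS]yE !det_mulmx cochar_det mulr1.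
have detN (x : 'M[k]_d) : \det (- x) = - \det x.
  by rewrite -scaleN1r detZ -signr_odd /= odd_double expr1 mulN1r.
case: (orth_det c_neq0 c_rev o1) dd => d1; rewrite d1 => dd.
  by exists l, (invmx a), (b' *m invmx b); split; rewrite /SOJ //; split=> //; rewrite -dd mul1r.
(* The dimension is odd, so -1 has determinant -1 and repairs both outer factors at once. *)
exists l, (- invmx a), (- (b' *m invmx b)); split.
- by split; [exact: orthN | rewrite detN d1 opprK].
- by split=> [i j|i j ji]; rewrite mxE rpredN; [apply: i1.1 | apply: i1.2].
- by split; [exact: orthN | rewrite detN -[LHS]mulN1r dd].
- by move=> i j; rewrite mxE rpredN.
by rewrite mulNmx mulmxN mulNmx opprK.
Qed.

End Elimination.

(** * Triangular factorization of integral matrices *)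

Section Triangular.
Variable (k : fieldType).

Lemma unitriangular_inv_ex m (M : 'M[k]_m) : unitriangular M ->
  exists U : 'M[k]_m, unitriangular U /\ M *m U = 1%:M.
Proof.
elim: m M => [|m IH] M [up dg].
  by exists 1%:M; split; [split=> -[] | apply/matrixP => -[]].
pose b : 'M_(1, m) := @ursubmx _ 1 m 1 m M; pose S : 'M_m := @drsubmx _ 1 m 1 m M.
have uS : unitriangular S.
  split=> [i j ji|i]; first by rewrite /S !mxE up //=; rewrite /bump /= !add1n.
  by rewrite /S !mxE; apply: dg.
have eM : M = block_mx (1%:M : 'M_1) b 0 S :> 'M_(1 + m).
  rewrite -[LHS](@submxK _ 1 m 1 m); congr block_mx; apply/matrixP => i j; rewrite !mxE.
    by rewrite !ord1 eqxx -[RHS](dg 0); congr (M _ _); apply: val_inj.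
  by rewrite up //= !ord1.
have [U [[upU dgU] SU]] := IH S uS.
exists (block_mx (1%:M : 'M_1) (- (b *m U)) 0 U : 'M_(1 + m)); split; last first.
  rewrite eM (@mulmx_block _ 1 m 1 m 1 m) !mul0mx !mulmx0 !mul1mx SU addNr addr0 !add0r.
  by rewrite -scalar_mx_block.
split=> [i j|i].
  case: (@splitP 1 m i) => i' ei; case: (@splitP 1 m j) => j' ej.
  - by rewrite ei ej !ord1.
  - by rewrite ei ej !ord1 /= ltn0.
  - have -> : i = rshift 1 i' by apply: val_inj.
    have -> : j = lshift m j' by apply: val_inj.
    by rewrite (@block_mxEdl _ 1 m 1 m) mxE.
  have -> : i = rshift 1 i' by apply: val_inj.
  have -> : j = rshift 1 j' by apply: val_inj.
  by rewrite (@block_mxEdr _ 1 m 1 m) ltn_add2l => ji; apply: upU.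
case: (@splitP 1 m i) => i' ei.
  have -> : i = lshift m i' by apply: val_inj.
  by rewrite (@block_mxEul _ 1 m 1 m) !ord1 mxE eqxx.
have -> : i = rshift 1 i' by apply: val_inj.
by rewrite (@block_mxEdr _ 1 m 1 m) dgU.
Qed.

Lemma det_unitriangular m (M : 'M[k]_m) : unitriangular M -> \det M = 1.
Proof.
move=> [up dg]; rewrite -det_tr det_trig ?big1 // => [i _|]; first by rewrite mxE.
by apply/is_trig_mxP => i j ij; rewrite mxE up.
Qed.

Lemma unitriangularV m (M : 'M[k]_m) : unitriangular M -> unitriangular (invmx M).
Proof.
move=> uM; have [U [uU MU]] := unitriangular_inv_ex uM.
by have [uM' _] := mulmx1_unit MU; rewrite -[invmx M]mulmx1 -MU mulKmx.
Qed.

Lemma unitriangularM m (M N : 'M[k]_m) :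
  unitriangular M -> unitriangular N -> unitriangular (M *m N).
Proof.
move=> [uM dM] [uN dN]; split=> [i j ji|i].
  rewrite mxE big1 // => a _; case: (ltnP a i) => ai; first by rewrite uM ?mul0r.
  by rewrite uN ?mulr0 // (leq_trans ji).
rewrite mxE (bigD1 i) //= big1 => [|a ai]; first by rewrite dM dN mulr1 addr0.
move: ai; rewrite neq_ltn => /orP[ai|ai]; first by rewrite uM ?mul0r.
by rewrite uN ?mulr0.
Qed.

Lemma unitriangular_unit m (M : 'M[k]_m) : unitriangular M -> M \in unitmx.
Proof. by move=> uM; rewrite unitmxE det_unitriangular // unitr1. Qed.

Variable w : place k.

Lemma det_vint m (M : 'M[k]_m) : mxint w M -> \det M \in vint w.
Proof.
move=> h; rewrite /determinant rpred_sum // => s _; rewrite rpredM ?rpred_prod //.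
by rewrite rpredX // rpredN rpred1.
Qed.

Lemma mxint_invmx m (M : 'M[k]_m) : mxint w M -> vunt w (\det M) -> mxint w (invmx M).
Proof.
move=> h u; have uM : M \in unitmx by rewrite unitmxE unitfE (vunt_neq0 u).
move=> i j; rewrite /invmx uM !mxE rpredM ?vintV // /cofactor rpredM //.
  by rewrite rpredX // rpredN rpred1.
by apply: det_vint => a b; rewrite !mxE.
Qed.

Lemma mxint_unitriV m (M : 'M[k]_m) : unitriangular M -> mxint w M -> mxint w (invmx M).
Proof. by move=> u h; apply: mxint_invmx => //; rewrite det_unitriangular // vunt1. Qed.

(** Gaussian elimination without pivoting: the Schur complement [S'] differs from [S] by multiples
    of pi, so its diagonal entries remain units and its lower part remains divisible by pi. *)
Lemma LU_iwahori m (A : 'M[k]_m) : mxint w A ->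
  (forall i j : 'I_m, (j < i)%N -> A i j \in vpow w 1) -> (forall i, vunt w (A i i)) ->
  exists U : 'M[k]_m, [/\ unitriangular U, mxint w U &
    forall i j : 'I_m, (i < j)%N -> (A *m U) i j = 0].
Proof.
elim: m A => [|m IH] A iA lA dA.
  by exists 1%:M; split; [split=> -[] | move=> -[] | move=> -[]].
pose a : k := A 0 0; pose b : 'M_(1, m) := @ursubmx _ 1 m 1 m A.
pose cc : 'M_(m, 1) := @dlsubmx _ 1 m 1 m A; pose S : 'M_m := @drsubmx _ 1 m 1 m A.
have eA : A = block_mx (a%:M : 'M_1) b cc S :> 'M_(1 + m).
  rewrite -[LHS](@submxK _ 1 m 1 m); congr block_mx; apply/matrixP => i j; rewrite !mxE !ord1 eqxx mulr1n.
  by congr (A _ _); apply: val_inj.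
have ua : vunt w a by apply: dA.
have ccE i j : cc i j \in vpow w 1 by rewrite /cc !mxE lA //= !ord1.
have bE i j : b i j \in vint w by rewrite /b !mxE.
pose S' := S - a^-1 *: (cc *m b).
have S'E i j : exists t, t \in vpow w 1 /\ S' i j = S i j + t.
  exists (- (a^-1 * (cc *m b) i j)); rewrite !mxE; split=> //.
  rewrite rpredN vpowMl ?vintV // rpred_sum // => x _.
  by rewrite vpowMr ?ccE // bE.
have [||| U [uU iU AU]] := IH S'.
- move=> i j; have [t [ht ->]] := S'E i j; rewrite rpredD //; first by rewrite /S !mxE.
  by apply: vpow_vint ht.
- move=> i j ji; have [t [ht ->]] := S'E i j; rewrite rpredD // /S !mxE lA //=.
- move=> i; have [t [ht ->]] := S'E i i; apply: vunt_add => //.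
  by rewrite /S !mxE; apply: dA.
exists (block_mx (1%:M : 'M_1) (- (a^-1 *: (b *m U))) 0 U : 'M_(1 + m)); split.
- split=> [i j|i].
    case: (@splitP 1 m i) => i' ei; case: (@splitP 1 m j) => j' ej.
    + by rewrite ei ej !ord1.
    + by rewrite ei ej !ord1 /= ltn0.
    + have -> : i = rshift 1 i' by apply: val_inj.
      have -> : j = lshift m j' by apply: val_inj.
      by rewrite (@block_mxEdl _ 1 m 1 m) mxE.
    have -> : i = rshift 1 i' by apply: val_inj.
    have -> : j = rshift 1 j' by apply: val_inj.
    by rewrite (@block_mxEdr _ 1 m 1 m) ltn_add2l => ji; apply: uU.1.
  case: (@splitP 1 m i) => i' ei.
    have -> : i = lshift m i' by apply: val_inj.
    by rewrite (@block_mxEul _ 1 m 1 m) !ord1 mxE eqxx.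
  have -> : i = rshift 1 i' by apply: val_inj.
  by rewrite (@block_mxEdr _ 1 m 1 m) uU.2.
- move=> i j; case: (@splitP 1 m i) => i' ei; case: (@splitP 1 m j) => j' ej.
  + have -> : i = lshift m i' by apply: val_inj.
    have -> : j = lshift m j' by apply: val_inj.
    by rewrite (@block_mxEul _ 1 m 1 m) !ord1 mxE eqxx rpred1.
  + have -> : i = lshift m i' by apply: val_inj.
    have -> : j = rshift 1 j' by apply: val_inj.
    rewrite (@block_mxEur _ 1 m 1 m) !mxE rpredN rpredM ?vintV //.
    by rewrite rpred_sum // => x _; rewrite rpredM ?bE ?iU.
  + have -> : i = rshift 1 i' by apply: val_inj.
    have -> : j = lshift m j' by apply: val_inj.
    by rewrite (@block_mxEdl _ 1 m 1 m) mxE rpred0.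
  have -> : i = rshift 1 i' by apply: val_inj.
  have -> : j = rshift 1 j' by apply: val_inj.
  by rewrite (@block_mxEdr _ 1 m 1 m) iU.
move=> i j ij; rewrite eA (@mulmx_block _ 1 m 1 m 1 m) !mulmxN -!scalemxAr !mul_scalar_mx !scalerA.
rewrite mulVf ?(vunt_neq0 ua) // scale1r addNr !mulmx0 !addr0.
have -> : - (a^-1 *: (cc *m (b *m U))) + S *m U = S' *m U.
  by rewrite /S' mulmxBl -scalemxAl mulmxA addrC.
case: (@splitP 1 m j) ij => j' ej; first by rewrite ej !ord1 ltn0.
have -> : j = rshift 1 j' by apply: val_inj.
case: (@splitP 1 m i) => i' ei.
  have -> : i = lshift m i' by apply: val_inj.
  by rewrite (@block_mxEur _ 1 m 1 m) mxE.
have -> : i = rshift 1 i' by apply: val_inj.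
by rewrite (@block_mxEdr _ 1 m 1 m) ltn_add2l; apply: AU.
Qed.

(** Under either triangularity assumption the block of a product involves only the blocks of the
    factors; this is what makes the leading minors in [psum_le] multiplicative. *)
Lemma widen_mulmx m r (rm : (r <= m)%N) (X Y : 'M[k]_m) :
  (forall i j : 'I_m, (i < j)%N -> X i j = 0) \/ (forall i j : 'I_m, (j < i)%N -> Y i j = 0) ->
  mxsub (widen_ord rm) (widen_ord rm) (X *m Y)
  = mxsub (widen_ord rm) (widen_ord rm) X *m mxsub (widen_ord rm) (widen_ord rm) Y.
Proof.
move=> h; apply/matrixP => i j; rewrite !mxE.
rewrite (bigID (fun a : 'I_m => (a < r)%N)) /= [X in _ + X]big1 ?addr0; last first.
  move=> a; rewrite -leqNgt => ra; case: h => h.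
    by rewrite h ?mul0r //= (leq_trans _ ra).
  by rewrite [Y _ _]h ?mulr0 //= (leq_trans _ ra).
rewrite (big_ord_narrow rm).
by apply: eq_bigr => a _; rewrite !mxE.
Qed.

Lemma trig_unit m (b b' : 'M[k]_m) : b *m b' = 1%:M -> mxint w b -> mxint w b' ->
  (forall i j : 'I_m, (i < j)%N -> b i j = 0) -> (forall i j : 'I_m, (i < j)%N -> b' i j = 0) ->
  forall i, vunt w (b i i).
Proof.
move=> bb ib ib' lb lb' i; apply: (@vint_vunt _ w _ (b' i i)) => //.
have := congr1 (fun M : 'M_m => M i i) bb; rewrite !mxE eqxx (bigD1 i) //= big1 ?addr0 // => a ai.
move: ai; rewrite neq_ltn => /orP[ai|ai]; first by rewrite [b' _ _]lb' ?mulr0.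
by rewrite lb ?mul0r.
Qed.
End Triangular.

(** * Iwahori cells against unipotent cells *)

Section Unipotent.
Variables (k : fieldType) (w : place k) (n : nat).
Local Notation d := n.*2.+1.
Variable c : 'I_d -> k.
Hypothesis c_unit : forall i, vunt w (c i).
Hypothesis c_rev : forall i, c (rev_ord i) = c i.
Let c_neq0 i : c i != 0 := vunt_neq0 (c_unit i).
Local Notation J := (antidiag c).

(** Modulo pi both x and its inverse are upper triangular, so the product of their ith diagonal
    entries is congruent to 1. *)
Lemma iwahori_diag x : orth c x -> iwahori w x -> forall i, vunt w (x i i).
Proof.
move=> ox ix i; have ix' := iwahoriV c_unit c_rev ox ix.
have := congr1 (fun M : 'M_d => M i i) (mulmxV (orth_unit c_neq0 c_rev ox)).
rewrite !mxE eqxx (bigD1 i) //= => e.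
have h : vunt w (x i i * invmx x i i).
  apply: (@vunt_cong _ w 1); first exact: vunt1.
  rewrite -[X in _ - X]e opprD addrA subrr sub0r rpredN rpred_sum // => a ai.
  move: ai; rewrite neq_ltn => /orP[ai|ai]; first by rewrite vpowMr ?ix.2 // ix'.1.
  by rewrite vpowMl ?ix'.2 // ix.1.
apply: (@vint_vunt _ w _ (invmx x i i * (x i i * invmx x i i)^-1)).
- by rewrite mulrA mulfV // (vunt_neq0 h).
- exact: ix.1.
by rewrite rpredM ?vintV // ix'.1.
Qed.

Lemma orth_lowerV x : orth c x -> (forall i j : 'I_d, (i < j)%N -> x i j = 0) ->
  forall i j : 'I_d, (i < j)%N -> invmx x i j = 0.
Proof.
move=> ox lx i j ij; rewrite (orth_inv_entry c_neq0 c_rev) // lx ?mulr0 ?mul0r //.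
by rewrite rev_ord_lt.
Qed.

(* [k^-1 u = L] lower triangular gives [L^T J L = u^T J u], whose two sides are
   supported on opposite sides of the antidiagonal. *)
Lemma iwahori_UL x : orth c x -> iwahori w x -> exists u b,
  [/\ [/\ SOJ c u, mxint w u & unitriangular u], orth c b, mxint w b,
   forall i j : 'I_d, (i < j)%N -> b i j = 0 & x = u *m b].
Proof.
move=> ox ix; have ix' := iwahoriV c_unit c_rev ox ix.
have ox' := orthV c_neq0 c_rev ox.
have [u [uu iu lu]] := LU_iwahori ix'.1 ix'.2 (iwahori_diag ox' ix').
set L := invmx x *m u in lu.
have e : L^T *m J *m L = u^T *m J *m u.
  by rewrite /L trmx_mul -[J in RHS]ox' !mulmxA.
have ou : orth c u.
  apply/matrixP => i j; case: (ltngtP j (rev_ord i)) => ij.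
  - rewrite gram_entry // [RHS]mxE (_ : j == _ = false); last by apply/eqP => ji; move: ij; rewrite ji ltnn.
    rewrite /bform big1 // => a _; case: (ltnP i a) => ia; first by rewrite uu.1 ?mul0r.
    rewrite [u (rev_ord a) j]uu.1 ?mulr0 //; apply: (leq_trans ij).
    by rewrite /= leq_sub2l // ltnS.
  - rewrite -e gram_entry // [RHS]mxE (_ : j == _ = false); last by apply/eqP => ji; move: ij; rewrite ji ltnn.
    rewrite /bform big1 // => a _; case: (ltnP a i) => ia; first by rewrite lu ?mul0r.
    rewrite [L (rev_ord a) j]lu ?mulr0 //; apply: leq_trans ij.
    by rewrite /= ltnS leq_sub2l // ltnS.
  have -> : j = rev_ord i by apply: val_inj.
  rewrite gram_entry // [RHS]mxE eqxx /bform (bigD1 i) //= big1 => [|a ai].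
    by rewrite !uu.2 mul1r mulr1 addr0.
  move: ai; rewrite neq_ltn => /orP[ai|ai]; last by rewrite uu.1 ?mul0r.
  by rewrite [u (rev_ord a) _]uu.1 ?mulr0 // rev_ord_lt.
have oL : orth c L by apply: orthM => //.
exists u, (invmx L); split.
- by split=> //; split=> //; rewrite det_unitriangular.
- exact: orthV.
- apply: mxintV => //; apply: mxintM => //; exact: ix'.1.
- exact: orth_lowerV.
have uL := orth_unit c_neq0 c_rev oL; have ux := orth_unit c_neq0 c_rev ox.
by apply: (can_inj (mulmxK uL)); rewrite mulmxKV // /L mulKVmx.
Qed.

Variable pi : k.
Hypothesis pi1 : w pi = 1.
Let pi0 : pi != 0 := pi_neq0 pi1.
Implicit Types l : {ffun 'I_n -> int}.

Definition psum l (r : nat) : int := \sum_(a < d | (a < r)%N) cochar_exp l a.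
(** One integer that is strictly monotone for the partial-sum order, so that a minimal cocharacter
    can be found by minimizing an integer. *)
Definition height l : int := \sum_(r < n.+1) psum l r.

Lemma det_widen_cochar l r (rd : (r <= d)%N) :
  \det (mxsub (widen_ord rd) (widen_ord rd) (cochar_mx pi l)) = pi ^ (psum l r).
Proof.
rewrite det_trig; last first.
  apply/is_trig_mxP => i j ij; rewrite !mxE (_ : _ == _ = false) //.
  by apply/eqP => /(congr1 val) /= e; move: ij; rewrite e ltnn.
rewrite /psum (big_ord_narrow rd) /=; elim/big_rec2: _ => [|i x y _ ->]; first by rewrite expr0z.
by rewrite !mxE eqxx mulr1n expfzDr.
Qed.

(** Compare the leading r x r minors: on the left a unit times pi^(psum l r) times an integer, on
    the right pi^(psum l' r). *)
Lemma psum_le l l' (b x u : 'M[k]_d) r : (forall i j : 'I_d, (i < j)%N -> b i j = 0) ->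
  (forall i, vunt w (b i i)) -> mxint w x -> unitriangular u ->
  b *m cochar_mx pi l *m x = u *m cochar_mx pi l' -> (r <= d)%N -> psum l r <= psum l' r.
Proof.
move=> lb db ix uu e rd; pose S (M : 'M[k]_d) := mxsub (widen_ord rd) (widen_ord rd) M.
have cl l0 i j : i != j -> cochar_mx pi l0 i j = 0 by move=> /negbTE ij; rewrite !mxE ij mulr0n.
have low0 l0 (i j : 'I_d) : (i < j)%N -> cochar_mx pi l0 i j = 0.
  by move=> ij; apply: cl; rewrite neq_ltn ij.
have up0 l0 (i j : 'I_d) : (j < i)%N -> cochar_mx pi l0 i j = 0.
  by move=> ij; apply: cl; rewrite neq_ltn ij orbT.
have : \det (S (b *m cochar_mx pi l *m x)) = \det (S (u *m cochar_mx pi l')) by rewrite e.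
rewrite /S -mulmxA !widen_mulmx; [|by right; apply: up0|by left; apply: low0|by left].
rewrite !det_mulmx !det_widen_cochar.
have -> : \det (mxsub (widen_ord rd) (widen_ord rd) u) = 1.
  apply: det_unitriangular; split=> [i j ji|i]; rewrite mxE; [exact: uu.1 | exact: uu.2].
have ub : vunt w (\det (mxsub (widen_ord rd) (widen_ord rd) b)).
  rewrite det_trig; last by apply/is_trig_mxP => i j ij; rewrite mxE lb.
  by apply: vunt_prod => i _; rewrite mxE.
have ix' : \det (mxsub (widen_ord rd) (widen_ord rd) x) \in vint w.
  by apply: det_vint => i j; rewrite mxE.
rewrite mul1r => e'; have : pi ^ psum l' r \in vpow w (psum l r).
  by rewrite -e' vpowMVl // vpowE // subrr.
by rewrite vpow_val ?(piz_neq0 pi1) // (pi_val pi1).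
Qed.

Lemma height_inj l l' : (forall r, (r <= d)%N -> psum l r <= psum l' r) ->
  height l <= height l' /\ (height l = height l' -> l = l').
Proof.
move=> h; have h' (r : 'I_n.+1) : psum l r <= psum l' r by apply: h; have := ltn_ord r; lia.
split; first by apply: ler_sum => r _; apply: h'.
move=> e; have e' (r : 'I_n.+1) : psum l' r - psum l r = 0.
  have : \sum_(r < n.+1) (psum l' r - psum l r) = 0 by rewrite sumrB -/(height l') -/(height l) e subrr.
  by move/eqP; rewrite psumr_eq0 => [/allP/(_ r (mem_index_enum _))/eqP|i _]; rewrite ?subr_ge0.
have step l0 (i : 'I_n) : psum l0 i.+1 = psum l0 i + l0 i.
  have id : (i < d)%N by have := ltn_ord i; lia.
  rewrite /psum (bigD1 (Ordinal id)) //= addrC cochar_exp_lt; congr (_ + _).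
  by apply: eq_bigl => a; rewrite ltnS andbC ltn_neqAle.
apply/ffunP => i; have h1 : (i < n.+1)%N by have := ltn_ord i; lia.
have h2 : (i.+1 < n.+1)%N by have := ltn_ord i; lia.
have := e' (Ordinal h1); have := e' (Ordinal h2); rewrite /= !step.
by move: (psum l i) (psum l' i) (l i) (l' i); clear; lia.
Qed.

(** With a = v b from [iwahori_UL], moving the unipotent v and the integral y to the other sides
    brings the equation to the form of [psum_le]. *)
Lemma iwahori_iwasawa l l' (a x u y : 'M[k]_d) : orth c a -> iwahori w a -> orth c x -> mxint w x ->
  unitriangular u -> orth c y -> mxint w y ->
  a *m cochar_mx pi l *m x = u *m cochar_mx pi l' *m y ->
  height l <= height l' /\ (height l = height l' -> l = l').
Proof.
move=> oa ia ox ix uu oy iy e; have [v [b [[[ov _] iv uv] ob ib lb ab]]] := iwahori_UL oa ia.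
have uy := orth_unit c_neq0 c_rev oy; have uv' := unitriangular_unit uv.
have ub := orth_unit c_neq0 c_rev ob.
apply: height_inj => r rd; apply: (@psum_le _ _ b (x *m invmx y) (invmx v *m u)) => //.
- apply: (@trig_unit _ w _ b (invmx b)) => //; [exact: mulmxV | exact: mxintV|].
  exact: orth_lowerV.
- by apply: mxintM => //; apply: mxintV.
- by apply: unitriangularM => //; apply: unitriangularV.
apply: (can_inj (mulmxK uy)); rewrite !mulmxA mulmxKV //.
by rewrite -[invmx v *m u *m _ *m y]mulmxA -[invmx v *m u *m _]mulmxA [u *m _]mulmxA -e ab !mulmxA mulVmx // mul1mx.
Qed.

End Unipotent.

(** * Cosets of unipotent subgroups *)

Lemma class_repr (T : finType) (R : T -> T -> bool) :
  (forall f, R f f) -> (forall f g, R f g -> R g f) ->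
  (forall f g h, R f g -> R g h -> R f h) ->
  exists2 rp : T -> T, forall f, R f (rp f) & forall f g, R f g -> rp f = rp g.
Proof.
move=> Rxx RC RT; exists (fun f => odflt f [pick g | R f g]) => [f|f g fg].
  by case: pickP => [g|/(_ f)]; rewrite ?Rxx.
have e : R f =1 R g by move=> h; apply/idP/idP; apply: RT => //; apply: RC.
by rewrite (eq_pick e); case: pickP => // /(_ g); rewrite Rxx.
Qed.

Section Cayley.
Variables (k : fieldType) (w : place k) (n : nat).
Local Notation d := n.*2.+1.
Variable c : 'I_d -> k.
Hypothesis c_unit : forall i, vunt w (c i).
Hypothesis c_rev : forall i, c (rev_ord i) = c i.
Hypothesis two_unit : vunt w 2%:R.
Let c_neq0 i : c i != 0 := vunt_neq0 (c_unit i).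
Let two0 : (2%:R : k) != 0 := vunt_neq0 two_unit.
Local Notation J := (antidiag c).
Implicit Types X u : 'M[k]_d.

Definition skew X := X^T *m J + J *m X = 0.
Definition strict X := forall i j : 'I_d, (j <= i)%N -> X i j = 0.

(** The Cayley transform (1 + X) / (1 - X). It replaces the exponential as a chart of the unipotent
    orthogonal group by skew matrices, and only 2 has to be a unit. *)
Definition cay X := 2%:R *: invmx (1%:M - X) - 1%:M.
Definition cayi u := 1%:M - invmx (2%:R^-1 *: (1%:M + u)).

Lemma strict_uni X : strict X <-> unitriangular (1%:M - X).
Proof.
split=> [h|[h1 h2] i j ij].
  split=> [i j ji|i]; rewrite !mxE.
    by rewrite h 1?ltnW // (_ : i == j = false) ?subr0 //; apply/eqP => e; move: ji; rewrite e ltnn.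
  by rewrite h // eqxx subr0.
move: ij; rewrite leq_eqVlt => /orP[/eqP/val_inj <-|ji].
  by have := h2 j; rewrite !mxE eqxx => /eqP; rewrite subr_eq addrC -subr_eq subrr => /eqP.
have := h1 i j ji; rewrite !mxE (_ : i == j = false) ?sub0r; last by apply/eqP => e; move: ji; rewrite e ltnn.
by move/eqP; rewrite oppr_eq0 => /eqP.
Qed.

Lemma half_uni u : unitriangular u -> unitriangular (2%:R^-1 *: (1%:M + u)).
Proof.
move=> [h1 h2]; split=> [i j ji|i]; rewrite !mxE.
  by rewrite h1 // (_ : i == j = false) ?addr0 ?mulr0 //; apply/eqP => e; move: ji; rewrite e ltnn.
by rewrite h2 eqxx -(natrD _ 1 1) mulVf.
Qed.

Lemma cayi_strict u : unitriangular u -> strict (cayi u).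
Proof.
move=> uu; apply/strict_uni; rewrite /cayi opprB addrCA subrr addr0.
by apply: unitriangularV; apply: half_uni.
Qed.

Lemma cay_half X : strict X -> 2%:R^-1 *: (1%:M + cay X) = invmx (1%:M - X).
Proof. by move=> sX; rewrite /cay addrCA subrr addr0 scalerA mulVf // scale1r. Qed.

Lemma cayK X : strict X -> cayi (cay X) = X.
Proof. by move=> sX; rewrite /cayi cay_half // invmxK opprB addrCA subrr addr0. Qed.

Lemma cayiK u : unitriangular u -> cay (cayi u) = u.
Proof.
move=> uu; rewrite /cay /cayi opprB addrCA subrr addr0 invmxK scalerA divff // scale1r.
by rewrite addrAC subrr add0r.
Qed.

Lemma cay_uni X : strict X -> unitriangular (cay X).
Proof.
move=> /strict_uni/unitriangularV [h1 h2]; split=> [i j ji|i]; rewrite !mxE.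
  by rewrite h1 // (_ : i == j = false) ?mulr0 ?subr0 //; apply/eqP => e; move: ji; rewrite e ltnn.
by rewrite h2 eqxx mulr1 (_ : 2%:R - 1 = 1 :> k) //; ring.
Qed.

Lemma cay_orth X : strict X -> skew X -> orth c (cay X).
Proof.
move=> sX kX; have /unitriangular_unit uX := (strict_uni X).1 sX.
have e1 : cay X = (1%:M + X) *m invmx (1%:M - X).
  apply: (can_inj (mulmxK uX)); rewrite mulmxKV // /cay mulmxBl mul1mx -scalemxAl mulVmx //.
  by rewrite scaler_nat mulr2n opprB addrACA subrr addr0.
have e2 : cay X = invmx (1%:M - X) *m (1%:M + X).
  apply: (can_inj (mulKmx uX)); rewrite mulKVmx // /cay mulmxBr mulmx1 -scalemxAr mulmxV //.
  by rewrite scaler_nat mulr2n opprB addrACA subrr addr0.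
have k' : X^T *m J = - (J *m X) by apply/eqP; rewrite -addr_eq0; apply/eqP.
have e3 : (1%:M + X)^T *m J = J *m (1%:M - X).
  by rewrite linearD /= trmx1 mulmxDl mul1mx k' mulmxBr mulmx1.
have e4 : (1%:M - X)^T *m J = J *m (1%:M + X).
  by rewrite linearB /= trmx1 mulmxBl mul1mx k' opprK mulmxDr mulmx1.
rewrite /orth {1}e1 e2 trmx_mul -mulmxA -mulmxA [(1%:M + X)^T *m _]mulmxA e3.
rewrite -mulmxA [(1%:M - X) *m _]mulmxA mulmxV // mul1mx -e4 mulmxA trmx_inv mulVmx ?mul1mx //.
by rewrite unitmx_tr.
Qed.

Lemma cayi_skew u : unitriangular u -> orth c u -> skew (cayi u).
Proof.
move=> uu ou; have /unitriangular_unit uv := half_uni uu.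
set v := 2%:R^-1 *: (1%:M + u) in uv *; rewrite /skew /cayi -/v.
have uvt : v^T \in unitmx by rewrite unitmx_tr.
apply: (can_inj (mulKmx uvt)); apply: (can_inj (mulmxK uv)).
rewrite mulmx0 mul0mx mulmxDr linearB /= trmx1 trmx_inv mulmxBl mul1mx mulmxBr mulKVmx //.
rewrite mulmxBr mulmx1 mulmxBr mulmxDl !mulmxBl -!mulmxA mulVmx // mulmx1.
have e : v^T *m (J *m v) = 2%:R^-1 *: (J *m v + v^T *m J).
  have e0 : (1%:M + u)^T *m (J *m (1%:M + u)) = J *m (1%:M + u) + (1%:M + u)^T *m J.
    rewrite (_ : J *m (1%:M + u) = J + J *m u); last by rewrite mulmxDr mulmx1.
    rewrite (_ : (1%:M + u)^T = 1%:M + u^T); last by rewrite linearD /= trmx1.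
    by rewrite !mulmxDl !mul1mx mulmxDr [u^T *m (J *m u)]mulmxA ou [_ + J]addrC.
  by rewrite /v linearZ /= -!(scalemxAl, scalemxAr) e0 !scalerDr.
rewrite e !scalerDr; apply/matrixP => i j; rewrite !mxE.
field; exact: two0.
Qed.

Lemma cay_int X : strict X -> mxint w X -> mxint w (cay X).
Proof.
move=> sX iX i j; rewrite !mxE rpredB //.
  apply: rpredM; first exact: vunt_int.
  apply: mxint_unitriV; first exact/strict_uni.
  by move=> a b; rewrite !mxE rpredB //; case: (_ == _); rewrite ?rpred0 ?rpred1.
by case: (_ == _); rewrite ?rpred0 ?rpred1.
Qed.

Lemma half_int u : mxint w u -> mxint w (2%:R^-1 *: (1%:M + u)).
Proof.
move=> iu i j; rewrite !mxE rpredM ?vintV // rpredD //.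
by case: (_ == _); rewrite ?rpred0 ?rpred1.
Qed.

Lemma cayi_int u : unitriangular u -> mxint w u -> mxint w (cayi u).
Proof.
move=> uu iu i j; rewrite !mxE rpredB //; first by case: (_ == _); rewrite ?rpred0 ?rpred1.
by apply: mxint_unitriV; [apply: half_uni | apply: half_int].
Qed.

Definition cong (m : int) (A B : 'M[k]_d) := forall i j, A i j - B i j \in vpow w m.

Lemma congM m (A B A' B' : 'M[k]_d) : mxint w A -> mxint w A' -> cong m B B' ->
  cong m (A *m B *m A') (A *m B' *m A').
Proof.
move=> iA iA' h i j.
have -> : (A *m B *m A') i j - (A *m B' *m A') i j = (A *m (B - B') *m A') i j.
  by rewrite mulmxBr mulmxBl [in RHS]mxE [in X in _ = _ + X]mxE.
rewrite mxE rpred_sum // => a _; rewrite vpowMr // mxE rpred_sum // => b _.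
by rewrite vpowMl // !mxE.
Qed.

Lemma invmx_cong m (A B : 'M[k]_d) : unitriangular A -> unitriangular B ->
  mxint w A -> mxint w B -> cong m A B -> cong m (invmx A) (invmx B).
Proof.
move=> uA uB iA iB h i j.
have [vA vB] := (unitriangular_unit uA, unitriangular_unit uB).
have -> : invmx A i j - invmx B i j = (invmx A *m B *m invmx B) i j - (invmx A *m A *m invmx B) i j.
  by rewrite mulmxK // mulVmx // mul1mx.
apply: congM; [exact: mxint_unitriV | exact: mxint_unitriV |].
by move=> a b; rewrite -opprB rpredN.
Qed.

Lemma cay_cong m X X' : strict X -> strict X' -> mxint w X -> mxint w X' ->
  cong m X X' -> cong m (cay X) (cay X').
Proof.
move=> sX sX' iX iX' h i j; rewrite !mxE opprB addrA subrK -mulrBr vpowMl ?vunt_int //.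
apply: invmx_cong; [exact/strict_uni | exact/strict_uni | | |].
- by move=> a b; rewrite !mxE rpredB //; case: (_ == _); rewrite ?rpred0 ?rpred1.
- by move=> a b; rewrite !mxE rpredB //; case: (_ == _); rewrite ?rpred0 ?rpred1.
move=> a b; have -> : (1%:M - X) a b - (1%:M - X') a b = - (X a b - X' a b).
  by rewrite !mxE; ring.
by rewrite rpredN.
Qed.

Lemma cayi_cong m u u' : unitriangular u -> unitriangular u' -> mxint w u -> mxint w u' ->
  cong m u u' -> cong m (cayi u) (cayi u').
Proof.
move=> uu uu' iu iu' h i j.
have -> : cayi u i j - cayi u' i j
    = invmx (2%:R^-1 *: (1%:M + u')) i j - invmx (2%:R^-1 *: (1%:M + u)) i j.
  by rewrite !mxE; ring.
have := invmx_cong (half_uni uu') (half_uni uu) (half_int iu') (half_int iu) (m := m).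
apply => a b; rewrite !mxE -mulrBr vpowMl ?vintV //.
by rewrite opprD addrACA subrr add0r -opprB rpredN.
Qed.

Variable pi : k.
Hypothesis pi1 : w pi = 1.
Let pi0 : pi != 0 := pi_neq0 pi1.
Variable l : {ffun 'I_n -> int}.
Local Notation e := (cochar_exp l).
Hypothesis e_dom : forall a b : 'I_d, (a <= b)%N -> e b <= e a.

Local Notation T := (cochar_mx pi l).
Definition tconj (A : 'M[k]_d) := cochar_mx pi (- l) *m A *m T.

Lemma tconjE A i j : tconj A i j = pi ^ (e j - e i) * A i j.
Proof.
rewrite /tconj cochar_mxEr cochar_mxE // cochar_expN mulrAC -expfzDr // addrC //.
Qed.

Lemma tconj_int A i j : (tconj A i j \in vint w) = (A i j \in vpow w (e i - e j)).
Proof. by rewrite tconjE [in RHS](vpow_vintE pi1) ?opprB. Qed.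

Lemma tVT : T *m cochar_mx pi (- l) = 1%:M.
Proof. by rewrite -(cochar_mxD pi1) subrr cochar_mx0. Qed.
Lemma tconjM A B : tconj (A *m B) = tconj A *m tconj B.
Proof.
rewrite /tconj !mulmxA; congr (_ *m _); rewrite -!mulmxA; congr (_ *m (_ *m _)).
by rewrite mulmxA tVT mul1mx.
Qed.
Lemma tconj1 : tconj 1%:M = 1%:M.
Proof. by rewrite /tconj mulmx1 (cochar_mxV pi1). Qed.
Lemma tconj_uni A : unitriangular A -> unitriangular (tconj A).
Proof.
move=> [h1 h2]; split=> [i j ji|i]; rewrite tconjE; first by rewrite h1 ?mulr0.
by rewrite h2 subrr expr0z mulr1.
Qed.
Lemma tconjV A : A \in unitmx -> tconj (invmx A) = invmx (tconj A).
Proof.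
move=> uA; have h : tconj (invmx A) *m tconj A = 1%:M by rewrite -tconjM mulVmx // tconj1.
have [_ uT] := mulmx1_unit h.
by rewrite -[RHS]mul1mx -h mulmxK.
Qed.

Lemma cay_tconj X : strict X -> tconj (cay X) = cay (tconj X).
Proof.
move=> /strict_uni/unitriangular_unit uX.
rewrite /cay -[in RHS]tconj1 -[tconj 1%:M - tconj X]/(_) .
have -> : tconj 1%:M - tconj X = tconj (1%:M - X) by rewrite /tconj mulmxBr mulmxBl.
by rewrite -tconjV // /tconj mulmxBr mulmxBl -scalemxAr -scalemxAl.
Qed.

Lemma strict_tconj X : strict X -> strict (tconj X).
Proof. by move=> sX i j ij; rewrite tconjE sX ?mulr0. Qed.

Lemma cayi_tconj u : unitriangular u -> tconj (cayi u) = cayi (tconj u).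
Proof.
move=> uu; have sX := cayi_strict uu.
by rewrite -[in RHS](cayiK uu) cay_tconj // cayK //; apply: strict_tconj.
Qed.

(** Positions above the diagonal and strictly before the antidiagonal, one for each positive root.
    They are coordinates for strictly upper triangular skew matrices: the antidiagonal of such a
    matrix vanishes, and the entries beyond it are determined by reflection. *)
Definition isfree : {pred 'I_d * 'I_d} :=
  fun p => (p.1 < p.2)%N && (p.2 < rev_ord p.1)%N.
Lemma isfreeE a b : ((a, b) \in isfree) = (a < b)%N && (b < rev_ord a)%N.
Proof. by []. Qed.

Definition frt := {p : 'I_d * 'I_d | p \in isfree}.

Definition getf (f : frt -> k) (a b : 'I_d) : k :=
  if insub (a, b) is Some p then f p else 0.

Definition mkskew (f : frt -> k) : 'M[k]_d := \matrix_(a, b)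
  (getf f a b - (c b / c a) * getf f (rev_ord b) (rev_ord a)).

Lemma isfree_rev a b : (a, b) \in isfree -> (rev_ord b, rev_ord a) \notin isfree.
Proof.
rewrite !isfreeE => /andP[_ /= h]; apply/negP => /andP[_ /= h']; move: h h'.
by have := ltn_ord a; have := ltn_ord b; clear; lia.
Qed.

Lemma mkskew_free f (p : frt) : mkskew f (val p).1 (val p).2 = f p.
Proof.
case: p => -[a b] /= h; rewrite mxE /getf insubT insubF ?mulr0 ?subr0 //.
by apply/negbTE; apply: isfree_rev.
Qed.

Lemma mkskew_strict f : strict (mkskew f).
Proof.
move=> i j ij; rewrite mxE /getf !insubF ?mulr0 ?subr0 //; apply/negP; rewrite isfreeE /= => /andP[h _].
  by move: h; have := ltn_ord i; have := ltn_ord j; move: ij; clear; lia.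
by move: h; rewrite ltnNge ij.
Qed.

Lemma skewP X : skew X <-> forall a b, c a * X a b = - (c b * X (rev_ord b) (rev_ord a)).
Proof.
have eX i j : (X^T *m J + J *m X) i j = X (rev_ord j) i * c j + c i * X (rev_ord i) j.
  by rewrite mxE mul_antidiag // antidiag_mul mxE.
split=> [h a b|h].
  have := eX (rev_ord a) b; rewrite h mxE rev_ordK c_rev => /esym/eqP.
  by rewrite addrC addr_eq0 => /eqP ->; rewrite mulrC.
apply/matrixP => i j; rewrite eX mxE; have := h (rev_ord i) j; rewrite c_rev rev_ordK => ->.
by rewrite mulrC subrr.
Qed.

Lemma mkskew_skew f : skew (mkskew f).
Proof.
apply/skewP => a b; rewrite !mxE !rev_ordK !c_rev; field.
by rewrite !c_neq0.
Qed.

Lemma skew_anti X a : skew X -> X a (rev_ord a) = 0.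
Proof.
move/skewP => /(_ a (rev_ord a)); rewrite rev_ordK c_rev => /eqP.
rewrite -addr_eq0 -mulr2n -mulr_natl !mulf_eq0 (negbTE two0) (negbTE (c_neq0 _)) => /eqP //.
Qed.

Lemma free_entries (m : 'I_d -> 'I_d -> int) X : strict X -> skew X ->
  (forall a b, m (rev_ord b) (rev_ord a) = m a b) ->
  (forall p : frt, X (val p).1 (val p).2 \in vpow w (m (val p).1 (val p).2)) ->
  forall a b, X a b \in vpow w (m a b).
Proof.
move=> sX kX mrev h a b; case: (leqP b a) => ab; first by rewrite sX ?rpred0.
case: (ltngtP b (rev_ord a)) => br.
- have f : (a, b) \in isfree by rewrite isfreeE /= ab.
  exact: (h (Sub (a, b) f)).
- have f : (rev_ord b, rev_ord a) \in isfree.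
    by rewrite isfreeE /=; move: ab br => /=; clear; have := ltn_ord a; have := ltn_ord b; lia.
  have h' : X (rev_ord b) (rev_ord a) \in vpow w (m a b) by rewrite -mrev; exact: (h (Sub (_, _) f)).
  rewrite -(vpowMVl _ _ (c_unit a)) ((skewP X).1 kX) rpredN vpowMVl //.
have -> : b = rev_ord a by apply: val_inj.
by rewrite skew_anti ?rpred0.
Qed.

Lemma e_rev2 (a b : 'I_d) : e (rev_ord b) - e (rev_ord a) = e a - e b.
Proof. by rewrite (cochar_exp_rev l a) (cochar_exp_rev l b) opprK addrC. Qed.

Variables (q : nat) (q_w : residue_card w q).

Lemma card_itv m a b : (a <= b <= m)%N -> #|[pred i : 'I_m | (a <= i < b)%N]| = (b - a)%N.
Proof.
case/andP=> ab bm; rewrite -sum1_card big_mkcond /=.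
rewrite -(big_mkord xpredT (fun i => if (a <= i < b)%N then 1%N else 0%N)).
rewrite (big_cat_nat (leq0n a) (leq_trans ab bm)) (big_cat_nat ab bm) /=.
rewrite big_nat big1 => [|i /andP[_ ia]]; last by rewrite leqNgt ia.
rewrite [X in (_ + X)%N]addnC big_nat big1 => [|i /andP[ib _]]; last by rewrite [(i < b)%N]ltnNge ib andbF.
rewrite !add0n big_nat (eq_bigr (fun=> 1%N)) => [|i ->//].
by rewrite -big_nat sum_nat_const_nat muln1.
Qed.

(** In row a the terms e_b cancel in pairs b, rev b, and 2 (n - a) - 1 copies of e_a remain. *)
Lemma sum_free : \sum_(p : frt) (e (val p).1 - e (val p).2) = two_rho l.
Proof.
rewrite -(big_sub isfree (fun p : 'I_d * 'I_d => e p.1 - e p.2)).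
rewrite -(pair_big_dep xpredT (fun a b => (a, b) \in isfree) (fun a b : 'I_d => e a - e b)) /=.
have inner (a : 'I_d) : \sum_(b < d | (a, b) \in isfree) (e a - e b)
    = (if (a < n)%N then ((n - a).*2.-1)%:Z * e a else 0).
  rewrite sumrB; have -> : \sum_(b < d | (a, b) \in isfree) e b = 0.
    set S := \sum_(b < d | _) _; have : S = - S.
      rewrite {1}/S (reindex_inj rev_ord_inj) /S -sumrN; apply: eq_big => b.
        by rewrite !isfreeE /=; have := ltn_ord a; have := ltn_ord b; clear; lia.
      by move=> _; exact: (cochar_exp_rev l b).
    by move: S; clear; lia.
  rewrite subr0 sumr_const; case: ltnP => an.
    rewrite (_ : #|_| = (n - a).*2.-1)%N; first by rewrite -mulr_natl natz.
    rewrite -(_ : (n.*2 - a - a.+1 = (n - a).*2.-1)%N); last by move: an; clear; lia.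
    rewrite -(@card_itv d); last by move: an; clear; lia.
    by apply: eq_card => b; rewrite /in_mem /=; have := ltn_ord b; clear; lia.
  rewrite (_ : #|_| = 0)%N ?mulr0n //; apply: eq_card0 => b; rewrite /in_mem /=.
  by apply/negP => /andP[]; move: an; have := ltn_ord b; clear; lia.
rewrite (eq_bigr _ (fun a _ => inner a)) -big_mkcond /=.
have nd : (n <= d)%N by lia.
rewrite (big_ord_narrow nd); apply: eq_bigr => k0 _ /=.
by rewrite cochar_exp_lt.
Qed.

Lemma e_free_ge0 (p : frt) : 0 <= e (val p).1 - e (val p).2.
Proof. by case: p => -[a b] /= /andP[/ltnW ab _]; rewrite subr_ge0 e_dom. Qed.

Definition wt (p : frt) : nat := `|e (val p).1 - e (val p).2|%N.

Lemma wtE (p : frt) : (wt p)%:Z = e (val p).1 - e (val p).2.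
Proof. by rewrite /wt gez0_abs // e_free_ge0. Qed.

Definition N0 u := [/\ orth c u, unitriangular u & mxint w u].

Lemma N0M u v : N0 u -> N0 v -> N0 (u *m v).
Proof.
by move=> [o1 t1 i1] [o2 t2 i2]; split; [apply: orthM | apply: unitriangularM | apply: mxintM].
Qed.
Lemma N0V u : N0 u -> N0 (invmx u).
Proof. by move=> [o1 t1 i1]; split; [apply: orthV | apply: unitriangularV | apply: mxint_unitriV]. Qed.

(** On [N0] this cuts out the subgroup l(pi) N0 l(pi)^-1, contained in [N0] as l is dominant; its
    index is the number of cosets in the Iwahori cell of l. *)
Definition tin (A : 'M[k]_d) := mxint w (tconj A).

Lemma tinM A B : tin A -> tin B -> tin (A *m B).
Proof. by move=> hA hB; rewrite /tin tconjM; apply: mxintM. Qed.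
Lemma tinV A : unitriangular A -> tin A -> tin (invmx A).
Proof.
move=> uA hA; rewrite /tin tconjV ?unitriangular_unit //.
by apply: mxint_unitriV => //; apply: tconj_uni.
Qed.

(** The depth from which a congruence between elements of [N0] implies that they have the same coset
    modulo [tin]. *)
Definition emax : nat := \max_(p : 'I_d * 'I_d) `|e p.1 - e p.2|%N.

Lemma cong_tin A B : N0 A -> N0 B -> cong emax A B -> tin (invmx A *m B).
Proof.
move=> [oA uA iA] [oB uB iB] h i j; rewrite tconj_int.
have uC : unitriangular (invmx A *m B) by apply: unitriangularM => //; apply: unitriangularV.
case: (ltngtP i j) => ij; last 2 first.
- by rewrite uC.1 ?rpred0.
- have -> : i = j by apply: val_inj.
  by rewrite uC.2 subrr; exact: vint1.
have := congM (mxint_unitriV uA iA) (@mxint1 _ w n) (A' := 1%:M) h i j.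
rewrite !mulmx1 mulVmx ?unitriangular_unit // [1%:M i j]mxE (_ : i == j = false); last first.
  by apply/eqP => e'; move: ij; rewrite e' ltnn.
rewrite sub0r rpredN; apply: vpow_le.
have : (`|e i - e j| <= emax)%N by apply: (leq_bigmax (i, j)).
by clear; lia.
Qed.

(** The index is computed in the finite model {u f} of [N0] modulo pi^emax given by Cayley
    coordinates. All classes of [tin] have the same size #|B| there, and B is a product of ideals in
    these coordinates, so the number of classes is the product of q^(wt p) over the free
    positions. *)
Lemma unip_transversal : exists s : seq 'M[k]_d,
  [/\ size s = (q ^ `|two_rho l|)%N, uniq s, forall v, v \in s -> N0 v,
   forall u, N0 u -> exists2 v, v \in s & tin (invmx v *m u) &
   forall v v', v \in s -> v' \in s -> tin (invmx v *m v') -> v = v'].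
Proof.
have wt_le p : (wt p <= emax)%N by apply: (leq_bigmax (val p)).
have [T [r [cT r_int r_inj r_cov]]] := residue_reps pi1 q_w emax.
pose Xf (f : {ffun frt -> T}) := mkskew (fun p => r (f p)).
have sX f : strict (Xf f) by apply: mkskew_strict.
have kX f : skew (Xf f) by apply: mkskew_skew.
have XfE f p : Xf f (val p).1 (val p).2 = r (f p) by apply: mkskew_free.
have iX f : mxint w (Xf f).
  by apply: (@free_entries (fun _ _ => 0)) => // p; rewrite XfE; apply: r_int.
pose u f := cay (Xf f).
have uN f : N0 (u f) by split; [apply: cay_orth | apply: cay_uni | apply: cay_int].
have red v : N0 v -> exists f, cong emax v (u f).
  move=> [ov uv iv]; have [X [XE sXv kXv iXv]] :
      exists X, [/\ cayi v = X, strict X, skew X & mxint w X].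
    by exists (cayi v); split; [| apply: cayi_strict | apply: cayi_skew | apply: cayi_int].
  have subE g i j : (X - Xf g) i j = X i j - Xf g i j by rewrite mxE [X in _ + X]mxE.
  have [f fP] := choice (fun p : frt => r_cov _ (iXv (val p).1 (val p).2)).
  exists [ffun p => f p]; rewrite -(cayiK uv) XE; apply: cay_cong => // a b.
  rewrite -subE; apply: (@free_entries (fun _ _ => emax)) => //.
  - by move=> i j ij; rewrite subE sXv // sX // subr0.
  - apply/skewP => i j; rewrite !subE !mulrBr ((skewP X).1 kXv) ((skewP (Xf _)).1 (kX _)).
    by rewrite opprB opprK addrC.
  by move=> p; rewrite subE XfE ffunE.
have u_inj f g : cong emax (u f) (u g) -> f = g.
  have [[_ uf jf] [_ ug jg]] := (uN f, uN g); move/(cayi_cong uf ug jf jg).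
  by rewrite /u !cayK // => h; apply/ffunP => p; apply: r_inj; rewrite -!XfE.
have [rd rdP] : exists rd : 'M[k]_d -> {ffun frt -> T}, forall v, N0 v -> cong emax v (u (rd v)).
  have [t0 _] := r_cov 0 (rpred0 _).
  suff /choice[rd h] : forall v, exists f, N0 v -> cong emax v (u f) by exists rd.
  move=> v; have [/red[f hf]|nv] := pselect (N0 v); first by exists f.
  by exists [ffun=> t0].
have rd_inj v f g : N0 v -> rd (v *m u f) = rd (v *m u g) -> f = g.
  move=> Nv e0; apply: u_inj => i j.
  have [h1 h2] := (rdP _ (N0M Nv (uN f)), rdP _ (N0M Nv (uN g))).
  have h : cong emax (v *m u f) (v *m u g).
    by move=> a b; have := rpredB (h1 a b) (h2 a b); rewrite e0 opprB addrA subrK.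
  have [_ uv iv] := Nv.
  have := congM (mxint_unitriV uv iv) (@mxint1 _ w n) (A' := 1%:M) h i j.
  by rewrite !mulmx1 !mulKmx ?unitriangular_unit.
have tin_rd v : N0 v -> tin (invmx v *m u (rd v)) by move=> Nv; apply: cong_tin => //; apply: rdP.
pose B := [pred g | `[< tin (u g) >]].
(* The Cayley transform commutes with conjugation by l(pi), so membership in [tin] becomes one
   independent condition for each free coordinate. *)
have cardB : #|B| = (q ^ (\sum_(p : frt) (emax - wt p)))%N.
  have -> : #|B| = #|(family (fun p : frt => [pred t | r t \in vpow w (wt p)]) : simpl_pred {ffun frt -> T})|.
    apply: eq_card => g; rewrite !inE; apply/asboolP/forallP => [h p|h].
      have := cayi_int (tconj_uni (cay_uni (sX g))) h.
      rewrite -cayi_tconj ?cayK //; last exact: cay_uni.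
      by move/(_ (val p).1 (val p).2); rewrite tconj_int XfE -wtE.
    rewrite /tin cay_tconj //; apply: cay_int; first exact: strict_tconj.
    move=> a b; rewrite tconj_int; apply: (@free_entries (fun a b => e a - e b)) => //.
      by move=> a' b'; exact: e_rev2.
    by move=> p; rewrite XfE -wtE; exact: (h p).
  rewrite card_family foldrE big_map big_enum expn_sum; apply: eq_bigr => p _.
  rewrite -(card_reps_vpow pi1 q_w (wt_le p) r_int r_inj r_cov).
  by apply: eq_card => t.
pose cl f := [pred g | `[< tin (invmx (u f) *m u g) >]].
(* The model is not a group, but translation by u f or by its inverse, followed by the reduction
   [rd], is injective; this gives the two inequalities. *)
have card_cl f : #|cl f| = #|B|.
  have Vu := fun f => unitriangular_unit (let: And3 _ h _ := uN f in h).
  have Nv := N0V (uN f).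
  apply/eqP; rewrite eqn_leq; apply/andP; split.
    rewrite -(card_in_imset (f := fun g => rd (invmx (u f) *m u g))); last by move=> g g' _ _; apply: rd_inj.
    apply/subset_leq_card/fintype.subsetP => _ /imsetP[g gc ->]; rewrite inE; apply/asboolP.
    have := tinM (asboolW gc) (tin_rd _ (N0M Nv (uN g))).
    by rewrite mulKVmx // unitmx_mul unitmx_inv !Vu.
  rewrite -(card_in_imset (f := fun g => rd (u f *m u g))); last by move=> g g' _ _; apply: rd_inj.
  apply/subset_leq_card/fintype.subsetP => _ /imsetP[g gc ->]; rewrite inE; apply/asboolP.
  have h := tin_rd _ (N0M (uN f) (uN g)).
  have := tinM (asboolW gc) h.
  have -> : invmx (u f *m u g) = invmx (u g) *m invmx (u f).
    apply: (can_inj (mulmxK (_ : u f *m u g \in unitmx))); first by rewrite unitmx_mul !Vu.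
    by rewrite mulVmx ?unitmx_mul ?Vu // -mulmxA mulKmx // mulVmx.
  by rewrite -mulmxA mulKVmx.
have Vu f : u f \in unitmx by apply: unitriangular_unit; have [] := uN f.
have clxx f : cl f f by rewrite /= mulVmx //; apply/asboolP; rewrite /tin tconj1; exact: mxint1.
have clC f g : cl f g -> cl g f.
  move=> /asboolW h; apply/asboolP; have := tinV _ h.
  have [_ uf _] := uN f; have [_ ug _] := uN g.
  have -> : invmx (invmx (u f) *m u g) = invmx (u g) *m u f.
    have uu : invmx (u f) *m u g \in unitmx by rewrite unitmx_mul unitmx_inv !Vu.
    by apply: (can_inj (mulmxK uu)); rewrite mulVmx // mulmxA mulmxK // mulVmx.
  by apply; apply: unitriangularM => //; apply: unitriangularV.
have clT f g h : cl f g -> cl g h -> cl f h.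
  move=> /asboolW h1 /asboolW h2; apply/asboolP; have := tinM h1 h2.
  by rewrite mulmxA mulmxK.
have [rp rp_cl rp_eq] := class_repr (R := cl) clxx clC clT.
pose S := [set rp f | f : {ffun frt -> T}].
have cardS : (#|S| * #|B| = #|{ffun frt -> T}|)%N.
  rewrite -[RHS]sum1_card (partition_big rp (mem S)) /=; last by move=> f _; apply: imset_f.
  rewrite -sum_nat_const; apply: eq_bigr => g /imsetP[f0 _ gE].
  rewrite sum1_card -(card_cl g); apply: eq_card => f; rewrite -[RHS]/(rp f == g) -[LHS]/(cl g f).
  have gg : rp g = g by rewrite gE; apply/esym/rp_eq/rp_cl.
  apply/idP/eqP => [h|<-]; first by rewrite -[RHS]gg; apply/esym/rp_eq.
  exact/clC/rp_cl.
have q0 : (0 < q)%N by apply: ltn_trans (residue_card_gt1 q_w).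
have sizeS : #|S| = (q ^ `|two_rho l|)%N.
  apply/eqP; rewrite -(eqn_pmul2r (m := #|B|)); last by rewrite cardB expn_gt0 q0.
  rewrite cardS card_ffun cT cardB -expnM -expnD; apply/eqP; congr (q ^ _)%N.
  have -> : `|two_rho l|%N = (\sum_(p : frt) wt p)%N.
    rewrite -sum_free -(eq_bigr _ (fun p _ => wtE p)).
    by rewrite -(big_morph Posz PoszD (erefl : Posz 0 = 0)).
  rewrite -big_split /= (eq_bigr (fun=> emax)) => [|p _]; last by rewrite subnKC.
  by rewrite sum_nat_const mulnC.
exists [seq u f | f <- enum S]; split.
- by rewrite size_map -cardE sizeS.
- by rewrite map_inj_uniq ?enum_uniq // => f g fg; apply: u_inj => i j; rewrite fg subrr rpred0.
- by move=> _ /mapP[f _ ->].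
- move=> v Nv; exists (u (rp (rd v))).
    by apply: map_f; rewrite mem_enum; apply: imset_f.
  have [_ uv _] := Nv; have h1 := tin_rd v Nv; have /asboolW h2 := clC _ _ (rp_cl (rd v)).
  have h3 : tin (invmx (invmx v *m u (rd v))).
    by apply: tinV => //; apply: unitriangularM; [apply: unitriangularV | have [] := uN (rd v)].
  have := tinM h2 h3.
  have uvu : v \in unitmx by apply: unitriangular_unit.
  have -> : invmx (invmx v *m u (rd v)) = invmx (u (rd v)) *m v.
    have uu : invmx v *m u (rd v) \in unitmx by rewrite unitmx_mul unitmx_inv uvu Vu.
    by apply: (can_inj (mulmxK uu)); rewrite mulVmx // mulmxA mulmxK // mulVmx.
  by rewrite mulmxA mulmxK.
move=> _ _ /mapP[f + ->] /mapP[g + ->] h; rewrite !mem_enum => /imsetP[f0 _ fE] /imsetP[g0 _ gE].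
have fg : cl f g by apply/asboolP.
have ff : rp f = f by rewrite fE; apply/esym/rp_eq/rp_cl.
have gg : rp g = g by rewrite gE; apply/esym/rp_eq/rp_cl.
by congr u; rewrite -ff -gg; apply: rp_eq.
Qed.
End Cayley.

(** * Unitary approximation *)

Section Unitary.
Variables (k : fieldType) (w : place k) (n : nat).
Local Notation d := n.*2.+1.
Variable c : 'I_d -> k.
Hypothesis c_unit : forall i, vunt w (c i).
Hypothesis c_rev : forall i, c (rev_ord i) = c i.
Hypothesis two_unit : vunt w 2%:R.
Let c_neq0 i : c i != 0 := vunt_neq0 (c_unit i).
Let two0 : (2%:R : k) != 0 := vunt_neq0 two_unit.
Local Notation J := (antidiag c).

Definition bl (x y : 'cV[k]_d) : k := (x^T *m J *m y) 0 0.

Lemma blC x y : bl x y = bl y x.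
Proof.
rewrite /bl -[in RHS](trmxK (y^T *m J *m x)) [in RHS]mxE !trmx_mul trmxK antidiag_sym //.
by rewrite mulmxA.
Qed.
Lemma blDl x x' y : bl (x + x') y = bl x y + bl x' y.
Proof. by rewrite /bl linearD /= !mulmxDl mxE. Qed.
Lemma blZl a x y : bl (a *: x) y = a * bl x y.
Proof. by rewrite /bl linearZ /= -!scalemxAl mxE. Qed.
Lemma blDr x y y' : bl x (y + y') = bl x y + bl x y'.
Proof. by rewrite blC blDl !(blC x). Qed.
Lemma blZr a x y : bl x (a *: y) = a * bl x y.
Proof. by rewrite blC blZl blC. Qed.
Lemma blNl x y : bl (- x) y = - bl x y.
Proof. by rewrite -scaleN1r blZl mulN1r. Qed.
Lemma blNr x y : bl x (- y) = - bl x y.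
Proof. by rewrite blC blNl blC. Qed.
Lemma bl0l y : bl 0 y = 0. Proof. by rewrite /bl linear0 !mul0mx mxE. Qed.
Lemma bl0r y : bl y 0 = 0. Proof. by rewrite blC bl0l. Qed.
Lemma bl_sumr (I : Type) (r : seq I) (P : pred I) (F : I -> 'cV_d) x :
  bl x (\sum_(i <- r | P i) F i) = \sum_(i <- r | P i) bl x (F i).
Proof. by elim/big_rec2: _ => [|i a b _ <-]; rewrite ?bl0r ?blDr. Qed.

Lemma bl_orth X x y : orth c X -> bl (X *m x) (X *m y) = bl x y.
Proof. by move=> oX; rewrite /bl trmx_mul !mulmxA -(mulmxA _ X^T) -(mulmxA _ (X^T *m J)) oX. Qed.

Lemma blE x y : bl x y = \sum_a x a 0 * c a * y (rev_ord a) 0.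
Proof. by rewrite /bl gram_entry. Qed.

Definition cvint (m : int) (x : 'cV[k]_d) := forall a, x a 0 \in vpow w m.

Lemma bl_int m x y : cvint 0 x -> cvint m y -> bl x y \in vpow w m.
Proof.
move=> hx hy; rewrite blE rpred_sum // => a _; apply: vpowMl (hy _).
by apply: rpredM; [exact: hx | exact: vunt_int].
Qed.
Lemma cvintD m x y : cvint m x -> cvint m y -> cvint m (x + y).
Proof. by move=> hx hy a; rewrite mxE rpredD. Qed.
Lemma cvintN m x : cvint m x -> cvint m (- x).
Proof. by move=> hx a; rewrite mxE rpredN. Qed.
Lemma cvintZ m m' t x : t \in vpow w m -> cvint m' x -> cvint (m + m') (t *: x).
Proof. by move=> ht hx a; rewrite mxE vpowM. Qed.
Lemma cvint_le m m' x : m <= m' -> cvint m' x -> cvint m x.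
Proof. by move=> mm h a; apply: vpow_le (h a). Qed.
Lemma cvintM m A x : mxint w A -> cvint m x -> cvint m (A *m x : 'cV_d).
Proof. by move=> hA hx a; rewrite mxE rpred_sum // => b _; rewrite vpowMl //; exact: hA. Qed.
Lemma cvint_sum m (I : Type) (r : seq I) (P : pred I) (F : I -> 'cV_d) :
  (forall i, P i -> cvint m (F i)) -> cvint m (\sum_(i <- r | P i) F i).
Proof.
move=> h; elim/big_ind: _ => // [a|x y]; first by rewrite mxE rpred0.
exact: cvintD.
Qed.

Definition ee (i : nat) : 'cV[k]_d := delta_mx (inord i) 0.

Lemma mul_ee m (A : 'M[k]_(m, d)) i j : (A *m ee j) i 0 = A i (inord j).
Proof. by rewrite -colE mxE. Qed.

Lemma sub1E (A : 'M[k]_d) a b : (A - 1%:M) a b = A a b - (a == b)%:R.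
Proof. by rewrite !mxE. Qed.

Lemma inord_eq i j : (i < d)%N -> (j < d)%N -> ((inord i : 'I_d) == inord j) = (i == j).
Proof. by move=> hi hj; rewrite -val_eqE /= !inordK. Qed.

Lemma ee_dual i j : (i < d)%N -> (j < d)%N -> ((ee i)^T *m ee j) 0 0 = (i == j)%:R.
Proof.
move=> hi hj; rewrite /ee trmx_delta mul_delta_mx_cond inord_eq //.
by case: eqP => _; rewrite ?mulr1n ?mulr0n mxE ?eqxx.
Qed.

Lemma ee_int i : cvint 0 (ee i).
Proof. by move=> a; rewrite mxE; case: (_ && _); rewrite ?rpred0 //; exact: vint1. Qed.

Lemma rev_inord i : (i < d)%N -> rev_ord (inord i : 'I_d) = inord (n.*2 - i).
Proof. by move=> hi; apply: val_inj; rewrite /= !inordK ?subSS //; move: hi; clear; lia. Qed.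

Lemma bl_ee i j : (i < d)%N -> (j < d)%N ->
  bl (ee i) (ee j) = if (i + j == n.*2)%N then c (inord i) else 0.
Proof.
move=> hi hj; rewrite blE (bigD1 (inord i)) //= big1 => [|a ai]; last first.
  by rewrite !mxE (negbTE ai) !mul0r.
rewrite addr0 !mxE !eqxx !andbT mul1r rev_inord // inord_eq //; last by move: hi; clear; lia.
have -> : (n.*2 - i == j)%N = (i + j == n.*2)%N by move: hi; clear; lia.
by case: eqP => _; rewrite ?mulr1 ?mulr0.
Qed.

(** Coordinates in the frame of v_j, and with [Ww] of w_j: e_j has index n - j and e_(-j) has index
    n + j, and v_j, w_j are their sum and difference. [Vd] and [Wd] are the dual rows; [nu j] is the
    value of the form on v_j, and its opposite is the value on w_j. *)
Definition Vv j := if j == 0%N then ee n else ee (n - j) + ee (n + j).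
Definition Ww j := ee (n - j) - ee (n + j).
Definition Vd j : 'rV[k]_d := if j == 0%N then (ee n)^T else 2%:R^-1 *: ((ee (n - j))^T + (ee (n + j))^T).
Definition Wd j : 'rV[k]_d := 2%:R^-1 *: ((ee (n - j))^T - (ee (n + j))^T).
Definition nu j : k := if j == 0%N then c (inord n) else 2%:R * c (inord (n - j)).

Lemma nu_unit j : vunt w (nu j).
Proof. by rewrite /nu; case: ifP => _ //; apply: vuntM. Qed.

Lemma ltd j : (j <= n)%N -> ((n - j < d)%N * (n + j < d)%N)%type.
Proof. by move=> h; split; move: h; clear; lia. Qed.

Lemma c_pm j : (j <= n)%N -> c (inord (n + j)) = c (inord (n - j)).
Proof.
move=> jn; have [h1 h2] := ltd jn; rewrite -[LHS]c_rev rev_inord //; congr (c (inord _)).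
by move: jn; clear; lia.
Qed.

Lemma Vv_int j : cvint 0 (Vv j).
Proof. by rewrite /Vv; case: ifP => _; [|apply: cvintD]; apply: ee_int. Qed.
Lemma Ww_int j : cvint 0 (Ww j).
Proof. by apply: cvintD; [|apply: cvintN]; apply: ee_int. Qed.

Lemma bl_VV i j : (i <= n)%N -> (j <= n)%N -> bl (Vv i) (Vv j) = if i == j then nu i else 0.
Proof.
move=> hi hj; have [i1 i2] := ltd hi; have [j1 j2] := ltd hj; have nd : (n < d)%N by lia.
rewrite /Vv /nu; case: (posnP i) => [->|i0]; case: (posnP j) => [->|j0] //=.
- by rewrite bl_ee // addnn eqxx.
- rewrite blDr !bl_ee //; do 2!(case: eqP => [e|_]; first by move: e j0 hj; clear; lia).
  by rewrite addr0 eq_sym (gtn_eqF j0).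
- rewrite blDl !bl_ee //; do 2!(case: eqP => [e|_]; first by move: e i0 hi; clear; lia).
  by rewrite addr0 (gtn_eqF i0).
rewrite blDl !blDr !bl_ee //.
rewrite (_ : (n - i + (n - j) == n.*2)%N = false); last by move: i0 hi; clear; lia.
rewrite (_ : (n + i + (n + j) == n.*2)%N = false); last by move: i0 hi; clear; lia.
rewrite (_ : (n - i + (n + j) == n.*2)%N = (i == j)); last by move: hi; clear; lia.
rewrite (_ : (n + i + (n - j) == n.*2)%N = (i == j)); last by move: hj; clear; lia.
by case: eqP => [_|_]; rewrite ?c_pm // ?add0r ?addr0 // mulrDl mul1r.
Qed.

Lemma bl_WW i j : (0 < i <= n)%N -> (0 < j <= n)%N -> bl (Ww i) (Ww j) = if i == j then - nu i else 0.
Proof.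
move=> /andP[i0 hi] /andP[j0 hj]; have [i1 i2] := ltd hi; have [j1 j2] := ltd hj.
rewrite /Ww /nu (gtn_eqF i0) blDl !blDr !blNl !blNr !bl_ee //.
rewrite (_ : (n - i + (n - j) == n.*2)%N = false); last by move: i0 hi; clear; lia.
rewrite (_ : (n + i + (n + j) == n.*2)%N = false); last by move: i0 hi; clear; lia.
rewrite (_ : (n - i + (n + j) == n.*2)%N = (i == j)); last by move: hi; clear; lia.
rewrite (_ : (n + i + (n - j) == n.*2)%N = (i == j)); last by move: hj; clear; lia.
by case: eqP => [_|_]; rewrite ?c_pm //; ring.
Qed.

Lemma bl_VW i j : (i <= n)%N -> (0 < j <= n)%N -> bl (Vv i) (Ww j) = 0.
Proof.
move=> hi /andP[j0 hj]; have [i1 i2] := ltd hi; have [j1 j2] := ltd hj; have nd : (n < d)%N by lia.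
rewrite /Vv /Ww; case: (posnP i) => [_|i0] /=.
  rewrite blDr blNr !bl_ee //; do 2!(case: eqP => [e|_]; first by move: e j0 hj; clear; lia).
  by rewrite subr0.
rewrite blDl !blDr !blNr !bl_ee //.
rewrite (_ : (n - i + (n - j) == n.*2)%N = false); last by move: i0 hi; clear; lia.
rewrite (_ : (n + i + (n + j) == n.*2)%N = false); last by move: i0 hi; clear; lia.
rewrite (_ : (n - i + (n + j) == n.*2)%N = (i == j)); last by move: hi; clear; lia.
rewrite (_ : (n + i + (n - j) == n.*2)%N = (i == j)); last by move: hj; clear; lia.
by case: eqP => [_|_]; rewrite ?c_pm //; ring.
Qed.

Lemma VdE j : (j <= n)%N -> Vd j = (nu j)^-1 *: ((Vv j)^T *m J).
Proof.
move=> hj; have [j1 j2] := ltd hj; have nd : (n < d)%N by lia.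
have eJ i : (i < d)%N -> (ee i)^T *m J = c (inord i) *: (ee (n.*2 - i))^T.
  move=> hi; apply/matrixP => a b; rewrite mul_antidiag // !mxE !ord1 eqxx !andbT.
  rewrite -(inj_eq rev_ord_inj) rev_ordK rev_inord //.
  by case: eqP => [->|_]; rewrite ?mul0r ?mulr0 // mul1r mulr1 -[RHS]c_rev rev_inord.
rewrite /Vd /Vv /nu; case: (posnP j) => [_|j0] /=.
  rewrite eJ // scalerA mulVf // scale1r; congr (ee _)^T; clear; lia.
have -> : (ee (n - j) + ee (n + j))^T = (ee (n - j))^T + (ee (n + j))^T.
  by apply/matrixP => a b; rewrite !mxE.
rewrite mulmxDl !eJ // c_pm // -scalerDr scalerA invfM mulfVK //.
rewrite addrC; congr (_ *: (_ + _)); congr (ee _)^T; move: hj; clear; lia.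
Qed.

Lemma WdE j : (0 < j <= n)%N -> Wd j = (- nu j)^-1 *: ((Ww j)^T *m J).
Proof.
move=> /andP[j0 hj]; have [j1 j2] := ltd hj.
have eJ i : (i < d)%N -> (ee i)^T *m J = c (inord i) *: (ee (n.*2 - i))^T.
  move=> hi; apply/matrixP => a b; rewrite mul_antidiag // !mxE !ord1 eqxx !andbT.
  rewrite -(inj_eq rev_ord_inj) rev_ordK rev_inord //.
  by case: eqP => [->|_]; rewrite ?mul0r ?mulr0 // mul1r mulr1 -[RHS]c_rev rev_inord.
have -> : (Ww j)^T = (ee (n - j))^T - (ee (n + j))^T by apply/matrixP => a b; rewrite !mxE.
rewrite /Wd /nu (gtn_eqF j0) mulmxBl !eJ // c_pm // -scalerBr scalerA.
rewrite invrN mulNr invfM mulfVK // scaleNr -scalerN opprB.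
congr (_ *: (_ - _)); congr (ee _)^T; move: hj; clear; lia.
Qed.

Lemma Vd_bl j x : (j <= n)%N -> (Vd j *m x) 0 0 = (nu j)^-1 * bl (Vv j) x.
Proof. by move=> hj; rewrite VdE // -scalemxAl mxE. Qed.
Lemma Wd_bl j x : (0 < j <= n)%N -> (Wd j *m x) 0 0 = (- nu j)^-1 * bl (Ww j) x.
Proof. by move=> hj; rewrite WdE // -scalemxAl mxE. Qed.

Lemma col_scal m (A : 'M[k]_(m, 1)) (s : 'M[k]_1) : A *m s = s 0 0 *: A.
Proof. by rewrite [s in LHS]mx11_scalar mul_mx_scalar. Qed.

(** The linear map with prescribed images of the v_i and the w_i. *)
Definition assemble (v' w' : nat -> 'cV[k]_d) : 'M[k]_d :=
  \sum_(i < n.+1) v' i *m Vd i + \sum_(i < n) w' i.+1 *m Wd i.+1.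

Lemma nu0 j : nu j != 0. Proof. exact: vunt_neq0 (nu_unit j). Qed.

Lemma assembleV v' w' j : (j <= n)%N -> assemble v' w' *m Vv j = v' j.
Proof.
move=> hj; rewrite mulmxDl !mulmx_suml [X in _ + X]big1 => [|i _]; last first.
  by rewrite -mulmxA col_scal Wd_bl ?ltn_ord // blC bl_VW ?ltn_ord // mulr0 scale0r.
have jn : (j < n.+1)%N by [].
rewrite addr0 (bigD1 (Ordinal jn)) //= big1 => [|i ij]; rewrite -mulmxA col_scal Vd_bl.
- by rewrite bl_VV // eqxx mulVf ?nu0 // scale1r addr0.
- by [].
- rewrite bl_VV // ?(negbTE ij) ?mulr0 ?scale0r //; last by rewrite -ltnS.
  by rewrite (_ : _ == j = false) ?mulr0 ?scale0r //; apply/negbTE; move: ij; rewrite -val_eqE.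
by rewrite -ltnS.
Qed.

Lemma assembleW v' w' j : (0 < j <= n)%N -> assemble v' w' *m Ww j = w' j.
Proof.
move=> hj; rewrite mulmxDl !mulmx_suml big1 => [|i _]; last first.
  have hi : (i <= n)%N by rewrite -ltnS.
  by rewrite -mulmxA col_scal Vd_bl // bl_VW // mulr0 scale0r.
have jn : (j.-1 < n)%N by move: hj; clear; lia.
have jE : j.-1.+1 = j by move: hj; clear; lia.
rewrite add0r (bigD1 (Ordinal jn)) //= big1 => [|i ij]; last first.
  rewrite -mulmxA col_scal Wd_bl ?ltn_ord // bl_WW ?ltn_ord // (_ : _ == j = false) ?mulr0 ?scale0r //.
  by apply/negbTE; move: ij; rewrite -val_eqE /=; move: hj; clear; lia.
rewrite -mulmxA col_scal Wd_bl ?ltn_ord //= jE bl_WW // eqxx mulVf ?oppr_eq0 ?nu0 //.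
by rewrite scale1r addr0.
Qed.

Lemma ee_pos j : (0 < j)%N -> ee (n - j) = 2%:R^-1 *: (Vv j + Ww j).
Proof. by move=> j0; rewrite /Vv /Ww (gtn_eqF j0) addrACA subrr addr0 -mulr2n -scaler_nat scalerA mulVf // scale1r. Qed.
Lemma ee_neg j : (0 < j)%N -> ee (n + j) = 2%:R^-1 *: (Vv j - Ww j).
Proof.
move=> j0; rewrite /Vv /Ww (gtn_eqF j0); apply/matrixP => a b; rewrite !mxE.
by field; exact: two0.
Qed.

Lemma basis_ext m (A B : 'M[k]_(m, d)) :
  (forall j, (j <= n)%N -> A *m Vv j = B *m Vv j) ->
  (forall j, (0 < j <= n)%N -> A *m Ww j = B *m Ww j) -> A = B.
Proof.
move=> hV hW; have hcol a : A *m ee a = B *m ee a -> col (inord a) A = col (inord a) B.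
  by rewrite !colE.
have heq (a : 'I_d) : col a A = col a B.
  rewrite -[a]inord_val; apply: hcol; case: (ltngtP a n) => an.
  - have -> : ee a = ee (n - (n - a)) by congr ee; move: an; clear; lia.
    rewrite ee_pos ?subn_gt0 // -!scalemxAr mulmxDr [B *m (_ + _)]mulmxDr hV ?leq_subr //.
    by rewrite hW // subn_gt0 an leq_subr.
  - have -> : ee a = ee (n + (a - n)) by congr ee; move: an; clear; lia.
    have h : (a - n <= n)%N by have := ltn_ord a; clear; lia.
    rewrite ee_neg ?subn_gt0 // -!scalemxAr mulmxBr [B *m (_ - _)]mulmxBr hV //.
    by rewrite hW // subn_gt0 an.
  by rewrite an; have := hV 0%N (leq0n n).
by apply/matrixP => i a; have := congr1 (fun M : 'cV_m => M i 0) (heq a); rewrite !mxE.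
Qed.

Lemma assemble_orth v' w' :
  (forall i j, (i <= n)%N -> (j <= n)%N -> bl (v' i) (v' j) = if i == j then nu i else 0) ->
  (forall i j, (0 < i <= n)%N -> (0 < j <= n)%N -> bl (w' i) (w' j) = if i == j then - nu i else 0) ->
  (forall i j, (i <= n)%N -> (0 < j <= n)%N -> bl (v' i) (w' j) = 0) ->
  orth c (assemble v' w').
Proof.
move=> hV hW hVW; set X := assemble v' w'.
have key x y : ((x^T *m (X^T *m J *m X)) *m y) 0 0 = bl (X *m x) (X *m y).
  by rewrite /bl trmx_mul !mulmxA.
have key' x y : ((x^T *m J) *m y) 0 0 = bl x y by [].
have m11 (A B : 'M[k]_1) : A 0 0 = B 0 0 -> A = B.
  by move=> e; rewrite [A]mx11_scalar e -mx11_scalar.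
have row_ext (x : 'cV[k]_d) : (forall j, (j <= n)%N -> bl (X *m x) (v' j) = bl x (Vv j)) ->
    (forall j, (0 < j <= n)%N -> bl (X *m x) (w' j) = bl x (Ww j)) ->
    x^T *m (X^T *m J *m X) = x^T *m J.
  move=> h1 h2; apply: basis_ext => j hj; apply: m11; rewrite key key'.
    by rewrite assembleV // h1.
  by rewrite assembleW // h2.
have trE (A B : 'M[k]_d) (x : 'cV[k]_d) : x^T *m A = x^T *m B -> A^T *m x = B^T *m x.
  by move=> /(congr1 trmx); rewrite !trmx_mul trmxK.
rewrite /orth; apply: trmx_inj; apply: basis_ext => j hj; apply: trE; apply: row_ext => i hi.
- by rewrite assembleV // hV // bl_VV.
- by rewrite assembleV // hVW // bl_VW.
- by rewrite assembleW // blC hVW // blC bl_VW.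
by rewrite assembleW // hW // bl_WW.
Qed.

Variable eps : k.
Hypothesis eps_unit : vunt w eps.
Hypothesis nu_eps : forall j, (j < n)%N -> nu j = eps * nu j.+1.

(** Multiplication by eta on W, extended by 0 on the line of v_n: it sends w_i to v_(i-1) and
    v_(i-1) to eps w_i, where eps stands for eta^2. An isometry that commutes with it and fixes v_n
    is a unitary one. *)
Definition Tm : 'M[k]_d := assemble (fun i => if (i < n)%N then eps *: Ww i.+1 else 0) (fun i => Vv i.-1).

Lemma TmV j : (j < n)%N -> Tm *m Vv j = eps *: Ww j.+1.
Proof. by move=> jn; rewrite /Tm assembleV ?(ltnW jn) //= jn. Qed.
Lemma TmVn : Tm *m Vv n = 0.
Proof. by rewrite assembleV // ltnn. Qed.
Lemma TmW j : (0 < j <= n)%N -> Tm *m Ww j = Vv j.-1.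
Proof. by move=> jn; rewrite assembleW. Qed.

Lemma Vd_int j a : Vd j 0 a \in vint w.
Proof.
have h i : (ee i)^T 0 a \in vint w by rewrite mxE; apply: ee_int.
by rewrite /Vd; case: ifP => _; rewrite ?h // mxE rpredM ?vintV // mxE rpredD.
Qed.
Lemma Wd_int j a : Wd j 0 a \in vint w.
Proof.
have h i : (ee i)^T 0 a \in vint w by rewrite mxE; apply: ee_int.
have -> : Wd j 0 a = 2%:R^-1 * ((ee (n - j))^T 0 a - (ee (n + j))^T 0 a) by rewrite !mxE.
by rewrite rpredM ?vintV // rpredB.
Qed.

Lemma assemble_int m v' w' : (forall j, (j <= n)%N -> cvint m (v' j)) ->
  (forall j, (0 < j <= n)%N -> cvint m (w' j)) ->
  forall a b, assemble v' w' a b \in vpow w m.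
Proof.
move=> hV hW a b; rewrite mxE rpredD // summxE rpred_sum // => i _.
  rewrite mxE big_ord1 vpowMr ?Vd_int //; apply: hV; by rewrite -ltnS.
by rewrite mxE big_ord1 vpowMr ?Wd_int //; apply: hW; rewrite ltn_ord.
Qed.

Lemma Tm_int : mxint w Tm.
Proof.
apply: assemble_int => j hj; last exact: Vv_int.
case: ifP => _; last by move=> a; rewrite mxE rpred0.
by rewrite -[0]addr0; apply: cvintZ (Ww_int _); apply: vunt_int.
Qed.

Lemma Tm_skew x y : bl (Tm *m x) y = - bl x (Tm *m y).
Proof.
suff e : Tm^T *m J = - (J *m Tm).
  by rewrite /bl trmx_mul -[X in X *m y]mulmxA e mulmxN mulNmx mxE !mulmxA.
have m11 (A B : 'M[k]_1) : A 0 0 = B 0 0 -> A = B.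
  by move=> e; rewrite [A]mx11_scalar e -mx11_scalar.
have key x' y' : (x'^T *m (Tm^T *m J) *m y') 0 0 = bl (Tm *m x') y'.
  by rewrite /bl trmx_mul !mulmxA.
have key' x' y' : (x'^T *m - (J *m Tm) *m y') 0 0 = - bl x' (Tm *m y').
  by rewrite /bl mulmxN mulNmx mxE !mulmxA.
have trE (A B : 'M[k]_d) (x' : 'cV[k]_d) : x'^T *m A = x'^T *m B -> A^T *m x' = B^T *m x'.
  by move=> /(congr1 trmx); rewrite !trmx_mul trmxK.
have lt_case j : (j <= n)%N -> (j < n)%N \/ j = n.
  by rewrite leq_eqVlt => /orP[/eqP|]; [right|left].
apply: trmx_inj; apply: basis_ext => i hi; apply: trE; apply: basis_ext => j hj;
  apply: m11; rewrite key key'.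
- have [jn|->] := lt_case j hj; have [ii|->] := lt_case i hi; rewrite ?TmVn ?bl0l ?bl0r ?oppr0 //.
  + by rewrite !TmV // blZl blZr blC !bl_VW ?mulr0 ?oppr0.
  + by rewrite TmV // blZr bl_VW ?mulr0 ?oppr0.
  by rewrite TmV // blZl blC bl_VW ?mulr0 ?oppr0.
- rewrite TmW // bl_VV //; last by move: hj; clear; lia.
  have [ii|->] := lt_case i hi.
    rewrite TmV // blZl bl_WW //; have -> : (i.+1 == j) = (i == j.-1) by move: hj; clear; lia.
    by case: eqP => _; rewrite ?mulr0 ?oppr0 // (nu_eps ii) mulrN.
  rewrite TmVn bl0l (_ : n == j.-1 = false) ?oppr0 //; by move: hj; clear; lia.
- rewrite TmW // bl_VV //; last by move: hi; clear; lia.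
  have [jj|->] := lt_case j hj.
    rewrite TmV // blZr bl_WW //; have -> : (i.-1 == j) = (i == j.+1) by move: hi; clear; lia.
    case: eqP => [e|_]; rewrite ?mulr0 ?oppr0 // e /= (nu_eps jj) mulrN opprK //.
  rewrite TmVn bl0r (_ : i.-1 == n = false) ?oppr0 //; by move: hi; clear; lia.
rewrite !TmW // bl_VW //; last by move: hi; clear; lia.
by rewrite blC bl_VW ?oppr0 //; move: hj; clear; lia.
Qed.

Lemma Tm_sqr x : bl (Vv n) x = 0 -> Tm *m (Tm *m x) = eps *: x.
Proof.
move=> x0; have e : Tm *m Tm = eps *: (1%:M - Vv n *m Vd n).
  apply: basis_ext => j hj; rewrite -mulmxA -scalemxAl mulmxBl mul1mx -mulmxA col_scal.
    rewrite Vd_bl // bl_VV //; move: hj; rewrite leq_eqVlt => /orP[/eqP->|jn].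
      by rewrite TmVn mulmx0 eqxx mulVf ?nu0 // scale1r subrr scaler0.
    rewrite (gtn_eqF jn) mulr0 scale0r subr0 TmV // -scalemxAr TmW //.
  rewrite Vd_bl // bl_VW // mulr0 scale0r subr0 TmW // TmV; last by move: hj; clear; lia.
  by congr (_ *: Ww _); move: hj; clear; lia.
by rewrite mulmxA e -scalemxAl mulmxBl mul1mx -mulmxA col_scal Vd_bl // x0 mulr0 scale0r subr0.
Qed.

(** The vector g lies in the span of the columns u e_(-i) with i >= j, a totally isotropic space
    when j > 0. *)
Definition lowcol (u : 'M[k]_d) (g : 'cV[k]_d) (j : nat) :=
  forall a : 'I_d, (a < n + j)%N -> (invmx u *m g) a 0 = 0.

Lemma lowcol_iso u g g' j j' : orth c u -> (0 < j)%N -> (0 < j')%N ->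
  lowcol u g j -> lowcol u g' j' -> bl g g' = 0.
Proof.
move=> ou j0 j0' hg hg'; rewrite -(bl_orth _ _ (orthV c_neq0 c_rev ou)) blE big1 // => a _.
case: (leqP a n) => an; first by rewrite hg ?mul0r // (leq_ltn_trans an) // -addn1 leq_add2l.
rewrite hg' ?mulr0 //=; move: an j0'; have := ltn_ord a; clear; lia.
Qed.

Variables (u : 'M[k]_d).
Hypothesis u_orth : orth c u.
Hypothesis u_uni : forall a b, u a b - (a == b)%:R \in vpow w 1.

Let u_int : mxint w u.
Proof.
move=> a b; rewrite -(subrK (a == b)%:R (u a b)) rpredD //; first exact: vpow_vint (u_uni a b).
by case: (_ == _); rewrite ?rpred0 ?rpred1.
Qed.

Lemma ucol_cong j : cvint 1 (u *m ee j - ee j).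
Proof.
move=> a; have -> : u *m ee j - ee j = (u - 1%:M) *m ee j by rewrite mulmxBl mul1mx.
by rewrite -colE !mxE u_uni.
Qed.

(* Gram-Schmidt over E: the flag spanned by the columns u e_(-n), u e_(-(n-1)), ...
   determines a unitary frame w'_n, w'_(n-1), ... with v'_(j-1) = eta w'_j. *)
Lemma gram_schmidt t : (t <= n)%N -> exists v' w' : nat -> 'cV[k]_d,
  [/\ v' n = Vv n,
   forall j, (n - t < j <= n)%N -> v' j.-1 = Tm *m w' j,
   [/\ forall i j, (n - t <= i <= n)%N -> (n - t <= j <= n)%N ->
         bl (v' i) (v' j) = if i == j then nu i else 0,
       forall i j, (n - t < i <= n)%N -> (n - t < j <= n)%N ->
         bl (w' i) (w' j) = if i == j then - nu i else 0 &
       forall i j, (n - t <= i <= n)%N -> (n - t < j <= n)%N -> bl (v' i) (w' j) = 0],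
   forall j, (n - t < j <= n)%N -> lowcol u (v' j - w' j) j &
   (forall j, (n - t <= j <= n)%N -> cvint 1 (v' j - Vv j)) /\
   (forall j, (n - t < j <= n)%N -> cvint 1 (w' j - Ww j))].
Proof.
elim: t => [|t IH] tn.
  exists Vv, Ww; rewrite subn0; split=> //; try by move=> j /andP[h1 h2]; move: h1; rewrite ltnNge h2.
  - split.
    + by move=> i j /andP[i1 i2] /andP[j1 j2]; apply: bl_VV.
    + by move=> i j /andP[h1 h2]; move: h1; rewrite ltnNge h2.
    by move=> i j _ /andP[h1 h2]; move: h1; rewrite ltnNge h2.
  split=> j; first by move=> _ a; rewrite subrr mxE rpred0.
  by move=> /andP[h1 h2]; move: h1; rewrite ltnNge h2.
have [v' [w' [v'n v'T [gV gW gVW] low [cV cW]]]] := IH (ltnW tn).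
pose j := (n - t)%N.
have j0 : (0 < j)%N by rewrite subn_gt0.
have jn : (j <= n)%N by apply: leq_subr.
have jt : (n - t.+1)%N = j.-1 by rewrite subnS.
pose rg := [seq i <- iota 0 n.+1 | (j < i)%N].
have rgP i : (i \in rg) = (j < i <= n)%N by rewrite mem_filter mem_iota add0n ltnS.
have rg_uniq : uniq rg by rewrite filter_uniq // iota_uniq.
pose G i := v' i - w' i.
have GV i i' : (j < i <= n)%N -> (j <= i' <= n)%N -> bl (G i) (v' i') = if i == i' then nu i else 0.
  move=> hi hi'; rewrite /G blDl blNl (blC (w' i)) gVW // subr0 gV //.
  by case/andP: hi => /ltnW -> ->.
have GG i i' : (j < i <= n)%N -> (j < i' <= n)%N -> bl (G i) (G i') = 0.
  move=> hi hi'; apply: (lowcol_iso u_orth _ _ (low i hi) (low i' hi')).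
    by case/andP: hi => h _; apply: leq_ltn_trans h.
  by case/andP: hi' => h _; apply: leq_ltn_trans h.
pose f := u *m ee (n + j).
have lowf : lowcol u f j.
  move=> a aj; rewrite /f mulKmx ?(orth_unit c_neq0 c_rev) // mxE.
  rewrite (_ : a == inord (n + j) = false) //; apply/eqP => e; move: aj.
  by rewrite e inordK ?ltnn //; have [] := ltd jn.
have cf : cvint 1 (f - ee (n + j)) by apply: ucol_cong.
(* The vectors [G i] are dual to the [v' i] up to [nu i], so this makes [g0] orthogonal to all
   earlier [v' i]. Orthogonality to the [G i], hence to the [w' i], is automatic because everything
   lies in one isotropic flag. *)
pose g0 := f - \sum_(i <- rg) (bl f (v' i) / nu i) *: G i.
have lowD g g' i : lowcol u g i -> lowcol u g' i -> lowcol u (g + g') i.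
  by move=> h h' a ai; rewrite mulmxDr mxE h // h' // addr0.
have lowZ g x i : lowcol u g i -> lowcol u (x *: g) i.
  by move=> h a ai; rewrite -scalemxAr mxE h // mulr0.
have low0 : lowcol u g0 j.
  apply: (lowD _ _ _) => //; rewrite -scaleN1r; apply: (lowZ _ _ _).
  rewrite big_seq; apply: (big_ind (fun x => lowcol u x j)); first by move=> a _; rewrite mulmx0 mxE.
    by move=> x y; apply: (lowD x y).
  move=> i; rewrite rgP => hi; apply: (lowZ _ _ _) => a aj; apply: (low i hi).
  by apply: (leq_trans aj); rewrite leq_add2l; case/andP: hi => /ltnW.
have v'int i : (j <= i <= n)%N -> cvint 0 (v' i).
  by move=> hi; rewrite -(subrK (Vv i) (v' i)); apply: cvintD (Vv_int _); apply: cvint_le (cV i hi).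
have w'int i : (j < i <= n)%N -> cvint 0 (w' i).
  by move=> hi; rewrite -(subrK (Ww i) (w' i)); apply: cvintD (Ww_int _); apply: cvint_le (cW i hi).
have fint : cvint 0 f by rewrite -(subrK (ee (n + j)) f); apply: cvintD (ee_int _); apply: cvint_le cf.
have eV i : (j <= i <= n)%N -> bl (ee (n + j)) (Vv i) = if i == j then 2%:R^-1 * nu i else 0.
  move=> /andP[ji hi]; rewrite ee_neg // blZl blDl blNl bl_VV // blC bl_VW ?j0 // subr0 eq_sym.
  by case: eqP => [->|_]; rewrite ?mulr0.
have bfV i : (j <= i <= n)%N -> bl f (v' i) - bl (ee (n + j)) (Vv i) \in vpow w 1.
  move=> hi; have -> : bl f (v' i) - bl (ee (n + j)) (Vv i)
     = bl (v' i) (f - ee (n + j)) + bl (ee (n + j)) (v' i - Vv i).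
    by rewrite !blDr !blNr !(blC (v' i)); ring.
  by rewrite rpredD // bl_int //; [apply: v'int | apply: ee_int | apply: cV].
have g0V i : (j < i <= n)%N -> bl g0 (v' i) = 0.
  move=> hi; rewrite /g0 blDl blNl (blC (\sum_(_ <- _) _)) bl_sumr.
  rewrite (bigD1_seq i) ?rgP //= big_seq_cond big1 => [|i' /andP[]]; last first.
    rewrite rgP => hi' ii; rewrite blZr (blC (v' i)) GV //; last by case/andP: hi => /ltnW -> ->.
    by rewrite (negbTE ii) mulr0.
  rewrite blZr (blC (v' i)) GV // ?eqxx; last by case/andP: hi => /ltnW -> ->.
  by rewrite addr0 divfK ?nu0 // subrr.
have cg0 : cvint 1 (g0 - ee (n + j)).
  rewrite /g0 addrAC; apply: cvintD => //; apply: cvintN; rewrite big_seq; apply: cvint_sum => i.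
  rewrite rgP => hi; rewrite -[1]addr0; apply: cvintZ.
    rewrite vpowMr ?vintV ?nu_unit //.
    have hi' : (j <= i <= n)%N by case/andP: hi => /ltnW -> ->.
    have := bfV i hi'; rewrite eV // (gtn_eqF _) ?subr0 //.
    by case/andP: hi.
  by apply: cvintD; [apply: v'int; case/andP: hi => /ltnW -> -> | apply/cvintN/w'int].
have g0int : cvint 0 g0 by rewrite -(subrK (ee (n + j)) g0); apply: cvintD (ee_int _); apply: cvint_le cg0.
have hjj : (j <= j <= n)%N by rewrite leqnn jn.
pose s := bl g0 (v' j).
have s_cong : s - 2%:R^-1 * nu j \in vpow w 1.
  have <- : bl (ee (n + j)) (Vv j) = 2%:R^-1 * nu j by rewrite eV // eqxx.
  have -> : s - bl (ee (n + j)) (Vv j) = bl (v' j) (g0 - ee (n + j)) + bl (ee (n + j)) (v' j - Vv j).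
    by rewrite /s (blC g0) (blDr (v' j) g0) (blDr (ee _)) !blNr (blC (v' j) (ee _)); ring.
  by rewrite rpredD // bl_int //; [apply: v'int | apply: ee_int | apply: cV].
have hn_unit : vunt w (2%:R^-1 * nu j) by rewrite vuntM ?vuntV ?nu_unit.
have s_unit : vunt w s by apply: vunt_cong hn_unit s_cong.
(* The scale is chosen so that g pairs with v'_j as e_(-j) does with v_j; it is congruent to 1
   modulo pi. *)
pose g := (2%:R^-1 * nu j / s) *: g0.
have lowg : lowcol u g j by apply: (lowZ _ _ _).
have gVj : bl g (v' j) = 2%:R^-1 * nu j by rewrite blZl divfK // (vunt_neq0 s_unit).
have gV0 i : (j < i <= n)%N -> bl g (v' i) = 0 by move=> hi; rewrite blZl g0V ?mulr0.
have gG i : (j < i <= n)%N -> bl g (G i) = 0.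
  move=> hi; apply: (lowcol_iso u_orth j0 _ lowg (low i hi)).
  by case/andP: hi => h _; apply: leq_ltn_trans h.
have gg : bl g g = 0 by apply: (lowcol_iso u_orth j0 j0 lowg lowg).
have cg : cvint 1 (g - ee (n + j)).
  have -> : g - ee (n + j) = (2%:R^-1 * nu j / s - 1) *: g0 + (g0 - ee (n + j)).
    by rewrite scalerBl scale1r addrA subrK.
  apply: cvintD => //; rewrite -[1]addr0; apply: cvintZ g0int.
  have -> : 2%:R^-1 * nu j / s - 1 = - (s - 2%:R^-1 * nu j) / s.
    by field; rewrite (vunt_neq0 s_unit) two0.
  by rewrite vpowMr ?rpredN // vintV.
(* This makes g equal to (v'_j - w'_j) / 2, the new e_(-j). *)
pose wj := v' j - 2%:R *: g.
have wG : v' j - wj = 2%:R *: g by rewrite opprB addrCA subrr addr0.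
have wjE x : bl x wj = bl x (v' j) - 2%:R * bl x g by rewrite blDr blNr blZr.
have wjwj : bl wj wj = - nu j.
  rewrite wjE (blC wj) (blC wj) !wjE gg gVj gV // eqxx (blC (v' j)) gVj.
  by field; exact: two0.
have wjV i : (j <= i <= n)%N -> bl (v' i) wj = 0.
  move=> hi; rewrite wjE gV // (blC (v' i)); move: hi; rewrite leq_eqVlt => /andP[/orP[/eqP <-|ji] hi].
    by rewrite eqxx gVj; field; exact: two0.
  by rewrite gV0 ?ji // (gtn_eqF ji) mulr0 subrr.
have wjW i : (j < i <= n)%N -> bl (w' i) wj = 0.
  move=> hi; rewrite wjE (blC (w' i)) gVW // sub0r.
  have -> : w' i = v' i - G i by rewrite /G opprB addrCA subrr addr0.
  by rewrite blC blDr blNr gV0 // gG // subr0 mulr0 oppr0.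
have cwj : cvint 1 (wj - Ww j).
  have -> : wj - Ww j = (v' j - Vv j) - 2%:R *: (g - ee (n + j)).
    rewrite /wj /Vv /Ww (gtn_eqF j0); apply/matrixP => a b; rewrite !mxE; ring.
  apply: cvintD; first exact: cV.
  by apply: cvintN; rewrite -[1]add0r; apply: cvintZ => //; apply: vunt_int.
have wjint : cvint 0 wj by rewrite -(subrK (Ww j) wj); apply: cvintD (Ww_int _); apply: cvint_le cwj.
pose W i := if i == j then wj else w' i.
pose V i := if i == j.-1 then Tm *m wj else v' i.
have jj1 : j.-1 == j = false by move: j0; clear; lia.
have Vold i : (j <= i)%N -> V i = v' i.
  by move=> ji; rewrite /V (_ : i == j.-1 = false) //; move: j0 ji; clear; lia.
have Wold i : (j < i)%N -> W i = w' i by move=> ji; rewrite /W (gtn_eqF ji).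
have Wj : W j = wj by rewrite /W eqxx.
have Vj : V j.-1 = Tm *m wj by rewrite /V eqxx.
have splitW i : (j.-1 < i <= n)%N -> i = j \/ (j < i <= n)%N by move: j0; clear; lia.
have splitV i : (j.-1 <= i <= n)%N -> i = j.-1 \/ (j <= i <= n)%N by move: j0; clear; lia.
have v'T' i : (j <= i < n)%N -> v' i = Tm *m w' i.+1 by move=> /andP[ji hi]; rewrite -v'T // ltnS ji.
have lt_case i : (i <= n)%N -> (i < n)%N \/ i = n.
  by rewrite leq_eqVlt => /orP[/eqP|]; [right|left].
have TV i : (j <= i <= n)%N -> bl (Tm *m wj) (v' i) = 0.
  move=> /andP[ji hi]; have [iln|->] := lt_case i hi; last by rewrite v'n Tm_skew TmVn bl0r oppr0.
  rewrite v'T' ?ji // Tm_skew Tm_sqr; last by rewrite -v'n gVW ?ltnS ?ji ?jn ?leqnn.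
  by rewrite blZr blC wjW ?mulr0 ?oppr0 // ltnS ji.
have TW i : (j < i <= n)%N -> bl (Tm *m wj) (w' i) = 0.
  move=> hi; rewrite Tm_skew -v'T // blC wjV ?oppr0 //; move: hi j0; clear; lia.
have TTj : Tm *m (Tm *m wj) = eps *: wj by apply: Tm_sqr; rewrite -v'n wjV // jn leqnn.
exists V, W; rewrite jt; split.
- by rewrite Vold.
- move=> i /splitW[->|hi]; first by rewrite Vj Wj.
  have h : (j <= i.-1)%N by move: hi; clear; lia.
  by rewrite Vold // Wold ?v'T //; case/andP: hi.
- split.
  + move=> i i' /splitV[->|hi] /splitV[->|hi'].
    * rewrite Vj eqxx Tm_skew TTj blZr wjwj mulrN opprK (nu_eps (j := j.-1)); last by move: j0 jn; clear; lia.
      by rewrite prednK.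
    * rewrite Vj Vold ?TV //; last by case/andP: hi'.
      by rewrite (_ : _ == _ = false) //; move: hi' j0; clear; lia.
    * rewrite Vj Vold; last by case/andP: hi.
      by rewrite blC TV // (_ : _ == _ = false) //; move: hi j0; clear; lia.
    by rewrite !Vold ?gV //; [case/andP: hi' | case/andP: hi].
  + move=> i i' /splitW[->|hi] /splitW[->|hi'].
    * by rewrite Wj eqxx.
    * rewrite Wj Wold; last by case/andP: hi'.
      by rewrite blC wjW // (ltn_eqF _) //; case/andP: hi'.
    * rewrite Wj Wold; last by case/andP: hi.
      by rewrite wjW // (gtn_eqF _) //; case/andP: hi.
    by rewrite !Wold ?gW //; [case/andP: hi' | case/andP: hi].
  move=> i i' /splitV[->|hi] /splitW[->|hi'].
  + rewrite Vj Wj; apply/eqP; have := Tm_skew wj wj; rewrite (blC wj) => /eqP.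
    by rewrite -addr_eq0 -mulr2n -mulr_natl mulf_eq0 (negbTE two0).
  + by rewrite Vj Wold ?TW //; case/andP: hi'.
  + by rewrite Wj Vold ?wjV //; case/andP: hi.
  by rewrite Vold ?Wold ?gVW //; [case/andP: hi' | case/andP: hi].
- move=> i /splitW[->|hi]; first by rewrite Wj Vold // wG; apply: (lowZ _ _ _).
  by rewrite Vold ?Wold; [apply: low | case/andP: hi | case/andP: hi => /ltnW].
split.
  move=> i /splitV[->|hi]; last by rewrite Vold; [apply: cV | case/andP: hi].
  rewrite Vj -(TmW (j := j)) ?j0 // -mulmxBr; apply: cvintM => //; exact: Tm_int.
move=> i /splitW[->|hi]; first by rewrite Wj.
by rewrite Wold; [apply: cW | case/andP: hi].
Qed.

(** X carries the v_j, w_j to the Gram-Schmidt frame. The process controls only the columns of b =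
    u^-1 X to the right of the middle, which are lower triangular. In the factorization of b by
    [iwahori_UL] the unipotent factor then has trivial columns there, and orthogonality makes its
    other columns trivial too, so all of b is lower triangular. *)
Lemma unitary_near : exists X, [/\ orth c X, X *m Tm = Tm *m X, X *m Vv n = Vv n,
  forall a b, X a b - (a == b)%:R \in vpow w 1 & exists b, [/\ orth c b, mxint w b,
   forall i j : 'I_d, (i < j)%N -> b i j = 0 & X = u *m b]].
Proof.
have [v' [w' [v'n v'T [gV gW gVW] low [cV cW]]]] := gram_schmidt (leqnn n).
rewrite subnn in v'T gV gW gVW low cV cW.
pose X := assemble v' w'.
have XV j : (j <= n)%N -> X *m Vv j = v' j by apply: assembleV.
have XW j : (0 < j <= n)%N -> X *m Ww j = w' j by apply: assembleW.
have oX : orth c X.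
  by apply: assemble_orth => i j hi hj; [apply: gV | apply: gW | apply: gVW].
have XT : X *m Tm = Tm *m X.
  apply: basis_ext => j hj; rewrite -!mulmxA.
    rewrite XV //; move: hj; rewrite leq_eqVlt => /orP[/eqP->|jn].
      by rewrite TmVn mulmx0 v'n TmVn.
    rewrite TmV // -scalemxAr XW // -[j]/(j.+1.-1) v'T // Tm_sqr //.
    by rewrite -v'n gVW // leqnn.
  by rewrite TmW // XW // XV ?v'T //; move: hj; clear; lia.
have X1 a b : X a b - (a == b)%:R \in vpow w 1.
  have -> : X a b - (a == b)%:R = assemble (fun j => v' j - Vv j) (fun j => w' j - Ww j) a b.
    have -> : assemble (fun j => v' j - Vv j) (fun j => w' j - Ww j) = X - 1%:M.
      apply: basis_ext => j hj; rewrite mulmxBl mul1mx.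
        by rewrite assembleV // XV.
      by rewrite assembleW // XW.
    by rewrite sub1E.
  by apply: assemble_int.
exists X; split=> //; first by rewrite XV // v'n.
have uu := orth_unit c_neq0 c_rev u_orth; have ou' := orthV c_neq0 c_rev u_orth.
have iu' : mxint w (invmx u) by apply: mxintV.
pose b := invmx u *m X.
have ob : orth c b by apply: orthM.
have iX : mxint w X.
  move=> i j; rewrite -(subrK (i == j)%:R (X i j)) rpredD //; first exact: vpow_vint (X1 i j).
  by case: (_ == _); rewrite ?rpred0 ?rpred1.
have ib : mxint w b by apply: mxintM.
have b1 i j : b i j - (i == j)%:R \in vpow w 1.
  have -> : b i j - (i == j)%:R = (invmx u *m (X - u)) i j.
    by rewrite mulmxBr mulVmx // [in RHS]mxE [in X in _ = _ + X]mxE [in X in _ = _ + X]mxE.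
  rewrite mxE rpred_sum // => a _; rewrite vpowMl // mxE [X in _ + X]mxE.
  have -> : X a j - u a j = (X a j - (a == j)%:R) - (u a j - (a == j)%:R) by ring.
  by rewrite rpredB.
have iwb : iwahori w b.
  split=> // i j ji; have := b1 i j; rewrite (_ : i == j = false) ?subr0 //.
  by apply/eqP => e; move: ji; rewrite e ltnn.
have lowb (i j : 'I_d) : (n < j)%N -> (i < j)%N -> b i j = 0.
  move=> nj ij; have j0 : (0 < j - n)%N by rewrite subn_gt0.
  have jn : (0 < j - n <= n)%N by rewrite j0 /=; have := ltn_ord j; clear; lia.
  have jE : (n + (j - n) = j)%N by rewrite subnKC // ltnW.
  have -> : b i j = (b *m ee j) i 0 by rewrite mul_ee inord_val.
  have -> : ee j = ee (n + (j - n)) by rewrite jE.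
  rewrite ee_neg // -scalemxAr mxE /b -mulmxA [X *m (_ - _)]mulmxBr XV ?XW //; last by case/andP: jn.
  by rewrite low ?mulr0 // jE.
have [v [b' [[[ov _] iv uv] ob' ib' lb' bE]]] := iwahori_UL c_unit c_rev ob iwb.
have ub' := orth_unit c_neq0 c_rev ob'.
have vE : v = b *m invmx b' by rewrite bE mulmxK.
have lb'V := orth_lowerV c_unit c_rev ob' lb'.
have vcol (i j : 'I_d) : (n < j)%N -> v i j = (i == j)%:R.
  move=> nj; case: (ltngtP i j) => ij.
  - rewrite (_ : i == j = false); last by apply/eqP => e; move: ij; rewrite e ltnn.
    rewrite vE mxE big1 // => a _; case: (ltnP a j) => aj; first by rewrite lb'V ?mulr0.
    by rewrite lowb ?mul0r // (leq_trans _ aj).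
  - rewrite uv.1 // (_ : i == j = false) //; apply/eqP => e; by move: ij; rewrite e ltnn.
  have -> : i = j by apply: val_inj.
  by rewrite uv.2 eqxx.
have vVcol (i j : 'I_d) : (n < j)%N -> invmx v i j = (i == j)%:R.
  move=> nj; have h : v *m ee j = ee j.
    by apply/matrixP => a a'; rewrite -colE !mxE inord_val vcol // !ord1 eqxx andbT.
  have : invmx v *m ee j = ee j by rewrite -{1}h mulKmx // unitriangular_unit.
  by move=> /(congr1 (fun M : 'cV_d => M i 0)); rewrite -colE !mxE inord_val eqxx andbT.
have v1 : v = 1%:M.
  apply/matrixP => i j; rewrite mxE; case: (ltnP n j) => nj; first exact: vcol.
  case: (ltngtP i j) => ij.
  - rewrite (_ : i == j = false); last by apply/eqP => e; move: ij; rewrite e ltnn.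
    have := orth_inv_entry c_neq0 c_rev (rev_ord j) (rev_ord i) ov.
    rewrite !rev_ordK vVcol; last by rewrite /=; move: ij nj; clear; lia.
    rewrite (inj_eq rev_ord_inj) (_ : j == i = false); last by apply/eqP => e; move: ij; rewrite e ltnn.
    move=> /esym/eqP; rewrite !mulf_eq0 invr_eq0 !(negbTE (c_neq0 _)) orbF /= => /eqP //.
  - rewrite uv.1 // (_ : i == j = false) //; apply/eqP => e; by move: ij; rewrite e ltnn.
  have -> : i = j by apply: val_inj.
  by rewrite uv.2 eqxx.
exists b; split=> //; last by rewrite /b mulKVmx.
by rewrite bE v1 mul1mx.
Qed.

End Unitary.

Set Default Proof Using "All".

(** * Matrices over E of unitary elements, and rotations of the line of w_1 *)

Section UnitaryDet.
Variables (k : fieldType) (w : place k) (n : nat).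
Local Notation d := n.*2.+1.
Variable c : 'I_d -> k.
Hypothesis c_unit : forall i, vunt w (c i).
Hypothesis c_rev : forall i, c (rev_ord i) = c i.
Hypothesis two_unit : vunt w 2%:R.
Hypothesis n0 : (0 < n)%N.
Let c_neq0 i : c i != 0 := vunt_neq0 (c_unit i).
Let two0 : (2%:R : k) != 0 := vunt_neq0 two_unit.
Variable eps : k.
Hypothesis eps_unit : vunt w eps.
Hypothesis nu_eps : forall j, (j < n)%N -> nu c j = eps * nu c j.+1.
Local Notation J := (antidiag c).
Local Notation T := (Tm n eps).
Local Notation bl := (bl c).
Local Notation ee := (@ee k n).
Local Notation Vv := (@Vv k n).
Local Notation Ww := (@Ww k n).
Local Notation TmV := (@TmV k w n c c_unit c_rev two_unit eps).
Local Notation TmVn := (@TmVn k w n c c_unit c_rev two_unit eps).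
Local Notation TmW := (@TmW k w n c c_unit c_rev two_unit eps).
Local Notation ee_neg := (@ee_neg k w n two_unit).
Local Notation bl_VV := (@bl_VV k w n c c_rev two_unit).
Local Notation bl_WW := (@bl_WW k n c c_rev).
Local Notation bl_VW := (@bl_VW k w n c c_rev two_unit).
Local Notation blC := (@blC k n c c_rev).
Local Notation blDr := (@blDr k n c c_rev).
Local Notation blZr := (@blZr k n c c_rev).
Local Notation blNr := (@blNr k n c c_rev).
Local Notation blE := (@blE k n c c_rev).
Local Notation basis_ext := (@basis_ext k w n two_unit _ _ _).
Local Notation assembleV := (@assembleV k w n c c_unit c_rev two_unit).
Local Notation assembleW := (@assembleW k w n c c_unit c_rev two_unit).
Local Notation assemble_orth := (@assemble_orth k w n c c_unit c_rev two_unit).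
Local Notation Tm_int := (@Tm_int k w n two_unit eps eps_unit).
Local Notation Tm_skew := (@Tm_skew k w n c c_unit c_rev two_unit eps nu_eps).

Lemma Tm_ee0 : T *m ee n = eps *: Ww 1.
Proof. by rewrite -TmV. Qed.
Lemma Tm_ee j : (0 < j < n)%N -> T *m ee (n + j) = 2%:R^-1 *: (eps *: Ww j.+1 - Vv j.-1).
Proof.
case/andP=> j0 jn; rewrite ee_neg // -scalemxAr mulmxBr TmV // TmW //.
by rewrite j0 ltnW.
Qed.

Definition Ymx : 'M[k]_(d, n) := \matrix_(a, j) (a == inord (n + j))%:R.

Lemma Ymx_col j : col j Ymx = ee (n + j).
Proof. by apply/matrixP => a b; rewrite !mxE !ord1 eqxx andbT. Qed.

Lemma Ymx_mul m (A : 'M[k]_(m, d)) i j : (A *m Ymx) i j = A i (inord (n + j)).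
Proof.
have := congr1 (fun M : 'cV_m => M i 0) (col_mulmx A Ymx j).
by rewrite Ymx_col mul_ee mxE.
Qed.

(** The index of e_(l + 1). The entries of X in these rows and in the columns e_(-i) control the
    eta-part of its matrix over E. *)
Definition topi (l : 'I_n) : 'I_d := inord (n - l.+1).

(* expresses an integral vector orthogonal to v_n in the O-basis y_j, T y_j
   where y_j = e_(-j), 0 <= j < n *)
Lemma Y_basis (C : int) (X : 'M[k]_d) : orth c X -> X *m Vv n = Vv n ->
  (forall a b, X a b - (a == b)%:R \in vpow w 1) ->
  (forall l i : 'I_n, X (topi l) (inord (n + i)) \in vpow w C) ->
  exists m m' : 'M[k]_n,
  [/\ X *m Ymx = Ymx *m m + T *m (Ymx *m m'),
      forall i j, m i j - (i == j)%:R \in vpow w 1,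
      forall i j, m' i j \in vpow w 1 & forall i j, m' i j \in vpow w C].
Proof.
move=> oX Xa X1 XC.
(* The top rows of the vectors T e_(-j). This matrix is triangular with unit diagonal, so the
   coefficients m' can be solved integrally from the top rows of X alone, and inherit their
   divisibility by pi^C. *)
pose S : 'M[k]_n := \matrix_(l, j) T (topi l) (inord (n + j)).
have SE l j : S l j = (T *m ee (n + j)) (topi l) 0 by rewrite mul_ee mxE.
have eeE i (l : 'I_n) : (i < d)%N -> ee i (topi l) 0 = (n - l.+1 == i)%N%:R.
  by move=> hi; rewrite !mxE eqxx andbT inord_eq //; have := ltn_ord l; clear; lia.
have WE i (l : 'I_n) : (0 < i <= n)%N -> Ww i (topi l) 0 = (i == l.+1)%:R.
  move=> /andP[i0 hi]; have [h1 h2] := ltd hi; rewrite mxE [X in _ + X]mxE !eeE //.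
  rewrite (_ : (n - l.+1 == n + i)%N = false) ?subr0; last by move: i0; have := ltn_ord l; clear; lia.
  by congr (_%:R); congr nat_of_bool; have := ltn_ord l; move: hi; clear; lia.
have VE i (l : 'I_n) : (i <= n)%N -> Vv i (topi l) 0 = (i == l.+1)%:R.
  move=> hi; have [h1 h2] := ltd hi; rewrite /Vv; case: (posnP i) => [->|i0].
    by rewrite eeE ?ltnS -?addnn ?leq_addr // (_ : (n - l.+1 == n)%N = false) //; have := ltn_ord l; clear; lia.
  rewrite mxE !eeE // (_ : (n - l.+1 == n + i)%N = false) ?addr0; last by move: i0; have := ltn_ord l; clear; lia.
  by congr (_%:R); congr nat_of_bool; have := ltn_ord l; move: hi; clear; lia.
have SE' l j : S l j = if j == 0%N :> nat then eps * (l == 0%N :> nat)%:R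
    else 2%:R^-1 * (eps * (l == j :> nat)%:R - (j == l.+2 :> nat)%:R).
  rewrite SE; case: (posnP j) => [j0|j0].
    by rewrite j0 addn0 Tm_ee0 mxE WE ?n0 // eqSS eq_sym.
  have combE (A B : 'cV[k]_d) a : (2%:R^-1 *: (eps *: A - B)) a 0 = 2%:R^-1 * (eps * A a 0 - B a 0).
    by rewrite !mxE.
  rewrite Tm_ee ?j0 ?ltn_ord // combE WE ?ltn_ord //.
  rewrite VE; last by have := ltn_ord j; clear; lia.
  rewrite eqSS [j == l :> nat]eq_sym; congr (_ * (_ - _%:R)); congr nat_of_bool.
  by move: j0; clear; lia.
have trS : is_trig_mx S^T.
  apply/is_trig_mxP => j l jl; rewrite mxE SE'; case: (posnP j) => j0.
    by rewrite (_ : (l == 0 :> nat)%N = false) ?mulr0 //; move: jl; clear; lia.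
  rewrite (_ : (l == j :> nat) = false); last by move: jl; clear; lia.
  by rewrite (_ : (j == l.+2 :> nat) = false) ?mulr0 ?subr0 ?mulr0 //; move: jl; clear; lia.
have uS : vunt w (\det S).
  rewrite -det_tr det_trig //; apply: vunt_prod => j _; rewrite mxE SE'.
  case: (posnP j) => j0; first by rewrite /= mulr1.
  rewrite eqxx (_ : (j == j.+2 :> nat) = false); last by clear; lia.
  by rewrite mulr1 subr0 vuntM // vuntV.
have iS : mxint w S by move=> l j; rewrite mxE; apply: Tm_int.
have iSV := mxint_invmx iS uS.
have uS' : S \in unitmx by rewrite unitmxE unitfE (vunt_neq0 uS).
pose P : 'M[k]_n := \matrix_(l, i) X (topi l) (inord (n + i)).
have PE l i : P l i = X (topi l) (inord (n + i)) by rewrite mxE.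
pose m' := invmx S *m P.
have P1 l i : P l i \in vpow w 1.
  rewrite PE; have := X1 (topi l) (inord (n + i)).
  have lt1 : (n - l.+1 < d)%N by clear; lia.
  have lt2 : (n + i < d)%N by have := ltn_ord i; clear; lia.
  rewrite (inord_eq lt1 lt2) (_ : (n - l.+1 == n + i)%N = false) ?subr0 //.
  by have := ltn_ord l; clear; lia.
have m'C i j : m' i j \in vpow w C.
  by rewrite mxE rpred_sum // => a _; rewrite vpowMl ?iSV // PE.
have m'1 i j : m' i j \in vpow w 1.
  by rewrite mxE rpred_sum // => a _; rewrite vpowMl ?iSV.
(* The remainder has no component on e_1, .., e_n by the choice of m', and none on e_(-n) because it
   is orthogonal to v_n = e_n + e_(-n). What is left lies in the span of the e_(-j) with 0 <= j <
   n. *)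
have [Z ZE] : exists Z, Z = X *m Ymx - T *m (Ymx *m m') by eexists.
have TYE a i : (T *m (Ymx *m m')) a i = \sum_(j < n) T a (inord (n + j)) * m' j i.
  by rewrite mulmxA mxE; apply: eq_bigr => j _; rewrite Ymx_mul.
have ZaE a i : Z a i = X a (inord (n + i)) - (T *m (Ymx *m m')) a i.
  by rewrite ZE mxE [X in _ + X]mxE Ymx_mul.
have Ztop l i : Z (topi l) i = 0.
  have PS : P l i = \sum_(j < n) S l j * m' j i.
    by have := mulKVmx uS' P; rewrite -/m' => <-; rewrite [LHS]mxE.
  rewrite ZaE -PE PS TYE -sumrB big1 // => j _.
  by rewrite !mxE subrr.
have nd : (n < d)%N by clear; lia.
have Zperp i : bl (Vv n) (col i Z) = 0.
  have -> : col i Z = X *m ee (n + i) - T *m (Ymx *m col i m').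
    by rewrite ZE linearB /= !col_mulmx Ymx_col.
  rewrite blDr // blNr // -{1}Xa bl_orth // -[X in _ - X]opprK -Tm_skew // TmVn bl0l oppr0 subr0.
  have h : (i <= n)%N by apply: ltnW.
  case: (posnP i) => [->|i0].
    rewrite addn0 -[ee n]/(Vv 0) bl_VV // (gtn_eqF n0) //.
  rewrite ee_neg // blZr // blDr // blNr // bl_VV // bl_VW ?i0 //.
  by rewrite (gtn_eqF (ltn_ord i)) subr0 mulr0.
have top0 : inord 0 = topi (Ordinal (n:=n) (m:=n.-1) (ltac:(by rewrite prednK))).
  by rewrite /topi /= prednK // subnn.
have VnE a : Vv n a 0 = (a == inord 0)%:R + (a == inord n.*2)%:R.
  by rewrite /Vv (gtn_eqF n0) subnn addnn !mxE eqxx !andbT.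
have Zbot i : Z (inord n.*2) i = 0.
  have := Zperp i; rewrite blC // blE // (bigD1 (inord n.*2)) //= rev_inord // subnn.
  rewrite (bigD1 (inord 0)) /=; last by rewrite inord_eq //; move: n0; clear; lia.
  rewrite big1 => [|a /andP[a1 a2]]; last first.
    rewrite VnE.
    rewrite (_ : rev_ord a == inord 0 = false); last first.
      apply/negbTE; apply: contra a1 => /eqP e; rewrite -[a]rev_ordK e rev_inord // subn0 //.
    rewrite (_ : rev_ord a == inord n.*2 = false) ?addr0 ?mulr0 //.
    apply/negbTE; apply: contra a2 => /eqP e; rewrite -[a]rev_ordK e rev_inord // subnn //.
  rewrite [col i Z (inord 0) 0]mxE top0 Ztop !mul0r !addr0 mxE.
  move=> /eqP; rewrite !mulf_eq0 (negbTE (c_neq0 _)) orbF => /orP[/eqP//|].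
  rewrite -top0 VnE eqxx inord_eq // (_ : (0 == n.*2)%N = false).
    by rewrite addr0 oner_eq0.
  by move: n0; clear; lia.
pose m : 'M[k]_n := \matrix_(j, i) Z (inord (n + j)) i.
have ZY : Z = Ymx *m m.
  apply/matrixP => a i; rewrite [RHS]mxE.
  case: (ltnP a n) => an.
    have an' : (n - a.+1 < n)%N by move: an; clear; lia.
    have -> : a = topi (Ordinal an').
      by apply: val_inj; rewrite /topi /= inordK; move: an; clear; lia.
    rewrite Ztop big1 // => j _; rewrite !mxE (_ : _ == _ = false) ?mul0r //.
    rewrite inord_eq; first by have := ltn_ord j; move: an'; clear; lia.
      by move: an'; clear; lia.
    by have := ltn_ord j; clear; lia.
  case: (eqVneq (a : nat) n.*2) => [a2|a2].
    have -> : a = inord n.*2 by apply: val_inj; rewrite /= inordK.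
    rewrite Zbot big1 // => j _; rewrite !mxE inord_eq //; last by have := ltn_ord j; clear; lia.
    by rewrite (_ : (n.*2 == n + j)%N = false) ?mul0r //; have := ltn_ord j; clear; lia.
  have an' : (a - n < n)%N by have := ltn_ord a; move: a2 an; clear; lia.
  have aE : inord (n + (a - n)) = a by rewrite subnKC // inord_val.
  rewrite (bigD1 (Ordinal an')) //= big1 => [|j ja]; rewrite !mxE.
    by rewrite aE eqxx mul1r addr0.
  rewrite -{1}aE inord_eq; last 2 first.
  - by have := ltn_ord a; move: an; clear; lia.
  - by have := ltn_ord j; clear; lia.
  rewrite eqn_add2l (_ : _ == _ = false) ?mul0r //; apply/negbTE.
  by move: ja; rewrite -val_eqE /= eq_sym.
exists m, m'; split=> //.
  by rewrite -ZY ZE subrK.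
move=> i j; rewrite mxE ZaE TYE.
have -> : (i == j) = (inord (n + i) == inord (n + j) :> 'I_d).
  rewrite inord_eq ?eqn_add2l //; [by have := ltn_ord i; clear; lia | by have := ltn_ord j; clear; lia].
rewrite addrAC rpredB // rpred_sum // => a _.
by rewrite vpowMl //; exact: Tm_int.
Qed.

Section Rotation.
Variables (al be : k).
Hypothesis norm1 : al ^+ 2 - eps * be ^+ 2 = 1.

(** With [rotW], multiplication by the norm-one element al + be eta on the E-line of w_1, which
    contains v_0 = eta w_1, and the identity on the other basis vectors. *)
Definition rotV j := if j == 0%N then al *: Vv 0 + (be * eps) *: Ww 1 else Vv j.
Definition rotW j := if j == 1%N then al *: Ww 1 + be *: Vv 0 else Ww j.
Definition rot := assemble rotV rotW.

Lemma rotVE j : (j <= n)%N -> rot *m Vv j = rotV j.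
Proof. exact: assembleV. Qed.
Lemma rotWE j : (0 < j <= n)%N -> rot *m Ww j = rotW j.
Proof. exact: assembleW. Qed.

Lemma rot_orth : orth c rot.
Proof.
have h1 : (0 < 1 <= n)%N by [].
have VW i j : (i <= n)%N -> (0 < j <= n)%N -> bl (Vv i) (Ww j) = 0 by apply: bl_VW.
have WV i j : (i <= n)%N -> (0 < j <= n)%N -> bl (Ww j) (Vv i) = 0 by move=> *; rewrite blC VW.
have nu01 : nu c 0 = eps * nu c 1 by apply: nu_eps.
apply: assemble_orth => // i j hi hj; rewrite /rotV /rotW.
- case: (posnP i) => [->|i0]; case: (posnP j) => [->|j0] //=.
  + rewrite blDl // !blDr // !(blZl, blZr) // bl_VV // bl_WW // VW // WV //= nu01.
    by rewrite -[RHS]mul1r -norm1; ring.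
  + by rewrite blDl // !blZl // bl_VV // WV // (ltn_eqF j0) !mulr0 addr0.
  + by rewrite blDr // !blZr // bl_VV // VW // (gtn_eqF i0) !mulr0 addr0.
  by rewrite bl_VV.
- case: (eqVneq i 1%N) => [ei|i1]; case: (eqVneq j 1%N) => [ej|j1]; rewrite ?ei ?ej ?eqxx.
  + rewrite blDl // !blDr // !(blZl, blZr) // bl_VV // bl_WW // VW // WV //= nu01.
    by rewrite -[RHS]mul1r -norm1; ring.
  + by rewrite blDl // !blZl // bl_WW // VW // ?[1%N == j]eq_sym ?(negbTE j1) !mulr0 addr0.
  + by rewrite blDr // !blZr // bl_WW // WV // ?(negbTE i1) !mulr0 addr0.
  by rewrite bl_WW.
case: (posnP i) => [ei|i0]; case: (eqVneq j 1%N) => [ej|j1]; rewrite ?ei ?ej.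
- rewrite blDl // !blDr // !(blZl, blZr) // bl_VV // bl_WW // VW // WV //= nu01; ring.
- by rewrite blDl // !blZl // VW // bl_WW // ?[1%N == j]eq_sym ?(negbTE j1) !mulr0 addr0.
- by rewrite blDr // !blZr // VW // bl_VV // (gtn_eqF i0) !mulr0 addr0.
by rewrite VW.
Qed.

Lemma rot_comm : rot *m T = T *m rot.
Proof.
have h1 : (0 < 1 <= n)%N by [].
apply: basis_ext => // j hj; rewrite -!mulmxA.
  rewrite rotVE // /rotV; case: (posnP j) => [->|j0].
    rewrite TmV // -scalemxAr rotWE // /rotW /= mulmxDr -!scalemxAr TmV // TmW //=.
    by rewrite scalerDr !scalerA [al * eps]mulrC [be * eps]mulrC.
  move: (hj); rewrite leq_eqVlt => /orP[/eqP ->|jn]; first by rewrite TmVn mulmx0.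
  by rewrite !TmV // -scalemxAr rotWE // /rotW eqSS (gtn_eqF j0).
rewrite rotWE // /rotW; have [->|j1] := eqVneq j 1%N.
  rewrite TmW //= rotVE // /rotV /= mulmxDr -!scalemxAr TmV // TmW //=.
  by rewrite scalerA.
rewrite TmW // rotVE; last by move: hj; clear; lia.
by rewrite /rotV (_ : (j.-1 == 0)%N = false) //; move: hj j1; clear; lia.
Qed.

Lemma rot_fix : rot *m Vv n = Vv n.
Proof. by rewrite rotVE // /rotV (gtn_eqF n0). Qed.

(** The difference lives on e_0, e_1 and e_(-1) only; the formula displays the powers of pi
    available when [rot] is conjugated by tau^m. *)
Lemma rot_entries a b : rot a b - (a == b)%:R =
  (al - 1) * (ee n a 0 * ee n b 0 + Ww 1 a 0 * (2%:R^-1 * Ww 1 b 0))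
  + be * (eps * (Ww 1 a 0 * ee n b 0) + ee n a 0 * (2%:R^-1 * Ww 1 b 0)).
Proof.
have h1 : (0 < 1 <= n)%N by [].
pose M : 'M[k]_d := (al - 1) *: (ee n *m (ee n)^T + 2%:R^-1 *: (Ww 1 *m (Ww 1)^T))
   + be *: (eps *: (Ww 1 *m (ee n)^T) + 2%:R^-1 *: (ee n *m (Ww 1)^T)).
have nd : (n < d)%N by clear; lia.
have dual i j : (i < d)%N -> (j < d)%N -> ((ee i)^T *m ee j) 0 0 = (i == j)%:R by apply: ee_dual.
have [p1 p2] : (n - 1 < d)%N /\ (n + 1 < d)%N by move: n0; clear; lia.
have eV j : (j <= n)%N -> ((ee n)^T *m Vv j) 0 0 = (j == 0%N)%:R.
  move=> hj; have [j1 j2] := ltd hj; rewrite /Vv; case: (posnP j) => [_|j0] /=; first by rewrite dual // eqxx.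
  rewrite mulmxDr mxE !dual // (_ : (n == n - j)%N = false); last by move: j0 hj; clear; lia.
  by rewrite (_ : (n == n + j)%N = false) ?addr0 //; move: j0 hj; clear; lia.
have eW j : (0 < j <= n)%N -> ((ee n)^T *m Ww j) 0 0 = 0.
  move=> /andP[j0 hj]; have [j1 j2] := ltd hj; rewrite mulmxBr mxE [X in _ + X]mxE !dual //.
  rewrite (_ : (n == n - j)%N = false); last by move: j0 hj; clear; lia.
  by rewrite (_ : (n == n + j)%N = false) ?subr0 //; move: j0 hj; clear; lia.
have tW : (Ww 1)^T = (ee (n - 1))^T - (ee (n + 1))^T by apply/matrixP => i j; rewrite !mxE.
have wV j : (j <= n)%N -> ((Ww 1)^T *m Vv j) 0 0 = 0.
  move=> hj; have [j1 j2] := ltd hj; rewrite tW mulmxBl mxE [X in _ + X]mxE /Vv.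
  case: (posnP j) => [_|j0] /=.
    rewrite !dual // (_ : (n - 1 == n)%N = false); last by move: n0; clear; lia.
    by rewrite (_ : (n + 1 == n)%N = false) ?subrr //; clear; lia.
  rewrite !mulmxDr mxE [X in _ - X]mxE !dual //.
  rewrite (_ : (n - 1 == n + j)%N = false); last by move: n0 j0; clear; lia.
  rewrite (_ : (n + 1 == n - j)%N = false); last by move: n0 j0; clear; lia.
  rewrite (_ : (n - 1 == n - j)%N = (1%N == j)); last by move: n0 j0 hj; clear; lia.
  by rewrite eqn_add2l addr0 add0r subrr.
have wW j : (0 < j <= n)%N -> ((Ww 1)^T *m Ww j) 0 0 = 2%:R * (j == 1%N)%:R.
  move=> /andP[j0 hj]; have [j1 j2] := ltd hj; rewrite tW mulmxBl mxE [X in _ + X]mxE.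
  rewrite !mulmxBr mxE [X in _ + X - _]mxE [X in _ - X]mxE [X in _ - (_ + X)]mxE !dual //.
  rewrite (_ : (n - 1 == n + j)%N = false); last by move: n0 j0; clear; lia.
  rewrite (_ : (n + 1 == n - j)%N = false); last by move: n0 j0; clear; lia.
  rewrite (_ : (n - 1 == n - j)%N = (j == 1%N)); last by move: n0 j0 hj; clear; lia.
  rewrite (_ : (n + 1 == n + j)%N = (j == 1%N)); last by move: j0; clear; lia.
  by case: (j == 1%N); rewrite /=; ring.
have gen (f g x : 'cV[k]_d) :
    ((al - 1) *: (f *m f^T + 2%:R^-1 *: (g *m g^T)) + be *: (eps *: (g *m f^T) + 2%:R^-1 *: (f *m g^T))) *m x
    = (al - 1) *: ((f^T *m x) 0 0 *: f + 2%:R^-1 *: ((g^T *m x) 0 0 *: g))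
      + be *: (eps *: ((f^T *m x) 0 0 *: g) + 2%:R^-1 *: ((g^T *m x) 0 0 *: f)).
  by rewrite !mulmxDl -!scalemxAl !mulmxDl -!scalemxAl -!mulmxA !col_scal.
have subM (A : 'M[k]_d) (x : 'cV[k]_d) : (A - 1%:M) *m x = A *m x - x by rewrite mulmxBl mul1mx.
have ME : rot - 1%:M = M.
  apply: basis_ext => // j hj; rewrite subM /M gen.
    rewrite rotVE // eV // wV // /rotV; case: (posnP j) => [->|j0].
      by rewrite -[ee n]/(Vv 0) !scale1r !scale0r !scaler0 !addr0 scalerBl scale1r scalerA addrAC.
    by rewrite subrr !(mulr0n, scale0r, scaler0, addr0).
  rewrite rotWE // eW // wW // /rotW; have [->|j1] := eqVneq j 1%N.
    rewrite !scale0r !mulr1 !scalerA mulVf // !scale1r !scaler0 !add0r.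
    by rewrite -[ee n]/(Vv 0) scalerBl scale1r addrAC.
  by rewrite subrr !(mulr0n, mulr0, scale0r, scaler0, addr0).
rewrite -sub1E ME /M !mxE !big_ord1 !mxE; ring.
Qed.
End Rotation.

End UnitaryDet.

Unset Default Proof Using.

(** * Cosets and characters *)

Section Cosets.
Variables (T : unitRingType) (K : set T).
Hypotheses (K1 : K 1) (KM : forall x y, K x -> K y -> K (x * y)).
Hypothesis KV : forall x, K x -> x \is a GRing.unit /\ K x^-1.

Definition lco (x : T) : set T := [set y | exists2 k, K k & y = x * k].
Definition rinvar (M : Type) (f : T -> M) := forall x k, K k -> f (x * k) = f x.
Definition coset_reps (A : set T) (s : seq T) :=
  [/\ uniq s, forall x, x \in s -> A x,
      forall a, A a -> exists2 x, x \in s & lco x a &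
      forall x y, x \in s -> y \in s -> lco x y -> x = y].
(** A sum over cosets without a chosen list of representatives. It serves to compare two lists of
    representatives of the same set, in particular a list and its left translate. *)
Definition csum (M : nmodType) (A : set T) (f : T -> M) : M :=
  \sum_(c \in lco @` A) f (xget 1 c).

Lemma lco_refl x : lco x x. Proof. by exists 1 => //; rewrite mulr1. Qed.

Lemma lco_sym x y : lco x y -> lco y x.
Proof.
by move=> [k Kk ->]; have [ku kV] := KV Kk; exists k^-1 => //; rewrite mulrK.
Qed.

Lemma lco_trans x y z : lco x y -> lco y z -> lco x z.
Proof. by move=> [k Kk ->] [k' Kk' ->]; exists (k * k'); [exact: KM|rewrite mulrA]. Qed.

Lemma lcoP x y : lco x = lco y <-> lco x y.
Proof.
split=> [->|xy]; first exact: lco_refl.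
apply/seteqP; split=> z /=; first exact: lco_trans (lco_sym xy).
exact: lco_trans xy.
Qed.

Lemma lco_mull a x y : lco x y -> lco (a * x) (a * y).
Proof. by move=> [k Kk ->]; exists k => //; rewrite mulrA. Qed.

Lemma lco_mulKl a x y : a \is a GRing.unit -> lco (a * x) y -> lco x (a^-1 * y).
Proof. by move=> ua [k Kk ->]; exists k => //; rewrite -mulrA mulKr. Qed.

Lemma csum_reps (M : nmodType) A s (f : T -> M) :
  coset_reps A s -> rinvar f -> csum A f = \sum_(x <- s) f x.
Proof.
move=> [us sA As si] fK.
rewrite fsbig_seq // /csum (@reindex_fsbig _ _ _ _ _ lco [set` s] (lco @` A)).
  apply: eq_fsbigr => x _.
  have /= [k Kk ->] : lco x (xget 1 (lco x)) by apply: (xgetPex 1); exists x; exact: lco_refl.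
  exact: fK.
split.
- by move=> x /= xs; exists x => //; exact: sA.
- move=> x y /set_mem /= xs /set_mem /= ys /lcoP; exact: si.
- move=> _ [a aA <-]; have [x xs xa] := As a aA; exists x => //; exact/lcoP.
Qed.

Lemma coset_reps_sub A A' s : coset_reps A s -> A' `<=` A ->
  rinvar A' -> coset_reps A' [seq x <- s | `[< A' x >]].
Proof.
move=> [us sA As si] sub inv; split; first exact: filter_uniq.
- by move=> x; rewrite mem_filter => /andP[/asboolP].
- move=> a aA; have [x xs [k Kk axk]] := As a (sub _ aA); exists x; last by exists k.
  by rewrite mem_filter xs andbT; apply/asboolP; rewrite axk inv in aA.
- by move=> x y; rewrite !mem_filter => /andP[_ xs] /andP[_ ys]; exact: si.
Qed.

Lemma coset_reps_mull A s a : a \is a GRing.unit -> coset_reps A s ->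
  coset_reps [set a * x | x in A] [seq a * x | x <- s].
Proof.
move=> ua [us sA As si]; split.
- by rewrite map_inj_uniq //; exact: mulrI.
- by move=> _ /mapP[x xs ->]; exists x => //; exact: sA.
- move=> _ [x xA <-]; have [y ys yx] := As x xA.
  by exists (a * y); [exact: map_f|exact: lco_mull].
- move=> _ _ /mapP[x xs ->] /mapP[y ys ->] /(lco_mulKl ua); rewrite mulKr // => h.
  by rewrite (si x y).
Qed.

Lemma finite_reps A : finite_set (lco @` A) -> exists s, coset_reps A s.
Proof.
move=> fin; pose p c := xget 1 (c `&` A).
have pP a : A a -> lco a (p (lco a)) /\ A (p (lco a)).
  by move=> aA; apply: (xgetPex 1 (P := lco a `&` A)); exists a; split=> //; exact: lco_refl.
pose s := undup [seq p c | c <- fset_set (lco @` A)].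
have sE x : x \in s -> exists2 a, A a & x = p (lco a).
  rewrite mem_undup => /mapP[c]; rewrite in_fset_set // => /set_mem[a aA <-] ->.
  by exists a.
exists s; split; first exact: undup_uniq.
- by move=> x /sE[a aA ->]; exact: (pP a aA).2.
- move=> a aA; exists (p (lco a)); last by apply: lco_sym; exact: (pP a aA).1.
  rewrite mem_undup; apply: map_f; rewrite in_fset_set //; apply/mem_set.
  by exists a.
- move=> x y /sE[a aA ->] /sE[b bA ->] h; congr p; apply/lcoP.
  apply: lco_trans (pP a aA).1 _; apply: lco_trans h _; apply: lco_sym.
  exact: (pP b bA).1.
Qed.

Lemma finite_cosets A (J : finType) (h : T -> J) :
  (forall x y, A x -> A y -> h x = h y -> lco x y) -> finite_set (lco @` A).
Proof.
move=> sep; pose rp (j : J) := xget 1 [set x | A x /\ h x = j].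
apply: (@sub_finite_set _ _ ((fun j => lco (rp j)) @` [set: J])).
  move=> _ [a aA <-]; exists (h a) => //.
  have [rA rh] : A (rp (h a)) /\ h (rp (h a)) = h a.
    by apply: (xgetPex 1 (P := [set x | A x /\ h x = h a])); exists a.
  by apply/lcoP; exact: sep.
by apply: finite_image; exact: finite_finset.
Qed.

End Cosets.

(** * Linear independence of characters of the dual torus *)

Section Characters.
Variables (Om : fieldType) (n : nat).
Hypothesis Om0 : forall m, m.+1%:R != 0 :> Om.
Implicit Types (l : {ffun 'I_n -> int}) (t : 'I_n -> Om).

Definition charac t l : Om := \prod_(k < n) t k ^ l k.

Lemma exp2z_inj (i j : int) : (2 : Om) ^ i = 2 ^ j -> i = j.
Proof.
have nz : (2 : Om) != 0 := Om0 1.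
have pos (m : nat) : (2 : Om) ^ m%:Z = 1 -> m = 0%N.
  case: m => // m; rewrite -exprnP => h; have := Om0 (2 ^ m.+1 - 2).
  rewrite -natr1 natrB; last by rewrite expnS; have := expn_gt0 2 m; lia.
  rewrite natrX h; have -> : (1 - 2 + 1 = 0 :> Om) by ring.
  by rewrite eqxx.
move=> h; have e1 : (2 : Om) ^ (i - j) = 1.
  by rewrite expfzDr // h -expfzDr // subrr expr0z.
have e2 : (2 : Om) ^ (j - i) = 1 by rewrite -opprB -invr_expz e1 invr1.
have [d|d] : (i - j = `|i - j|%N%:Z) \/ (j - i = `|i - j|%N%:Z) by lia.
  by move: (pos `|i - j|%N); rewrite -d e1 => /(_ erefl); lia.
by move: (pos `|i - j|%N); rewrite -d e2 => /(_ erefl); lia.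
Qed.

(** Dedekind's argument: doubling the coordinate of t at which l and l0 differ multiplies the two
    characters by distinct powers of 2, an element of infinite order in characteristic zero.
    Subtracting 2^(l0 k) times the relation eliminates l0. *)
Lemma charac_indep (s : seq {ffun 'I_n -> int}) (a : {ffun 'I_n -> int} -> Om) :
  uniq s ->
  (forall t, (forall k, t k != 0) -> \sum_(l <- s) a l * charac t l = 0) ->
  forall l, l \in s -> a l = 0.
Proof.
elim: s a => [|l0 s IH] a //= /andP[l0s us] h.
have hs l : l \in s -> a l = 0.
  move=> ls; have ne : l != l0 by apply: contraNneq l0s => <-.
  have [k lk] : exists k, l k != l0 k.
    apply/existsP; apply: contraNT ne; rewrite negb_exists => /forallP e.
    by apply/eqP/ffunP => k; apply/eqP; have := e k; rewrite negbK.
  have := IH (fun l => a l * (2 ^ l k - 2 ^ l0 k)) us _ l ls.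
  move=> /(_ _)/eqP; rewrite mulf_eq0 subr_eq0 => H; apply/eqP.
  suff: (a l == 0) || ((2 : Om) ^ l k == 2 ^ l0 k).
    by case/orP => // /eqP /exp2z_inj e; rewrite e eqxx in lk.
  apply: H => t t0; pose t' i := if i == k then 2 * t i else t i.
  have t'0 i : t' i != 0 by rewrite /t'; case: ifP => // _; rewrite mulf_neq0 ?Om0 ?(Om0 1).
  have t'E l' : charac t' l' = 2 ^ l' k * charac t l'.
    rewrite /charac (bigD1 k) //= [in RHS](bigD1 k) //= {1}/t' eqxx.
    rewrite expfzMl -!mulrA; do 2!congr (_ * _).
    by apply: eq_bigr => i /negbTE ik; rewrite /t' ik.
  have h1 := h _ t'0; have h2 := h _ t0.
  rewrite big_cons t'E in h1; rewrite big_cons in h2.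
  have -> : \sum_(j <- s) a j * (2 ^ j k - 2 ^ l0 k) * charac t j =
     \sum_(j <- s) a j * charac t' j - 2 ^ l0 k * \sum_(j <- s) a j * charac t j.
    rewrite mulr_sumr -sumrB; apply: eq_bigr => j _; rewrite t'E; ring.
  move/eqP: h1; rewrite addrC addr_eq0 => /eqP ->.
  move/eqP: h2; rewrite addrC addr_eq0 => /eqP ->; ring.
move=> l; rewrite inE => /orP[/eqP ->|]; last exact: hs.
have := h (fun=> 1) (fun=> oner_neq0 _); rewrite big_cons big1_seq ?addr0.
  by rewrite /charac big1 ?mulr1 // => i _; rewrite exp1rz.
by move=> j /= js; rewrite hs ?mul0r.
Qed.

Lemma characD t l l' : (forall k, t k != 0) ->
  charac t (l + l') = charac t l * charac t l'.
Proof.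
move=> t0; rewrite /charac -big_split /=; apply: eq_bigr => k _.
by rewrite ffunE expfzDr.
Qed.

Lemma characMn t l i : (forall k, t k != 0) -> charac t (l *+ i) = charac t l ^+ i.
Proof.
move=> t0; elim: i => [|i IH]; last by rewrite mulrS characD // IH exprS.
by rewrite expr0 /charac big1 // => k _; rewrite ffunE expr0z.
Qed.

(** The left side is the coefficient of the character nu once the powers of e mu are multiplied out;
    the list S bounds all supports, so that [charac_indep] applies to a finite sum. *)
Lemma satake_extract (N : nat) (mu : {ffun 'I_n -> int}) (e : Om)
    (f : nat -> {ffun 'I_n -> int} -> Om) (S : seq {ffun 'I_n -> int}) :
  (forall i l, (i < N)%N -> f i l != 0 -> l \in S) ->
  (forall t, (forall k, t k != 0) ->
     \sum_(i < N) (\sum_(l \in [set: {ffun 'I_n -> int}]) f i l * charac t l)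
        * (e * charac t mu) ^+ i = 0) ->
  forall nu, \sum_(i < N) f i (nu - mu *+ i) * e ^+ i = 0.
Proof.
move=> supp h nu.
pose a l := \sum_(i < N) f i (l - mu *+ i) * e ^+ i.
pose S' := undup (flatten [seq [seq l + mu *+ i | l <- S] | i <- iota 0 N]).
have inS' i l : (i < N)%N -> f i (l - mu *+ i) != 0 -> l \in S'.
  move=> iN /(supp _ _ iN) lS; rewrite mem_undup; apply/flattenP.
  exists [seq l + mu *+ i | l <- S]; first by apply/mapP; exists i; rewrite ?mem_iota.
  by apply/mapP; exists (l - mu *+ i); rewrite ?subrK.
rewrite -/(a nu); have [nuS|nuS] := boolP (nu \in S'); last first.
  rewrite /a big1 // => i _; have [->|fn] := eqVneq (f i (nu - mu *+ i)) 0.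
    by rewrite mul0r.
  by rewrite (inS' i nu) // in nuS.
apply: (charac_indep (s := S')) nuS; first exact: undup_uniq.
move=> t t0; rewrite -[RHS](h t t0) /a.
under eq_bigr do rewrite mulr_suml.
rewrite exchange_big /=; apply: eq_bigr => i _.
rewrite exprMn -characMn // [X in _ = X * _](_ : _ = \sum_(l <- S') f i (l - mu *+ i) * charac t (l - mu *+ i)).
  rewrite mulr_suml; apply: eq_bigr => l _.
  have e1 : charac t l = charac t (l - mu *+ i) * charac t (mu *+ i) by rewrite -characD // subrK.
  by rewrite {1}e1; ring.
have ub : uniq [seq l - mu *+ i | l <- S'] by rewrite map_inj_uniq ?undup_uniq //; exact: addIr.
rewrite -(big_map (fun l => l - mu *+ i) xpredT (fun l => f i l * charac t l)) [RHS]fsbig_seq //.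
symmetry.
apply: fsbig_widen => // l [_ /= nl]; apply/eqP; apply: contra_notT nl => ne /=.
apply/mapP; exists (l + mu *+ i); last by rewrite addrK.
apply: (inS' i) => //; rewrite addrK; apply: contraNneq ne => ->; by rewrite mul0r.
Qed.

End Characters.

(** * Vanishing of the Hecke polynomial *)

Lemma seq_min_int (T : eqType) (s : seq T) (h : T -> int) :
  s != [::] -> exists2 x, x \in s & forall y, y \in s -> h x <= h y.
Proof.
elim: s => [|x s IH] // _; case: (eqVneq s [::]) => [->|/IH[y ys ymin]].
  by exists x; rewrite ?mem_head // => y; rewrite inE => /eqP ->.
have [xy|yx] := leP (h x) (h y).
  exists x; rewrite ?mem_head // => z; rewrite inE => /orP[/eqP -> //|/ymin].
  exact: le_trans.
by exists y; rewrite ?inE ?ys ?orbT // => z /orP[/eqP ->|/ymin //]; exact: ltW.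
Qed.

Section Vanish.
Variables (k : fieldType) (w : place k) (n : nat) (c : 'I_n.*2.+1 -> k).
Hypotheses (c_unit : forall i, vunt w (c i)) (c_rev : forall i, c (rev_ord i) = c i).
Hypothesis two_unit : vunt w 2%:R.
Variables (pi : k) (q : nat).
Hypotheses (pi1 : w pi = 1) (q_w : residue_card w q).
Local Notation T := 'M[k]_n.*2.+1.
Local Notation cv l := (@cochar_mx k n pi l).

Definition K0 : set T := [set x | SOJ c x /\ mxint w x].

Lemma c_nz i : c i != 0. Proof. exact: (vunt_neq0 (c_unit i)). Qed.

Lemma SOJ_unit (x : T) : SOJ c x -> x \in unitmx.
Proof. by case=> /(orth_unit c_nz c_rev). Qed.

Lemma K0_1 : K0 1. Proof. by split; [exact: SOJ1|exact: mxint1]. Qed.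

Lemma K0M x y : K0 x -> K0 y -> K0 (x * y).
Proof. by move=> [a b] [e f]; split; [exact: SOJM|exact: mxintM]. Qed.

Lemma K0V x : K0 x -> x \is a GRing.unit /\ K0 x^-1.
Proof.
move=> [a b]; split; first exact: SOJ_unit.
split; first exact: (SOJV c_unit c_rev a).
by apply: (mxintV c_unit c_rev _ b); case: a.
Qed.

Lemma SOJ_unitr (x : T) : SOJ c x -> x \is a GRing.unit. Proof. exact: SOJ_unit. Qed.

(** If x and y have entries in pi^-b and agree modulo pi^b, then x^-1 y = 1 + x^-1 (y - x) is
    integral. After scaling by pi^b only the finitely many residues modulo pi^(2b) matter. *)
Lemma bounded_cosets (A : set T) b : (forall y, A y -> SOJ c y) ->
  (forall y, A y -> forall i j, y i j \in vpow w (- b%:Z)) ->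
  finite_set (lco K0 @` A).
Proof.
move=> AS Ab; have [J [r [_ _ _ rc]]] := residue_reps pi1 q_w (b + b)%N.
pose h (y : T) : {ffun 'I_n.*2.+1 * 'I_n.*2.+1 -> option J} :=
  [ffun p => [pick a | pi ^ b%:Z * y p.1 p.2 - r a \in vpow w (b + b)%N%:Z]].
apply: (finite_cosets K0_1 K0M K0V (h := h)) => x y Ax Ay hxy.
have Sx := AS _ Ax; have Sy := AS _ Ay.
have d i j : y i j - x i j \in vpow w b%:Z.
  have xb z : A z -> pi ^ b%:Z * z i j \in vint w.
    move=> Az; have := vpowM (vpow_pi pi1 b%:Z) (Ab _ Az i j).
    by rewrite subrr.
  have /ffunP/(_ (i, j)) := hxy; rewrite !ffunE /=.
  case: pickP => [a ha|no]; last by have [a ha] := rc _ (xb _ Ax); rewrite no in ha.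
  case: pickP => // a' ha' [aa']; rewrite -aa' in ha'.
  have := rpredB ha' ha; rewrite opprB addrA subrK -mulrBr => hd.
  have := vpowM (vpow_pi pi1 (- b%:Z)) hd.
  rewrite mulrA -expfzDr ?(pi_neq0 pi1) // addNr expr0z mul1r.
  by rewrite PoszD addrA addNr add0r.
exists (x^-1 * y); last by rewrite mulrA mulrV ?mul1r // SOJ_unitr.
split; first by apply: SOJM => //; exact: (SOJV c_unit c_rev).
have -> : x^-1 * y = 1%:M + invmx x *m (y - x).
  by rewrite mulmxBr mulVmx ?SOJ_unit // addrC subrK.
move=> i j; rewrite mxE rpredD ?(mxint1) // mxE; apply: rpred_sum => a _.
rewrite (orth_inv_entry c_nz c_rev _ _ Sx.1) 2!mxE.
have := vpowM (Ab _ Ax (rev_ord a) (rev_ord i)) (d a j).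
rewrite addNr => hd.
set Z := y a j - _ in hd *; set X := x (rev_ord a) _ in hd *.
have -> : (c i)^-1 * X * c a * Z = (c i)^-1 * (c a * (X * Z)) by ring.
by rewrite rpredM ?(vunt_int (vuntV (c_unit i))) // rpredM ?(vunt_int (c_unit a)).
Qed.

Variables (mu : {ffun 'I_n -> int}).
Hypothesis mu_dom : forall a b : 'I_n.*2.+1, (a <= b)%N -> cochar_exp mu b <= cochar_exp mu a.

Definition Iw : set T := [set x | SOJ c x /\ iwahori w x].
Definition iwahori_cell i : set T :=
  [set x | exists a b, [/\ Iw a, K0 b & x = a *m cv (mu *+ i) *m b]].
Definition unip_cell l : set T :=
  [set x | exists u b, [/\ SOJ c u, unitriangular u, K0 b & x = u *m cv l *m b]].

Lemma cochar_expMn i a : cochar_exp (mu *+ i) a = cochar_exp mu a *+ i.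
Proof.
elim: i => [|i IH]; first by rewrite !mulr0n cochar_exp0.
by rewrite !mulrS cochar_expD IH.
Qed.

Lemma two_rhoMn i : two_rho (mu *+ i) = two_rho mu *+ i.
Proof.
by rewrite /two_rho -sumrMnl; apply: eq_bigr => j _; rewrite ffunMnE mulrnAr.
Qed.

Lemma cv_unit l : cv l \is a GRing.unit.
Proof. by apply: SOJ_unitr; exact: (cochar_SOJ c pi1). Qed.

Lemma lower_tconj i (b : T) : mxint w b -> (forall i j : 'I_n.*2.+1, (i < j)%N -> b i j = 0) ->
  mxint w (tconj pi (mu *+ i) b).
Proof.
move=> bi bl r s; rewrite (tconjE pi1).
have [rs|sr] := ltnP r s; first by rewrite bl // mulr0 rpred0.
have e : cochar_exp (mu *+ i) r <= cochar_exp (mu *+ i) s.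
  by rewrite !cochar_expMn lerMn2r mu_dom ?orbT.
apply: rpredM (bi r s); apply: (vpow_le _ (vpow_pi pi1 _)); move: e; clear; lia.
Qed.

(** An Iwahori element is a product of an element of [N0] and an integral lower triangular one, and
    the second is conjugated into K by mu(pi)^i. Hence I mu(pi)^i K = N0 mu(pi)^i K, and its cosets
    are counted by [unip_transversal]. *)
Lemma iwahori_cell_reps i : exists s,
  [/\ coset_reps K0 (iwahori_cell i) s, size s = (q ^ (i * `|two_rho mu|))%N &
      forall x, x \in s -> exists u,
        [/\ SOJ c u, unitriangular u, mxint w u & x = u *m cv (mu *+ i)]].
Proof.
pose l := mu *+ i.
have ldom (a b : 'I_n.*2.+1) : (a <= b)%N -> cochar_exp l b <= cochar_exp l a.
  by move=> ab; rewrite !cochar_expMn lerMn2r mu_dom ?orbT.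
have [s0 [sz us sN cov inj]] := unip_transversal c_unit c_rev two_unit pi1 ldom q_w.
have NS u : N0 w c u -> SOJ c u by move=> [uo ut _]; split=> //; exact: det_unitriangular.
exists [seq v *m cv l | v <- s0]; split; last 2 first.
- by rewrite size_map sz /l two_rhoMn; congr (q ^ _)%N; lia.
- move=> _ /mapP[v vs ->]; exists v; have vN := sN _ vs.
  by split=> //; [exact: NS|case: vN|case: vN].
split.
- by rewrite map_inj_uniq //; apply: (mulIr (cv_unit l)).
- move=> _ /mapP[v vs ->]; exists v, 1; split; [|exact: K0_1|by rewrite mulmx1].
  have vN := sN _ vs; split; [exact: NS|]; case: vN => _ vt vi; split=> // a b ba.
  by rewrite vt.1 // rpred0.
- move=> _ [a [b [[Sa Ia] Kb ->]]].
  have [u [b' [[Su ui ut] b'o b'i b'l ae]]] := iwahori_UL c_unit c_rev Sa.1 Ia.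
  have uN : N0 w c u by split=> //; case: Su.
  have [v vs vt] := cov u uN; have vS := NS _ (sN _ vs).
  exists (v *m cv l); first exact: map_f.
  have b'S : SOJ c b'.
    split=> //; have := Sa.2; by rewrite ae det_mulmx Su.2 mul1r.
  exists (tconj pi l (invmx v *m u) *m tconj pi l b' *m b).
    apply: (K0M _ Kb); apply: K0M.
      split=> //; rewrite /tconj; apply: SOJM; last exact: (cochar_SOJ c pi1).
      apply: SOJM; first exact: (cochar_SOJ c pi1).
      by apply: SOJM => //; exact: (SOJV c_unit c_rev).
    split; last exact: lower_tconj.
    rewrite /tconj; apply: SOJM; last exact: (cochar_SOJ c pi1).
    by apply: SOJM => //; exact: (cochar_SOJ c pi1).
  have cV : cv l *m cv (- l) = 1%:M by rewrite -[l in cv l]opprK (cochar_mxV pi1).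
  have E1 A : cv l *m tconj pi l A = A *m cv l.
    by rewrite /tconj !mulmxA cV mul1mx.
  change (a *m cv l *m b = v *m cv l *m (tconj pi l (invmx v *m u) *m tconj pi l b' *m b)).
  rewrite 2!mulmxA -[v *m cv l *m _]mulmxA E1 ae !mulmxA mulmxV ?mul1mx ?SOJ_unit //.
  by rewrite -[u *m cv l *m cv (- l)]mulmxA cV mulmx1.
- move=> _ _ /mapP[v vs ->] /mapP[v' v's ->] [x [_ xi] e].
  congr (_ *m _); apply: inj => //; rewrite /tin /tconj.
  suff -> : cv (- l) *m (invmx v *m v') *m cv l = x by [].
  have vu := SOJ_unit (NS _ (sN _ vs)).
  rewrite -!mulmxA [v' *m _]e -[v *m cv l * x]mulmxA mulKmx // mulmxA.
  by rewrite (cochar_mxV pi1) mul1mx.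
Qed.

Lemma Iw_unit b : Iw b -> b \is a GRing.unit.
Proof. by move=> [/SOJ_unitr]. Qed.

Lemma iwahori_cell_mull i b : Iw b -> [set b * x | x in iwahori_cell i] = iwahori_cell i.
Proof.
move=> [Sb Ib].
have H b' : Iw b' -> [set b' * x | x in iwahori_cell i] `<=` iwahori_cell i.
  move=> [S' I'] _ [_ [a [d [[Sa Ia] Kd ->]]] <-]; exists (b' *m a), d.
  by split=> //; [split; [exact: SOJM|exact: iwahoriM]|rewrite -!mulmxA].
apply/seteqP; split; first exact: H.
have IV : Iw b^-1.
  split; [exact: (SOJV c_unit c_rev)|apply: (iwahoriV c_unit c_rev _ Ib)]; by case: Sb.
move=> x xX; exists (b^-1 * x); first by apply: (H _ IV); exists x.
by rewrite mulrA mulrV ?mul1r // SOJ_unitr.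
Qed.

Lemma unip_cell_rinvar l : rinvar K0 (unip_cell l).
Proof.
have H x b : K0 b -> unip_cell l x -> unip_cell l (x * b).
  move=> Kb [u [d [Su ut Kd ->]]]; exists u, (d *m b); split=> //; first exact: K0M.
  exact: (esym (mulmxA _ _ _)).
move=> x b Kb; apply/propext; split; last exact: H.
by have [bu bV] := K0V Kb; move=> /(H _ _ bV); rewrite mulrK.
Qed.

Lemma cartan_cell y : SOJ c y ->
  exists l, exists2 a, Iw a & lco K0 (a * cv l) y.
Proof.
move=> /(iwahori_cartan c_unit c_rev pi1)[l [a [b [Sa Ia Sb ib ->]]]].
by exists l, a => //; exists b.
Qed.

Lemma cartan_unip l l' a y : Iw a -> lco K0 (a * cv l) y -> unip_cell l' y ->
  height l <= height l' /\ (height l = height l' -> l = l').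
Proof.
move=> [Sa Ia] [b [Sb ib] ->] [u [d [Su ut [Sd di] e]]].
exact: (iwahori_iwasawa c_unit c_rev pi1 Sa.1 Ia Sb.1 ib ut Sd.1 di e).
Qed.

(** * From vanishing on unipotent cells to vanishing on G / K *)

Section Terms.
Variables (R : comUnitRingType) (Om : fieldType) (iota : {rmorphism R -> Om}).
Hypothesis iota_inj : injective iota.
Hypothesis Om0 : forall m, m.+1%:R != 0 :> Om.
Variables (J : eqType) (P : seq J) (cf : J -> R) (ix : J -> nat).
Variables (C : J -> set T) (t : J -> seq T).
Hypothesis tP : forall j, coset_reps K0 (C j) (t j).
Hypothesis CS : forall j x, C j x -> SOJ c x.
Hypothesis CK : forall j x b, K0 b -> C j x -> C j (b * x).
(** The coefficient at nu of the Hecke polynomial evaluated at its root, written as a weighted count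
    of cosets. An index j stands for an exponent [ix j] together with a double coset [C j]. *)
Hypothesis satake0 : forall nu, \sum_(j <- P) iota (cf j) *
   ((q ^ (ix j * `|two_rho mu|))%N%:R *
    (count (fun d => `[< unip_cell (nu - mu *+ ix j) d >]) (t j))%:R) = 0.

Lemma csum_mull j b (M : nmodType) (f : T -> M) : K0 b -> rinvar K0 f ->
  csum K0 (C j) (fun d => f (b * d)) = csum K0 (C j) f.
Proof.
move=> Kb fK; have [bu bV] := K0V Kb.
have fbK : rinvar K0 (fun d => f (b * d)) by move=> x y Ky; rewrite mulrA fK.
have e : [set b * x | x in C j] = C j.
  apply/seteqP; split=> x; first by move=> [y Cy <-]; exact: CK.
  by move=> Cx; exists (b^-1 * x); [exact: CK|rewrite mulrA mulrV ?mul1r].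
have tb := coset_reps_mull bu (tP j); rewrite e in tb.
by rewrite (csum_reps K0_1 K0M K0V (tP j) fbK) (csum_reps K0_1 K0M K0V tb fK) big_map.
Qed.

Lemma csum_rinvar j (M : nmodType) (f : T -> M) : rinvar K0 f ->
  rinvar K0 (fun a => csum K0 (C j) (fun d => f (a * d))).
Proof.
move=> fK a b Kb /=; have faK : rinvar K0 (fun d => f (a * d)).
  by move=> x y Ky; rewrite mulrA fK.
rewrite -[RHS](csum_mull j Kb faK); congr (csum _ _ _); apply/funext => d.
by rewrite mulrA.
Qed.

Variable s : nat -> seq T.
Hypothesis sP : forall i, coset_reps K0 (iwahori_cell i) (s i).
Hypothesis s_size : forall i, size (s i) = (q ^ (i * `|two_rho mu|))%N.
Hypothesis s_unip : forall i x, x \in s i -> exists u,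
        [/\ SOJ c u, unitriangular u, mxint w u & x = u *m cv (mu *+ i)].

Lemma csum2_list j (M : nmodType) (f : T -> M) : rinvar K0 f ->
  csum K0 (iwahori_cell (ix j)) (fun a => csum K0 (C j) (fun d => f (a * d)))
  = \sum_(a <- s (ix j)) \sum_(d <- t j) f (a * d).
Proof.
move=> fK; rewrite (csum_reps K0_1 K0M K0V (sP _) (csum_rinvar j fK)).
apply: eq_bigr => a _; rewrite (csum_reps K0_1 K0M K0V (tP j)) //.
by move=> x y Ky; rewrite mulrA fK.
Qed.

Definition ind y z : nat := `[< lco K0 y z >].

Lemma ind_rinvar y : rinvar K0 (ind y).
Proof.
move=> x b Kb; congr (nat_of_bool _); apply/asbool_equiv_eq; split=> h.
  apply: (lco_trans K0M h); apply: (lco_sym K0V); by exists b.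
by apply: (lco_trans K0M h); exists b.
Qed.

Definition icount j y : nat := \sum_(a <- s (ix j)) \sum_(d <- t j) ind y (a * d).
(** The coefficient at the coset y K of the element of R[G / K] obtained by applying the A_i to the
    cells I tau^i K / K. It is invariant under I on the left, see [xf_mull]. *)
Definition xf y : R := \sum_(j <- P) cf j * (icount j y)%:R.

Lemma ind_lco y y' z : lco K0 y y' -> ind y z = ind y' z.
Proof.
move=> h; congr (nat_of_bool _); apply/asbool_equiv_eq; split.
  by apply: (lco_trans K0M); exact: (lco_sym K0V).
exact: (lco_trans K0M).
Qed.

Lemma xf_lco y y' : lco K0 y y' -> xf y = xf y'.
Proof.
move=> h; apply: eq_bigr => j _; congr (_ * _%:R).
by do 2!(apply: eq_bigr => ? _); exact: ind_lco.
Qed.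

Lemma icount_mull j b y : Iw b -> icount j (b * y) = icount j y.
Proof.
move=> Ib; have bu := Iw_unit Ib.
rewrite /icount -(csum2_list j (@ind_rinvar y)).
have tb := coset_reps_mull bu (sP (ix j)); rewrite iwahori_cell_mull // in tb.
have := csum2_list j (@ind_rinvar (b * y)).
rewrite (csum_reps K0_1 K0M K0V tb (csum_rinvar j (@ind_rinvar (b * y)))).
rewrite /icount => <-; rewrite big_map.
rewrite (csum_reps K0_1 K0M K0V (sP _) (csum_rinvar j (@ind_rinvar y))).
apply: eq_bigr => a _; congr (csum _ _ _); apply/funext => d.
congr (nat_of_bool _); apply/asbool_equiv_eq; rewrite -mulrA; split=> h.
  by have := lco_mulKl bu h; rewrite mulKr.
exact: lco_mull.
Qed.

Lemma xf_mull b y : Iw b -> xf (b * y) = xf y.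
Proof. by move=> Ib; apply: eq_bigr => j _; rewrite icount_mull. Qed.

Let prods := flatten [seq [seq a * d | a <- s (ix j), d <- t j] | j <- P].

Lemma prodsP j a d : j \in P -> a \in s (ix j) -> d \in t j -> a * d \in prods.
Proof.
move=> jP aj dj; apply/flattenP; exists [seq a * d | a <- s (ix j), d <- t j].
  by apply/mapP; exists j.
by apply/allpairsP; exists (a, d).
Qed.

Lemma prods_SOJ y : y \in prods -> SOJ c y.
Proof.
move=> /flattenP[_ /mapP[j jP ->] /allpairsP[[a d] /= [aj dj ->]]].
apply: SOJM; last by have [_ /(_ _ dj)/CS] := tP j.
have [u [Su _ _ ->]] := s_unip aj; apply: SOJM => //; exact: (cochar_SOJ c pi1).
Qed.

Lemma xf_prods y : xf y != 0 -> exists2 z, z \in prods & lco K0 y z.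
Proof.
move=> h; apply: contrapT => no; case/negP: h; apply/eqP.
rewrite /xf big1_seq // => j /= jP; rewrite /icount big1_seq ?mulr0 // => a /= aj.
rewrite big1_seq // => d /= dj; rewrite /ind; case: asboolP => // h; case: no.
by exists (a * d); [exact: (prodsP jP aj dj)|exact: h].
Qed.

Let Y : set T := [set z | exists2 y, y \in prods & lco K0 y z].

Lemma Y_reps : exists u, coset_reps K0 Y u.
Proof.
apply: (finite_reps K0_1 K0M K0V).
apply: (@sub_finite_set _ _ (lco K0 @` [set` prods])); last exact: finite_image.
by move=> _ [z [y yp yz] <-]; exists y => //; apply/(lcoP K0_1 K0M K0V).
Qed.

Lemma sum_prods u (M : lmodType R) (f : T -> M) : coset_reps K0 Y u ->
  rinvar K0 f ->
  \sum_(j <- P) cf j *: \sum_(a <- s (ix j)) \sum_(d <- t j) f (a * d)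
  = \sum_(y <- u) xf y *: f y.
Proof.
move=> [uu uY cov inj] fK.
under [RHS]eq_bigr do rewrite /xf scaler_suml.
rewrite exchange_big; apply: eq_big_seq => j jP /=.
under [RHS]eq_bigr do rewrite -scalerA /icount natr_sum scaler_suml.
rewrite -scaler_sumr [in RHS]exchange_big; congr (_ *: _); apply: eq_big_seq => a aj /=.
under [RHS]eq_bigr do rewrite natr_sum scaler_suml.
rewrite exchange_big; apply: eq_big_seq => d dj /=.
have Yad : Y (a * d).
  exists (a * d); first exact: (prodsP jP aj dj).
  exact: (lco_refl K0_1).
have [y yu yad] := cov _ Yad.
rewrite (bigD1_seq y) //= [ind y _](_ : _ = 1%N); last by rewrite /ind asboolT.
rewrite scale1r big1_seq ?addr0 //; first by have [b Kb ->] := yad; rewrite fK.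
move=> z /andP[zy zu]; rewrite /ind; case: asboolP => [h|]; rewrite ?scale0r //.
case/eqP: zy; apply: inj => //; apply: (lco_trans K0M h); exact: (lco_sym K0V).
Qed.

(** Otherwise choose y0 in the support whose Cartan cocharacter nu has minimal height, and sum [xf]
    over the cosets in N nu(pi) K. Each coset of the support met there has cocharacter at most nu,
    hence equal to nu by minimality, and then [xf] has the value [xf y0] by Iwahori invariance. The
    sum is [xf y0] times a positive integer, while [satake0] makes it zero. *)
Lemma xf0 u : coset_reps K0 Y u -> forall y, y \in u -> xf y = 0.
Proof.
move=> tu; have [uu uY cov inj] := tu.
have uS y : y \in u -> SOJ c y.
  move=> /uY[z /prods_SOJ Sz [b [Sb _] ->]]; exact: SOJM.
have /choice[lam lamP] : forall y, exists l, y \in u -> exists2 a, Iw a & lco K0 (a * cv l) y.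
  move=> y; have [yu|yu] := boolP (y \in u); last by exists 0.
  by have [l h] := cartan_cell (uS _ yu); exists l.
suff : [seq y <- u | xf y != 0] == [::].
  rewrite -[_ == _]negbK -has_filter => /hasPn h y /h; rewrite negbK => /eqP //.
apply: contraT => /(@seq_min_int _ _ (fun y => height (lam y)))[y0].
rewrite mem_filter => /andP[x0 y0u] ymin.
pose nu := lam y0.
have xnu y : y \in u -> xf (cv (lam y)) = xf y.
  by move=> yu; have [a Ia h] := lamP _ yu; rewrite -(xf_lco h) xf_mull.
pose f (y : T) : nat := `[< unip_cell nu y >].
have fK : rinvar K0 f by move=> y b Kb; rewrite /f (unip_cell_rinvar nu y Kb).
have e1 : \sum_(j <- P) cf j * (\sum_(a <- s (ix j)) \sum_(d <- t j) f (a * d)%R)%N%:R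
          = \sum_(y <- u) xf y * (f y)%:R.
  have fK' : rinvar K0 (fun y => (f y)%:R : R^o) by move=> y b Kb; rewrite fK.
  rewrite -[RHS](sum_prods tu fK'); apply: eq_bigr => j _; congr (_ * _).
  rewrite natr_sum; apply: eq_bigr => a _; exact: natr_sum.
(* A representative a = v mu(pi)^i with v unipotent shifts the cells: a d lies in the cell of nu
   exactly when d lies in that of nu - i mu. All representatives thus contribute equally, which
   produces the factor q^(i <2 rho, mu>). *)
have e2 : iota (\sum_(y <- u) xf y * (f y)%:R) = 0.
  rewrite -e1 rmorph_sum -[RHS](satake0 nu) /=; apply: eq_big_seq => j jP.
  rewrite rmorphM rmorph_nat -natrM; congr (_ * _%:R).
  rewrite -s_size -sum1_size big_distrl /=; apply: eq_big_seq => a aj.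
  rewrite mul1n -sum1_count [RHS]big_mkcond; apply: eq_bigr => d _ /=.
  have [v [Sv vt _ ->]] := s_unip aj.
  rewrite /f; set b1 := asbool _; set b2 := asbool _.
  suff -> : b1 = b2 by case: b2.
  have cV l : cv l *m cv (- l) = 1%:M by rewrite -[l in cv l]opprK (cochar_mxV pi1).
  have cV' l : cv (- l) *m cv l = 1%:M by rewrite (cochar_mxV pi1).
  set m := mu *+ ix j; have vu := SOJ_unit Sv.
  have vVt : unitriangular (invmx v) by exact: unitriangularV.
  have conjt l (x : T) : unitriangular x -> unitriangular (tconj pi l x).
    move=> [x1 x2]; split=> [i1 i2 lt|i1]; rewrite (tconjE pi1).
      by rewrite x1 ?mulr0.
    by rewrite x2 mulr1 subrr expr0z.
  have conjS l (x : T) : SOJ c x -> SOJ c (tconj pi l x).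
    move=> Sx; rewrite /tconj; apply: SOJM; last exact: (cochar_SOJ c pi1).
    by apply: SOJM => //; exact: (cochar_SOJ c pi1).
  have tE l (x : T) : tconj pi l x *m cv (- l) = cv (- l) *m x.
    by rewrite /tconj -!mulmxA cV mulmx1.
  apply/asbool_equiv_eq; split.
    move=> [u1 [b [Su1 tu1 Kb e]]]; exists (tconj pi m (invmx v *m u1)), b; split=> //.
    - by apply: conjS; apply: SOJM => //; exact: (SOJV c_unit c_rev).
    - by apply: conjt; exact: unitriangularM.
    - rewrite [nu - m]addrC (cochar_mxD pi1) !mulmxA tE -!mulmxA [u1 *m (_ *m b)]mulmxA -e.
      rewrite -[v *m cv _ * d]mulmxA mulKmx // mulmxA.
      by rewrite cV' mul1mx.
  move=> [u1 [b [Su1 tu1 Kb ->]]]; exists (v *m tconj pi (- m) u1), b; split=> //.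
  - by apply: SOJM => //; exact: conjS.
  - by apply: unitriangularM => //; exact: conjt.
  - rewrite [nu - m]addrC (cochar_mxD pi1).
    change (v *m cv m *m (u1 *m (cv (- m) *m cv nu) *m b) = v *m tconj pi (- m) u1 *m cv nu *m b).
    by rewrite /tconj opprK !mulmxA.
have e3 : \sum_(y <- u) xf y * (f y)%:R
    = xf y0 * (count (fun y => `[< unip_cell nu y >] && (xf y != 0)) u)%:R.
  rewrite -sum1_count [in RHS]big_mkcond natr_sum mulr_sumr; apply: eq_big_seq => y yu /=.
  have [->|xy] := eqVneq (xf y) 0; first by rewrite mul0r andbF mulr0.
  rewrite andbT /f; case: asboolP => h; rewrite ?mulr0 // !mulr1.
  have [a Ia la] := lamP _ yu; have [h1 h2] := cartan_unip Ia la h.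
  have e : lam y = nu.
    apply: h2; apply/eqP; rewrite eq_le h1 /=; apply: ymin.
    by rewrite mem_filter xy yu.
  by rewrite -(xnu _ yu) e xnu.
have cnt : (0 < count (fun y => `[< unip_cell nu y >] && (xf y != 0)%R) u)%N.
  rewrite -has_count; apply/hasP.
  have xn : xf (cv nu) != 0 by rewrite xnu.
  have [z zp nz] := xf_prods xn.
  have Yz : Y z by exists z; [exact: zp|exact: (lco_refl K0_1)].
  have [y yu yz] := cov _ Yz.
  have yn : lco K0 (cv nu) y by apply: (lco_trans K0M nz); exact: (lco_sym K0V).
  exists y => //; rewrite -(xf_lco yn) xn andbT; apply/asboolP.
  have [b Kb ->] := yn; exists 1%:M, b; split=> //; last by rewrite mul1mx.
    exact: SOJ1.
  by split=> [i1 i2 lt|i1]; rewrite mxE ?eqxx //; case: eqP lt => // ->; rewrite ltnn.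
move: e2; rewrite e3 rmorphM rmorph_nat => /eqP; rewrite mulf_eq0.
case: (count _ _) cnt => // m' _; rewrite (negbTE (Om0 m')) orbF => /eqP.
by rewrite -(rmorph0 iota) => /iota_inj e; rewrite e eqxx in x0.
Qed.

Lemma hecke_vanish_list (M : lmodType R) (f : T -> M) : rinvar K0 f ->
  \sum_(j <- P) cf j *: \sum_(a <- s (ix j)) \sum_(d <- t j) f (a * d) = 0.
Proof.
move=> fK; have [u tu] := Y_reps; rewrite (sum_prods tu fK).
by rewrite big1_seq // => y /= yu; rewrite (xf0 tu) // scale0r.
Qed.

End Terms.
End Vanish.

(** * Quadratic algebras *)

Section QuadTheory.
Variables (k : fieldType) (D : k).
Local Notation E := (quad D).
Implicit Types x y z : E.

Lemma quadE x y : qre x = qre y -> qim x = qim y -> x = y.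
Proof. by case: x y => [a b] [c d] /= -> ->. Qed.

Lemma qreD x y : qre (x + y) = qre x + qre y. Proof. by []. Qed.
Lemma qimD x y : qim (x + y) = qim x + qim y. Proof. by []. Qed.
Lemma qreN x : qre (- x) = - qre x. Proof. by []. Qed.
Lemma qimN x : qim (- x) = - qim x. Proof. by []. Qed.
Lemma qreM x y : qre (x * y) = qre x * qre y + D * (qim x * qim y). Proof. by []. Qed.
Lemma qimM x y : qim (x * y) = qre x * qim y + qim x * qre y. Proof. by []. Qed.
Lemma qre1 : qre (1 : E) = 1. Proof. by []. Qed.
Lemma qim1 : qim (1 : E) = 0. Proof. by []. Qed.
Lemma qre0 : qre (0 : E) = 0. Proof. by []. Qed.
Lemma qim0 : qim (0 : E) = 0. Proof. by []. Qed.
Definition qrew := (qreD, qimD, qreN, qimN, qreM, qimM, qre1, qim1, qre0, qim0).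

Ltac qring := apply: quadE; rewrite ?qrew /=; ring.

Lemma qconj_is_additive : zmod_morphism (@qconj k D).
Proof. by move=> x y; qring. Qed.
Lemma qconj_is_monoid : monoid_morphism (@qconj k D).
Proof. by split=> [|x y]; qring. Qed.
HB.instance Definition _ := GRing.isZmodMorphism.Build E E (@qconj k D) qconj_is_additive.
HB.instance Definition _ := GRing.isMonoidMorphism.Build E E (@qconj k D) qconj_is_monoid.

Lemma qin_is_additive : zmod_morphism (@qin k D).
Proof. by move=> x y; qring. Qed.
Lemma qin_is_monoid : monoid_morphism (@qin k D).
Proof. by split=> [|x y]; qring. Qed.
HB.instance Definition _ := GRing.isZmodMorphism.Build k E (@qin k D) qin_is_additive.
HB.instance Definition _ := GRing.isMonoidMorphism.Build k E (@qin k D) qin_is_monoid.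

Lemma qinM a b : qin D (a * b) = qin D a * qin D b. Proof. exact: rmorphM. Qed.
Lemma qconjK x : qconj (qconj x) = x. Proof. by qring. Qed.
Lemma qconj_qin a : qconj (qin D a) = qin D a. Proof. by qring. Qed.
Lemma qmul_conj x : x * qconj x = qin D (qnorm x).
Proof. by rewrite /qnorm; qring. Qed.
Lemma qnormM x y : qnorm (x * y) = qnorm x * qnorm y.
Proof. by rewrite /qnorm !qrew; ring. Qed.
Lemma qnorm1 : qnorm (1 : E) = 1. Proof. by rewrite /qnorm !qrew; ring. Qed.
Lemma qnorm_conj x : qnorm (qconj x) = qnorm x. Proof. by rewrite /qnorm /=; ring. Qed.
Lemma qnorm_qin a : qnorm (qin D a) = a ^+ 2. Proof. by rewrite /qnorm /=; ring. Qed.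
Lemma qtrD x y : qtr (x + y) = qtr x + qtr y. Proof. by rewrite /qtr !qrew; ring. Qed.
Lemma qtrN x : qtr (- x) = - qtr x. Proof. by rewrite /qtr !qrew; ring. Qed.
Lemma qtr_qinM a x : qtr (qin D a * x) = a * qtr x.
Proof. by rewrite /qtr !qrew /=; ring. Qed.
Lemma qunitE x : (x \is a GRing.unit) = (qnorm x != 0). Proof. by []. Qed.
Lemma qunit_norm1 x : x * qconj x = 1 -> x \is a GRing.unit.
Proof. by move=> e; apply/unitrP; exists (qconj x); rewrite [qconj x * x]mulrC. Qed.
Lemma qinv_norm1 x : x * qconj x = 1 -> x^-1 = qconj x.
Proof. by move=> e; apply: (mulrI (qunit_norm1 e)); rewrite divrr ?qunit_norm1. Qed.
Lemma qnorm_sub1 x : qnorm x - 1 = qtr (x - 1) + qnorm (x - 1).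
Proof. by rewrite /qnorm /qtr !qrew; ring. Qed.
Lemma norm1M x y : x * qconj x = 1 -> y * qconj y = 1 -> x * y * qconj (x * y) = 1.
Proof. by move=> ex ey; rewrite rmorphM mulrACA ex ey mulr1. Qed.
Lemma norm1V x : x * qconj x = 1 -> x^-1 * qconj x^-1 = 1.
Proof. by move=> e; rewrite (qinv_norm1 e) qconjK mulrC. Qed.
Lemma norm1_1 : (1 : E) * qconj 1 = 1. Proof. by rewrite rmorph1 mulr1. Qed.

Lemma qconjV x : x \is a GRing.unit -> qconj x^-1 = (qconj x)^-1.
Proof. by move=> ux; rewrite rmorphV. Qed.
Lemma qconj_unit x : x \is a GRing.unit -> qconj x \is a GRing.unit.
Proof. by rewrite !qunitE qnorm_conj. Qed.
End QuadTheory.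

Section QuadInt.
Variables (k : fieldType) (w : place k) (D : k).
Local Notation E := (quad D).
Implicit Types x y z : E.

(* the fractional ideal m^j O_E *)
Definition oe (j : int) : {pred E} :=
  fun x => (qtr x \in vpow w j) && (qnorm x \in vpow w (j + j)).

Lemma oeP j x : reflect (qtr x \in vpow w j /\ qnorm x \in vpow w (j + j)) (x \in oe j).
Proof. exact: andP. Qed.

(** If w a < j, then also w b < j because of the sum, and the product has too small a valuation. *)
Lemma vpow_quadratic j a b : a + b \in vpow w j -> a * b \in vpow w (j + j) ->
  a \in vpow w j.
Proof.
move=> s p; have [->|a0] := eqVneq a 0; first exact: rpred0.
rewrite vpow_val // leNgt; apply/negP => aj.
have naj : a \notin vpow w j by rewrite vpow_val // -ltNge.
have b0 : b != 0.
  by apply: contraNneq naj => b0; rewrite b0 addr0 in s.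
have bj : w b < j.
  rewrite ltNge -vpow_val //; apply: contra naj => bj.
  by have := rpredB s bj; rewrite addrK.
by move: p; rewrite vpow_val ?mulf_neq0 // place_valM //; move: aj bj; vlia.
Qed.

(** The traces of x y and of x ybar are the roots of a quadratic polynomial whose coefficients are
    controlled by the traces and norms of x and y. This argument also covers a split algebra, where
    no valuation is available. *)
Lemma qtr_mul i j x y : x \in oe i -> y \in oe j -> qtr (x * y) \in vpow w (i + j).
Proof.
move=> /oeP[tx nx] /oeP[ty ny].
apply: (@vpow_quadratic _ _ (qtr (x * qconj y))).
  rewrite (_ : _ + _ = qtr x * qtr y); first exact: vpowM.
  by rewrite /qtr !qrew /=; ring.
rewrite (_ : _ * _ = qnorm y * (qtr x * qtr x - (qnorm x + qnorm x))
   + qnorm x * (qtr y * qtr y - (qnorm y + qnorm y))); last first.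
  by rewrite /qtr /qnorm !qrew /=; ring.
have -> : i + j + (i + j) = (i + i) + (j + j) by vlia.
apply: rpredD; last by apply: vpowM => //; apply: rpredB; [exact: vpowM|exact: rpredD].
rewrite [i + i + _]addrC; apply: vpowM => //; apply: rpredB; [exact: vpowM|exact: rpredD].
Qed.

Lemma oe_conj j x : (qconj x \in oe j) = (x \in oe j).
Proof. by rewrite !unfold_in qnorm_conj. Qed.

Lemma oeM i j x y : x \in oe i -> y \in oe j -> x * y \in oe (i + j).
Proof.
move=> hx hy; apply/oeP; split; first exact: qtr_mul.
rewrite qnormM; have -> : i + j + (i + j) = (i + i) + (j + j) by vlia.
by apply: vpowM; [case/oeP: hx|case/oeP: hy].
Qed.

Lemma oe_zmod j : zmod_closed (oe j).
Proof.
split=> [|x y hx hy].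
  by apply/oeP; rewrite /qtr /qnorm /= !(addr0, expr0n, mulr0, subr0); split; exact: rpred0.
have [tx nx] := oeP _ _ hx; have [ty ny] := oeP _ _ hy.
apply/oeP; split; first by rewrite qtrD qtrN rpredB.
have -> : qnorm (x - y) = qnorm x + qnorm y - qtr (x * qconj y).
  by rewrite /qnorm /qtr !qrew /=; ring.
by apply: rpredB; [exact: rpredD|apply: qtr_mul; rewrite ?oe_conj].
Qed.
HB.instance Definition _ j := GRing.isZmodClosed.Build E (oe j) (oe_zmod j).

Lemma oe_le i j x : i <= j -> x \in oe j -> x \in oe i.
Proof.
move=> ij /oeP[a b]; apply/oeP; split; first exact: vpow_le a.
by apply: vpow_le b; vlia.
Qed.

Definition oint : {pred E} := oe 0.
Lemma oint_sub : subring_closed oint.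
Proof.
split=> [||x y hx hy]; last by have := oeM hx hy; rewrite addr0.
  apply/oeP; rewrite /qtr qnorm1 /= vint1 rpredD //; exact: vint1.
by move=> x y; exact: rpredB.
Qed.
HB.instance Definition _ := GRing.isSubringClosed.Build E oint oint_sub.

Lemma oe_qin j a : a \in vpow w j -> qin D a \in oe j.
Proof.
move=> h; apply/oeP; split; first by rewrite /qtr /= rpredD.
by rewrite qnorm_qin expr2; exact: vpowM.
Qed.

Lemma oeMl j x y : x \in oint -> y \in oe j -> x * y \in oe j.
Proof. by move=> hx hy; have := oeM hx hy; rewrite add0r. Qed.

Lemma oeMr j x y : x \in oe j -> y \in oint -> x * y \in oe j.
Proof. by move=> hx hy; have := oeM hx hy; rewrite addr0. Qed.

Hypotheses (D0 : D != 0) (two0 : 2%:R != 0 :> k).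

(** The maximal order and the lattice of coordinates differ by bounded denominators, which depend on
    the valuations of 2 and D only. Limits in E_w can therefore be taken coordinatewise. *)
Lemma oe_coord : exists kp : nat, forall j x,
  (x \in oe j -> qre x \in vpow w (j - kp%:Z) /\ qim x \in vpow w (j - kp%:Z)) /\
  (qre x \in vpow w (j + kp%:Z) -> qim x \in vpow w (j + kp%:Z) -> x \in oe j).
Proof.
have w2 : 0 <= w 2%:R by rewrite -vpow_val // -/(vint w) rpred_nat.
have val2 i (x : k) : x ^+ 2 \in vpow w (i + i) -> x \in vpow w i.
  have [->|x0] := eqVneq x 0; first by rewrite rpred0.
  by rewrite expr2 !vpow_val ?mulf_neq0 // place_valM //; clear; vlia.
have valM (x y : k) i : x != 0 -> x * y \in vpow w i -> y \in vpow w (i - w x).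
  move=> x0; have [->|y0] := eqVneq y 0; first by rewrite !rpred0.
  by rewrite !vpow_val ?mulf_neq0 // place_valM //; clear; vlia.
have valM' (x y : k) i : x != 0 -> y \in vpow w (i - w x) -> x * y \in vpow w i.
  move=> x0; have [->|y0] := eqVneq y 0; first by rewrite mulr0 !rpred0.
  by rewrite !vpow_val ?mulf_neq0 // place_valM //; clear; vlia.
exists (`|w 2%:R| + `|w D|)%N => j x; split=> [/oeP[tx nx]|hr hi].
  have hr : qre x \in vpow w (j - w 2%:R).
    by apply: valM => //; rewrite mulr_natl mulr2n.
  split; first by apply: vpow_le hr; move: w2; clear; vlia.
  apply: val2; have h : D * qim x ^+ 2 \in vpow w ((j - w 2%:R) + (j - w 2%:R)).
    rewrite (_ : D * _ = qre x ^+ 2 - qnorm x); last by rewrite /qnorm; ring.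
    apply: rpredB; first by rewrite expr2; exact: vpowM.
    by apply: vpow_le nx; move: w2; clear; vlia.
  by apply: vpow_le (valM _ _ _ D0 h); move: w2; clear; vlia.
apply/oeP; split.
  rewrite /qtr -mulr2n -mulr_natl; apply: valM' => //.
  by apply: vpow_le hr; move: w2; clear; vlia.
apply: rpredB; rewrite expr2.
  by apply: vpow_le (vpowM hr hr); clear; vlia.
by apply: valM' => //; apply: vpow_le (vpowM hi hi); clear; vlia.
Qed.

Lemma oe_bounded x : exists b : nat, x \in oe (- b%:Z).
Proof.
have [kp h] := oe_coord.
have B a : exists b : nat, a \in vpow w (- b%:Z).
  have [->|a0] := eqVneq a 0; first by exists 0%N; exact: rpred0.
  by exists `|w a|%N; rewrite vpow_val //; vlia.
have [b1 h1] := B (qre x); have [b2 h2] := B (qim x).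
exists (b1 + b2 + kp)%N; apply: (h _ _).2.
  by apply: vpow_le h1; vlia.
by apply: vpow_le h2; vlia.
Qed.

Lemma norm1_close1 j x : 0 <= j -> x - 1 \in oe j -> x \in oint.
Proof.
move=> j0 h; rewrite -[x](subrK 1) rpredD //; last exact: rpred1.
exact: oe_le h.
Qed.

Lemma close1M j x y : 0 <= j -> x - 1 \in oe j -> y - 1 \in oe j -> x * y - 1 \in oe j.
Proof.
move=> j0 hx hy; have -> : x * y - 1 = x * (y - 1) + (x - 1) by ring.
by rewrite rpredD // oeMl // (norm1_close1 j0 hx).
Qed.

Lemma close1V j x : x * qconj x = 1 -> x - 1 \in oe j -> x^-1 - 1 \in oe j.
Proof.
move=> e h; rewrite (qinv_norm1 e) -(rmorph1 (@qconj k D)) -rmorphB /=.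
by rewrite oe_conj.
Qed.

End QuadInt.
Arguments oe {k} w {D}.
Arguments oint {k} w {D}.

Section DetCongr.
Variables (R : comNzRingType) (O I : {pred R}).
Hypotheses (O1 : 1 \in O) (OM : forall x y, x \in O -> y \in O -> x * y \in O).
Hypotheses (I0 : 0 \in I) (IB : forall x y, x \in I -> y \in I -> x - y \in I).
Hypothesis (IM : forall x y, x \in O -> y \in I -> x * y \in I).

Lemma prod_congr (T : Type) (s : seq T) (f g : T -> R) :
  (forall i, f i \in O) -> (forall i, g i \in O) -> (forall i, f i - g i \in I) ->
  \prod_(i <- s) f i - \prod_(i <- s) g i \in I.
Proof.
move=> fO gO fg; elim: s => [|a s IH]; first by rewrite !big_nil subrr.
have gsO : \prod_(i <- s) g i \in O by elim/big_rec: _ => // i x _; exact: OM.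
rewrite !big_cons; have -> : f a * \prod_(j <- s) f j - g a * \prod_(j <- s) g j =
  f a * (\prod_(j <- s) f j - \prod_(j <- s) g j) - (\prod_(j <- s) g j) * (0 - (f a - g a)) by ring.
by apply: IB; apply: IM => //; exact: IB.
Qed.

(** Stated for abstract predicates, to be used both for [vpow] inside [vint] and for [oe] inside
    [oint]. *)
Lemma det_congr m (M N : 'M[R]_m) :
  (forall i j, M i j \in O) -> (forall i j, N i j \in O) ->
  (forall i j, M i j - N i j \in I) -> \det M - \det N \in I.
Proof.
move=> MO NO MN; rewrite /determinant -sumrB.
have ID x y : x \in I -> y \in I -> x + y \in I.
  by move=> hx hy; rewrite -[y]opprK -[- y]sub0r; apply: IB => //; exact: IB.
elim/big_rec: _ => // s x _ xI; apply: ID => //.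
have h : \prod_i M i (perm.fun_of_perm.body s i) - \prod_i N i (perm.fun_of_perm.body s i) \in I.
  by apply: prod_congr => i; [exact: MO|exact: NO|exact: MN].
rewrite -mulrBr; case: (perm.odd_perm s); rewrite ?expr0 ?expr1 ?mul1r //.
by rewrite mulN1r -[X in X \in I]sub0r; exact: IB.
Qed.
End DetCongr.

Section QuadMap.
Variables (K L : fieldType) (phi : {rmorphism K -> L}) (D : K).
Lemma qmap_is_additive : zmod_morphism (@qmap K L phi D).
Proof. by move=> x y; apply: quadE; rewrite /= ?rmorphB. Qed.
Lemma qmap_is_monoid : monoid_morphism (@qmap K L phi D).
Proof.
by split=> [|x y]; apply: quadE; rewrite /= ?rmorph1 ?rmorph0 // ?rmorphD !rmorphM.
Qed.
HB.instance Definition _ := GRing.isZmodMorphism.Build (quad D) (quad (phi D)) (@qmap K L phi D) qmap_is_additive.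
HB.instance Definition _ := GRing.isMonoidMorphism.Build (quad D) (quad (phi D)) (@qmap K L phi D) qmap_is_monoid.

Lemma qmap_conj x : @qmap K L phi D (qconj x) = qconj (qmap phi x).
Proof. by apply: quadE; rewrite /= ?rmorphN. Qed.
Lemma qmap_qin a : @qmap K L phi D (qin D a) = qin (phi D) (phi a).
Proof. by apply: quadE; rewrite /= ?rmorph0. Qed.
End QuadMap.

(** * Places and completions *)

Lemma fieldExt_char0 (F : fieldExtType rat) m : m.+1%:R != 0 :> F.
Proof.
by rewrite -(rmorph_nat (in_alg F)) fmorph_eq0 pnatr_eq0.
Qed.

Section AdelicLocal.
Variables (F : fieldExtType rat) (D : F) (Fw : completions F).
Hypothesis D0 : D != 0.
Variable w : place F.
Local Notation k := (Fw w).
Local Notation Dw := (comp_inj (Fw w) D).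
Local Notation vw := (comp_val (Fw w)).
Local Notation Ek := (quad Dw).
Implicit Types x y t : Ek.

Lemma Fw_char0 m : m.+1%:R != 0 :> k.
Proof. by rewrite -(rmorph_nat (comp_inj (Fw w))) fmorph_eq0 fieldExt_char0. Qed.
Lemma Dw0 : Dw != 0. Proof. by rewrite fmorph_eq0. Qed.
Lemma vgeP j (a : k) : vge vw j a <-> a \in vpow vw j.
Proof. by split=> /vpowP. Qed.

Lemma OEP x : OE x <-> x \in oint vw.
Proof. by split=> [[/vgeP a /vgeP b]|/oeP[/vgeP a /vgeP b]] //; apply/oeP. Qed.

Lemma OEgeP c x : OEge c x <-> x \in oe vw c%:Z.
Proof.
split=> [[a [y [/vgeP ha /OEP hy ->]]]|hx].
  by have := oeM (oe_qin Dw ha) hy; rewrite addr0.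
have [p p0 p1] := place_unif vw.
exists (p ^ c%:Z), (qin Dw (p ^ (- c%:Z)) * x); split.
- by apply/vgeP; exact: vpow_pi.
- by apply/OEP; have := oeM (oe_qin Dw (vpow_pi p1 (- c%:Z))) hx; rewrite addNr.
- by rewrite mulrA -rmorphM -expfzDr // subrr expr0z rmorph1 mul1r.
Qed.

Lemma EorderP c x : Eorder c x <-> exists2 b, b \in vint vw & x - qin Dw b \in oe vw c%:Z.
Proof.
split=> [[b [y [/vgeP hb /OEgeP hy ->]]]|[b hb hx]].
  by exists b => //; rewrite addrC addKr.
exists b, (x - qin Dw b); split; [exact/vgeP|exact/OEgeP|by rewrite addrC subrK].
Qed.

Lemma Eorder_int c x : Eorder c x -> x \in oint vw.
Proof.
move=> /EorderP[b hb hx]; rewrite -[x](subrK (qin Dw b)) rpredD //.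
  exact: oe_le hx.
exact: oe_qin.
Qed.

Lemma EorderM c x y : Eorder c x -> Eorder c y -> Eorder c (x * y).
Proof.
move=> hx hy; have xi := Eorder_int hx.
move: hx hy => /EorderP[b hb hx] /EorderP[d hd hy]; apply/EorderP.
exists (b * d); first exact: rpredM.
rewrite rmorphM; have -> : x * y - qin Dw b * qin Dw d =
  x * (y - qin Dw d) + qin Dw d * (x - qin Dw b) by ring.
rewrite rpredD //; first exact: oeMl.
by apply: oeMl => //; exact: oe_qin.
Qed.

Lemma Eorder_unitM c x y : Eorder_unit c x -> Eorder_unit c y -> Eorder_unit c (x * y).
Proof.
move=> [ux ox oxV] [uy oy oyV]; split; [by rewrite unitrM ux|exact: EorderM|].
by rewrite invrM // ; exact: EorderM.
Qed.

Lemma Eorder_unitV c x : Eorder_unit c x -> Eorder_unit c x^-1.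
Proof. by move=> [ux ox oxV]; split; rewrite ?unitrV ?invrK. Qed.

Lemma Eorder1 c : Eorder c (1 : Ek).
Proof.
apply/EorderP; exists 1; first exact: vint1.
by rewrite rmorph1 subrr rpred0.
Qed.

Lemma Eorder_le c c' x : (c <= c')%N -> Eorder c' x -> Eorder c x.
Proof.
move=> cc /EorderP[b hb hx]; apply/EorderP; exists b => //; apply: oe_le hx; lia.
Qed.

Lemma Eorder_unit_OEunit c x : Eorder_unit c x -> OEunit x.
Proof. by move=> [ux /Eorder_int/OEP a /Eorder_int/OEP b]. Qed.

Lemma U1_norm1 c t : U1 c t -> t * qconj t = 1.
Proof.
move=> [a [ua _ _] ->]; rewrite rmorphM rmorphV ?qconj_unit //=.
by rewrite qconjK mulrA mulrVK ?qconj_unit // divrr.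
Qed.

Lemma U1_int c t : U1 c t -> t \in oint vw.
Proof.
move=> [a [ua /Eorder_int oa /Eorder_int oaV] ->].
apply: rpredM => //; rewrite -(qconjV ua); by rewrite oe_conj.
Qed.

Lemma U1_le c c' t : (c <= c')%N -> U1 c' t -> U1 c t.
Proof. by move=> cc [a [ua oa oaV] ->]; exists a => //; split=> //; exact: (Eorder_le cc). Qed.

Lemma U1_1 c : U1 c (1 : Ek).
Proof.
exists 1; last by rewrite rmorph1 invr1 mulr1.
by split; rewrite ?unitr1 ?invr1 //; exact: Eorder1.
Qed.

Lemma U1M c s t : U1 c s -> U1 c t -> U1 c (s * t : Ek).
Proof.
move=> [a ha ->] [b hb ->]; exists (a * b); first exact: Eorder_unitM.
have [ua _ _] := ha; have [ub _ _] := hb.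
by rewrite rmorphM invrM ?qconj_unit //= [_^-1 * _^-1]mulrC mulrACA.
Qed.

Lemma U1V c t : U1 c t -> U1 c (t^-1 : Ek).
Proof.
move=> [a ha ->]; have [ua _ _] := ha; exists a^-1; first exact: Eorder_unitV.
by rewrite invrM ?unitrV ?qconj_unit // invrK (qconjV ua) invrK mulrC.
Qed.

Definition depth2 : nat := `|vw 2%:R|%N.+1.

(** Hilbert 90 with x = (1 + t) / 2, which satisfies t xbar = x. The extra depth [depth2] pays for
    the denominator 2, at places above 2 as well, and leaves x congruent to 1 modulo the
    conductor. *)
Lemma U1_close c t : t * qconj t = 1 -> t - 1 \in oe vw (c + depth2)%N%:Z -> U1 c t.
Proof.
move=> nt ht; have two0 := Fw_char0 1.
pose x : Ek := qin Dw 2%:R^-1 * (1 + t).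
have x1 : x - 1 = qin Dw 2%:R^-1 * (t - 1).
  have hh : qin Dw 2%:R^-1 + qin Dw 2%:R^-1 = 1.
    have e2 : 2%:R^-1 + 2%:R^-1 = 1 :> k by field.
    by rewrite -rmorphD /= e2 rmorph1.
  by rewrite /x -[X in _ - X]hh; ring.
have hx : x - 1 \in oe vw c.+1%:Z.
  have h2 : 2%:R^-1 \in vpow vw (- vw 2%:R) by rewrite vpow_val ?invr_eq0 // placeV.
  rewrite x1; have := oeM (oe_qin Dw h2) ht; apply: oe_le; rewrite /depth2; vlia.
have xt : t * qconj x = x.
  rewrite /x rmorphM /= qconj_qin rmorphD rmorph1 /= mulrCA mulrDr mulr1 nt.
  by rewrite [t + 1]addrC.
have nx : qnorm x - 1 \in vpow vw c.+1%:Z.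
  rewrite qnorm_sub1; have [a b] := oeP _ _ _ hx; rewrite rpredD //; apply: vpow_le b; lia.
have nu : vunt vw (qnorm x).
  rewrite -[qnorm x](subrK 1) addrC; apply: vunt_add; first exact: vunt1.
  by apply: vpow_le nx; lia.
have ux : x \is a GRing.unit by rewrite qunitE (vunt_neq0 nu).
have oc y : y - 1 \in oe vw c.+1%:Z -> Eorder c y.
  move=> h; apply/EorderP; exists 1; first exact: vint1.
  by rewrite rmorph1; apply: oe_le h; lia.
have xV : x^-1 = qin Dw (qnorm x)^-1 * qconj x.
  apply: (mulrI ux); rewrite divrr // mulrCA qmul_conj -rmorphM mulVf ?rmorph1 //.
exists x; last by rewrite -{1}xt mulrK // qconj_unit.
split=> //; first exact: oc.
rewrite xV; apply: EorderM; last by apply: oc; rewrite -(rmorph1 (@qconj _ Dw)) -rmorphB oe_conj.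
apply/EorderP; exists (qnorm x)^-1; last by rewrite subrr rpred0.
by apply: vunt_int; exact: vuntV.
Qed.

End AdelicLocal.

HB.instance Definition _ (K : comNzRingType) := gen_choiceMixin (place K).

(** * Finiteness of the set of places above given primes *)

Section FinitePlaces.
Variable F : fieldExtType rat.
Implicit Types w : place F.

Lemma place_eq w w' : (forall x, w x = w' x) -> w = w'.
Proof.
case: w w' => [f f0 fM fD fU] [g g0 gM gD gU] /= /funext fg; subst g.
by congr Place; exact: Prop_irrelevance.
Qed.

(** Units of w are units of w', so w' is w times the value of w' at a uniformizer p of w; since w'
    takes the value 1 and w' p >= 0, that value is 1. *)
Lemma place_incl w w' : (forall x, x != 0 -> 0 <= w x -> 0 <= w' x) -> w = w'.
Proof.
move=> h; have [p p0 p1] := place_unif w.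
have unit0 x : x != 0 -> w x = 0 -> w' x = 0.
  move=> x0 wx; have h1 : 0 <= w' x by apply: h; rewrite ?wx.
  have h2 : 0 <= w' x^-1 by apply: h; rewrite ?invr_eq0 // placeV wx.
  by rewrite placeV in h2; move: h1 h2; clear; vlia.
have e x : x != 0 -> w' x = w x * w' p.
  move=> x0; have y0 : x * p ^ (- w x) != 0 by rewrite mulf_neq0 // expfz_neq0.
  have := unit0 _ y0; rewrite !place_valM ?expfz_neq0 // !placeXz // p1.
  move=> /(_ _); rewrite mul1r subrr => /(_ erefl); rewrite mulrN mulrC => /eqP.
  by rewrite subr_eq0 => /eqP.
have p'0 : 0 <= w' p by apply: h; rewrite ?p1.
have [p' p'nz p'1] := place_unif w'.
have p'p : w' p = 1.
  have := e p' p'nz; rewrite p'1 => /esym; move: p'0; case: (w' p) => // m _.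
  case: (w p') => i.
    move=> im; have : (i * m)%N = 1%N by move: im; clear; lia.
    by move/eqP; rewrite muln_eq1 => /andP[_ /eqP ->].
  by move=> /eqP; nia.
apply: place_eq => x; have [->|x0] := eqVneq x 0; first by rewrite !place_val0.
by rewrite e // p'p mulr1.
Qed.

Lemma place_separate w w' : w <> w' -> exists2 z, z != 0 & w z < 0 /\ 0 < w' z.
Proof.
move=> ne.
have sep (u u' : place F) : u <> u' -> exists2 x, x != 0 & 0 <= u x /\ u' x < 0.
  move=> uu; apply: contrapT => no; apply: uu; apply: place_incl => x x0 ux.
  by rewrite leNgt; apply/negP => lt; apply: no; exists x.
have [x x0 [x1 x2]] := sep _ _ ne; have [y y0 [y1 y2]] := sep _ _ (nesym ne).
exists (y / x); first by rewrite mulf_neq0 ?invr_eq0.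
by rewrite !place_valM ?invr_eq0 // !placeV; move: x1 x2 y1 y2; clear; vlia.
Qed.

Lemma place_addl w x y : x != 0 -> y != 0 -> w x < w y -> x + y != 0 /\ w (x + y) = w x.
Proof.
move=> x0 y0 xy.
have nz : x + y != 0.
  by apply: contraTneq xy => /eqP; rewrite addr_eq0 => /eqP ->; rewrite placeN ltxx.
split=> //; apply/eqP; rewrite eq_le; apply/andP; split.
  have := @place_valD _ w (x + y) (- y) nz; rewrite oppr_eq0 addrK => /(_ y0 x0).
  by rewrite placeN; move: xy; clear; vlia.
by have := @place_valD _ w x y x0 y0 nz; move: xy; clear; vlia.
Qed.

Lemma place_expn w x m : x != 0 -> w (x ^+ m) = w x *+ m.
Proof.
move=> x0; elim: m => [|m IH]; first by rewrite expr0 place1 mulr0n.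
by rewrite exprS place_valM ?expf_neq0 // IH mulrS.
Qed.

Lemma int_mulrn_ge (a : int) (m m' : nat) : 0 < a -> (m <= m')%N -> a *+ m <= a *+ m'.
Proof. by move=> a0 mm; rewrite -(subnK mm) mulrnDr lerDr mulrn_wge0 // ltW. Qed.

Lemma int_mulrn_gt (a : int) (m : nat) : 0 < a -> m%:Z <= a *+ m.
Proof.
move=> a0; elim: m => [|m IH]; first by rewrite mulr0n.
by rewrite mulrS; move: a0 IH; clear; lia.
Qed.

(** Induction on the list: z is the element for the old list, and y separates w from the new place
    u. For large N the element is z, z^N y or y z^N / (1 + z^N), according to whether u z is
    positive, zero or negative. *)
Lemma place_approx w (s : seq (place F)) : w \notin s ->
  exists2 z, z != 0 & w z < 0 /\ forall w', w' \in s -> 0 < w' z.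
Proof.
elim: s => [|u s IH].
  move=> _; have [p p0 p1] := place_unif w; exists p^-1; rewrite ?invr_eq0 //.
  by split=> //; rewrite placeV p1.
rewrite inE negb_or => /andP[/eqP wu /IH[z z0 [wz sz]]].
have [y y0 [wy uy]] := place_separate wu.
have big (N0 : nat) : exists N : nat, forall w', w' \in s -> 0 < w' z *+ N + w' y.
  elim: s {IH} sz => [|u' s IH'] sz; first by exists 0%N.
  have [w'|N hN] := IH'; first by move=> h; apply: sz; rewrite inE h orbT.
  exists (N + `|u' y| + 1)%N => w'; rewrite inE => /orP[/eqP ->|w's].
    have := int_mulrn_gt (N + `|u' y| + 1) (sz u' (mem_head _ _)).
    by clear; vlia.
  have s0 : 0 < w' z by apply: sz; rewrite inE w's orbT.
  have le : (N <= N + `|u' y| + 1)%N by rewrite -addnA leq_addr.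
  by have := hN _ w's; have := int_mulrn_ge s0 le; clear; vlia.
have [N hN] := big 0%N.
have zN0 : z ^+ N.+1 != 0 by rewrite expf_neq0.
have wzN (u' : place F) : u' (z ^+ N.+1) = u' z *+ N.+1.
  exact: place_expn.
have hN' w' : w' \in s -> 0 < w' z *+ N.+1 + w' y.
  by move=> w's; have := hN _ w's; have := sz _ w's; rewrite mulrS; clear; vlia.
have [uz|uz|uz] := ltgtP (u z) 0.
- have n1 : (1 : F) != 0 := oner_neq0 F.
  have inv1 (u' : place F) : u' z < 0 -> 1 + z ^+ N.+1 != 0 /\ u' (1 + z ^+ N.+1) = u' z *+ N.+1.
    move=> h; rewrite addrC -wzN; apply: place_addl => //.
    by rewrite wzN place1 pmulrn_llt0.
  have [nz wv] := inv1 w wz; have [_ uv] := inv1 u uz.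
  exists (z ^+ N.+1 / (1 + z ^+ N.+1) * y); first by rewrite !mulf_neq0 ?invr_eq0.
  have val (u' : place F) : u' (z ^+ N.+1 / (1 + z ^+ N.+1) * y) = u' z *+ N.+1 - u' (1 + z ^+ N.+1) + u' y.
    by rewrite !place_valM ?mulf_neq0 ?invr_eq0 // placeV wzN.
  split; first by rewrite val wv subrr add0r.
  move=> w'; rewrite inE => /orP[/eqP ->|w's]; first by rewrite val uv subrr add0r.
  have sv : w' (1 + z ^+ N.+1) = 0.
    have lt : w' 1 < w' (z ^+ N.+1) by rewrite place1 wzN pmulrn_lgt0 // sz.
    by have [_ ->] := place_addl n1 zN0 lt; rewrite place1.
  by rewrite val sv subr0 hN'.
- exists z => //; split=> // w'; rewrite inE => /orP[/eqP ->|] //; exact: sz.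
- exists (z ^+ N.+1 * y); first by rewrite mulf_neq0.
  have val (u' : place F) : u' (z ^+ N.+1 * y) = u' z *+ N.+1 + u' y by rewrite place_valM // wzN.
  split; first by rewrite val; have := wy; have : w z *+ N.+1 < 0 by [rewrite pmulrn_llt0]; clear; vlia.
  move=> w'; rewrite inE => /orP[/eqP ->|w's]; last by rewrite val hN'.
  by rewrite val uz mul0rn add0r.
Qed.

Lemma place_int w (z : int) : z%:~R != 0 :> F -> 0 <= w z%:~R.
Proof.
have nat m : m%:R != 0 :> F -> 0 <= w m%:R.
  by move=> h; rewrite -vpow_val // -/(vint w) rpred_nat.
case: (intP z) => [|m|m]; rewrite ?rmorph0 ?eqxx // ?rmorphN /= ?oppr_eq0 ?placeN; exact: nat.
Qed.

Lemma place_coprime w (t : nat) (z : int) : 0 < w t%:R -> coprimez t z -> w z%:~R = 0.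
Proof.
move=> wt cop; have [[a b] /= e] := coprimezP _ _ cop.
have t0 : t%:R != 0 :> F by apply: contraTneq wt => ->; rewrite place_val0.
have z0 : z%:~R != 0 :> F.
  apply: contraTneq wt => z0; have : 0 < w (a%:~R * t%:R) -> False.
    have : (a * t%:Z + b * z)%:~R = 1 :> F by rewrite e.
    by rewrite rmorphD !rmorphM /= z0 mulr0 addr0 => ->; rewrite place1.
  move=> h; apply/negP => wt; apply: h.
  have a0 : a%:~R != 0 :> F.
    apply/eqP => a0; have : (a * t%:Z + b * z)%:~R = 1 :> F by rewrite e.
    by rewrite rmorphD !rmorphM /= a0 z0 mul0r mulr0 addr0 => /eqP; rewrite eq_sym oner_eq0.
  by rewrite place_valM //; have := place_int w a0; move: wt; clear; vlia.
apply/eqP; rewrite eq_le place_int // andbT leNgt; apply/negP => wz.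
have bad : (1 : F) \in vpow w 1.
  have <- : (a * t%:Z + b * z)%:~R = 1 :> F by rewrite e.
  rewrite rmorphD !rmorphM /= rpredD //; apply: vpowMl; rewrite ?rpred_int //.
    by rewrite vpow_val //; lia.
  by rewrite vpow_val //; lia.
by move: bad; rewrite vpow_val ?oner_neq0 // place1.
Qed.

(** The t-adic valuation of a nonzero rational number. *)
Definition tval (t : nat) (c : rat) : int := (logn t `|numq c|)%:Z - (logn t `|denq c|)%:Z.

Lemma place_rat w t (c : rat) : prime t -> 0 < w t%:R -> c != 0 ->
  w c%:A = tval t c * w t%:R.
Proof.
move=> pt wt c0.
have t0 : t%:R != 0 :> F by have := fieldExt_char0 F t.-1; rewrite prednK ?prime_gt0.
have int0 z : z != 0 -> z%:~R != 0 :> F.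
  move=> z0; case: (intP z) z0 => // m _; rewrite ?rmorphN ?oppr_eq0; exact: fieldExt_char0.
have H z : z != 0 -> w z%:~R = (logn t `|z|)%:Z * w t%:R.
  move=> z0; have zp : (0 < `|z|)%N by rewrite absz_gt0.
  have [m cop e] := pfactor_coprime pt zp.
  have m0 : m%:R != 0 :> F.
    have : (m%:Z)%:~R != 0 :> F by apply: int0; move: z0; rewrite -absz_eq0 e; case: (m).
    by [].
  have zE : w z%:~R = w (`|z|%N%:R).
    case: (intP z) => //= p; by rewrite rmorphN /= placeN.
  rewrite zE {1}e natrM natrX place_valM ?expf_neq0 // place_expn //.
  have -> : w m%:R = 0 by apply: (@place_coprime w t m%:Z).
  rewrite add0r; move: (w t%:R) (logn t _) => a j; clear.
  by elim: j => [|j IH]; rewrite ?mulr0n ?mulrS ?IH; lia.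
have cE : c%:A = (numq c)%:~R / (denq c)%:~R :> F.
  rewrite -{1}(divq_num_den c); rewrite -[_%:A]/(in_alg F _) fmorph_div.
  by rewrite !rmorph_int.
rewrite cE place_valM ?invr_eq0 ?int0 ?denq_neq0 ?numq_eq0 // placeV !H ?denq_neq0 ?numq_eq0 //.
by rewrite /tval mulrBl.
Qed.

(** Elements z_w that are negative at w and positive at the other places of s are linearly
    independent over Q. In a relation take the coefficient of least t-adic valuation: at its place
    every other term has strictly larger valuation than this one. *)
Lemma places_above_bound (t : nat) (s : seq (place F)) : prime t -> uniq s ->
  (forall w, w \in s -> 0 < w t%:R) -> (size s <= \dim {: F})%N.
Proof.
move=> pt us st; rewrite leqNgt; apply/negP => big.
have /choice[z zP] : forall w, exists z, w \in s ->
    [/\ z != 0, w z < 0 & forall w', w' \in s -> w' != w -> 0 < w' z].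
  move=> w; have [ws|ws] := boolP (w \in s); last by exists 0.
  have [|z z0 [wz sz]] := @place_approx w (rem w s).
    by rewrite mem_rem_uniq // inE eqxx.
  exists z => _; split=> // w' w's w'w; apply: sz; by rewrite mem_rem_uniq // inE w'w.
pose X := [seq z w | w <- s].
have nfree : ~~ free X.
  apply: contraL big => fX; rewrite -leqNgt -(size_map z) -/X.
  by rewrite -(eqP fX) dimvS // subvf.
have [cf [i0 ci0 e]] : exists cf : 'I_(size X) -> rat, exists2 i0, cf i0 != 0 & \sum_i cf i *: X`_i = 0.
  have nf : ~ (forall cf : 'I_(size X) -> rat, \sum_i cf i *: X`_i = 0 -> forall i, cf i = 0).
    by move=> h; case/negP: nfree; apply/(@freeP _ _ _ (in_tuple X)).
  apply: contrapT => no; apply: nf => cf e i; apply/eqP; apply: contrapT => ci.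
  by apply: no; exists cf, i => //; apply/negP.
have sX : size X = size s by rewrite size_map.
pose sup := [seq i <- enum 'I_(size X) | cf i != 0].
have [|i1] := @seq_min_int _ sup (fun i => tval t (cf i)).
  apply/eqP => sup0; have : i0 \in sup by rewrite mem_filter ci0 mem_enum.
  by rewrite sup0.
rewrite mem_filter => /andP[ci1 _] imin.
have inX (i : 'I_(size X)) : (i < size s)%N by rewrite -sX.
have ex_w0 : exists w0 : place F, True by case: s big {st us zP X nfree cf i0 ci0 e sX sup i1 ci1 imin inX} => // w0 s _; exists w0.
case: ex_w0 => w0 _; pose wi (i : 'I_(size X)) := nth w0 s i.
have wis i : wi i \in s by rewrite mem_nth.
have XE (i : 'I_(size X)) : X`_i = z (wi i) by rewrite (nth_map w0).
have wiinj i j : wi i = wi j -> i = j.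
  by move/eqP; rewrite nth_uniq // => /eqP/val_inj.
have [w ew] : exists w, w = wi i1 by exists (wi i1).
have wt := st _ (wis i1); have [zw0 wz zo] := zP _ (wis i1); rewrite -ew in wt wz zw0.
have A0 c : c != 0 -> c%:A != 0 :> F by move=> c0; rewrite -[_%:A]/(in_alg F _) fmorph_eq0.
have bad : cf i1 *: X`_i1 \in vpow w (tval t (cf i1) * w t%:R).
  have -> : cf i1 *: X`_i1 = - \sum_(i | i != i1) cf i *: X`_i.
    by apply/eqP; rewrite -addr_eq0 -[_ + _]/(cf i1 *: X`_i1 + _) -(bigD1 i1 (P := xpredT)) //= e.
  rewrite rpredN; apply: rpred_sum => i ii1.
  have [->|ci] := eqVneq (cf i) 0; first by rewrite scale0r rpred0.
  have [zi0 _ zi] := zP _ (wis i); rewrite XE -mulr_algl vpow_val ?mulf_neq0 ?A0 //.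
  rewrite place_valM ?A0 // (place_rat pt wt ci).
  have h1 : tval t (cf i1) <= tval t (cf i) by apply: imin; rewrite mem_filter ci mem_enum.
  have h2 : 0 < w (z (wi i)).
    by apply: zi; rewrite ew; [exact: wis|apply: contra ii1 => /eqP/wiinj ->].
  by apply: (le_trans (ler_wpM2r (ltW wt) h1)); rewrite lerDl ltW.
move: bad; rewrite XE -ew -mulr_algl vpow_val ?mulf_neq0 ?A0 // place_valM ?A0 //.
by rewrite (place_rat pt wt ci1) lerDl leNgt wz.
Qed.

Lemma finite_places_above (S1 : seq nat) : (forall t, t \in S1 -> prime t) ->
  finite_set [set w : place F | Sabove S1 w].
Proof.
move=> pS; have one t : prime t -> finite_set [set w : place F | 0 < w t%:R].
  move=> pt; apply: contrapT => inf.
  have [A sA cA] := infinite_set_fset (\dim {: F}).+1 inf.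
  have := @places_above_bound t (enum_fset A) pt (fset_uniq A).
  move=> /(_ (fun w wA => sA w wA)); rewrite leqNgt => /negP; apply.
  exact: cA.
have -> : [set w : place F | Sabove S1 w] = \bigcup_(t in [set` S1]) [set w : place F | 0 < w t%:R].
  by apply/seteqP; split=> w [t tS wt]; exists t.
by apply: bigcup_finite => // t /= tS; apply: one; exact: pS.
Qed.

End FinitePlaces.

(** * Determinants on compact subgroups *)

Lemma mulmx1C_cast (R : comUnitRingType) m m' (e : m = m') (A : 'M[R]_(m, m')) (B : 'M[R]_(m', m)) :
  A *m B = 1%:M -> B *m A = 1%:M.
Proof. by subst m'; exact: mulmx1C. Qed.

Section RightInverse.
Variables (F : fieldType) (D : F) (n : nat) (Phi : 'M[F]_n.*2.+1).
Hypotheses (Phi_sym : Phi^T = Phi) (Phi_unit : Phi \in unitmx).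
Variable W : hermitian_hyperplane D Phi.
Local Notation E := (quad D).
Local Notation qx := (qinmx D).
Let c := coordW W.
Let p := perp W.
Let b := bil Phi p p.

Lemma qinmxM m r t (A : 'M[F]_(m, r)) (B : 'M[F]_(r, t)) : qx (A *m B) = qx A *m qx B.
Proof. exact: map_mxM. Qed.

(** Both arguments are projected along [perp] onto W, where the form is the trace of the hermitian
    one; the correction is the last, rank one, term. *)
Lemma form_decomposition :
  qx Phi = (conjmx c)^T *m Psi W *m c + conjmx ((conjmx c)^T *m Psi W *m c)
    + qin D b^-1 *: (qx (Phi *m p) *m qx (p^T *m Phi)).
Proof.
have b0 : b != 0 := perp_aniso W.
have key (x y : 'cV[F]_n.*2.+1) : bil Phi x y = qtr (herm (Psi W) (c *m qx x) (c *m qx y))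
    + b^-1 * (bil Phi x p * bil Phi p y).
  have bl a u u' v : bil Phi (u - a *: u') v = bil Phi u v - a * bil Phi u' v.
    by rewrite /bil linearB linearZ /= !mulmxBl -!scalemxAl !mxE.
  have br a u u' v : bil Phi v (u - a *: u') = bil Phi v u - a * bil Phi v u'.
    by rewrite /bil mulmxBr -scalemxAr !mxE.
  have sym u v : bil Phi u v = bil Phi v u.
    have e : u^T *m Phi *m v = (v^T *m Phi *m u)^T by rewrite !trmx_mul trmxK Phi_sym mulmxA.
    by rewrite /bil e mxE.
  pose pr u := u - (bil Phi u p / b) *: p.
  have prp u : bil Phi (pr u) p = 0 by rewrite bl -/b divfK // subrr.
  have cpr u : c *m qx (pr u) = c *m qx u.
    rewrite /pr /qinmx map_mxB map_mxZ mulmxBr -scalemxAr (coordW_perp W).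
    by rewrite scaler0 subr0.
  have := hcompat (prp x) (prp y); rewrite -/c !cpr => <-.
  rewrite /pr !br !bl -/b [bil Phi y p]sym; field.
  exact: b0.
apply/matrixP => i j; have := key (delta_mx i 0) (delta_mx j 0).
have d1 (M : 'M[F]_n.*2.+1) : bil M (delta_mx i 0) (delta_mx j 0) = M i j.
  by rewrite /bil trmx_delta -rowE -colE !mxE.
have qd u : qx (delta_mx u 0 : 'cV_ _) = delta_mx u 0.
  by apply/matrixP => r s; rewrite !mxE; case: (_ && _); rewrite ?rmorph1 ?rmorph0.
rewrite d1 !qd => e.
have hE : herm (Psi W) (c *m delta_mx i 0) (c *m delta_mx j 0) = ((conjmx c)^T *m Psi W *m c) i j.
  rewrite /herm /conjmx map_mxM -/(conjmx c) trmx_mul.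
  have -> : (map_mx (@qconj F D) (delta_mx i 0 : 'cV_n.*2.+1))^T = delta_mx 0 i.
    by apply/matrixP => r s; rewrite !mxE andbC; case: (_ && _); rewrite ?rmorph1 ?rmorph0.
  set A := (conjmx c)^T.
  have -> : delta_mx 0 i *m A *m Psi W *m (c *m delta_mx j 0) =
    (delta_mx 0 i : 'rV_ _) *m (A *m Psi W *m c) *m (delta_mx j 0 : 'cV_ _) by rewrite !mulmxA.
  by rewrite -rowE -colE !mxE.
move: ((conjmx c)^T *m Psi W *m c) hE => M hE.
rewrite !mxE e hE rmorphD rmorphM; congr (_ + _ * _).
  by apply: quadE; rewrite /= ?subrr.
rewrite big_ord1 !mxE rmorphM; congr (qin D _ * qin D _).
  by rewrite /bil trmx_delta -mulmxA -rowE !mxE.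
by rewrite /bil -colE !mxE.
Qed.

(** Over E the space V splits into W, its conjugate and the line of [perp]. The matrix S stacking
    the three coordinate maps is square, and [form_decomposition] exhibits a left inverse T of it;
    the first block column of T is the required inverse. *)
Lemma coordW_right_inverse : exists Rm : 'M[E]_(n.*2.+1, n), c *m Rm = 1%:M.
Proof.
pose Q := qx (invmx Phi).
pose T1 := Q *m (conjmx c)^T *m Psi W.
pose T2 := Q *m conjmx ((conjmx c)^T *m Psi W).
pose T3 : 'cV[E]_n.*2.+1 := qin D b^-1 *: qx p.
pose T := row_mx (row_mx T1 T2) T3.
pose S := col_mx (col_mx c (conjmx c)) (qx (p^T *m Phi)).
have TS : T *m S = 1%:M.
  rewrite /T /S !mul_row_col.
  have <- : Q *m qx Phi = 1%:M by rewrite -qinmxM mulVmx // /qinmx map_mx1.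
  rewrite form_decomposition !mulmxDr -scalemxAr -scalemxAl; congr (_ + _ + _ *: _).
  - by rewrite /T1 !mulmxA.
  - by rewrite /T2 -mulmxA; congr (_ *m _); rewrite -map_mxM.
  - have e3 : Q *m qx (Phi *m p) = qx p by rewrite /Q -qinmxM mulmxA mulVmx // mul1mx.
    by rewrite [RHS]mulmxA e3.
have e : n.*2.+1 = (n + n + 1)%N by rewrite addn1 addnn.
have ST := mulmx1C_cast e TS.
exists T1; have -> : c = row_mx (row_mx 1%:M 0) 0 *m S.
  by rewrite /S !mul_row_col mul1mx !mul0mx !addr0.
have -> : T1 = T *m col_mx (col_mx 1%:M 0) 0.
  by rewrite /T !mul_row_col mulmx1 !mulmx0 !addr0.
rewrite -mulmxA [S *m _]mulmxA ST mul1mx !mul_row_col mulmx1 !mulmx0 !addr0.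
by rewrite ?mul1mx ?mulmx1.
Qed.

Lemma coordL_right_inverse (L : fieldType) (phi : {rmorphism F -> L}) :
  exists Rm : 'M[quad (phi D)]_(n.*2.+1, n), coordL W phi *m Rm = 1%:M.
Proof.
have [Rm e] := coordW_right_inverse.
exists (map_mx (@qmap F L phi D) Rm).
by rewrite /coordL -map_mxM /= e map_mx1.
Qed.

End RightInverse.

Lemma mx_oe_bounded (k : fieldType) (w : place k) (D : k) (D0 : D != 0)
   (two0 : 2%:R != 0 :> k) r t (M : 'M[quad D]_(r, t)) :
  exists b : nat, forall i j, M i j \in oe w (- b%:Z).
Proof.
have /choice[f fP] : forall p : 'I_r * 'I_t, exists b : nat, M p.1 p.2 \in oe w (- b%:Z).
  by move=> p; exact: oe_bounded.
exists (\max_p f p) => i j; apply: oe_le (fP (i, j)).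
by have := leq_bigmax (F := f) (i, j); lia.
Qed.

Lemma conjmxK (R : comUnitRingType) m (G X : 'M[R]_m) : G \in unitmx ->
  G *m (invmx G *m X *m G) *m invmx G = X.
Proof. by move=> uG; rewrite -!mulmxA mulKVmx // mulmxV // mulmx1. Qed.

Section Compact.
Variables (F : fieldExtType rat) (D : F) (Fw : completions F).
Hypothesis D0 : D != 0.
Variables (n : nat) (Phi : 'M[F]_n.*2.+1).
Hypotheses (Phi_sym : Phi^T = Phi) (Phi_unit : Phi \in unitmx).
Variable W : hermitian_hyperplane D Phi.
Local Notation vw w := (comp_val (Fw w)).
Local Notation cj w := (comp_inj (Fw w)).

(** One has h - 1 = L1 (y - 1) R1 with matrices L1 and R1 that depend on g only; the bounds b1 and
    b2 on their denominators are the loss of depth. *)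
Lemma det_close w (g : 'M[Fw w]_n.*2.+1) (N0 : nat) : exists N : nat, forall y h,
  mxge N (y - 1%:M) -> g \in unitmx ->
  coordL W (cj w) *m qinmx (cj w D) (g *m y *m invmx g) = h *m coordL W (cj w) ->
  \det h - 1 \in oe (vw w) N0%:Z.
Proof.
have [Rm cR] := coordL_right_inverse Phi_sym Phi_unit W (cj w).
pose L1 := coordL W (cj w) *m qinmx (cj w D) g.
pose R1 := qinmx (cj w D) (invmx g) *m Rm.
have Dk : cj w D != 0 by exact: Dw0.
have two0 : 2%:R != 0 :> Fw w by exact: Fw_char0.
have [b1 B1] := mx_oe_bounded (vw w) Dk two0 L1.
have [b2 B2] := mx_oe_bounded (vw w) Dk two0 R1.
exists (N0 + b1 + b2)%N => y h hy gu e.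
have hE : h - 1%:M = L1 *m qinmx (cj w D) (y - 1%:M) *m R1.
  have -> : h = coordL W (cj w) *m qinmx (cj w D) (g *m y *m invmx g) *m Rm.
    by rewrite e -mulmxA cR mulmx1.
  have e1 : 1%:M = coordL W (cj w) *m qinmx (cj w D) (g *m invmx g) *m Rm.
    by rewrite mulmxV // /qinmx map_mx1 mulmx1 cR.
  rewrite [in LHS]e1.
  rewrite -mulmxBl -mulmxBr.
  have eA : g *m y *m invmx g - g *m invmx g = g *m (y - 1%:M) *m invmx g.
    by rewrite mulmxBr mulmx1 mulmxBl.
  rewrite -[_ - _ in LHS](map_mxB (qin (cj w D))) eA -/(qinmx _ _).
  by rewrite !qinmxM /L1 /R1 !mulmxA.
clearbody L1 R1.
have hI i j : h i j - (1%:M : 'M_n) i j \in oe (vw w) N0%:Z.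
  have -> : h i j - (1%:M : 'M_n) i j = (h - 1%:M) i j by rewrite !mxE.
  rewrite hE !mxE; apply: rpred_sum => r _; rewrite !mxE mulr_suml; apply: rpred_sum => s _.
  have hs : qin (cj w D) ((y - 1%:M) s r) \in oe (vw w) (N0 + b1 + b2)%N%:Z.
    by apply: oe_qin; apply/vgeP; exact: hy.
  have := oeM (oeM (B1 i s) hs) (B2 r j); rewrite ![qinmx _ _ _ _]mxE.
  by apply: oe_le; lia.
rewrite -(det1 _ n); apply: (@det_congr _ (oint (vw w)) (oe (vw w) N0%:Z)).
- exact: rpred1.
- by move=> x z; exact: rpredM.
- exact: rpred0.
- by move=> x z; exact: rpredB.
- by move=> x z; exact: oeMl.
- move=> i j; rewrite -[h i j](subrK ((1%:M : 'M_n) i j)) rpredD //.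
    by apply: oe_le (hI i j); lia.
  by rewrite mxE; case: (_ == _); rewrite ?rpred1 ?rpred0.
- by move=> i j; rewrite mxE; case: (_ == _); rewrite ?rpred1 ?rpred0.
- exact: hI.
Qed.

Lemma SOw_unit w (x : 'M[Fw w]_n.*2.+1) : SOw Phi x -> x \in unitmx.
Proof. by move=> [_ d]; rewrite unitmxE d unitr1. Qed.

Lemma mxge_ldiv w (N : nat) (x y : 'M[Fw w]_n.*2.+1) : (0 < N)%N ->
  mxge N (x - 1%:M) -> mxge N (y - 1%:M) -> mxge N (invmx x *m y - 1%:M).
Proof.
move=> N0 hx hy.
have I z : mxge N (z - 1%:M) -> mxint (vw w) z.
  move=> hz i j; rewrite -[z](subrK 1%:M) mxE rpredD ?mxint1 //.
  apply: (@vpow_le _ _ 0 N%:Z) => //; exact/vgeP.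
have dx : vunt (vw w) (\det x).
  have h : \det x - \det (1%:M : 'M[Fw w]_n.*2.+1) \in vpow (vw w) 1.
    apply: (@det_congr _ (vint (vw w)) (vpow (vw w) 1)).
    - exact: vint1.
    - by move=> ? ?; exact: rpredM.
    - exact: rpred0.
    - by move=> ? ?; exact: rpredB.
    - by move=> ? ?; exact: vpowMl.
    - exact: I.
    - exact: mxint1.
    - move=> i j; have /vgeP := hx i j; rewrite !mxE; apply: vpow_le; lia.
  rewrite -[\det x](subrK 1) -{1}(det1 _ n.*2.+1) addrC.
  by apply: vunt_add h; exact: vunt1.
have xu : x \in unitmx by rewrite unitmxE unitfE (vunt_neq0 dx).
have xi : mxint (vw w) (invmx x) by apply: mxint_invmx => //; exact: I.
have -> : invmx x *m y - 1%:M = invmx x *m ((y - 1%:M) - (x - 1%:M)).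
  by rewrite opprB addrA subrK mulmxBr mulVmx.
move=> i j; apply/vgeP; rewrite mxE; apply: rpred_sum => r _.
apply: vpowMl; first exact: xi.
have -> : (y - 1%:M - (x - 1%:M)) r j = (y - 1%:M) r j - (x - 1%:M) r j by rewrite !mxE.
by rewrite rpredB //; apply/vgeP; [exact: hy|exact: hx].
Qed.

Variables (K : set (Gfam Fw n)) (g : Gfam Fw n).
Hypotheses (K_compact_open : compact_open_G Phi K) (g_G : Gad Phi g).
Variable U : set (Efam Fw D).
Hypothesis U_T1 : U `<=` @T1ad _ _ _.
Hypothesis U_det : forall t, U t -> exists2 s, Hdet W s t & K (Gldiv g (Gmul s g)).

Lemma det_ldiv w (s s' : 'M[Fw w]_n.*2.+1) h h' : Upt W s h -> Upt W s' h' ->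
  \det h \is a GRing.unit ->
  coordL W (cj w) *m qinmx (cj w D) (invmx s *m s') = invmx h *m h' *m coordL W (cj w).
Proof.
move=> [Ss _ _ e] [Ss' _ _ e'] hu; have hu' : h \in unitmx by rewrite unitmxE.
have su : s \in unitmx by apply: SOw_unit; split; [case: Ss|case: Ss].
have eV : coordL W (cj w) *m qinmx (cj w D) (invmx s) = invmx h *m coordL W (cj w).
  rewrite -[coordL W (cj w) in LHS](mulKmx hu') -e -!mulmxA -qinmxM mulmxV //.
  by rewrite /qinmx map_mx1 mulmx1.
by rewrite qinmxM mulmxA eV -[LHS]mulmxA e' mulmxA.
Qed.

(** Every element of U is the determinant of some s with g^-1 s g in K. Total boundedness passes
    from K to U, because [det_close] gives uniform continuity of the determinant at the finitely
    many places of C. *)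
Lemma total_bounded (C : conductor F) : exists us : seq (Efam Fw D),
  forall u, U u -> exists2 u', u' \in us & U u' /\
    forall w, C w <> 0%N -> (u' w)^-1 * u w - 1 \in oe (vw w) (C w)%:Z.
Proof.
have /choice[sd sdP] : forall t, exists s, U t -> Hdet W s t /\ K (Gldiv g (Gmul s g)).
  by move=> t; case: (pselect (U t)) => [/U_det[s]|]; [exists s|exists g].
have gu w : g w \in unitmx by apply: SOw_unit; case: g_G.
have /choice[Nw NwP] : forall w, exists N : nat, forall y h,
  mxge N (y - 1%:M) -> g w \in unitmx ->
  coordL W (cj w) *m qinmx (cj w D) (g w *m y *m invmx (g w)) = h *m coordL W (cj w) ->
  \det h - 1 \in oe (vw w) (C w)%:Z by move=> w; exact: det_close.
(* The successor keeps the depth positive, as [mxge_ldiv] requires. *)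
pose cd w := if C w == 0%N then 0%N else (Nw w).+1.
have cd_fin : finite_set [set w | cd w <> 0%N].
  apply: sub_finite_set (cond_fin C) => w /=; rewrite /cd; case: eqP => //.
pose C'' := Conductor cd_fin.
have [KG [K1 KD [c0 Kc0] Ktb]] := K_compact_open.
have [B [/finite_seqP[sB ->] BK Bc]] := Ktb C''.
pose X u := Gldiv g (Gmul (sd u) g).
have /choice[f fP] : forall b : Gfam Fw n, exists u, (exists u, U u /\ Gnbhd Phi C'' (Gldiv b (X u))) ->
    U u /\ Gnbhd Phi C'' (Gldiv b (X u)).
  move=> b; case: (pselect (exists u, U u /\ Gnbhd Phi C'' (Gldiv b (X u)))) => [[u h]|no].
    by exists u.
  by exists (fun=> 1).
exists [seq f b | b <- sB] => u uU; have [b /= bB hb] := Bc _ (sdP u uU).2.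
have [fU hf] := fP b (ex_intro _ u (conj uU hb)).
exists (f b); first exact: map_f.
split=> // w Cw.
have [[_ hdu] _] := sdP _ uU; have [[_ hdf] _] := sdP _ fU.
have [h hU du] := hdu w; have [h' h'U df] := hdf w.
have duf : \det h' \is a GRing.unit.
  by rewrite -df; apply: qunit_norm1; exact: (U_T1 fU).1.
have bu : b w \in unitmx by apply: SOw_unit; exact: (KG _ (BK _ bB)).1.
have sfu : sd (f b) w \in unitmx by apply: SOw_unit; case: h'U => -[].
pose y := invmx (invmx (b w) *m X (f b) w) *m (invmx (b w) *m X u w).
have XE t : X t w = invmx (g w) *m (sd t w *m g w) by [].
have bX : invmx (b w) *m X (f b) w \in unitmx.
  by rewrite XE !unitmx_mul !unitmx_inv bu sfu gu.
have yN : mxge (Nw w).+1 (y - 1%:M).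
  have cdw : cd w = (Nw w).+1 by rewrite /cd; case: eqP.
  apply: mxge_ldiv => //; rewrite -cdw; [exact: hf.2|exact: hb.2].
have yE : g w *m y *m invmx (g w) = invmx (sd (f b) w) *m sd u w.
  have -> : y = invmx (g w) *m (invmx (sd (f b) w) *m sd u w) *m g w.
    apply: (canLR (mulKmx bX)); rewrite !XE -!mulmxA.
    by rewrite (mulKVmx (gu w)) (mulKVmx sfu).
  exact: (conjmxK _ (gu w)).
rewrite du df; have -> : (\det h')^-1 * \det h = \det (invmx h' *m h) by rewrite det_mulmx det_inv.
apply: (NwP w y) => //; last by rewrite yE; exact: det_ldiv.
by move=> i j; have /vgeP a := yN i j; apply/vgeP; apply: vpow_le a; lia.
Qed.

End Compact.

(** * Galois descent *)

Lemma map_prod_XsubC (r : {rmorphism algC -> algC}) (s : seq algC) :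
  map_poly r (\prod_(b <- s) ('X - b%:P)) = \prod_(b <- map r s) ('X - b%:P).
Proof.
rewrite rmorph_prod big_map; apply: eq_bigr => b _.
by rewrite rmorphB /= map_polyX map_polyC.
Qed.

Lemma dchoice (T : Type) (B : T -> Type) (P : forall x, B x -> Prop) :
  (forall x, exists y, P x y) -> exists f : forall x, B x, forall x, P x (f x).
Proof. by move=> h; exists (fun x => projT1 (cid (h x))) => x; case: cid. Qed.

Section Galois.
Variables (F : fieldExtType rat) (D : F) (fplus : {rmorphism quad D -> algC}).
Hypothesis D0 : D != 0.
Variable Fw : completions F.
Variables (art art1 : Efam Fw D -> autC).
Hypotheses (art_artin : artin_map fplus art) (art1_artin : artin1_map fplus art art1).
Local Notation vw w := (comp_val (Fw w)).
Local Notation rc := (ring_class_field fplus art).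
Implicit Types (a : algC) (c : conductor F) (t u : Efam Fw D) (r : {rmorphism algC -> algC}).

Lemma max_cond_fin c c' : finite_set [set w | maxn (c w) (c' w) <> 0%N].
Proof.
apply: (@sub_finite_set _ _ ([set w | c w <> 0%N] `|` [set w | c' w <> 0%N])).
  move=> w /= h; have [e|e] := eqVneq (c w) 0%N; last by left; apply/eqP.
  by right=> e'; apply: h; rewrite e e'.
by rewrite finite_setU; split; exact: cond_fin.
Qed.

Definition max_cond c c' : conductor F := Conductor (max_cond_fin c c').

Lemma rc_max c c' a : rc c a -> rc (max_cond c c') a /\ rc (max_cond c' c) a.
Proof.
move=> [ab hz hy]; split; split=> // z zo; apply: hz => w; have [uz o1 o2] := zo w;
  by split=> //; [apply: Eorder_le o1|apply: Eorder_le o2]; rewrite /= ?leq_maxl ?leq_maxr.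
Qed.

Lemma OEunit_Eidele (z : Efam Fw D) : (forall w, OEunit (z w)) -> Eidele z.
Proof.
move=> h; split=> [w|]; first by case: (h w).
by rewrite (_ : [set w | _] = set0) //; apply/seteqP; split=> w //= [].
Qed.

Lemma Eorder_Eidele (k : place F -> nat) (z : Efam Fw D) : (forall w, Eorder_unit (k w) (z w)) -> Eidele z.
Proof. by move=> h; apply: OEunit_Eidele => w; apply: Eorder_unit_OEunit (h w). Qed.

Lemma FtoE_Eidele (y : forall w, Fw w) : Fidele y -> Eidele (FtoE D y).
Proof.
move=> [y0 yf]; have un w : FtoE D y w \is a GRing.unit.
  by rewrite /FtoE qunitE qnorm_qin expf_neq0 // y0.
split=> //; apply: sub_finite_set yf => w /= h [_ vy]; apply: h; split=> //.
  by apply/OEP; apply: oe_qin; rewrite vpow_val ?y0 //; vlia.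
have -> : (FtoE D y w)^-1 = qin _ (y w)^-1.
  have q1 : FtoE D y w * qin _ (y w)^-1 = 1 by rewrite /FtoE -qinM mulfV ?y0.
  by apply: (mulrI (un w)); rewrite q1 divrr ?un.
by apply/OEP; apply: oe_qin; rewrite vpow_val ?invr_eq0 ?y0 // placeV; vlia.
Qed.

Lemma GalE_comp r r' : GalE fplus r -> GalE fplus r' ->
  GalE fplus (r \o r' : {rmorphism algC -> algC}).
Proof. by move=> h h' a ha /=; rewrite h' // h. Qed.

Lemma fplus_rc c e : rc c (fplus e).
Proof.
have ft r : GalE fplus r -> r (fplus e) = fplus e by move=> h; apply: h; exists e.
split.
- by move=> r t hr ht; rewrite (ft r hr) (ft t ht) (ft r hr).
- by move=> z hz; apply: ft; exact: (artin_gal art_artin (Eorder_Eidele hz)).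
- by move=> y hy; apply: ft; exact: (artin_gal art_artin (FtoE_Eidele hy)).
Qed.

Lemma rc_aut r a c : GalE fplus r -> rc c a -> rc c (r a).
Proof.
move=> hr [ab hz hy]; split.
- move=> s s' hs hs'; have := ab s (s' \o r : {rmorphism algC -> algC}) hs (GalE_comp hs' hr).
  by move=> /= ->; rewrite (ab s r).
- by move=> z zo; rewrite (ab _ r) ?hz //; exact: (artin_gal art_artin (Eorder_Eidele zo)).
- by move=> y yo; rewrite (ab _ r) ?hy //; exact: (artin_gal art_artin (FtoE_Eidele yo)).
Qed.

Lemma rc_lincomb c (I : finType) (k : I -> nat) (x : I -> algC) :
  (forall i, rc c (x i)) -> rc c (\sum_i (k i)%:R * x i).
Proof.
have E r : r (\sum_i (k i)%:R * x i) = \sum_i (k i)%:R * r (x i).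
  by rewrite rmorph_sum; apply: eq_bigr => i _; rewrite rmorphM rmorph_nat.
have E2 r r' : r (r' (\sum_i (k i)%:R * x i)) = \sum_i (k i)%:R * r (r' (x i)).
  rewrite E rmorph_sum; apply: eq_bigr => i _; by rewrite rmorphM rmorph_nat.
move=> h; split.
- move=> r t hr ht; rewrite !E2; apply: eq_bigr => i _.
  by have [ab _ _] := h i; rewrite ab.
- by move=> z zo; rewrite E; apply: eq_bigr => i _; have [_ hz _] := h i; rewrite hz.
- by move=> y yo; rewrite E; apply: eq_bigr => i _; have [_ _ hy] := h i; rewrite hy.
Qed.

Lemma rc_poly_roots c (s : seq algC) i : (forall b, b \in s -> rc c b) ->
  rc c (\prod_(b <- s) ('X - b%:P))`_i.
Proof.
move=> h; set P := \prod_(b <- s) _.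
have fixP r : (forall b, b \in s -> r b = b) -> r P`_i = P`_i.
  move=> rb; rewrite -coef_map /= map_prod_XsubC.
  by rewrite (_ : map r s = s) // -[RHS]map_id; apply/eq_in_map.
split.
- move=> r t hr ht.
  rewrite -(coef_map t) -(coef_map r) -(coef_map r) -(coef_map t) /= !map_prod_XsubC.
  rewrite (_ : map r (map t s) = map t (map r s)) // -!map_comp; apply/eq_in_map => b bs /=.
  by have [ab _ _] := h _ bs; rewrite ab.
- by move=> z zo; apply: fixP => b /h[_ hz _]; exact: hz.
- by move=> y yo; apply: fixP => b /h[_ _ hy]; exact: hy.
Qed.

Lemma T1ad_norm1 t w : T1ad t -> t w * qconj (t w) = 1. Proof. by case. Qed.

Lemma T1adM t u : T1ad t -> T1ad u -> T1ad (Emul t u).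
Proof.
move=> [nt ft] [nu fu]; split=> [w|]; first exact: norm1M.
apply: (@sub_finite_set _ _ ([set w | ~ OE (t w)] `|` [set w | ~ OE (u w)])); last by rewrite finite_setU.
move=> w /= h; case: (pselect (OE (t w))) => [ot|]; last by left.
right=> ou; apply: h; apply/OEP; apply: rpredM; exact/OEP.
Qed.

Lemma T1adV t : T1ad t -> T1ad (fun w => (t w)^-1).
Proof.
move=> [nt ft]; split=> [w|]; first exact: norm1V.
apply: sub_finite_set ft => w /= h ot; apply: h; apply/OEP.
by rewrite (qinv_norm1 (nt w)) oe_conj; apply/OEP.
Qed.

Lemma U1_fix c t a : (forall w, U1 (c w) (t w)) -> rc c a -> T1ad t /\ art1 t a = a.
Proof.
move=> h ra; split.
  split=> [w|]; first exact: U1_norm1 (h w).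
  rewrite (_ : [set w | _] = set0) //; apply/seteqP; split=> w //=; apply.
  by apply/OEP; apply: U1_int (h w).
have /dchoice[x xP] : forall w, exists x : Ew Fw D w, Eorder_unit (c w) x /\ t w = x / qconj x.
  by move=> w; have [x xo e] := h w; exists x.
have -> : t = (fun w => x w / qconj (x w)).
  by apply: functional_extensionality_dep => w; case: (xP w).
have xo : forall w, Eorder_unit (c w) (x w) by move=> w; case: (xP w).
rewrite (artin1_art art1_artin (Eorder_Eidele xo)); last by exists c.
by have [_ hz _] := ra; exact: hz.
Qed.

Variables (S1 : seq nat).
Hypothesis S1_prime : forall p : nat, p \in S1 -> prime p.
Variable US : set (Efam Fw D).
Hypothesis US_compact_open : compact_open_T1S S1 US.
Local Notation S := (Sabove S1).

Lemma US1 : US (@Eone F D Fw). Proof. by case: US_compact_open => _ []. Qed.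
Lemma US_ldiv x y : US x -> US y -> US (Eldiv x y).
Proof. by case: US_compact_open => _ [_ h _ _]; exact: h. Qed.
Lemma USV x : US x -> US (fun w => (x w)^-1).
Proof.
move=> /US_ldiv/(_ US1); congr US; apply: functional_extensionality_dep => w.
by rewrite /Eldiv /Eone mulr1.
Qed.
Lemma USM x y : US x -> US y -> US (Emul x y).
Proof.
move=> /USV hx hy; have := US_ldiv hx hy; congr US.
by apply: functional_extensionality_dep => w; rewrite /Eldiv /Emul invrK.
Qed.

Local Notation Ul k := (Ulevel S1 US k).

Lemma Etrunc1 : Etrunc S1 (@Eone F D Fw) = @Eone F D Fw.
Proof. by apply: functional_extensionality_dep => w; rewrite /Etrunc; case: pselect. Qed.
Lemma EtruncM (x y : Efam Fw D) : Etrunc S1 (Emul x y) = Emul (Etrunc S1 x) (Etrunc S1 y).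
Proof.
apply: functional_extensionality_dep => w; by rewrite /Etrunc /Emul; case: pselect => h /=; rewrite ?mulr1.
Qed.
Lemma EtruncV (x : Efam Fw D) : Etrunc S1 (fun w => (x w)^-1) = (fun w => (Etrunc S1 x w)^-1).
Proof.
apply: functional_extensionality_dep => w; by rewrite /Etrunc; case: pselect => h /=; rewrite ?invr1.
Qed.

Lemma UlM k x y : Ul k x -> Ul k y -> Ul k (Emul x y).
Proof.
move=> [tx ux hx] [ty uy hy]; split; first exact: T1adM.
  by rewrite EtruncM; exact: USM.
by move=> w wS; apply: U1M; [exact: hx|exact: hy].
Qed.

Lemma UlV k x : Ul k x -> Ul k (fun w => (x w)^-1).
Proof.
move=> [tx ux hx]; split; first exact: T1adV.
  by rewrite EtruncV; exact: USV.
by move=> w wS; apply: U1V; exact: hx.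
Qed.

Lemma Ul_le k k' x : (forall w, (k w <= k' w)%N) -> Ul k' x -> Ul k x.
Proof. by move=> h [tx ux hx]; split=> // w wS; apply: U1_le (h w) (hx w wS). Qed.

Hypothesis US_small : forall e : quad D, Ul (fun=> 0%N) (Ediag Fw e) -> e = 1.

(** The quotient of x and y lies in the kernel T^1(Q) of Art^1, which meets the level group
    trivially by [US_small]. *)
Lemma art1_inj k x y : Ul k x -> Ul k y ->
  (forall a, Einfty fplus art a -> art1 x a = art1 y a) -> x = y.
Proof.
move=> hx hy e; pose z := Emul (fun w => (y w)^-1) x.
have hz : Ul k z by apply: UlM => //; exact: UlV.
have [Tx _ _] := hx; have [Ty _ _] := hy; have Tz : T1ad z by case: hz.
have yz : Emul y z = x.
  apply: functional_extensionality_dep => w; rewrite /Emul /z mulrA divrr ?mul1r //.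
  exact: qunit_norm1 (T1ad_norm1 w Ty).
have fz a : Einfty fplus art a -> art1 z a = a.
  move=> ha; apply: (fmorph_inj (art1 y)).
  by rewrite -(artin1_mul art1_artin Ty Tz ha) yz e.
have [e0 _ ze] := (artin1_ker art1_artin Tz).1 fz.
have e1 : e0 = 1.
  by apply: US_small; rewrite -ze; apply: Ul_le hz.
rewrite -yz ze e1; apply: functional_extensionality_dep => w.
by rewrite /Emul /Ediag rmorph1 mulr1.
Qed.

Variables (n : nat) (Phi : 'M[F]_n.*2.+1).
Hypotheses (Phi_sym : Phi^T = Phi) (Phi_unit : Phi \in unitmx).
Variables (W : hermitian_hyperplane D Phi) (K : set (Gfam Fw n)) (g : Gfam Fw n).
Hypotheses (K_compact_open : compact_open_G Phi K) (g_G : Gad Phi g).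
Hypothesis US_det : forall t, Ul (fun=> 0%N) t -> exists2 s, Hdet W s t & K (Gldiv g (Gmul s g)).

Section Level.
Variable k : place F -> nat.
Let U := Ul k.

Lemma U_bounded (C : conductor F) : exists us : seq (Efam Fw D),
  forall u, U u -> exists2 u', u' \in us & U u' /\
    forall w, C w <> 0%N -> (u' w)^-1 * u w - 1 \in oe (vw w) (C w)%:Z.
Proof.
apply: (total_bounded D0 Phi_sym Phi_unit K_compact_open g_G (W := W)).
  by move=> t [].
by move=> t ht; apply: US_det; apply: Ul_le ht.
Qed.

Lemma deep_fin c : finite_set [set w : place F |
  (if pselect (S w) then c w + depth2 Fw w else if c w == 0%N then 0%N else c w + depth2 Fw w)%N <> 0%N].
Proof.
apply: (@sub_finite_set _ _ ([set w | S w] `|` [set w | c w <> 0%N])).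
  by move=> w /=; case: pselect => [h _|_ /=]; [left|case: eqP => // h _; right].
by rewrite finite_setU; split; [exact: finite_places_above|exact: cond_fin].
Qed.
(* closeness to this depth at finitely many places makes an element of U
   indistinguishable from 1 on the ring class field of conductor c *)
Definition deep c : conductor F := Conductor (deep_fin c).

Lemma deep_U1 c t : Ul (fun=> 0%N) t ->
  (forall w, deep c w <> 0%N -> t w - 1 \in oe (vw w) (deep c w)%:Z) ->
  forall w, U1 (c w) (t w).
Proof.
move=> [Tt _ ht] close w.
have [e|/eqP e] := eqVneq (deep c w) 0%N.
  move: e => /=; case: pselect => [?|nS] /=; first by rewrite /depth2 addnS.
  case: eqP => [-> _|_]; [exact: ht|by rewrite /depth2 addnS].
have nt := T1ad_norm1 w Tt; apply: U1_close => //.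
by move: e (close w e) => /=; case: pselect => h //=; case: eqP.
Qed.

Lemma deep_art1 c a u u' : U u -> U u' ->
  (forall w, deep c w <> 0%N -> (u' w)^-1 * u w - 1 \in oe (vw w) (deep c w)%:Z) ->
  rc c a -> art1 u a = art1 u' a.
Proof.
move=> hu hu' close ra; pose t := Emul (fun w => (u' w)^-1) u.
have ht : U t by apply: UlM => //; exact: UlV.
have ht0 : Ul (fun=> 0%N) t by apply: Ul_le ht.
have [Tt ta] := U1_fix (deep_U1 ht0 close) ra.
have Tu' : T1ad u' by case: hu'.
have ut : Emul u' t = u.
  apply: functional_extensionality_dep => w; rewrite /Emul /t /Emul mulrA divrr ?mul1r //.
  exact: qunit_norm1 (T1ad_norm1 w Tu').
by rewrite -ut (artin1_mul art1_artin Tu' Tt) ?ta //; exists c.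
Qed.

Variable rho : {rmorphism algC -> algC}.
Hypothesis rho_fix : galfix (fixed_field fplus art art1 U) rho.

Definition cond0 : conductor F.
Proof. by apply: (@Conductor F (fun=> 0%N)); rewrite (_ : [set w | _] = set0) //; apply/seteqP; split=> w. Defined.

Lemma rho_gal : GalE fplus rho.
Proof.
move=> a [e _ <-]; apply: rho_fix; split; first by exists cond0; exact: fplus_rc.
by move=> t [Tt _ _]; apply: (artin1_gal art1_artin Tt); exists e.
Qed.

Lemma U_one : U (@Eone F D Fw).
Proof.
split; last by move=> w _; exact: U1_1.
  split=> [w|]; first exact: norm1_1.
  rewrite (_ : [set w | _] = set0) //; apply/seteqP; split=> w //=; apply.
  by apply/OEP; exact: rpred1.
by rewrite Etrunc1; exact: US1.
Qed.

(** Galois theory of a ring class field by hand. By [U_bounded] finitely many elements [gs]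
    represent the action of U there. Each single a is treated by its orbit polynomial, and a generic
    combination of counterexamples, as for a primitive element, yields one u for all a. *)
Lemma level_exists c : exists2 u, U u & forall a, rc c a -> art1 u a = rho a.
Proof.
have [us usP] := U_bounded (deep c).
pose gs := [seq u <- us | `[< U u >]].
have gsU u : u \in gs -> U u by rewrite mem_filter => /andP[/asboolP].
have gsP u : U u -> exists2 u', u' \in gs & forall a, rc c a -> art1 u a = art1 u' a.
  move=> hu; have [u' u's [hu' cl]] := usP u hu.
  exists u'; first by rewrite mem_filter u's andbT; apply/asboolP.
  by move=> a; exact: deep_art1.
(* The polynomial whose roots are the finite orbit of a has coefficients fixed by U, hence by rho;
   therefore rho a is again a root. *)
have st1 a : rc c a -> exists2 u, u \in gs & art1 u a = rho a.
  move=> ra; pose orb := undup [seq art1 u a | u <- gs].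
  have orbP b : b \in orb -> exists2 u, u \in gs & b = art1 u a.
    by rewrite mem_undup => /mapP.
  have orbU u : U u -> art1 u a \in orb.
    move=> hu; have [u' u's ->//] := gsP u hu.
    by rewrite mem_undup; exact: map_f.
  have rorb b : b \in orb -> rc c b.
    move=> /orbP[u /gsU[Tu _ _] ->]; apply: rc_aut => //; exact: (artin1_gal art1_artin Tu).
  pose P := \prod_(b <- orb) ('X - b%:P).
  have fixP i : rho P`_i = P`_i.
    apply: rho_fix; split; first by exists c; exact: rc_poly_roots.
    move=> t ht; rewrite -coef_map /= map_prod_XsubC; congr (_`_i).
    suff pe : perm_eq (map (art1 t) orb) orb by rewrite /P (perm_big _ pe).
    have uo : uniq (map (art1 t) orb) by rewrite map_inj_uniq ?undup_uniq //; exact: fmorph_inj.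
    apply: uniq_perm => //; first exact: undup_uniq.
    have [] // := @uniq_min_size _ (map (art1 t) orb) orb uo; last by rewrite size_map.
    move=> _ /mapP[b /orbP[u hu ->] ->].
    have [Tt _ _] := ht; have [Tu _ _] := gsU _ hu.
    rewrite -(artin1_mul art1_artin Tt Tu); last by exists c.
    by apply: orbU; apply: UlM => //; exact: gsU.
  have aorb : a \in orb.
    have [_ e1] : T1ad (@Eone F D Fw) /\ art1 (@Eone F D Fw) a = a.
      by apply: (U1_fix _ ra) => w; exact: U1_1.
    by have := orbU _ U_one; rewrite e1.
  have : rho a \in orb.
    rewrite -root_prod_XsubC -/P.
    have -> : P = map_poly rho P by apply/polyP => i; rewrite coef_map /= fixP.
    by rewrite fmorph_root root_prod_XsubC.
  by move=> /orbP[u ug e]; exists u.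
apply: contrapT => no.
have /choice[x xP] : forall u : Efam Fw D, exists a, u \in gs -> rc c a /\ art1 u a != rho a.
  move=> u; have [ug|ug] := boolP (u \in gs); last by exists 0.
  apply: contrapT => nou; apply: no; exists u; first exact: gsU.
  move=> a ra; apply/eqP; apply: contrapT => /negP ne; apply: nou.
  by exists a.
pose N := size gs; pose ui (i : 'I_N) := nth (@Eone F D Fw) gs i.
have uig i : ui i \in gs by rewrite mem_nth.
(* At X = m this is the failure of [ui j] to agree with rho on the sum of the m^i x_i. Its jth
   coefficient is nonzero, so some integer m is a root of none of the [Q j]. *)
pose Q j := \sum_(i < N) (rho (x (ui i)) - art1 (ui j) (x (ui i))) *: 'X^i.
have Qj j : Q j != 0.
  apply/eqP => /(congr1 (fun p : {poly algC} => p`_j)); rewrite coef0 /Q coef_sum (bigD1 j) //= big1.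
    by rewrite coefZ coefXn eqxx mulr1 addr0 => /eqP; rewrite subr_eq0 eq_sym (negbTE (xP _ (uig j)).2).
  move=> i ij; rewrite coefZ coefXn; case: eqP => [e|]; rewrite ?mulr0 //.
  by case/eqP: ij; apply/val_inj.
have [m Qm] : exists m : nat, forall j, (Q j).[m%:R] != 0.
  pose QQ := \prod_j Q j; have QQ0 : QQ != 0 by apply/prodf_neq0 => j _.
  pose rs : seq algC := [seq m%:R | m <- iota 0 (size QQ)].
  have urs : uniq rs by rewrite map_inj_uniq ?iota_uniq //; exact: mulrIn (oner_neq0 _).
  have : ~~ all (root QQ) rs.
    apply/negP => al; have := max_poly_roots QQ0 al urs.
    by rewrite size_map size_iota ltnn.
  rewrite -has_predC => /hasP[_ /mapP[m _ ->]] /=; rewrite rootE horner_prod => /prodf_neq0 h.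
  by exists m => j; exact: h.
have ra : rc c (\sum_(i < N) (m ^ i)%:R * x (ui i)).
  by apply: (rc_lincomb (fun i : 'I_N => (m ^ i)%N)) => i; exact: (xP _ (uig i)).1.
have [u ug e] := st1 _ ra.
have uN : (index u gs < N)%N by rewrite index_mem.
have uE : u = ui (Ordinal uN) by rewrite /ui /= nth_index.
have /negP := Qm (Ordinal uN); apply; apply/eqP.
rewrite /Q horner_sum -uE -[RHS](subrr (rho (\sum_(i < N) (m ^ i)%:R * x (ui i)))) -{2}e.
rewrite !rmorph_sum -sumrB; apply: eq_bigr => i _.
by rewrite hornerZ hornerXn !rmorphM !rmorph_nat natrX; ring.
Qed.

Lemma ultra_cover (T : Type) (J : eqType) (G : set (set T)) (s : seq J) (P : J -> set T) :
  UltraFilter G -> G [set u | exists2 x, x \in s & P x u] -> exists2 x, x \in s & G (P x).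
Proof.
move=> GU; elim: s => [|x s IH] h.
  by have [u [y]] := filter_ex h.
have [Gx|Gx] := in_ultra_setVsetC (P x) GU; first by exists x; rewrite ?mem_head.
have [|y ys Gy] := IH; last by exists y; rewrite ?inE ?ys ?orbT.
apply: filterS (filterI h Gx) => u [[y]]; rewrite inE => /orP[/eqP -> //|ys Py _].
by exists y.
Qed.

Lemma vpow_all0 (kk : fieldType) (w : place kk) (a : kk) :
  (forall j : nat, a \in vpow w j%:Z) -> a = 0.
Proof.
move=> h; apply/eqP; apply: contraT => a0.
by have := h (`|w a|%N.+1); rewrite vpow_val //; vlia.
Qed.

(** * Limit of level elements along an ultrafilter *)

Section Limit.
Variable G : set (set (Efam Fw D)).
Hypothesis GU : UltraFilter G.
Hypothesis GS : forall c, G [set u | U u /\ forall a, rc c a -> art1 u a = rho a].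

Lemma G_U : G U. Proof. by apply: filterS (GS cond0) => u []. Qed.

Lemma coord_approx w (N : nat) : exists2 x : Ew Fw D w, x * qconj x = 1 &
  G [set u | U u /\ x^-1 * u w - 1 \in oe (vw w) N%:Z].
Proof.
(* The depth N + 1 is nonzero even for N = 0, so that the place w is really constrained by the
   conductor. *)
pose kk w' := if w' == w then N.+1 else 0%N.
have kf : finite_set [set w' | kk w' <> 0%N].
  apply: (@sub_finite_set _ _ [set w]); last exact: finite_set1.
  by move=> w' /=; rewrite /kk; case: eqP.
have [us usP] := U_bounded (Conductor kf).
have [|u us' Gu] := @ultra_cover _ _ G us (fun u' => [set u | U u /\ (U u' /\ (u' w)^-1 * u w - 1 \in oe (vw w) N%:Z)]) GU.
  apply: filterS G_U => u hu; have [u' u's [hu' cl]] := usP u hu.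
  exists u' => //; split=> //; split=> //.
  have h := cl w; rewrite /= /kk eqxx in h; apply: oe_le (h _) => //; lia.
have [u1 [_ [[Tu _ _] _]]] := filter_ex Gu.
exists (u w); first exact: T1ad_norm1.
by apply: filterS Gu => u2 [h1 [_ h2]].
Qed.

(** The ultrafilter concentrates near some x_N at every depth N, and the x_N form a Cauchy sequence.
    Its limit exists by completeness of F_w, applied to the two coordinates by means of
    [oe_coord]. *)
Lemma coord_limit w : exists2 l : Ew Fw D w, l * qconj l = 1 &
  forall N : nat, G [set u | U u /\ (u w)^-1 * l - 1 \in oe (vw w) N%:Z].
Proof.
have /choice[x xP] : forall N : nat, exists x : Ew Fw D w, x * qconj x = 1 /\
  G [set u | U u /\ x^-1 * u w - 1 \in oe (vw w) N%:Z].
  by move=> N; have [x h1 h2] := coord_approx w N; exists x.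
have xu N := qunit_norm1 (xP N).1.
have un u : U u -> u w * qconj (u w) = 1 by move=> [Tu _ _]; exact: T1ad_norm1.
have div1 N M : (N <= M)%N -> (x N)^-1 * x M - 1 \in oe (vw w) N%:Z.
  move=> NM; have [u [[hu h1] [_ h2]]] := filter_ex (filterI (xP N).2 (xP M).2).
  have uu := qunit_norm1 (un _ hu).
  have n2 : (x M)^-1 * u w * qconj ((x M)^-1 * u w) = 1.
    by apply: norm1M; [exact: norm1V (xP M).1|exact: un].
  have -> : (x N)^-1 * x M = ((x N)^-1 * u w) * ((x M)^-1 * u w)^-1.
    by rewrite invrM ?unitrV // invrK mulrA mulrK.
  apply: close1M => //; apply: close1V => //; apply: oe_le h2; lia.
(* Dividing by x_0 makes the sequence integral, so that closeness of quotients to 1 becomes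
   closeness of differences to 0. *)
pose y N := (x 0%N)^-1 * x N.
have yn N : y N * qconj (y N) = 1.
  by apply: norm1M; [exact: norm1V (xP 0%N).1|exact: (xP N).1].
have yi N : y N \in oint (vw w).
  by apply: (@norm1_close1 _ _ _ 0) => //; exact: (div1 0%N N (leq0n _)).
have ydiff N M : (N <= M)%N -> y M - y N \in oe (vw w) N%:Z.
  move=> NM; have -> : y M - y N = y N * ((x N)^-1 * x M - 1).
    by rewrite mulrBr mulr1 /y -mulrA mulVKr.
  by apply: oeMl => //; exact: div1.
have Dk : comp_inj (Fw w) D != 0 by exact: Dw0.
have two0 : 2%:R != 0 :> Fw w by exact: Fw_char0.
have [kp kpP] := oe_coord (vw w) Dk two0.
have lim (f : Ew Fw D w -> Fw w) :
    (forall a b : Ew Fw D w, f (a - b) = f a - f b) ->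
    (forall j z, z \in oe (vw w) j -> f z \in vpow (vw w) (j - kp%:Z)) ->
    exists l, forall j : int, exists N, forall i, (N <= i)%N -> vge (vw w) j (f (y i) - l).
  move=> fB fo; suff H : forall j : int, exists N, forall a b : nat, (N <= a)%N -> (N <= b)%N ->
      vge (vw w) j (f (y a) - f (y b)).
    by have [l0 l0P] := @comp_complete F w (Fw w) (fun i => f (y i)) H; exists l0.
  move=> j; exists (`|j| + kp)%N => a b ha hb.
  wlog ab : a b ha hb / (b <= a)%N.
    move=> H; case/orP: (leq_total a b) => [ab|]; last exact: H.
    have /vpowP/rpredNr := H b a hb ha ab; rewrite opprB => h; exact/vpowP.
  apply/vpowP; rewrite /= -fB; apply: vpow_le (fo _ _ (ydiff _ _ ab)); lia.
have [lr lrP] := lim (@qre _ _) (fun _ _ => erefl) (fun j z h => ((kpP j z).1 h).1).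
have [li liP] := lim (@qim _ _) (fun _ _ => erefl) (fun j z h => ((kpP j z).1 h).2).
pose yl : Ew Fw D w := Quad _ lr li.
have ylP (j : nat) : exists M, (j <= M)%N /\ y M - yl \in oe (vw w) j%:Z.
  have [N1 h1] := lrP (j%:Z + kp%:Z); have [N2 h2] := liP (j%:Z + kp%:Z).
  exists (maxn j (maxn N1 N2)); split; first exact: leq_maxl.
  apply: (kpP _ _).2; apply/vpowP.
    by apply: h1; rewrite !leq_max leqnn orbT.
  by apply: h2; rewrite !leq_max leqnn !orbT.
have yln : yl * qconj yl = 1.
  apply/eqP; rewrite -subr_eq0; apply/eqP.
  have small (j : nat) : yl * qconj yl - 1 \in oe (vw w) j%:Z.
    have [M [_ hM]] := ylP j; set e := y M - yl in hM.
    have -> : yl = y M - e by rewrite /e opprB addrC subrK.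
    rewrite rmorphB -(yn M) /=.
    have -> : (y M - e) * (qconj (y M) - qconj e) - y M * qconj (y M) =
      - (e * (qconj (y M))) + (e - y M) * qconj e by ring.
    have ei : e \in oint (vw w) by apply: oe_le hM.
    apply: rpredD; first by rewrite rpredN; apply: oeMr; rewrite ?oe_conj.
    by apply: oeMl; [apply: rpredB|rewrite oe_conj].
  apply: quadE; apply: (@vpow_all0 _ (vw w)) => j.
    by apply: vpow_le ((kpP _ _).1 (small (j + kp)%N)).1; lia.
  by apply: vpow_le ((kpP _ _).1 (small (j + kp)%N)).2; lia.
exists (x 0%N * yl); first by apply: norm1M => //; exact: (xP 0%N).1.
move=> N; have [M [NM hM]] := ylP N.
apply: filterS (xP M).2 => u [hu h]; split=> //.
have uu := qunit_norm1 (un _ hu).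
have n1 : (x M)^-1 * u w * qconj ((x M)^-1 * u w) = 1.
  by apply: norm1M; [exact: norm1V (xP M).1|exact: un].
have -> : (u w)^-1 * (x 0%N * yl) = ((x M)^-1 * u w)^-1 * ((y M)^-1 * yl).
  rewrite invrM ?unitrV // invrK /y invrM ?unitrV // invrK -!mulrA mulVKr //.
have yMu := qunit_norm1 (yn M).
apply: close1M => //; first by apply: close1V => //; apply: oe_le h; lia.
have -> : (y M)^-1 * yl - 1 = - ((y M)^-1 * (y M - yl)).
  by rewrite mulrBr mulVr // opprB.
rewrite rpredN; apply: oeMl => //.
by rewrite (qinv_norm1 (yn M)) /oint oe_conj; exact: yi.
Qed.

(** At any finite set of places, and to any depth, the limit agrees with an element of U that also
    acts as rho on a given ring class field. Open subgroups being closed, the limit lies in U; by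
    [deep_art1] it acts as rho. *)
Lemma limit_exists : exists2 l, U l & forall a, Einfty fplus art a -> art1 l a = rho a.
Proof.
have /dchoice[l lP] : forall w, exists l : Ew Fw D w, l * qconj l = 1 /\
  forall N : nat, G [set u | U u /\ (u w)^-1 * l - 1 \in oe (vw w) N%:Z].
  by move=> w; have [x h1 h2] := coord_limit w; exists x.
have near (A : set (place F)) (d : place F -> nat) (X : set (Efam Fw D)) : finite_set A -> G X ->
    exists2 u, U u /\ X u & forall w, A w -> (u w)^-1 * l w - 1 \in oe (vw w) (d w)%:Z.
  move=> fA GX; have FG : Filter G := @filter_filter _ _ (@ultra_proper _ _ GU).
  have GI := @filter_bigI _ _ (fset_set A) (fun w => [set u | U u /\ (u w)^-1 * l w - 1 \in oe (vw w) (d w)%:Z]) G FG (fun w _ => (lP w).2 (d w)).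
  have [u [[hu Xu] hI]] := filter_ex (@filterI _ _ FG _ _ (@filterI _ _ FG _ _ G_U GX) GI).
  exists u => // w Aw.
  have wA : [set` fset_set A] w by rewrite /= in_fset_set //; apply/mem_set.
  exact: (hI w wA).2.
have finS := finite_places_above F S1_prime.
have GT : G setT by apply: filterS G_U.
have lU1 w : ~ S w -> U1 (k w) (l w).
  move=> nS; have [u [hu _] hc] := near [set w] (fun=> (k w + depth2 Fw w)%N) setT (finite_set1 w) GT.
  have [Tu _ uo] := hu; have un := T1ad_norm1 w Tu.
  have -> : l w = u w * ((u w)^-1 * l w) by rewrite mulVKr // qunit_norm1.
  apply: U1M; first exact: uo.
  apply: U1_close => //; last exact: hc.
  by apply: norm1M; [exact: norm1V|case: (lP w)].
have Tl : T1ad l.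
  split=> [w|]; first by case: (lP w).
  apply: sub_finite_set finS => w /= h; apply: contrapT => nS; apply: h.
  by apply/OEP; exact: U1_int (lU1 _ nS).
have lU : U l.
  split=> //.
  have [_ [_ _ [c0 nb] _]] := US_compact_open.
  have [u [[Tu uS uo] _] hc] := near _ c0 setT finS GT.
  have -> : Etrunc S1 l = Emul (Etrunc S1 u) (Etrunc S1 (Emul (fun w => (u w)^-1) l)).
    rewrite -EtruncM; congr (Etrunc _ _); apply: functional_extensionality_dep => w.
    by rewrite /Emul mulVKr // qunit_norm1 // T1ad_norm1.
  apply: USM => //; apply: nb; split; last first.
    by move=> w Sw; rewrite /Etrunc; case: pselect => // h /=; apply/OEgeP; exact: hc.
  split; last by move=> w nS; rewrite /Etrunc; case: pselect.
  have [nn ff] := T1adM (T1adV Tu) Tl; split=> [w|].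
    by rewrite /Etrunc; case: pselect => h /=; [exact: nn|exact: norm1_1].
  apply: sub_finite_set ff => w /= h ow; apply: h; rewrite /Etrunc; case: pselect => // ? /=.
  by apply/OEP; exact: rpred1.
exists l => // a [c ra].
have [u [hu [_ su]] hc] := near _ (deep c) _ (cond_fin (deep c)) (GS c).
by rewrite (deep_art1 lU hu hc ra) su.
Qed.

End Limit.

(** The sets [Sc c] of solutions on the ring class field of conductor c are nonempty and decrease
    along the directed set of conductors, so they generate a proper filter, which is refined to an
    ultrafilter. *)
Lemma galois_lift : exists2 l, U l & forall a, Einfty fplus art a -> art1 l a = rho a.
Proof.
pose Sc c := [set u | U u /\ forall a, rc c a -> art1 u a = rho a].
pose Fil : set (set (Efam Fw D)) := [set A | exists c, Sc c `<=` A].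
have PF : ProperFilter Fil.
  split; first by move=> [c hc]; have [u h1 h2] := level_exists c; exact: (hc u).
  split.
  - by exists cond0.
  - move=> A B [c hA] [c' hB]; exists (max_cond c c') => u [hu h]; split.
      by apply: hA; split=> // a ra; apply: h; exact: (rc_max c' ra).1.
    by apply: hB; split=> // a ra; apply: h; exact: (rc_max c ra).2.
  - by move=> A B AB [c hc]; exists c; exact: subset_trans AB.
have [G [GU FG]] := ultraFilterLemma PF.
by apply: (limit_exists GU) => c; apply: FG; exists c.
Qed.

End Level.
End Galois.

Lemma qconjmxM (k : fieldType) (D : k) r s t (A : 'M[quad D]_(r, s)) (B : 'M[quad D]_(s, t)) :
  conjmx (A *m B) = conjmx A *m conjmx B.
Proof. exact: map_mxM. Qed.
Lemma conjmx_tr (k : fieldType) (D : k) r s (A : 'M[quad D]_(r, s)) :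
  conjmx A^T = (conjmx A)^T.
Proof. by apply/matrixP => i j; rewrite !mxE. Qed.
Lemma conjmxK2 (k : fieldType) (D : k) r s (A : 'M[quad D]_(r, s)) : conjmx (conjmx A) = A.
Proof. by apply/matrixP => i j; rewrite !mxE qconjK. Qed.
Lemma conj_qinmx (k : fieldType) (D : k) r s (M : 'M[k]_(r, s)) : conjmx (qinmx D M) = qinmx D M.
Proof. by apply/matrixP => i j; rewrite !mxE qconj_qin. Qed.
Lemma qinmx_tr (k : fieldType) (D : k) r s (M : 'M[k]_(r, s)) : qinmx D M^T = (qinmx D M)^T.
Proof. by apply/matrixP => i j; rewrite !mxE. Qed.

(** * Norm one elements *)

Ltac slia := repeat match goal with H : ?P |- _ =>
   lazymatch type of P with Prop =>
     lazymatch P with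
     | context [leq] => fail | context [@Order.le] => fail | context [@Order.lt] => fail
     | @eq nat _ _ => fail | @eq int _ _ => fail | not (@eq nat _ _) => fail | context [@eq_op] => fail
     | or _ _ => fail
     | _ => clear H end end end; lia.

Set Default Proof Using "All".

Section NormOne.
Variables (F : fieldExtType rat) (D : F) (Fw : completions F) (v : place F).
Hypothesis D0 : D != 0.
Local Notation k := (Fw v).
Local Notation vv := (comp_val (Fw v)).
Local Notation Dv := (comp_inj (Fw v) D).
Local Notation Ek := (quad Dv).
Hypothesis two_unit : vunt vv 2%:R.
Variable b0 : k.
Local Notation eps := (Dv * b0 ^+ 2).
Hypothesis eps_unit : vunt vv eps.

Lemma b0_nz : b0 != 0.
Proof. by have := vunt_neq0 eps_unit; rewrite mulf_eq0 negb_or expf_eq0 => /andP[_]. Qed.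

Ltac qs := repeat (rewrite ?(@qreM (Fw v) (comp_inj (Fw v) D)) ?(@qimM (Fw v) (comp_inj (Fw v) D)) ?(@qreD (Fw v) (comp_inj (Fw v) D)) ?(@qimD (Fw v) (comp_inj (Fw v) D)) ?(@qreN (Fw v) (comp_inj (Fw v) D)) ?(@qimN (Fw v) (comp_inj (Fw v) D)) /=).
Definition eta1 : Ek := Quad Dv 0 b0.

Lemma qin_unit r (x : Ek) : vunt vv r -> x - qin Dv r \in oe vv 1 -> vunt vv (qnorm x).
Proof.
move=> ur h; have [t1 n1] := oeP _ _ _ h.
have -> : qnorm x = r ^+ 2 + (r * qtr (x - qin Dv r) + qnorm (x - qin Dv r)).
  by case: (x) => a b; rewrite /qnorm /qtr /=; ring.
apply: vunt_add; first exact: vuntX.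
rewrite rpredD //; first by apply: vpowMl t1; exact: vunt_int.
by apply: vpow_le n1.
Qed.

Lemma Eorder_unit_near (C : nat) r (x : Ek) : (0 < C)%N -> vunt vv r ->
  x - qin Dv r \in oe vv C%:Z -> Eorder_unit C x.
Proof.
move=> C0 ur h; have h1 : x - qin Dv r \in oe vv 1 by apply: oe_le h; slia.
have nu := qin_unit ur h1; have ux : x \is a GRing.unit by rewrite qunitE (vunt_neq0 nu).
have o1 : Eorder C x by apply/EorderP; exists r => //; exact: vunt_int.
split=> //; have xV : x^-1 = qin Dv (qnorm x)^-1 * qconj x.
  by apply: (mulrI ux); rewrite divrr // mulrCA qmul_conj -qinM mulVf ?(vunt_neq0 nu).
rewrite xV; apply: EorderM.
  apply/EorderP; exists (qnorm x)^-1; last by rewrite subrr rpred0.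
  by apply: vunt_int; exact: vuntV.
apply/EorderP; exists r; first exact: vunt_int.
by rewrite -(qconj_qin Dv) -rmorphB oe_conj.
Qed.

(** Hilbert 90 with 1 + t. It is a unit of the order of conductor C, being congruent modulo pi^C to
    1 + r, a unit because r is near 1 and 2 is a unit. *)
Lemma U1_near (C : nat) r (t : Ek) : (0 < C)%N -> t * qconj t = 1 -> r - 1 \in vpow vv 1 ->
  t - qin Dv r \in oe vv C%:Z -> U1 C t.
Proof.
move=> C0 nt hr ht; have u1r : vunt vv (1 + r).
  have -> : 1 + r = 2%:R + (r - 1) by ring.
  exact: vunt_add.
have ho : Eorder_unit C (1 + t).
  apply: (Eorder_unit_near C0 u1r); rewrite rmorphD rmorph1 /=.
  by rewrite opprD addrACA subrr add0r.
exists (1 + t) => //; have [ux _ _] := ho.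
have e : t * qconj (1 + t) = 1 + t by rewrite rmorphD rmorph1 /= mulrDr mulr1 nt addrC.
by rewrite -{1}e mulrK // qconj_unit.
Qed.

(** Cayley parametrization of the norm-one group: [Ny y] is 1 + y eta, and [tt y] = (1 + y eta) / (1
    - y eta) has coordinates [al y] and [be y] with respect to 1 and eta. The values y in pi^C give
    the group U^1_v(C) for C > 0. *)
Definition Ny (y : k) : Ek := Quad Dv 1 (y * b0).
Definition tt (y : k) : Ek := Ny y / qconj (Ny y).
Definition al (y : k) := (1 + eps * y ^+ 2) / (1 - eps * y ^+ 2).
Definition be (y : k) := 2%:R * y / (1 - eps * y ^+ 2).

Lemma den_unit y z : y \in vpow vv 1 -> z \in vpow vv 1 -> vunt vv (1 - eps * (y * z)).
Proof.
move=> hy hz; apply: vunt_add; first exact: vunt1.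
rewrite rpredN; apply: vpowMl; first exact: vunt_int.
by apply: vpowMr => //; apply: vpow_vint hz.
Qed.

Lemma Ny_unit y : y \in vpow vv 1 -> Ny y \is a GRing.unit.
Proof.
move=> hy; rewrite qunitE; have -> : qnorm (Ny y) = 1 - eps * (y * y) by rewrite /qnorm /=; ring.
exact: vunt_neq0 (den_unit hy hy).
Qed.

Lemma tt_norm1 y : y \in vpow vv 1 -> tt y * qconj (tt y) = 1.
Proof.
move=> hy; have u := Ny_unit hy; have cu := qconj_unit u.
by rewrite /tt rmorphM /= (qconjV cu) qconjK mulrA mulrVK // divrr.
Qed.

Lemma al_be y : y \in vpow vv 1 -> al y ^+ 2 - eps * be y ^+ 2 = 1.
Proof.
move=> hy; have := vunt_neq0 (den_unit hy hy); rewrite -expr2 /al /be => nz.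
by field.
Qed.

Lemma tt_al_be y : y \in vpow vv 1 -> tt y = qin Dv (al y) + qin Dv (be y) * eta1.
Proof.
move=> hy; have u := qconj_unit (Ny_unit hy); apply: (mulIr u); rewrite /tt mulrVK //.
have := vunt_neq0 (den_unit hy hy); rewrite -expr2 => nz.
apply: (@quadE _ Dv); rewrite /al /be /Ny /eta1; qs; [field; done|field; done].
Qed.

Lemma al_close (C : nat) y : (0 < C)%N -> y \in vpow vv C%:Z -> al y - 1 \in vpow vv (C + C)%N%:Z.
Proof.
move=> C0 hy; have hy1 : y \in vpow vv 1 by apply: vpow_le hy; slia.
have u := den_unit hy1 hy1; have nz := vunt_neq0 u.
have -> : al y - 1 = (1 - eps * (y * y))^-1 * (2%:R * (eps * (y * y))).
  by rewrite /al; move: nz; rewrite -expr2 => nz; field.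
apply: vpowMl; first by apply: vunt_int; exact: vuntV.
apply: vpowMl; first exact: vunt_int.
apply: vpowMl; first exact: vunt_int.
by have := vpowM hy hy; rewrite PoszD.
Qed.
Lemma be_close (C : nat) y : (0 < C)%N -> y \in vpow vv C%:Z -> be y \in vpow vv C%:Z.
Proof.
move=> C0 hy; have hy1 : y \in vpow vv 1 by apply: vpow_le hy; slia.
have u := den_unit hy1 hy1.
rewrite /be; apply: vpowMr; first by apply: vpowMl hy; exact: vunt_int.
by rewrite expr2; apply: vunt_int; exact: vuntV.
Qed.

Lemma eta1_int : eta1 \in oint vv.
Proof.
apply/oeP; rewrite /qtr /qnorm /= addr0 rpred0; split=> //.
by rewrite expr0n sub0r rpredN; exact: vunt_int.
Qed.

Lemma U1_tt (C : nat) y : (0 < C)%N -> y \in vpow vv C%:Z -> U1 C (tt y).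
Proof.
move=> C0 hy; have hy1 : y \in vpow vv 1 by apply: vpow_le hy; slia.
apply: (@U1_near C (al y)) => //; first exact: tt_norm1.
  by apply: vpow_le (al_close C0 hy); slia.
rewrite tt_al_be // addrC addKr; apply: oeMr; last exact: eta1_int.
by apply: oe_qin; exact: be_close.
Qed.

(** Writing t = a / abar with a = a1 + a2 eta, the real part a1 is a unit as C > 0, and y = a2 / a1
    does not change the quotient. *)
Lemma U1_ex_tt (C : nat) t : (0 < C)%N -> U1 C t -> exists2 y, y \in vpow vv C%:Z & t = tt y.
Proof.
move=> C0 [a [ua oa oaV] ->]; have bn := b0_nz.
pose a1 := qre a; pose a2 := qim a / b0.
have aE : a = Quad Dv a1 (a2 * b0) by apply: quadE; rewrite /= ?divfK.
have /EorderP[r hr hz] := oa; have [tz nz] := oeP _ _ _ hz.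
have h2 : a1 - r \in vpow vv C%:Z.
  have : 2%:R * (a1 - r) \in vpow vv C%:Z by rewrite mulr_natl mulr2n.
  by rewrite vpowMVl.
have ha2 : a2 \in vpow vv C%:Z.
  have h : eps * a2 ^+ 2 \in vpow vv (C%:Z + C%:Z).
    have -> : eps * a2 ^+ 2 = (a1 - r) ^+ 2 - qnorm (a - qin Dv r).
      by rewrite aE /qnorm /=; ring.
    by apply: rpredB => //; rewrite expr2; exact: vpowM.
  rewrite vpowMVl // in h; have [->|a0] := eqVneq a2 0; first exact: rpred0.
  by apply: vpow_sqr; rewrite mulr2n.
have a1i : a1 \in vint vv.
  by rewrite -[a1](subrK r) rpredD //; apply: vpow_vint h2.
have na : vunt vv (qnorm a).
  have ai := Eorder_int oa; have aVi := Eorder_int oaV.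
  have [_ n1] := oeP _ _ _ ai; have [_ n2] := oeP _ _ _ aVi.
  have e : qnorm a * qnorm a^-1 = 1 by rewrite -qnormM divrr // qnorm1.
  have nz1 : qnorm a != 0 by rewrite -qunitE.
  have e2 : qnorm a^-1 = (qnorm a)^-1 by apply: (mulfI nz1); rewrite e divff.
  rewrite /vunt nz1 /=; move: n1 n2; rewrite e2 !vpow_val ?invr_eq0 // placeV; clear; vlia.
have a1u : vunt vv a1.
  have h : vunt vv (a1 ^+ 2).
    have -> : a1 ^+ 2 = qnorm a + eps * a2 ^+ 2 by rewrite aE /qnorm /=; ring.
    apply: vunt_add => //; apply: vpowMl; first exact: vunt_int.
    by rewrite expr2; have := vpowM ha2 ha2; apply: vpow_le; slia.
  have nz2 := vunt_neq0 h.
  apply: (@vint_vunt _ vv a1 (a1 / a1 ^+ 2)) => //; first by rewrite mulrA -expr2 divff.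
  by apply: rpredM => //; apply: vunt_int; exact: vuntV.
have a1n := vunt_neq0 a1u.
pose y := a2 / a1.
have hy : y \in vpow vv C%:Z by apply: vpowMr => //; apply: vunt_int; exact: vuntV.
exists y => //; have hy1 : y \in vpow vv 1 by apply: vpow_le hy; slia.
have e : a = qin Dv a1 * Ny y.
  rewrite aE /y; apply: (@quadE _ Dv); qs; [field; done|field; done].
have q1 : qin Dv a1 \is a GRing.unit by rewrite qunitE qnorm_qin expf_neq0.
rewrite e rmorphM /= qconj_qin invrM // ?qconj_unit ?Ny_unit //.
by rewrite [qin _ _ * _]mulrC -mulrA [qin _ _ * _]mulrCA divrr // mulr1.
Qed.

Lemma tt_inj y z : y \in vpow vv 1 -> z \in vpow vv 1 -> tt y = tt z -> y = z.
Proof.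
move=> hy hz e; have uy := qconj_unit (Ny_unit hy); have uz := qconj_unit (Ny_unit hz).
have : Ny y * qconj (Ny z) = Ny z * qconj (Ny y).
  have : tt y * (qconj (Ny y) * qconj (Ny z)) = tt z * (qconj (Ny y) * qconj (Ny z)) by rewrite e.
  by rewrite /tt mulrA mulrVK // [qconj (Ny y) * qconj (Ny z)]mulrC mulrA mulrVK.
move=> /(congr1 (@qim _ _)); rewrite !qimM /= => /eqP; rewrite -subr_eq0 => /eqP h.
have h2 : 2%:R * b0 * (y - z) = 0 by rewrite -[RHS]h; ring.
move/eqP: h2; rewrite !mulf_eq0 (negbTE (vunt_neq0 two_unit)) (negbTE b0_nz) /= subr_eq0.
by move/eqP.
Qed.

(** Subtraction law of the parameter: y' = (z - y) / (1 - eps y z), with a unit as denominator.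
    Classes modulo U^1_v(C) thus correspond to classes of the parameter modulo pi^C. *)
Lemma tt_ldiv y z : y \in vpow vv 1 -> z \in vpow vv 1 ->
  exists y', [/\ (tt y)^-1 * tt z = tt y', y' \in vpow vv 1 &
     forall C : int, (y' \in vpow vv C) = (z - y \in vpow vv C)].
Proof.
move=> hy hz; pose d := 1 - eps * (y * z); have du : vunt vv d := den_unit hy hz.
have dn := vunt_neq0 du.
exists ((z - y) / d).
have hV C : ((z - y) / d \in vpow vv C) = (z - y \in vpow vv C).
  by rewrite mulrC vpowMVl // vuntV.
split=> //; last by rewrite hV rpredB.
have h' : (z - y) / d \in vpow vv 1 by rewrite hV rpredB.
have e : Ny z * qconj (Ny y) = qin Dv d * Ny ((z - y) / d).
  apply: (@quadE _ Dv); rewrite /Ny /d; qs; [field; done|field; done].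
have uy := Ny_unit hy; have uz := Ny_unit hz; have u' := Ny_unit h'.
have qd : qin Dv d \is a GRing.unit by rewrite qunitE qnorm_qin expf_neq0.
have e' := congr1 (@qconj _ _) e; rewrite !rmorphM /= qconjK qconj_qin in e'.
apply: (mulIr (qconj_unit u')); rewrite [RHS]mulrVK ?qconj_unit //.
apply: (mulrI qd); rewrite -e /tt.
rewrite mulrCA -e' invrM ?unitrV ?qconj_unit // invrK.
rewrite -!mulrA [_^-1 * (qconj (Ny z) * _)]mulKr ?qconj_unit //.
by rewrite [Ny z * Ny y]mulrC (mulKr uy) mulrC.
Qed.

End NormOne.
Unset Default Proof Using.

(** * Geometry at the place v *)

Section VwInd.
Variables (k : fieldType) (w : place k) (n : nat).
Hypothesis two_unit : vunt w 2%:R.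
Lemma vw_ind (Pr : 'cV[k]_n.*2.+1 -> Prop) :
  (forall x y, Pr x -> Pr y -> Pr (x + y)) -> (forall a x, Pr x -> Pr (a *: x)) ->
  (forall j, (j <= n)%N -> Pr (Vv k n j)) -> (forall j, (0 < j <= n)%N -> Pr (Ww k n j)) ->
  forall y, Pr y.
Proof.
move=> PD PZ hV hW y.
have P0 : Pr 0 by rewrite -(scale0r (Vv k n n)); apply: (PZ _ _); exact: hV.
have Pe (a : 'I_n.*2.+1) : Pr (ee k n a).
  case: (ltngtP a n) => an.
  - have -> : ee k n a = ee k n (n - (n - a)) by congr ee; move: an; clear; slia.
    rewrite (ee_pos n two_unit) ?subn_gt0 //; apply: (PZ _ _); apply: (PD _ _ _ _); [apply: (hV _ _)|apply: (hW _ _)].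
      exact: leq_subr.
    by rewrite subn_gt0 an leq_subr.
  - have -> : ee k n a = ee k n (n + (a - n)) by congr ee; move: an; clear; slia.
    have h : (a - n <= n)%N by have := ltn_ord a; clear; slia.
    rewrite (ee_neg n two_unit) ?subn_gt0 //; apply: (PZ _ _); apply: (PD _ _ _ _); first exact: hV.
    by rewrite -scaleN1r; apply: (PZ _ _); apply: (hW _ _); rewrite subn_gt0 an.
  - by rewrite an; exact: (hV 0%N (leq0n n)).
have -> : y = \sum_(a < n.*2.+1) y a 0 *: ee k n a.
  apply/matrixP => i j; rewrite ord1 summxE (bigD1 i) //= big1.
    by rewrite !mxE inord_val !eqxx mulr1 addr0.
  by move=> a ai; rewrite !mxE inord_val eq_sym (negbTE ai) mulr0.
by elim/big_rec: _ => // a x _ Px; apply: (PD _ _ _ _) => //; apply: (PZ _ _); exact: Pe.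
Qed.

Lemma form_ext (A A' : 'M[k]_n.*2.+1) :
  (forall i j, (i <= n)%N -> (j <= n)%N -> (Vv k n i)^T *m A *m Vv k n j = (Vv k n i)^T *m A' *m Vv k n j) ->
  (forall i j, (i <= n)%N -> (0 < j <= n)%N -> (Vv k n i)^T *m A *m Ww k n j = (Vv k n i)^T *m A' *m Ww k n j) ->
  (forall i j, (0 < i <= n)%N -> (j <= n)%N -> (Ww k n i)^T *m A *m Vv k n j = (Ww k n i)^T *m A' *m Vv k n j) ->
  (forall i j, (0 < i <= n)%N -> (0 < j <= n)%N -> (Ww k n i)^T *m A *m Ww k n j = (Ww k n i)^T *m A' *m Ww k n j) ->
  A = A'.
Proof.
move=> h1 h2 h3 h4; apply: trmx_inj; apply: (basis_ext two_unit) => j hj.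
  apply: trmx_inj; rewrite !trmx_mul !trmxK; apply: (basis_ext two_unit) => i hi; [exact: h1|exact: h2].
apply: trmx_inj; rewrite !trmx_mul !trmxK; apply: (basis_ext two_unit) => i hi; [exact: h3|exact: h4].
Qed.
End VwInd.

Lemma bool_int (k : fieldType) (w : place k) (bb : bool) : bb%:R \in vint w.
Proof. by case: bb; [exact: vint1|exact: rpred0]. Qed.

Lemma int_comb (k : fieldType) (w : place k) (a b' c d h : k) : a \in vint w -> b' \in vint w ->
  c \in vint w -> d \in vint w -> h \in vint w -> a * b' + c * (h * d) \in vint w.
Proof. by move=> ? ? ? ? ?; apply: rpredD; apply: rpredM => //; apply: rpredM. Qed.

Lemma int_comb2 (k : fieldType) (w : place k) (e a b' c d h : k) : e \in vint w -> a \in vint w -> b' \in vint w ->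
  c \in vint w -> d \in vint w -> h \in vint w -> e * (a * b') + c * (h * d) \in vint w.
Proof. by move=> ? ? ? ? ? ?; apply: rpredD; apply: rpredM => //; apply: rpredM. Qed.

Lemma qtr_imag_inj (k : fieldType) (D : k) (e t u : quad D) : 2%:R != 0 :> k -> D != 0 ->
  qim e != 0 -> qre e = 0 -> qtr (e * t) = qtr (e * u) -> qim t = qim u.
Proof.
move=> n2 nD ne re0; rewrite /qtr !qreM re0 !mul0r !add0r => h.
by apply: (mulfI ne); apply: (mulfI nD); apply: (mulfI n2); rewrite !mulr_natl !mulr2n.
Qed.

Set Default Proof Using "All".

Section Local.
Variables (F : fieldExtType rat) (D : F) (Fw : completions F) (n : nat).
Variables (Phi : 'M[F]_n.*2.+1) (W : hermitian_hyperplane D Phi) (v : place F).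
Hypotheses (D0 : D != 0) (n0 : (0 < n)%N).
Hypotheses (Phi_sym : Phi^T = Phi) (Phi_unit : Phi \in unitmx).
Local Notation k := (Fw v).
Local Notation phi := (comp_inj (Fw v)).
Local Notation vv := (comp_val (Fw v)).
Local Notation Dv := (comp_inj (Fw v) D).
Local Notation Ek := (quad Dv).
Hypothesis two_unit : vunt vv 2%:R.
Variables (eta : Ek) (ws vs : nat -> 'cV[k]_n.*2.+1).
Hypothesis lb : local_basis W eta ws vs.
Local Notation P := (PhiL Phi phi).
Local Notation p := (perpL W phi).
Local Notation cL := (coordL W phi).
Local Notation Ps := (PsiL W phi).
Local Notation qx := (qinmx Dv).
Local Notation b := (bil P).
Local Notation B := (frame ws vs).
Definition cW (x : 'cV[k]_n.*2.+1) : 'cV[Ek]_n := cL *m qx x.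
Definition hm x y : Ek := herm Ps (cW x) (cW y).

Lemma two0 : 2%:R != 0 :> k. Proof. exact: vunt_neq0 two_unit. Qed.

Lemma P_sym : P^T = P. Proof. by apply/matrixP => i j; rewrite !mxE -[in LHS]Phi_sym mxE. Qed.
Lemma P_unit : P \in unitmx. Proof. by rewrite /PhiL map_unitmx. Qed.

Lemma bsym x y : b x y = b y x.
Proof.
have e : x^T *m P *m y = (y^T *m P *m x)^T by rewrite !trmx_mul trmxK P_sym mulmxA.
by rewrite /bil e mxE.
Qed.
Lemma bDr x y z : b x (y + z) = b x y + b x z. Proof. by rewrite /bil mulmxDr mxE. Qed.
Lemma bZr a x y : b x (a *: y) = a * b x y. Proof. by rewrite /bil -scalemxAr mxE. Qed.
Lemma bNr x y : b x (- y) = - b x y. Proof. by rewrite /bil mulmxN mxE. Qed.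
Lemma bDl x y z : b (y + z) x = b y x + b z x. Proof. by rewrite !(bsym _ x) bDr. Qed.
Lemma bZl a x y : b (a *: y) x = a * b y x. Proof. by rewrite !(bsym _ x) bZr. Qed.
Lemma bNl x y : b (- y) x = - b y x. Proof. by rewrite !(bsym _ x) bNr. Qed.

Lemma cWD x y : cW (x + y) = cW x + cW y. Proof. by rewrite /cW /qinmx map_mxD mulmxDr. Qed.
Lemma cWZ a x : cW (a *: x) = qin Dv a *: cW x. Proof. by rewrite /cW /qinmx map_mxZ -scalemxAr. Qed.

Lemma qmap_qinmx r t (M : 'M[F]_(r, t)) : map_mx (@qmap F k phi D) (qinmx D M) = qx (map_mx phi M).
Proof. by apply/matrixP => i j; rewrite !mxE qmap_qin. Qed.
Lemma qmap_conjmx r t (M : 'M[quad D]_(r, t)) :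
  map_mx (@qmap F k phi D) (conjmx M) = conjmx (map_mx (@qmap F k phi D) M).
Proof. by apply/matrixP => i j; rewrite !mxE qmap_conj. Qed.

Lemma map_tr (R1 R2 : Type) (f : R1 -> R2) r t (M : 'M[R1]_(r, t)) : map_mx f M^T = (map_mx f M)^T.
Proof. by apply/matrixP => i j; rewrite !mxE. Qed.

Lemma formL : exists lam : k, qx P = (conjmx cL)^T *m Ps *m cL + conjmx ((conjmx cL)^T *m Ps *m cL)
   + qin Dv lam *: (qx (P *m p) *m qx (p^T *m P)).
Proof.
exists (phi (bil Phi (perp W) (perp W))^-1).
have := congr1 (map_mx (@qmap F k phi D)) (form_decomposition Phi_sym W).
rewrite !(map_mxD, map_mxZ, qmap_conjmx, qmap_qinmx, map_mxM, map_tr) /= qmap_qin.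
by [].
Qed.

Lemma perp0 y : b y p = 0 -> p^T *m P *m y = 0.
Proof.
rewrite bsym => h; apply/matrixP => i j; rewrite !ord1 [RHS]mxE.
exact: h.
Qed.

Lemma hermE x y : b y p = 0 -> b x y = qtr (hm x y).
Proof.
move=> hy; have [lam e] := formL.
have [A eA] : exists A, A = (conjmx cL)^T *m Ps *m cL by exists ((conjmx cL)^T *m Ps *m cL).
rewrite -eA in e.
have e2 : qx (x^T *m P *m y) = (qx x)^T *m A *m qx y + conjmx ((qx x)^T *m A *m qx y).
  rewrite !qconjmxM conjmx_tr !conj_qinmx !qinmxM qinmx_tr e !mulmxDr !mulmxDl.
  rewrite -[RHS]addr0; congr (_ + _).
  rewrite -scalemxAr -scalemxAl -!mulmxA -[qx (p^T *m P) *m _]qinmxM perp0 //.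
  by rewrite /qinmx map_mx0 !mulmx0 scaler0.
have hE : hm x y = ((qx x)^T *m A *m qx y) 0 0.
  by rewrite /hm /herm /cW eA qconjmxM conj_qinmx trmx_mul !mulmxA.
have e3 : (qx (x^T *m P *m y)) 0 0 = hm x y + qconj (hm x y).
  by rewrite e2 mxE -hE [X in _ + X]mxE -hE.
by have := congr1 (@qre _ _) e3; rewrite /qinmx mxE qreD.
Qed.

Lemma Ps_herm : (conjmx Ps)^T = Ps.
Proof. by rewrite /PsiL -qmap_conjmx map_trmx (Psi_herm W). Qed.

Lemma hmC x y : hm y x = qconj (hm x y).
Proof.
have entry (M : 'M[Ek]_1) : (conjmx M)^T 0 0 = qconj (M 0 0) by rewrite /Defs.conjmx !mxE.
have gen (X Y : 'cV[Ek]_n) : herm Ps X Y = qconj (herm Ps Y X).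
  have e : (conjmx X)^T *m Ps *m Y = (conjmx ((conjmx Y)^T *m Ps *m X))^T.
    by rewrite !qconjmxM !trmx_mul conjmx_tr trmxK conjmxK2 Ps_herm mulmxA.
  by rewrite /herm e; exact: entry.
exact: gen.
Qed.
Lemma hmZr e x y z : cW z = e *: cW y -> hm x z = e * hm x y.
Proof. by move=> h; rewrite /hm /herm h -scalemxAr mxE. Qed.
Lemma hmZl e x y z : cW z = e *: cW y -> hm z x = qconj e * hm y x.
Proof. by move=> h; rewrite hmC (hmZr x h) rmorphM /= -hmC. Qed.

Ltac qs_ := repeat (rewrite ?(@qreM (Fw v) (comp_inj (Fw v) D)) ?(@qimM (Fw v) (comp_inj (Fw v) D)) ?(@qreD (Fw v) (comp_inj (Fw v) D)) ?(@qimD (Fw v) (comp_inj (Fw v) D)) ?(@qreN (Fw v) (comp_inj (Fw v) D)) ?(@qimN (Fw v) (comp_inj (Fw v) D)) /=).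
Definition b0 := qim eta.
Definition eps := Dv * b0 ^+ 2.

Lemma eta_re : qre eta = 0.
Proof.
have [_ /(congr1 (@qre _ _))] := lb_eta lb; rewrite qreD /= => /eqP.
by rewrite -mulr2n -mulr_natl mulf_eq0 (negbTE two0) => /eqP.
Qed.
Lemma eta_sqr : eta * eta = qin Dv eps.
Proof. by apply: quadE; rewrite /eps /b0; qs_; rewrite ?eta_re; ring. Qed.
Lemma eta_conj : qconj eta = - eta.
Proof. by apply: quadE; qs_; rewrite ?eta_re ?oppr0. Qed.
Lemma eps_unit : vunt vv eps.
Proof.
have [[ue oe1 oe2] _] := lb_eta lb.
have nE : qnorm eta = - eps by rewrite /qnorm eta_re /eps /b0; ring.
have [_ h1] := oe1; have [_ h2] := oe2.
have ne0 : eps != 0 by move: ue; rewrite qunitE nE oppr_eq0.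
have nV : qnorm eta^-1 = - eps^-1.
  have : qnorm eta * qnorm eta^-1 = 1 by rewrite -qnormM divrr // qnorm1.
  by rewrite nE => h; apply: (mulfI (_ : - eps != 0)); rewrite ?oppr_eq0 // h mulrNN divff.
have a1 : eps \in vint vv by rewrite -[eps]opprK rpredN -nE; apply/vgeP.
have a2 : eps^-1 \in vint vv by rewrite -[eps^-1]opprK rpredN -nV; apply/vgeP.
rewrite /vunt ne0 /=; move: a1 a2; rewrite !vpow_val ?invr_eq0 // placeV; clear; vlia.
Qed.
Lemma b00 : b0 != 0.
Proof.
by have := vunt_neq0 eps_unit; rewrite /eps mulf_eq0 negb_or expf_eq0 => /andP[_].
Qed.

Definition beta i := b (ws i) (ws i).

Lemma vs_perp j : (j < n)%N -> b (vs j) p = 0 /\ cW (vs j) = eta *: cW (ws j.+1).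
Proof. by move=> jn; exact: (lb_vs lb (i := j.+1)). Qed.

Lemma hm_ne i j : (0 < i <= n)%N -> (0 < j <= n)%N -> i <> j -> hm (ws i) (ws j) = 0.
Proof. exact: (lb_orth lb). Qed.
Lemma hm_real i : qim (hm (ws i) (ws i)) = 0.
Proof.
have /(congr1 (@qim _ _)) /= /eqP := hmC (ws i) (ws i).
by rewrite -addr_eq0 -mulr2n -mulr_natl mulf_eq0 (negbTE two0) => /eqP.
Qed.

Lemma b_ww i j : (0 < i <= n)%N -> (0 < j <= n)%N -> b (ws i) (ws j) = if i == j then beta i else 0.
Proof.
move=> hi hj; case: eqP => [<- //|ij]; rewrite (hermE _ (lb_inW lb hj)) hm_ne //.
by rewrite /qtr /= addr0.
Qed.
Lemma b_wv i j : (0 < i <= n)%N -> (j <= n)%N -> b (ws i) (vs j) = 0.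
Proof.
move=> hi hj; have [jn|jn|jn] := ltngtP j n; last 1 first.
- by rewrite jn bsym; apply: (lb_vn lb).1; exact: (lb_inW lb).
- have [h1 h2] := vs_perp jn; rewrite (hermE _ h1) (hmZr _ h2).
  have [e|ne] := eqVneq i j.+1.
    by rewrite -e /qtr qreM hm_real eta_re mul0r !mulr0 !addr0.
  by rewrite hm_ne // ?mulr0 /qtr /= ?addr0 //; exact/eqP.
- by move: hj; rewrite leqNgt jn.
Qed.
Lemma b_vv1 i j : (i < n)%N -> (j < n)%N -> b (vs i) (vs j) = if i == j then - (eps * beta i.+1) else 0.
Proof.
move=> hi hj; have [h1 h2] := vs_perp hi; have [h3 h4] := vs_perp hj.
rewrite (hermE _ h3) (hmZr _ h4) (hmZl _ h2).
have [e|ne] := eqVneq i j.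
  rewrite -e mulrA eta_conj mulrN eta_sqr /beta (hermE _ (lb_inW lb (_ : 0 < i.+1 <= n)%N)) //.
  by rewrite mulNr qtrN qtr_qinM.
have -> : hm (ws i.+1) (ws j.+1) = 0 by apply: hm_ne => // -[e]; case/eqP: ne.
by rewrite !mulr0 /qtr /= addr0.
Qed.

Lemma b_vnorm j : (0 < j <= n)%N -> b (vs j) (vs j) = - beta j.
Proof. by move=> hj; have /eqP := lb_norm lb hj; rewrite addrC addr_eq0 => /eqP. Qed.

Lemma b_vv i j : (i <= n)%N -> (j <= n)%N -> i <> j -> b (vs i) (vs j) = 0.
Proof.
move=> hi hj ij; have [ei|ni] := eqVneq i n.
  rewrite ei; apply: (lb_vn lb).1; apply: (vs_perp _).1; move: hj ij; rewrite ei; slia.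
have [ej|nj] := eqVneq j n.
  rewrite ej bsym; apply: (lb_vn lb).1; apply: (vs_perp _).1; move: hi ni; slia.
by rewrite b_vv1 ?ltn_neqAle ?ni ?nj //; case: eqP.
Qed.

(** The antidiagonal Gram entries: phi(e_0, e_0) = phi(v_0, v_0) = - eps phi(w_1, w_1), and phi(e_j,
    e_(-j)) = - phi(w_j, w_j) / 2 by the normalization of the basis. The sum of truncated
    differences is the distance from i to n. *)
Definition cc (i : 'I_n.*2.+1) : k :=
  if i == n :> nat then - (eps * beta 1) else - (2%:R^-1 * beta ((i - n) + (n - i))%N).

Lemma beta_unit j : (0 < j <= n)%N -> vunt vv (beta j).
Proof. by move=> hj; have [a e] := lb_unit lb hj; rewrite /vunt a /=; apply/eqP. Qed.

Lemma cc_unit i : vunt vv (cc i).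
Proof.
rewrite /cc; case: eqP => [_|ne]; apply: vuntN.
  have h1 : (0 < 1 <= n)%N by rewrite /= n0.
  exact: (vuntM eps_unit (beta_unit h1)).
have h1 : (0 < i - n + (n - i) <= n)%N by have := ltn_ord i; move: ne; slia.
exact: (vuntM (vuntV two_unit) (beta_unit h1)).
Qed.
Lemma cc_rev i : cc (rev_ord i) = cc i.
Proof.
rewrite /cc /=; have := ltn_ord i => hi.
have -> : (n.*2.+1 - i.+1 == n :> nat)%N = (i == n :> nat)%N by apply/eqP/eqP; slia.
case: eqP => // ne; congr (- (_ * beta _)); slia.
Qed.

Lemma nu_cc j : (j <= n)%N -> nu cc j = b (vs j) (vs j).
Proof.
move=> hj; rewrite /nu; have nd : (n < n.*2.+1)%N by slia.
case: j hj => [_|j hj] /=.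
  by rewrite /cc inordK // eqxx b_vv1 // eqxx.
have jd : (n - j.+1 < n.*2.+1)%N by slia.
rewrite /cc inordK //; have -> : (n - j.+1 == n)%N = false by apply/eqP; slia.
have -> : (n - j.+1 - n + (n - (n - j.+1)) = j.+1)%N by slia.
by rewrite b_vnorm // mulrN mulrA divff ?two0 // mul1r.
Qed.

Lemma nu_eps j : (j < n)%N -> nu cc j = eps * nu cc j.+1.
Proof.
move=> hj; rewrite !nu_cc ?(ltnW hj) // b_vv1 // eqxx b_vnorm //.
by rewrite mulrN.
Qed.

Lemma frame_ee a : (a <= n)%N -> B *m ee k n (n - a) = (if (0 < a)%N then 2%:R^-1 *: (vs a + ws a) else vs 0%N).
Proof.
move=> an; have ad : (n - a < n.*2.+1)%N by slia.
apply/matrixP => i j; rewrite ord1 mul_ee /frame mxE inordK //.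
have nn := n0; case: (posnP a) => [a0|a0].
  have -> : (n - a < n)%N = false by slia.
  by have -> : (n - a == n :> nat)%N by apply/eqP; slia.
have -> : (n - a < n)%N by slia.
by have -> : (n - (n - a) = a)%N by slia.
Qed.
Lemma frame_ee2 a : (0 < a <= n)%N -> B *m ee k n (n + a) = 2%:R^-1 *: (vs a - ws a).
Proof.
move=> an; have ad : (n + a < n.*2.+1)%N by slia.
apply/matrixP => i j; rewrite ord1 mul_ee /frame mxE inordK //.
have -> : (n + a < n)%N = false by slia.
have -> : (n + a == n :> nat)%N = false by apply/eqP; slia.
by have -> : (n + a - n = a)%N by slia.
Qed.
Lemma half2 (x : 'cV[k]_n.*2.+1) : 2%:R^-1 *: (x + x) = x.
Proof. by rewrite -mulr2n -scaler_nat scalerA mulVf ?scale1r ?two0. Qed.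

Lemma frame_Vv j : (j <= n)%N -> B *m Vv k n j = vs j.
Proof.
move=> hj; rewrite /Vv; case: eqP => [->|/eqP j0].
  by have := frame_ee (leq0n n); rewrite subn0.
have j0' : (0 < j)%N by rewrite lt0n.
rewrite mulmxDr frame_ee // j0' frame_ee2 ?j0' // -scalerDr.
by rewrite addrACA subrr addr0 half2.
Qed.
Lemma frame_Ww j : (0 < j <= n)%N -> B *m Ww k n j = ws j.
Proof.
move=> /andP[j0 hj]; rewrite /Ww mulmxBr frame_ee // j0 frame_ee2 ?j0 // -scalerBr.
have -> : vs j + ws j - (vs j - ws j) = ws j + ws j.
  by apply/matrixP => a e; rewrite !mxE; ring.
exact: half2.
Qed.

Lemma gram : B^T *m P *m B = antidiag cc.
Proof.
have E x y x' y' : B *m x = x' -> B *m y = y' -> x^T *m (B^T *m P *m B) *m y = (b x' y')%:M.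
  move=> <- <-; apply/matrixP => i j; rewrite !ord1 [RHS]mxE eqxx mulr1n /bil trmx_mul.
  by rewrite !mulmxA.
have E2 (x y : 'cV[k]_n.*2.+1) : x^T *m antidiag cc *m y = (bl cc x y)%:M.
  by apply/matrixP => i j; rewrite !ord1 [RHS]mxE eqxx mulr1n.
apply: (form_ext two_unit) => i j hi hj.
- rewrite (E _ _ _ _ (frame_Vv hi) (frame_Vv hj)) E2 (bl_VV cc_rev two_unit hi hj).
  by case: eqP => [<-|ij]; [rewrite nu_cc|rewrite b_vv].
- by rewrite (E _ _ _ _ (frame_Vv hi) (frame_Ww hj)) E2 (bl_VW cc_rev two_unit hi hj) bsym b_wv.
- have e : bl cc (Ww k n i) (Vv k n j) = 0 by rewrite (blC cc_rev) (bl_VW cc_rev two_unit hj hi).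
  by rewrite (E _ _ _ _ (frame_Ww hi) (frame_Vv hj)) E2 e b_wv.
- rewrite (E _ _ _ _ (frame_Ww hi) (frame_Ww hj)) E2 (bl_WW cc_rev hi hj) b_ww //.
  case: eqP => [_|//]; have hi2 : (i <= n)%N by case/andP: hi.
  by rewrite (nu_cc hi2) (b_vnorm hi) opprK.
Qed.

Lemma cc_nz i : cc i != 0. Proof. exact: vunt_neq0 (cc_unit i). Qed.

Lemma B_unit : B \in unitmx.
Proof.
have h := antidiagV cc_nz cc_rev; rewrite -gram in h.
have h' : (antidiag (fun i => (cc i)^-1) *m (B^T *m P)) *m B = 1%:M by rewrite -mulmxA.
by have [_] := mulmx1_unit h'.
Qed.

Local Notation cj X := (B *m X *m invmx B).
Lemma cjK X : invmx B *m cj X *m B = X.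
Proof. by rewrite !mulmxA mulVmx ?B_unit // mul1mx -mulmxA mulVmx ?B_unit // mulmx1. Qed.
Lemma SOw_SOJ x : SOw Phi x <-> SOJ cc (invmx B *m x *m B).
Proof.
have dB : \det (invmx B *m x *m B) = \det x.
  rewrite !det_mulmx det_inv mulrAC mulVr ?mul1r //; have := B_unit; by rewrite unitmxE.
have e : (invmx B *m x *m B)^T *m antidiag cc *m (invmx B *m x *m B) = B^T *m (x^T *m P *m x) *m B.
  rewrite -gram !trmx_mul trmx_inv.
  have BT : invmx B^T *m B^T = 1%:M by rewrite mulVmx // unitmx_tr B_unit.
  rewrite -!mulmxA [B *m (invmx B *m _)]mulmxA mulmxV ?B_unit // mul1mx.
  by rewrite [invmx B^T *m _]mulmxA BT mul1mx.
split=> [[xP dx]|[xo dx]]; split; rewrite ?dB //.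
- by rewrite /orth e -gram; congr (_ *m _ *m _).
- move: xo; rewrite /orth e -gram => h.
  have BTu : B^T \in unitmx by rewrite unitmx_tr B_unit.
  by move/(can_inj (mulmxK B_unit)): h => /(can_inj (mulKmx BTu)).
- by rewrite -dB.
Qed.

Lemma SOJ_SOw X : SOJ cc X -> SOw Phi (cj X).
Proof. by move=> h; apply/SOw_SOJ; rewrite cjK. Qed.

Local Notation T := (Tm n eps).

Lemma bpp : b p p != 0.
Proof.
have e : p^T *m P *m p = map_mx phi ((perp W)^T *m Phi *m perp W).
  by rewrite !map_mxM map_tr.
have -> : b p p = phi (bil Phi (perp W) (perp W)) by rewrite /bil e mxE.
by rewrite fmorph_eq0 (perp_aniso W).
Qed.

Lemma cW_p : cW p = 0.
Proof. by rewrite /cW -qmap_qinmx -map_mxM (coordW_perp W) map_mx0. Qed.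

Lemma bnondeg u : (forall z, b z u = 0) -> u = 0.
Proof.
move=> h; have e : P *m u = 0.
  apply/matrixP => i j; rewrite ord1 [RHS]mxE -[RHS](h (delta_mx i 0)).
  by rewrite /bil trmx_delta -mulmxA -rowE [RHS]mxE.
by rewrite -[u](mulKmx P_unit) e mulmx0.
Qed.

Lemma vn_p : exists2 lam, lam != 0 & vs n = lam *: p.
Proof.
pose lam := b (vs n) p / b p p; pose u := vs n - lam *: p.
have pu : b p u = 0 by rewrite /u bDr bNr bZr /lam divfK ?bpp // bsym subrr.
have hu z : b z u = 0.
  pose m := b z p / b p p; rewrite -[z](subrK (m *: p)) bDl bZl pu mulr0 addr0.
  have zp : b (z - m *: p) p = 0 by rewrite bDl bNl bZl /m divfK ?bpp // subrr.
  rewrite /u bDr bNr bZr zp mulr0 subr0 bsym; exact: (lb_vn lb).1.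
have e : vs n = lam *: p by apply/eqP; rewrite -subr_eq0 -/u (bnondeg hu).
exists lam => //; apply/eqP => l0; have [h _] := (lb_vn lb).2.
by case/eqP: h; rewrite {1}e l0 scale0r /bil trmx0 !mul0mx mxE.
Qed.

Lemma cW_vn : cW (vs n) = 0.
Proof. by have [lam _ ->] := vn_p; rewrite cWZ cW_p scaler0. Qed.

Lemma perp_vn z : b z (vs n) = 0 -> b z p = 0.
Proof.
have [lam l0 ->] := vn_p; rewrite bZr => /eqP; rewrite mulf_eq0 (negbTE l0) /=.
by move/eqP.
Qed.

(** The coordinate map also kills v_n, which spans the orthogonal of W; hence the identity holds on
    all of V. *)
Lemma cW_T y : cW (B *m (T *m y)) = eta *: cW (B *m y).
Proof.
apply: (vw_ind two_unit (Pr := fun y => cW (B *m (T *m y)) = eta *: cW (B *m y))).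
- by move=> x z hx hz; rewrite !mulmxDr !cWD hx hz scalerDr.
- by move=> a x hx; rewrite -!scalemxAr !cWZ hx !scalerA mulrC.
- move=> j hj; have [jn|jn|jn] := ltngtP j n; last 1 first.
  + rewrite jn (@TmVn _ _ _ _ cc_unit cc_rev two_unit eps) mulmx0 frame_Vv // cW_vn scaler0.
    by rewrite /cW /qinmx map_mx0 mulmx0.
  + have hj1 : (0 < j.+1 <= n)%N by [].
    have h1 : T *m Vv k n j = eps *: Ww k n j.+1 by exact: (@TmV _ _ _ _ cc_unit cc_rev two_unit eps _ jn).
    have h2 : B *m (eps *: Ww k n j.+1) = eps *: ws j.+1 by rewrite -scalemxAr (frame_Ww hj1).
    by rewrite h1 h2 (frame_Vv (ltnW jn)) cWZ (vs_perp jn).2 scalerA eta_sqr.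
  + by move: hj; rewrite leqNgt jn.
- move=> j hj; rewrite (@TmW _ _ _ _ cc_unit cc_rev two_unit eps _ hj) (frame_Ww hj).
  have jn : (j.-1 < n)%N by move: hj; slia.
  rewrite frame_Vv ?(ltnW jn) // (vs_perp jn).2 prednK //.
  by case/andP: hj.
Qed.

Definition Mc : 'M[Ek]_n := \matrix_(a, j) cW (ws j.+1) a 0.
Lemma Mc_unit : Mc \in unitmx. Proof. exact: (lb_basis lb). Qed.
Lemma col_Mc j : col j Mc = cW (ws j.+1).
Proof. by apply/matrixP => a i; rewrite !mxE ord1. Qed.

Lemma gram_col (Q : 'M[Ek]_n) (M : 'M[Ek]_n) i j :
  ((conjmx M)^T *m Q *m M) i j = herm Q (col i M) (col j M).
Proof.
rewrite /herm !mxE; apply: eq_bigr => r _; rewrite !mxE; congr (_ * _).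
by apply: eq_bigr => s _; rewrite !mxE.
Qed.

Lemma det_conjmx m (h : 'M[Ek]_m) : \det (conjmx h) = qconj (\det h).
Proof. exact: det_map_mx. Qed.

Lemma Ps_unit : Ps \in unitmx.
Proof.
have := Psi_nondeg W; rewrite !unitmxE => h.
have -> : \det Ps = @qmap F k phi D (\det (Psi W)) by rewrite /PsiL det_map_mx.
exact: rmorph_unit.
Qed.

Lemma unitary_norm1 (h : 'M[Ek]_n) : (conjmx h)^T *m Ps *m h = Ps -> \det h * qconj (\det h) = 1.
Proof.
move=> /(congr1 determinant); rewrite !det_mulmx det_tr det_conjmx => e.
have u := Ps_unit; rewrite unitmxE in u; apply: (mulIr u); rewrite mul1r -[RHS]e; ring.
Qed.

Lemma qx_ext (A A' : 'M[Ek]_(n, n.*2.+1)) :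
  (forall y : 'cV[k]_n.*2.+1, A *m qx y = A' *m qx y) -> A = A'.
Proof.
move=> hA; apply/matrixP => i j.
have dj : qx (delta_mx j 0 : 'cV[k]_n.*2.+1) = delta_mx j 0.
  by apply/matrixP => r s; rewrite !mxE; case: (_ && _).
have := congr1 (fun M : 'cV[Ek]_n => M i 0) (hA (delta_mx j 0)).
by rewrite dj -!colE !mxE.
Qed.

(** Commutation with T makes X linear over E on W, so h is defined by the images of the w_j. It is
    unitary because a value of psi is determined by its trace and by the trace of its product with
    eta, and these two traces are values of phi on w_j and v_(j-1), which X preserves. *)
Lemma unitary_point X : SOJ cc X -> X *m T = T *m X -> X *m Vv k n n = Vv k n n ->
  exists h, [/\ Upt W (cj X) h, h *m Mc = \matrix_(a, j) cW (B *m (X *m Ww k n j.+1)) a 0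
     & forall y, cW (B *m (X *m y)) = h *m cW (B *m y)].
Proof.
move=> SX XT Xn; pose MX : 'M[Ek]_n := \matrix_(a, j) cW (B *m (X *m Ww k n j.+1)) a 0.
pose h := MX *m invmx Mc; have hM : h *m Mc = MX by rewrite /h mulmxKV // Mc_unit.
have hw (j : 'I_n) : h *m cW (ws j.+1) = cW (B *m (X *m Ww k n j.+1)).
  rewrite -col_Mc -col_mulmx hM; apply/matrixP => a i; by rewrite !mxE ord1.
have XV j : (j < n)%N -> X *m Vv k n j = T *m (X *m Ww k n j.+1).
  move=> jn; have hj1 : (0 < j.+1 <= n)%N by [].
  have -> : Vv k n j = T *m Ww k n j.+1 by rewrite (@TmW _ _ _ _ cc_unit cc_rev two_unit eps _ hj1).
  by rewrite mulmxA XT -mulmxA.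
have hP y : cW (B *m (X *m y)) = h *m cW (B *m y).
  apply: (vw_ind two_unit (Pr := fun y => cW (B *m (X *m y)) = h *m cW (B *m y))).
  - by move=> x z hx hz; rewrite !mulmxDr !cWD hx hz mulmxDr.
  - by move=> a x hx; rewrite -!scalemxAr !cWZ hx scalemxAr.
  - move=> j hj; have [jn|jn|jn] := ltngtP j n; last 1 first.
    + by rewrite jn Xn frame_Vv // cW_vn mulmx0.
    + rewrite XV // cW_T -(hw (Ordinal jn)) frame_Vv // (vs_perp jn).2.
      by rewrite scalemxAr.
    + by move: hj; rewrite leqNgt jn.
  - move=> j hj; have jn : (j.-1 < n)%N by move: hj; slia.
    have e : j.-1.+1 = j by rewrite prednK //; case/andP: hj.
    by have := hw (Ordinal jn); rewrite /= e frame_Ww.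
exists h; split=> //; have SO := SOJ_SOw SX.
have Bu := B_unit.
have bX x y : b (B *m (X *m x)) (B *m (X *m y)) = b (B *m x) (B *m y).
  have e : (cj X)^T *m P *m cj X = P := SO.1.
  have f z : B *m (X *m z) = cj X *m (B *m z) by rewrite -!mulmxA mulKmx.
  rewrite !f /bil trmx_mul -{2}e; by rewrite !mulmxA.
have wp j : (0 < j <= n)%N -> b (B *m (X *m Ww k n j)) p = 0.
  move=> hj; apply: perp_vn.
  have h' := bX (Ww k n j) (Vv k n n); rewrite Xn (frame_Vv (leqnn n)) (frame_Ww hj) in h'.
  by rewrite h' b_wv.
have cXn : cj X *m vs n = vs n.
  by rewrite -[vs n]frame_Vv // -!mulmxA mulKmx // Xn.
split.
- exact: SO.
- have McT : (conjmx Mc)^T \in unitmx.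
    have := Mc_unit; rewrite unitmx_tr !unitmxE det_conjmx; exact: qconj_unit.
  suff e : (conjmx Mc)^T *m ((conjmx h)^T *m Ps *m h) *m Mc = (conjmx Mc)^T *m Ps *m Mc.
    by move/(can_inj (mulmxK Mc_unit)): e => /(can_inj (mulKmx McT)).
  have -> : (conjmx Mc)^T *m ((conjmx h)^T *m Ps *m h) *m Mc = (conjmx MX)^T *m Ps *m MX.
    by rewrite -hM qconjmxM trmx_mul !mulmxA.
  apply/matrixP => i j.
  have cMX a : col a MX = cW (B *m (X *m Ww k n a.+1)).
    by apply/matrixP => r s; rewrite !mxE ord1.
  apply: (etrans (etrans (gram_col Ps MX i j) (f_equal2 (herm Ps) (cMX i) (cMX j)))); apply: esym.
  apply: (etrans (etrans (gram_col Ps Mc i j) (f_equal2 (herm Ps) (col_Mc i) (col_Mc j)))); apply: esym.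
  change (hm (B *m (X *m Ww k n i.+1)) (B *m (X *m Ww k n j.+1)) = hm (ws i.+1) (ws j.+1)).
  have hi : (0 < i.+1 <= n)%N by rewrite ltn_ord.
  have hj : (0 < j.+1 <= n)%N by rewrite ltn_ord.
  have jn : (j < n)%N := ltn_ord j.
  set t1 := hm _ _; set t2 := hm _ _.
  have q1 : qtr t1 = qtr t2.
    by rewrite /t1 /t2 -(hermE _ (wp _ hj)) -(hermE _ (lb_inW lb hj)) bX (frame_Ww hi) (frame_Ww hj).
  have q2 : qtr (eta * t1) = qtr (eta * t2).
    have [h3 h4] := vs_perp jn.
    have vp : b (B *m (X *m Vv k n j)) p = 0.
      apply: perp_vn.
      have h' := bX (Vv k n j) (Vv k n n); rewrite Xn (frame_Vv (leqnn n)) (frame_Vv (ltnW jn)) in h'.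
      have ne : nat_of_ord j <> n by move=> e'; move: jn; rewrite e' ltnn.
      exact: (etrans h' (b_vv (ltnW jn) (leqnn n) ne)).
    have e1 : cW (B *m (X *m Vv k n j)) = eta *: cW (B *m (X *m Ww k n j.+1)).
      exact: (etrans (congr1 (fun z => cW (B *m z)) (XV _ jn)) (cW_T (X *m Ww k n j.+1))).
    rewrite /t1 /t2 -(hmZr _ e1) -(hmZr _ h4) -(hermE _ vp) -(hermE _ h3) bX.
    by rewrite (frame_Ww hi) (frame_Vv (ltnW jn)).
  have t2nz := two0; have dn : Dv != 0 by exact: Dw0.
  have [bn en] := (b00, eta_re); clearbody t1 t2.
  apply: quadE.
    apply: (mulfI t2nz); rewrite !mulr_natl !mulr2n; exact: q1.
  exact: (qtr_imag_inj t2nz dn bn en q2).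
- have [lam l0 e] := vn_p; move: cXn; rewrite e -scalemxAr => /(congr1 (GRing.scale lam^-1)).
  by rewrite !scalerA mulVf // !scale1r.
- apply: qx_ext => y.
  have cWM (Z : 'M[k]_n.*2.+1) : cW (Z *m y) = cL *m qx Z *m qx y.
    first [by rewrite /cW qinmxM mulmxA|by rewrite /cW /qinmx map_mxM mulmxA].
  have -> : cL *m qx (cj X) *m qx y = cW (cj X *m y) by exact: (esym (cWM (cj X))).
  have -> : h *m cL *m qx y = h *m cW y by rewrite /cW mulmxA.
  have -> : cj X *m y = B *m (X *m (invmx B *m y)) by rewrite !mulmxA.
  by rewrite hP (mulKVmx Bu).
Qed.

Local Notation ycol j := (ee k n (n + j)).

(** For j > 0 the vector e_(-j) is (eta w_(j+1) - w_j) / 2, and e_0 = eta w_1, so the transition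
    matrix to the w_j is triangular with unit diagonal. *)
Lemma Y_unit : cL *m qx B *m qx (Ymx k n) \in unitmx.
Proof.
pose Tri : 'M[Ek]_n := \matrix_(a, j) (if a == j then (if (j == 0 :> nat)%N then eta else qin Dv 2%:R^-1 * eta)
   else if (a.+1 == j :> nat)%N then - qin Dv 2%:R^-1 else 0).
have e : cL *m qx B *m qx (Ymx k n) = Mc *m Tri.
  apply/matrixP => a j.
  have cY : cW (B *m ycol j) = col j (cL *m qx B *m qx (Ymx k n)).
    rewrite -mulmxA !col_mulmx /cW qinmxM; congr (_ *m (_ *m _)).
    by apply/matrixP => r t; rewrite (ord1 t) /ee /Ymx /qinmx !mxE eqxx andbT.
  have -> : (cL *m qx B *m qx (Ymx k n)) a j = cW (B *m ycol j) a 0 by rewrite cY [RHS]mxE.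
  have jn := ltn_ord j; have ejj : Tri j j = if (j == 0 :> nat)%N then eta else qin Dv 2%:R^-1 * eta.
    by rewrite mxE eqxx.
  rewrite [RHS]mxE (bigD1 j) //= ejj [Mc a j]mxE; case: (posnP j) => [j0|j0].
    have -> : ycol j = Vv k n 0 by rewrite /Vv eqxx j0 addn0.
    rewrite (frame_Vv (leq0n n)) (vs_perp n0).2 big1 ?addr0; last first.
      by move=> r rj; rewrite [Tri r j]mxE (negbTE rj) j0 /= mulr0.
    by rewrite [LHS]mxE mulrC j0.
  have hj : (0 < j <= n)%N by rewrite j0 ltnW.
  rewrite (frame_ee2 hj) cWZ -[- ws j]scaleN1r cWD cWZ (vs_perp jn).2.
  have pj : (j.-1 < n)%N by move: jn; slia.
  have nej : Ordinal pj != j by rewrite -val_eqE /=; apply/eqP; move: j0; slia.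
  rewrite (bigD1 (Ordinal pj)) //= big1 ?addr0; last first.
    move=> r /andP[rj rp]; rewrite [Tri r j]mxE (negbTE rj).
    case: eqP => [e|_]; last by rewrite mulr0.
    by case/eqP: rp; apply/val_inj => /=; rewrite -e.
  rewrite [Tri _ _]mxE (negbTE nej) /= prednK // eqxx [Mc a _]mxE /= prednK //.
  move: (cW (ws j.+1)) (cW (ws j)) => X Y; rewrite !mxE rmorphN1; ring.
have td : \det Tri \is a GRing.unit.
  rewrite -det_tr det_trig; last first.
    apply/is_trig_mxP => i j ij; rewrite !mxE; case: eqP => [e'|_]; first by rewrite e' ltnn in ij.
    by case: eqP => // e'; move: ij; rewrite -e'; slia.
  elim/big_rec: _ => [|i x _ ux]; first exact: unitr1.
  rewrite unitrM ux andbT !mxE eqxx; have [[ue _ _] _] := lb_eta lb.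
  case: ifP => // _; rewrite unitrM ue andbT qunitE qnorm_qin expf_neq0 ?invr_eq0 //.
  exact: two0.
by rewrite e unitmx_mul Mc_unit unitmxE td.
Qed.

(** In the basis of the e_(-j), 0 <= j < n, the map h has the matrix m + eta m' of [Y_basis], with
    m' divisible by pi^C. Its determinant is congruent modulo pi^C to that of m, which lies in F_v
    and is near 1, so that [U1_near] applies. *)
Lemma unitary_det (C : nat) X (h : 'M[Ek]_n) : (0 < C)%N -> orth cc X -> X *m Vv k n n = Vv k n n ->
  (forall a b, X a b - (a == b)%:R \in vpow vv 1) ->
  (forall l i : 'I_n, X (topi l) (inord (n + i)) \in vpow vv C%:Z) ->
  (forall y, cW (B *m (X *m y)) = h *m cW (B *m y)) -> \det h * qconj (\det h) = 1 ->
  U1 C (\det h).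
Proof.
move=> C0 oX Xn X1 XC hP nh.
have [m [m' [e m1 _ m'C]]] := Y_basis cc_unit cc_rev two_unit n0 eps_unit nu_eps oX Xn X1 XC.
have H1 : cL *m qx B *m qx X = h *m (cL *m qx B).
  by apply: qx_ext => y; have := hP y; rewrite /cW !qinmxM !mulmxA.
have H2 : cL *m qx B *m qx T = eta *: (cL *m qx B).
  by apply: qx_ext => y; have := cW_T y; rewrite /cW !qinmxM !mulmxA -scalemxAl.
set MY := cL *m qx B *m qx (Ymx k n); pose Q := qx m + eta *: qx m'.
have hMY : h *m MY = MY *m Q.
  have qxD (M1 M2 : 'M[k]_(n.*2.+1, n)) : qx (M1 + M2) = qx M1 + qx M2 by rewrite /qinmx map_mxD.
  rewrite /MY mulmxA -H1 -mulmxA -qinmxM e qxD !qinmxM mulmxDr /Q [RHS]mulmxDr -scalemxAr.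
  congr (_ + _); first by rewrite mulmxA.
  by rewrite mulmxA H2 -scalemxAl !mulmxA.
have dh : \det h = \det Q.
  have := congr1 determinant hMY; rewrite !det_mulmx [RHS]mulrC.
  by apply: mulIr; have := Y_unit; rewrite unitmxE.
have etai : eta \in oint vv by apply/OEP; case: (lb_eta lb) => -[].
have mi i j : qin Dv (m i j) \in oint vv.
  apply: oe_qin; rewrite -[m i j](subrK (i == j)%:R); apply: rpredD; last exact: bool_int.
  by apply: vpow_vint (m1 i j).
have dQ : \det Q - qin Dv (\det m) \in oe vv C%:Z.
  have -> : qin Dv (\det m) = \det (qx m) by rewrite det_map_mx.
  have QI i j : Q i j - qx m i j \in oe vv C%:Z.
    have -> : Q i j - qx m i j = eta * qin Dv (m' i j) by rewrite !mxE addrC addKr.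
    by apply: oeMl => //; apply: oe_qin.
  apply: (@det_congr _ (oint vv) (oe vv C%:Z)).
  - exact: rpred1.
  - by move=> x z; exact: rpredM.
  - exact: rpred0.
  - by move=> x z; exact: rpredB.
  - by move=> x z; exact: oeMl.
  - move=> i j; rewrite -[Q i j](subrK (qx m i j)); apply: rpredD; last by rewrite mxE; exact: mi.
    by apply: oe_le (QI i j).
  - by move=> i j; rewrite mxE; exact: mi.
  - exact: QI.
have dm : \det m - 1 \in vpow vv 1.
  have -> : \det m - 1 = \det m - \det (1%:M : 'M[k]_n) by rewrite det1.
  apply: (@det_congr _ (vint vv) (vpow vv 1)).
  - exact: vint1.
  - by move=> ? ?; exact: rpredM.
  - exact: rpred0.
  - by move=> ? ?; exact: rpredB.
  - by move=> ? ?; exact: vpowMl.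
  - move=> i j; rewrite -[m i j](subrK (i == j)%:R); apply: rpredD; last exact: bool_int.
    by apply: vpow_vint (m1 i j).
  - by move=> i j; rewrite mxE; exact: bool_int.
  - by move=> i j; rewrite [1%:M i j]mxE.
apply: (@U1_near F D Fw v D0 two_unit b0 eps_unit C _ _ C0 nh dm); rewrite dh; exact: dQ.
Qed.

Lemma orth_near_det X : orth cc X -> (forall a b, X a b - (a == b)%:R \in vpow vv 1) -> \det X = 1.
Proof.
move=> oX X1.
have d1 : \det X - 1 \in vpow vv 1.
  have -> : \det X - 1 = \det X - \det (1%:M : 'M[k]_n.*2.+1) by rewrite det1.
  apply: (@det_congr _ (vint vv) (vpow vv 1)).
  - exact: vint1.
  - by move=> ? ?; exact: rpredM.
  - exact: rpred0.
  - by move=> ? ?; exact: rpredB.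
  - by move=> ? ?; exact: vpowMl.
  - move=> i j; rewrite -[X i j](subrK (i == j)%:R); apply: rpredD; last exact: bool_int.
    by apply: vpow_vint (X1 i j).
  - by move=> i j; rewrite mxE; exact: bool_int.
  - by move=> i j; rewrite [1%:M i j]mxE.
case: (orth_det cc_nz cc_rev oX) => // e; move: d1; rewrite e.
have -> : -1 - 1 = - 2%:R :> k by ring.
rewrite rpredN => h; have := two_unit; rewrite /vunt => /andP[nz /eqP z].
by move: h; rewrite vpow_val //; move: z; clear; vlia.
Qed.

Local Notation ttv := (@tt F D Fw v b0).
Local Notation alv := (@al F D Fw v b0).
Local Notation bev := (@be F D Fw v b0).
Local Notation rott y := (rot n eps (alv y) (bev y)).

Lemma rotation y : y \in vpow vv 1 -> exists h,
  [/\ SOJ cc (rott y), Upt W (cj (rott y)) h & \det h = ttv y].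
Proof.
move=> hy; have ab := @al_be F D Fw v D0 two_unit b0 eps_unit y hy.
have al1 : alv y - 1 \in vpow vv 1.
  by apply: vpow_le (@al_close F D Fw v D0 two_unit b0 eps_unit 1%N y isT hy).
have be1 : bev y \in vpow vv 1 by exact: (@be_close F D Fw v D0 two_unit b0 eps_unit 1%N y isT hy).
have oX := rot_orth cc_unit cc_rev two_unit n0 eps_unit nu_eps ab.
have eint a : ee k n n a 0 \in vint vv by rewrite /ee !mxE bool_int.
have [hv he] := (vunt_int (vuntV two_unit), vunt_int eps_unit).
have wint a : Ww k n 1 a 0 \in vint vv.
  by rewrite /Ww /ee !mxE rpredB ?bool_int.
have X1 a c : rott y a c - (a == c)%:R \in vpow vv 1.
  rewrite (rot_entries cc_unit cc_rev two_unit n0 eps_unit nu_eps ab).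
  by apply: rpredD; apply: vpowMr => //; [apply: int_comb|apply: int_comb2].
have SX : SOJ cc (rott y) by split=> //; exact: orth_near_det.
have [h [hU hM _]] := unitary_point SX (rot_comm cc_unit cc_rev two_unit n0 eps_unit nu_eps ab) (rot_fix cc_unit cc_rev two_unit n0 eps_unit nu_eps ab).
have etaE : eta = @eta1 F D Fw v b0 by apply: quadE; rewrite /= ?eta_re.
exists h; split=> //.
pose dd : 'rV[Ek]_n := \row_j (if (j == 0 :> nat)%N then ttv y else 1).
have e : h *m Mc = Mc *m diag_mx dd.
  rewrite hM; apply/matrixP => a j; rewrite mul_mx_diag [LHS]mxE [RHS]mxE [Mc a j]mxE [dd 0 j]mxE.
  have hj : (0 < j.+1 <= n)%N by rewrite ltn_ord.
  rewrite (rotWE cc_unit cc_rev two_unit n0 eps_unit nu_eps ab hj) /rotW; case: (posnP j) => [j0|j0].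
    have -> : (j.+1 == 1)%N by rewrite j0.
    have h1 : (0 < 1 <= n)%N by rewrite /= n0.
    rewrite mulmxDr -!scalemxAr (frame_Ww h1) (frame_Vv (leq0n n)) cWD !cWZ (vs_perp n0).2.
    rewrite scalerA -scalerDl [LHS]mxE (@tt_al_be F D Fw v D0 two_unit b0 eps_unit y hy) mulrC j0 -etaE.
    by [].
  have -> : (j.+1 == 1)%N = false by rewrite eqSS gtn_eqF.
  by rewrite ?gtn_eqF // mulr1 (frame_Ww hj).
have := congr1 determinant e; rewrite !det_mulmx [RHS]mulrC det_diag => e2.
have -> : \det h = \prod_i dd 0 i.
  by apply: (mulIr (_ : \det Mc \is a GRing.unit)) e2; have := Mc_unit; rewrite unitmxE.
have i0 : 'I_n := Ordinal n0.
rewrite (bigD1 (Ordinal n0)) //= big1 ?mulr1 ?mxE // => i; rewrite -val_eqE /= mxE => /negbTE ->.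
by [].
Qed.

(** In [rot_entries] each index e_1 or e_(-1) can cost a factor pi^-C under conjugation, while e_0
    costs nothing. The factor al - 1, in pi^(2C), covers the terms with two such indices, and be, in
    pi^C, those with one. This balance is the reason for the level m s_1. *)
Lemma rot_tconj pi l (C : nat) y : vv pi = 1 -> (0 < C)%N -> y \in vpow vv C%:Z ->
  (forall a b : 'I_n.*2.+1, (a <= b)%N -> cochar_exp l b <= cochar_exp l a) ->
  cochar_exp l n = 0 -> cochar_exp l n.-1 <= C%:Z -> cochar_exp l n.+1 = - cochar_exp l n.-1 ->
  Iw vv cc (tconj pi l (rott y)).
Proof.
move=> pi1 C0 hy dom en en1 en2; have hy1 : y \in vpow vv 1 by apply: vpow_le hy; slia.
have [h [SX _ _]] := rotation hy1; split.
  rewrite /tconj; apply: SOJM; last exact: (cochar_SOJ cc pi1).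
  by apply: SOJM => //; exact: (cochar_SOJ cc pi1).
have e0 : 0 <= cochar_exp l n.-1.
  have a1 : (n.-1 < n.*2.+1)%N by slia.
  have a2 : (n < n.*2.+1)%N by slia.
  by have := dom (Ordinal a1) (Ordinal a2); rewrite /= en; apply; slia.
have alC := @al_close F D Fw v D0 two_unit b0 eps_unit C y C0 hy.
have beC := @be_close F D Fw v D0 two_unit b0 eps_unit C y C0 hy.
have ab := @al_be F D Fw v D0 two_unit b0 eps_unit y hy1.
have wval (a : 'I_n.*2.+1) s (hs : s = 1 \/ s = -1) : pi ^ (s * cochar_exp l a) * Ww k n 1 a 0 \in vpow vv (- C%:Z).
  rewrite /Ww !mxE; have nz : (n - 1 < n.*2.+1)%N by slia.
  have nz2 : (n + 1 < n.*2.+1)%N by slia.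
  have ex m : (m < n.*2.+1)%N -> `|cochar_exp l m| <= C%:Z ->
     pi ^ (s * cochar_exp l a) * (a == inord m :> 'I_n.*2.+1)%:R \in vpow vv (- C%:Z).
    move=> hm hl; case: eqP => [ea|_]; last by rewrite mulr0 rpred0.
    rewrite mulr1 ea inordK //; apply: vpow_le (vpow_pi pi1 _).
    by move: hl; case: hs => ->; rewrite ?mul1r ?mulN1r; slia.
  rewrite ?eqxx ?andbT mulrBr; apply: rpredB; apply: (ex _ _ _) => //; rewrite ?subn1 ?addn1 ?en2 ler_norml; move: e0 en1; clear; lia.
have eval (a : 'I_n.*2.+1) s : pi ^ (s * cochar_exp l a) * ee k n n a 0 \in vpow vv 0.
  rewrite /ee !mxE ?eqxx andbT; case: eqP => [ea|_]; last by rewrite mulr0 rpred0.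
  have a2 : (n < n.*2.+1)%N by slia.
  by rewrite mulr1 ea inordK // en mulr0 expr0z; exact: vint1.
have p0 := pi_neq0 pi1.
have main (a c : 'I_n.*2.+1) : pi ^ (cochar_exp l c - cochar_exp l a) * (rott y a c - (a == c)%:R) \in vint vv.
  have -> : pi ^ (cochar_exp l c - cochar_exp l a) = pi ^ (-1 * cochar_exp l a) * pi ^ (1 * cochar_exp l c).
    by rewrite mulN1r mul1r -expfzDr // addrC.
  rewrite (rot_entries cc_unit cc_rev two_unit n0 eps_unit nu_eps ab).
  have w1 := wval a (-1) (or_intror erefl); have w2 := wval c 1 (or_introl erefl).
  have v1 := eval a (-1); have v2 := eval c 1.
  set pa := pi ^ _ in w1 v1 *; set pc := pi ^ _ in w2 v2 *.
  set Wa := Ww k n 1 a 0 in w1 *; set Wc := Ww k n 1 c 0 in w2 *.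
  set Ea := ee k n n a 0 in v1 *; set Ec := ee k n n c 0 in v2 *.
  have -> : pa * pc * ((alv y - 1) * (Ea * Ec + Wa * (2%:R^-1 * Wc)) + bev y * (eps * (Wa * Ec) + Ea * (2%:R^-1 * Wc)))
    = (alv y - 1) * ((pa * Ea) * (pc * Ec) + 2%:R^-1 * ((pa * Wa) * (pc * Wc)))
      + bev y * (eps * ((pa * Wa) * (pc * Ec)) + 2%:R^-1 * ((pa * Ea) * (pc * Wc))) by ring.
  have h2 := vunt_int (vuntV two_unit); have he := vunt_int eps_unit.
  have s1 : (pa * Ea) * (pc * Ec) + 2%:R^-1 * ((pa * Wa) * (pc * Wc)) \in vpow vv (- C%:Z + - C%:Z).
    apply: rpredD; first by apply: vpow_le (vpowM v1 v2); slia.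
    by apply: vpowMl => //; exact: vpowM.
  have s2 : eps * ((pa * Wa) * (pc * Ec)) + 2%:R^-1 * ((pa * Ea) * (pc * Wc)) \in vpow vv (- C%:Z).
    apply: rpredD; apply: vpowMl => //; first by have := vpowM w1 v2; rewrite addr0.
    by have := vpowM v1 w2; rewrite add0r.
  rewrite rpredD //; first by apply: vpow_le (vpowM alC s1); slia.
  by apply: vpow_le (vpowM beC s2); slia.
have ent a c : tconj pi l (rott y) a c = (a == c)%:R + pi ^ (cochar_exp l c - cochar_exp l a) * (rott y a c - (a == c)%:R).
  rewrite (tconjE pi1) mulrBr; case: eqP => [->|_]; last by rewrite mulr0 subr0 add0r.
  by rewrite subrr expr0z !mul1r addrC subrK.
split=> [a c|a c ca]; rewrite ent.
  by apply: rpredD; [exact: bool_int|exact: main].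
have -> : (a == c) = false by apply/eqP => e; rewrite e ltnn in ca.
have X1 : rott y a c - (a == c)%:R \in vpow vv 1.
  rewrite (rot_entries cc_unit cc_rev two_unit n0 eps_unit nu_eps ab).
  have wint (a' : 'I_n.*2.+1) : Ww k n 1 a' 0 \in vint vv.
    by rewrite /Ww /ee !mxE rpredB ?bool_int.
  have eint (a' : 'I_n.*2.+1) : ee k n n a' 0 \in vint vv by rewrite /ee !mxE bool_int.
  have [hv he] := (vunt_int (vuntV two_unit), vunt_int eps_unit).
  have be1 : bev y \in vpow vv 1 by apply: vpow_le beC; slia.
  have al1 : alv y - 1 \in vpow vv 1 by apply: vpow_le alC; slia.
  by apply: rpredD; apply: vpowMr => //; [apply: int_comb|apply: int_comb2].
have ne : (a == c) = false by apply/eqP => e; rewrite e ltnn in ca.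
rewrite add0r; apply: vpowMl; last by move: X1; rewrite ne.
by apply: vpow_vint (vpow_pi pi1 _); rewrite subr_ge0 dom // ltnW.
Qed.

End Local.
Unset Default Proof Using.

(** * Special cycles *)

Section UptGroup.
Variables (F : fieldType) (D : F) (n : nat) (Phi : 'M[F]_n.*2.+1) (W : hermitian_hyperplane D Phi).
Variables (L : fieldType) (phi : {rmorphism F -> L}).
Local Notation Up := (@Upt F D n Phi W L phi).

Lemma PsiL_unit : PsiL W phi \in unitmx.
Proof.
have := Psi_nondeg W; rewrite !unitmxE => h.
have -> : \det (PsiL W phi) = @qmap F L phi D (\det (Psi W)) by rewrite /PsiL det_map_mx.
exact: rmorph_unit.
Qed.

Lemma Upt_unit x h : Up x h -> x \in unitmx /\ h \in unitmx.
Proof.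
move=> [[_ dx] e _ _]; split; first by rewrite unitmxE dx unitr1.
have u := PsiL_unit; rewrite !unitmxE in u *.
move/(congr1 determinant): e; rewrite !det_mulmx => e.
by move: u; rewrite -{1}e unitrM => /andP[].
Qed.

Lemma UptM x x' h h' : Up x h -> Up x' h' -> Up (x *m x') (h *m h').
Proof.
move=> [[o d] e pe ce] [[o' d'] e' pe' ce']; split.
- split; last by rewrite det_mulmx d d' mulr1.
  have -> : (x *m x')^T *m map_mx phi Phi *m (x *m x') = x'^T *m (x^T *m map_mx phi Phi *m x) *m x'.
    by rewrite trmx_mul !mulmxA.
  by rewrite o o'.
- have -> : (conjmx (h *m h'))^T *m PsiL W phi *m (h *m h')
    = (conjmx h')^T *m ((conjmx h)^T *m PsiL W phi *m h) *m h' by rewrite qconjmxM trmx_mul !mulmxA.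
  by rewrite e e'.
- by rewrite -mulmxA pe' pe.
- by rewrite qinmxM mulmxA ce -mulmxA ce' mulmxA.
Qed.

Lemma UptV x h : Up x h -> Up (invmx x) (invmx h).
Proof.
move=> H; have [ux uh] := Upt_unit H; have [[o d] e pe ce] := H; split.
- split; last by rewrite det_inv d invr1.
  rewrite -{1}o trmx_inv !mulmxA mulVmx ?unitmx_tr // mul1mx.
  by rewrite -mulmxA mulmxV // mulmx1.
- have i1 : (conjmx (invmx h))^T *m (conjmx h)^T = 1%:M.
    by rewrite -trmx_mul -qconjmxM mulmxV // /Defs.conjmx map_mx1 trmx1.
  by rewrite -{1}e !mulmxA i1 mul1mx -mulmxA mulmxV // mulmx1.
- by rewrite -{1}pe mulKmx.
- have : invmx h *m (coordL W phi *m qinmx (phi D) x) = coordL W phi by rewrite ce mulKmx.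
  move=> <-; rewrite -!mulmxA -qinmxM mulmxV // /qinmx map_mx1 mulmx1.
  by rewrite ce mulKmx.
Qed.
End UptGroup.

Section Updv.
Variables (F : fieldExtType rat) (Fw : completions F) (n : nat) (Phi : 'M[F]_n.*2.+1).
Local Notation Gf := (Gfam Fw n).

Lemma SOwM w (x y : 'M[Fw w]_n.*2.+1) : SOw Phi x -> SOw Phi y -> SOw Phi (x *m y).
Proof.
move=> [o d] [o' d']; split; last by rewrite det_mulmx d d' mulr1.
have -> : (x *m y)^T *m map_mx (comp_inj (Fw w)) Phi *m (x *m y)
  = y^T *m (x^T *m map_mx (comp_inj (Fw w)) Phi *m x) *m y by rewrite trmx_mul !mulmxA.
by rewrite o o'.
Qed.

Lemma SOw1 w : SOw Phi (1%:M : 'M[Fw w]_n.*2.+1).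
Proof. by split; rewrite ?det1 // trmx1 mul1mx mulmx1. Qed.

Variable v : place F.

Lemma updv_v (h : Gf) (x : 'M[Fw v]_n.*2.+1) : updv h x v = x. Proof. exact: dfwith_in. Qed.
Lemma updv_ne (h : Gf) (x : 'M[Fw v]_n.*2.+1) w : w <> v -> updv h x w = h w.
Proof. by move=> ne; apply: dfwith_out; apply/eqP => e; apply: ne. Qed.

Lemma updv_Gad (h : Gf) (x : 'M[Fw v]_n.*2.+1) : Gad Phi h -> SOw Phi x -> Gad Phi (updv h x).
Proof.
move=> [hh fh] hx; split=> [w|].
  case: (pselect (w = v)) => [e|ne]; last by rewrite updv_ne.
  by subst w; rewrite updv_v.
apply: (@sub_finite_set _ _ ([set w | ~ Defs.mxint (h w)] `|` [set v])); last first.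
  by rewrite finite_setU; split => //; exact: finite_set1.
move=> w /= hw; case: (pselect (w = v)) => [->|ne]; first by right.
by left; rewrite updv_ne in hw.
Qed.

Lemma updv_Gmul (h h' : Gf) (x y : 'M[Fw v]_n.*2.+1) :
  Gmul (updv h x) (updv h' y) = updv (Gmul h h') (x *m y).
Proof.
apply: functional_extensionality_dep => w; rewrite /Gmul; case: (pselect (w = v)) => [e|ne].
  by subst w; rewrite !updv_v.
by rewrite !updv_ne.
Qed.

Lemma Gtrunc_updv (S1 : seq nat) (h : Gf) (x : 'M[Fw v]_n.*2.+1) : ~ Sabove S1 v ->
  Gtrunc S1 (updv h x) = Gtrunc S1 h.
Proof.
move=> v_S; apply: functional_extensionality_dep => w; rewrite /Gtrunc; case: pselect => // Sw /=.
by rewrite updv_ne // => e; rewrite e in Sw.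
Qed.
End Updv.

Set Default Proof Using "All".

Section Zeta.
Variables (F : fieldExtType rat) (D : F) (Fw : completions F) (n : nat).
Variables (Phi : 'M[F]_n.*2.+1) (W : hermitian_hyperplane D Phi) (K : set (Gfam Fw n)).
Hypotheses (KG : K `<=` Gad Phi) (K1 : K (@Gone F Fw n)).
Hypothesis KD : forall x y, K x -> K y -> K (Gldiv x y).
Local Notation Gf := (Gfam Fw n).
Implicit Types (x y g h : Gf).

Lemma Gad_unit g w : Gad Phi g -> g w \in unitmx.
Proof. by move=> [h _]; apply: SOw_unit; exact: h. Qed.

Lemma KV x : K x -> K (fun w => invmx (x w)).
Proof.
move=> Kx; have := KD Kx K1; congr K; apply: functional_extensionality_dep => w.
by rewrite /Gldiv /Gone mulmx1.
Qed.
Lemma KM x y : K x -> K y -> K (Gmul x y).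
Proof.
move=> /KV Kx Ky; have := KD Kx Ky; congr K; apply: functional_extensionality_dep => w.
by rewrite /Gldiv /Gmul invmxK.
Qed.

Lemma GadM x y : Gad Phi x -> Gad Phi y -> Gad Phi (Gmul x y).
Proof.
move=> [hx fx] [hy fy]; split=> [w|]; first exact: SOwM.
apply: (@sub_finite_set _ _ ([set w | ~ Defs.mxint (x w)] `|` [set w | ~ Defs.mxint (y w)])); last by rewrite finite_setU.
move=> w /= h; case: (pselect (Defs.mxint (x w))) => [ix|]; last by left.
right=> iy; apply: h => i j; apply/vgeP; rewrite mxE; apply: rpred_sum => a _.
have h1 : x w i a \in vpow (comp_val (Fw w)) 0 by apply/vgeP; exact: ix.
have h2 : y w a j \in vpow (comp_val (Fw w)) 0 by apply/vgeP; exact: iy.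
exact: (vpowMl h1 h2).
Qed.

Lemma HQM x y : HQ W x -> HQ W y -> HQ W (Gmul x y).
Proof.
move=> [a [[h Uh] ->]] [a' [[h' Uh'] ->]]; exists (a *m a'); split; first by exists (h *m h'); exact: (@UptM F D n Phi W F idfun).
by apply: functional_extensionality_dep => w; rewrite /Gmul map_mxM.
Qed.
Lemma HQV x : HQ W x -> HQ W (fun w => invmx (x w)).
Proof.
move=> [a [[h Uh] ->]]; exists (invmx a); split; first by exists (invmx h); exact: (@UptV F D n Phi W F idfun).
by apply: functional_extensionality_dep => w; rewrite map_invmx.
Qed.
Lemma HQ1 : HQ W (@Gone F Fw n).
Proof.
exists 1%:M; split; last by apply: functional_extensionality_dep => w; rewrite map_mx1.
exists 1%:M; split.
- by split; rewrite ?det1 // trmx1 mul1mx mulmx1.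
- by rewrite /Defs.conjmx map_mx1 trmx1 mul1mx mulmx1.
- by rewrite mul1mx.
- by rewrite /qinmx map_mx1 mulmx1 mul1mx.
Qed.
Lemma HQ_unit x w : HQ W x -> x w \in unitmx.
Proof.
move=> [a [[h Uh] ->]]; have [u _] := @Upt_unit F D n Phi W F idfun _ _ Uh.
by rewrite map_unitmx.
Qed.

Lemma GmulA x y h : Gmul x (Gmul y h) = Gmul (Gmul x y) h.
Proof. by apply: functional_extensionality_dep => w; exact: mulmxA. Qed.

Lemma Zclass_mul gam g kap : HQ W gam -> K kap ->
  Zclass W K (Gmul (Gmul gam g) kap) = Zclass W K g.
Proof.
move=> Hg Kk; apply/seteqP; split=> x [ga [ka [H1 H2 ->]]].
  exists (Gmul ga gam), (Gmul kap ka); split; [exact: HQM|exact: KM|by rewrite !GmulA].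
exists (Gmul ga (fun w => invmx (gam w))), (Gmul (fun w => invmx (kap w)) ka); split.
- by apply: HQM => //; exact: HQV.
- by apply: KM => //; exact: KV.
- apply: functional_extensionality_dep => w; rewrite /Gmul.
  have uk : kap w \in unitmx by apply: Gad_unit; exact: KG.
  have ug := HQ_unit w Hg; rewrite -!mulmxA (mulKVmx uk) [invmx (gam w) *m _]mulmxA mulVmx // mul1mx.
  by [].
Qed.

Lemma ZK_eq (z z' : ZK W K) : Zset z = Zset z' -> z = z'.
Proof. by case: z z' => [s h] [s' h'] /= e; subst s'; congr ZKset; exact: Prop_irrelevance. Qed.
Lemma ZcycE g : Gad Phi g -> Zset (Zcyc W K g) = Zclass W K g.
Proof. by move=> hg; rewrite /Zcyc; case: pselect. Qed.

Lemma Zcyc_mul gam g kap : Gad Phi g -> Gad Phi (Gmul (Gmul gam g) kap) -> HQ W gam -> K kap ->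
  Zcyc W K (Gmul (Gmul gam g) kap) = Zcyc W K g.
Proof. by move=> hg hg' Hg Kk; apply: ZK_eq; rewrite !ZcycE // Zclass_mul. Qed.

Lemma Zcyc_mulr g kap : Gad Phi g -> K kap -> Zcyc W K (Gmul g kap) = Zcyc W K g.
Proof.
move=> hg Kk; have e : Gmul (Gmul (@Gone F Fw n) g) kap = Gmul g kap.
  by apply: functional_extensionality_dep => w; rewrite /Gmul /Gone mul1mx.
rewrite -e Zcyc_mul //; last exact: HQ1.
by rewrite e; apply: GadM => //; exact: KG.
Qed.

Variables (S1 : seq nat) (Kloc : forall w, set 'M[Fw w]_n.*2.+1).
Hypothesis K_product : level_product S1 Phi K Kloc.
Variable v : place F.
Hypothesis v_S : ~ Sabove S1 v.
Variable g : Gf.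
Hypothesis g_G : Gad Phi g.

Lemma K_updv (kap : Gf) (x : 'M[Fw v]_n.*2.+1) : K kap -> SOw Phi x -> @Kloc v x -> K (updv kap x).
Proof.
move=> Kk Sx Kx; have gk := KG Kk; move/(K_product gk): (Kk) => [h1 h2].
apply/(K_product (updv_Gad gk Sx)); rewrite Gtrunc_updv //; split=> // w nS.
case: (pselect (w = v)) => [e|ne]; last by rewrite updv_ne //; exact: h2.
by subst w; rewrite updv_v.
Qed.

Lemma K_loc kap : K kap -> @Kloc v (kap v).
Proof. by move=> Kk; move/(K_product (KG Kk)): (Kk) => [_ h]; exact: h. Qed.

Local Notation zc y := (Zcyc W K (updv g y)).

Lemma zc_mulr (y kap : 'M[Fw v]_n.*2.+1) : SOw Phi y -> SOw Phi kap -> @Kloc v kap -> zc (y *m kap) = zc y.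
Proof.
move=> Sy Sk Kk; rewrite -(Zcyc_mulr (updv_Gad g_G Sy) (K_updv K1 Sk Kk)) updv_Gmul.
congr (Zcyc W K (updv _ _)); apply: functional_extensionality_dep => w.
by rewrite /Gmul /Gone mulmx1.
Qed.

(** Away from v one has s g = g (g^-1 s g), and the last factor is absorbed by K; only the action of
    x at v remains. *)
Lemma zc_gact (s : Gf) (y x : 'M[Fw v]_n.*2.+1) : Gad Phi s -> K (Gldiv g (Gmul s g)) -> SOw Phi y -> SOw Phi x ->
  Zcyc W K (Gmul (updv s x) (updv g y)) = zc (x *m y).
Proof.
move=> Gs Ks Sy Sx; have Sxy := SOwM Sx Sy.
have Kk := K_updv Ks (SOw1 Fw Phi v) (K_loc K1).
rewrite -(Zcyc_mulr (updv_Gad g_G Sxy) Kk) !updv_Gmul mulmx1.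
congr (Zcyc W K (updv _ _)); apply: functional_extensionality_dep => w.
by rewrite /Gmul /Gldiv mulKVmx //; exact: Gad_unit.
Qed.

Lemma Zrep_zc (y : 'M[Fw v]_n.*2.+1) : SOw Phi y -> exists gam kap, [/\ HQ W gam, K kap,
  Gad Phi (Zrep (zc y)) & Zrep (zc y) = Gmul (Gmul gam (updv g y)) kap].
Proof.
move=> Sy; have gy := updv_Gad g_G Sy.
have [h1 h2] : Gad Phi (Zrep (zc y)) /\ Zset (zc y) = Zclass W K (Zrep (zc y)).
  apply: (xgetPex (@Gone F Fw n) (P := [set g | Gad Phi g /\ Zset (zc y) = Zclass W K g])).
  by exists (updv g y); split=> //; rewrite ZcycE.
have : Zclass W K (Zrep (zc y)) (Zrep (zc y)).
  exists (@Gone F Fw n), (@Gone F Fw n); split; [exact: HQ1|exact: K1|].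
  by apply: functional_extensionality_dep => w; rewrite /Gmul /Gone mul1mx mulmx1.
rewrite -{1}h2 ZcycE // => -[ga [ka [H1 H2 e]]].
by exists ga, ka.
Qed.

(** The representative [Zrep] differs from the given one by H(Q) on the left, which is harmless, and
    by K on the right, whose v-component becomes the twist kap in front of d. *)
Lemma Zcyc_rep (y : 'M[Fw v]_n.*2.+1) : SOw Phi y -> exists2 kap, @Kloc v kap /\ SOw Phi kap & forall d, SOw Phi d ->
  let h := Zrep (zc y) in Zcyc W K (updv h (h v *m d)) = zc (y *m (kap *m d)).
Proof.
move=> Sy; have [ga [ka [H1 H2 Gh e]]] := Zrep_zc Sy.
have Ska : SOw Phi (ka v) by case: (KG H2).
exists (ka v); first by split=> //; exact: K_loc.
move=> d Sd /=; set h := Zrep _ in e Gh *.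
have Kk := K_updv H2 (SOw1 Fw Phi v) (K_loc K1).
have Sy2 : SOw Phi (y *m (ka v *m d)) by apply: SOwM => //; exact: SOwM.
have e2 : updv h (h v *m d) = Gmul (Gmul ga (updv g (y *m (ka v *m d)))) (updv ka (1%:M : 'M[Fw v]_n.*2.+1)).
  apply: functional_extensionality_dep => w; rewrite /Gmul; case: (pselect (w = v)) => [ew|ne].
    by subst w; rewrite !updv_v e /Gmul updv_v mulmx1 !mulmxA.
  by rewrite !updv_ne // e /Gmul updv_ne.
rewrite e2 Zcyc_mul //; first exact: updv_Gad.
by rewrite -e2; apply: updv_Gad => //; apply: SOwM => //; case: Gh.
Qed.

End Zeta.

(** * Linearity of the Hecke action *)

Section HeckeFormal.
Variables (F : fieldExtType rat) (D : F) (Fw : completions F) (n : nat).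
Variables (Phi : 'M[F]_n.*2.+1) (W : hermitian_hyperplane D Phi) (K : set (Gfam Fw n)).
Variables (R : comUnitRingType) (v : place F) (Kv : set 'M[Fw v]_n.*2.+1).
Implicit Types (x : {malg R[ZK W K]}) (C : dcoset Phi Kv).

Definition hop (C : dcoset Phi Kv) x : {malg R[ZK W K]} :=
  \sum_(z <- enum_fset (msupp x)) x@_z *: hecke_basis R z C.

Lemma hecke_hop x (A : {malg R[dcoset Phi Kv]}) :
  hecke x A = \sum_(C <- enum_fset (msupp A)) A@_C *: hop C x.
Proof.
rewrite /hecke exchange_big; apply: eq_bigr => C _ /=; rewrite /hop scaler_sumr.
by apply: eq_bigr => z _; rewrite scalerA mulrC.
Qed.

Lemma hop_wide C x (s : seq (ZK W K)) : uniq s -> {subset enum_fset (msupp x) <= s} ->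
  hop C x = \sum_(z <- s) x@_z *: hecke_basis R z C.
Proof.
move=> us sub; rewrite [RHS](bigID (mem (enum_fset (msupp x)))) /=.
rewrite [X in _ + X]big1_seq ?addr0; last first.
  move=> z /andP[nz _]; rewrite mcoeff_outdom ?scale0r //.
rewrite -big_filter; apply: perm_big; apply: uniq_perm; rewrite ?fset_uniq ?filter_uniq //.
by move=> z; rewrite mem_filter; case: (boolP (z \in _)) => //= /sub ->.
Qed.

Lemma hop_sum C (J : eqType) (r : seq J) (a : J -> R) (z : J -> ZK W K) :
  hop C (\sum_(j <- r) a j *: Zbasis R (z j)) = \sum_(j <- r) a j *: hecke_basis R (z j) C.
Proof.
set x := \sum_(j <- r) _; pose s := undup (enum_fset (msupp x) ++ [seq z j | j <- r]).
have us : uniq s by exact: undup_uniq.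
rewrite (@hop_wide C x s us); last by move=> y ys; rewrite mem_undup mem_cat ys.
have xE y : x@_y = \sum_(j <- r) a j * (z j == y)%:R.
  by rewrite /x raddf_sum; apply: eq_bigr => j _ /=; rewrite mcoeffZ mcoeffU.
under eq_bigr do rewrite xE scaler_suml.
rewrite exchange_big /=; apply: eq_big_seq => j jr.
have zs : z j \in s by rewrite mem_undup mem_cat (map_f z jr) orbT.
rewrite (bigD1_seq (z j)) //= eqxx mulr1 big1 ?addr0 // => y ny.
by rewrite eq_sym (negbTE ny) mulr0 scale0r.
Qed.

Lemma hop_scale C (a : R) x : hop C (a *: x) = a *: hop C x.
Proof.
pose s := undup (enum_fset (msupp x) ++ enum_fset (msupp (a *: x))).
have us : uniq s by exact: undup_uniq.
rewrite (@hop_wide C x s us); last by move=> y ys; rewrite mem_undup mem_cat ys.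
rewrite (@hop_wide C (a *: x) s us); last by move=> y ys; rewrite mem_undup mem_cat ys orbT.
by rewrite scaler_sumr; apply: eq_bigr => z _; rewrite mcoeffZ scalerA.
Qed.

Lemma hecke_scale (a : R) x (A : {malg R[dcoset Phi Kv]}) : a *: hecke x A = hecke (a *: x) A.
Proof.
rewrite !hecke_hop scaler_sumr; apply: eq_bigr => C _.
by rewrite hop_scale !scalerA mulrC.
Qed.
End HeckeFormal.

(** * Traces as sums over quotients of level groups *)

Section Trace.
Variables (F : fieldExtType rat) (D : F) (fplus : {rmorphism quad D -> algC}).
Hypothesis D0 : D != 0.
Variables (Fw : completions F) (art art1 : Efam Fw D -> autC).
Hypotheses (art_artin : artin_map fplus art) (art1_artin : artin1_map fplus art art1).
Variables (S1 : seq nat) (S1_prime : forall p : nat, p \in S1 -> prime p).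
Variable US : set (Efam Fw D).
Hypothesis US_compact_open : compact_open_T1S S1 US.
Hypothesis US_small : forall e : quad D, Ulevel S1 US (fun=> 0%N) (Ediag Fw e) -> e = 1.
Variables (n : nat) (Phi : 'M[F]_n.*2.+1).
Hypotheses (Phi_sym : Phi^T = Phi) (Phi_unit : Phi \in unitmx).
Variables (W : hermitian_hyperplane D Phi) (K : set (Gfam Fw n)) (g : Gfam Fw n).
Hypotheses (K_compact_open : compact_open_G Phi K) (g_G : Gad Phi g).
Hypothesis US_det : forall t, Ulevel S1 US (fun=> 0%N) t -> exists2 s, Hdet W s t & K (Gldiv g (Gmul s g)).
Variables (gact : autC -> ZK W K -> ZK W K) (R : comUnitRingType).
Variables (km kM : place F -> nat).
Hypothesis kmM : forall w, (km w <= kM w)%N.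
Local Notation Ul k := (Ulevel S1 US k).
Local Notation EE k := (fixed_field fplus art art1 (Ul k)).
Variables (z : ZK W K) (J : finType) (uf : J -> Efam Fw D).
Hypotheses (ufU : forall a, Ul km (uf a)).
Hypothesis cover : forall u, Ul km u -> exists a, Ul kM (Emul (fun w => (uf a w)^-1) u).
Hypothesis sep : forall a b, Ul kM (Emul (fun w => (uf a w)^-1) (uf b)) -> a = b.
Hypothesis Hz1 : forall (rho : {rmorphism algC -> algC}) u, GalE fplus rho -> Ul km u ->
  (forall x, Einfty fplus art x -> art1 u x = rho x) -> gact rho z = gact (art1 u) z.
Hypothesis Hz2 : forall u t, Ul km u -> Ul kM t -> gact (art1 (Emul u t)) z = gact (art1 u) z.

Lemma Emul_inv_l (u t : Efam Fw D) : Ul km u -> Emul u (Emul (fun w => (u w)^-1) t) = t.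
Proof.
move=> [[nu _] _ _]; apply: functional_extensionality_dep => w.
by rewrite /Emul mulVKr // qunit_norm1.
Qed.

(** The element of [gal_rel] represented by the Artin symbol of [uf a]; by [cover] and [sep] every
    element of the Galois group occurs for exactly one a. *)
Definition gcl a : set autC := [set r' : {rmorphism algC -> algC} | galfix (EE km) r' /\
  forall x, EE kM x -> r' x = art1 (uf a) x].

(** The Artin symbol of the quotient is trivial on the upper field, so [galois_lift] represents it
    by an element of the deeper level, and [art1_inj] identifies that element with the quotient
    itself. *)
Lemma agree_level (r : {rmorphism algC -> algC}) a u : Ul km u -> (forall x, Einfty fplus art x -> art1 u x = r x) ->
  (forall x, EE kM x -> r x = art1 (uf a) x) -> Ul kM (Emul (fun w => (uf a w)^-1) u).
Proof.
move=> hu e1 e2; pose t := Emul (fun w => (uf a w)^-1) u.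
have Ua := ufU a; have ht : Ul km t by apply: UlM => //; exact: UlV.
have [Ta _ _] := Ua; have [Tt _ _] := ht.
have ut : Emul (uf a) t = u by exact: Emul_inv_l.
have fixt : galfix (EE kM) (art1 t).
  move=> x [xi xf]; apply: (fmorph_inj (art1 (uf a))).
  by rewrite -(artin1_mul art1_artin Ta Tt xi) ut e1 // e2.
have [t' ht' e] := galois_lift D0 art_artin art1_artin S1_prime US_compact_open Phi_sym Phi_unit K_compact_open g_G US_det fixt.
suff -> : Emul (fun w => (uf a w)^-1) u = t' by [].
have ht2 : Ul km t' by eapply Ul_le; eassumption.
change (t = t'); eapply art1_inj; try eassumption.
by move=> x xi; rewrite e.
Qed.

Lemma gal_trace_reps : gal_trace R gact (EE kM) (EE km) z = \sum_a Zbasis R (gact (art1 (uf a)) z).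
Proof.
have aut_fix a : galfix (EE km) (art1 (uf a)).
  by move=> x [_ xf]; apply: xf; exact: ufU.
have lift (r : {rmorphism algC -> algC}) : galfix (EE km) r -> exists2 u, Ul km u & forall x, Einfty fplus art x -> art1 u x = r x.
  move=> hr; exact: (galois_lift D0 art_artin art1_artin S1_prime US_compact_open Phi_sym Phi_unit K_compact_open g_G US_det hr).
transitivity (\sum_(a \in [set` index_enum J]) Zbasis R (gact (xget (@idC) (gcl a)) z)); last first.
  rewrite [RHS]fsbig_seq ?index_enum_uniq //.
  apply: eq_fsbigr => a _; congr (Zbasis R _).
  have [h1 h2] : gcl a (xget (@idC) (gcl a)).
    by apply: (xgetPex idC); exists (art1 (uf a)); split.
  set r0 := xget _ _ in h1 h2 *.
  have [u hu e] := lift _ h1.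
  have gr : GalE fplus r0 by eapply rho_gal; eassumption.
  rewrite (Hz1 gr hu e) -(Emul_inv_l u (ufU a)) Hz2 //.
  exact: agree_level hu e h2.
rewrite /gal_trace; apply: (reindex_fsbig gcl); split.
- by move=> a _; exists (art1 (uf a)).
- move=> a b _ _ eab; apply: sep.
  have : gcl b (art1 (uf b)) by split.
  rewrite -eab => -[_ h2].
  by apply: (agree_level (r := art1 (uf b))) => //.
- move=> _ [r hr <-]; have [u hu e] := lift _ hr; have [a ha] := cover hu.
  exists a; first by rewrite /= mem_index_enum.
  have ag x : EE kM x -> art1 (uf a) x = r x.
    move=> [xi xf]; have [Ta _ _] := ufU a; have [Tt _ _] := ha.
    by rewrite -e // -(Emul_inv_l u (ufU a)) (artin1_mul art1_artin Ta Tt xi) (xf _ ha).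
  by apply/seteqP; split=> r' [f h]; split=> // x hx; rewrite h // ag.
Qed.

End Trace.
Unset Default Proof Using.

(** * The norm relation *)

Set Default Proof Using "All".

Section Assembly.
Variables (F : fieldExtType rat) (D : F) (fplus : {rmorphism quad D -> algC}).
Hypothesis D0 : D != 0.
Variables (Fw : completions F) (art art1 : Efam Fw D -> autC).
Hypotheses (art_artin : artin_map fplus art) (art1_artin : artin1_map fplus art art1).
Variables (S1 : seq nat).
Hypothesis S1_prime : forall p : nat, p \in S1 -> prime p.
Variable US : set (Efam Fw D).
Hypothesis US_compact_open : compact_open_T1S S1 US.
Hypothesis US_small : forall e : quad D, Ulevel S1 US (fun=> 0%N) (Ediag Fw e) -> e = 1.
Variables (n : nat) (Phi : 'M[F]_n.*2.+1).
Hypotheses (n0 : (0 < n)%N) (Phi_sym : Phi^T = Phi) (Phi_unit : Phi \in unitmx).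
Variables (W : hermitian_hyperplane D Phi) (K : set (Gfam Fw n)).
Variables (Kloc : forall w, set 'M[Fw w]_n.*2.+1) (g : Gfam Fw n).
Hypotheses (K_compact_open : compact_open_G Phi K) (K_product : level_product S1 Phi K Kloc).
Hypothesis g_G : Gad Phi g.
Hypothesis US_det : forall t, Ulevel S1 US (fun=> 0%N) t -> exists2 s, Hdet W s t & K (Gldiv g (Gmul s g)).
Variable gact : autC -> ZK W K -> ZK W K.
Hypothesis gact_galois : galois_action fplus art art1 gact.
Variable v : place F.
Hypothesis v_S : ~ Sabove S1 v.
Local Notation k := (Fw v).
Local Notation vv := (comp_val (Fw v)).
Local Notation T := 'M[k]_n.*2.+1.
Hypothesis two_unit : vunt vv 2%:R.
Variables (pi : k) (q : nat).
Hypotheses (pi1 : vv pi = 1) (q_w : residue_card vv q).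
Variables (eta : Ew Fw D v) (ws vs : nat -> 'cV[k]_n.*2.+1).
Hypothesis lb : local_basis W eta ws vs.
Local Notation B := (frame ws vs).
Local Notation c := (cc Phi eta ws).
Local Notation K0v := (K0 vv c).
Local Notation un X := (B *m X *m invmx B).
Local Notation dn x := (invmx B *m x *m B).
Local Notation Kv := (@Kloc v).
Local Notation cv l := (@cochar_mx k n pi l).
Local Notation zc y := (Zcyc W K (updv g y)).
Hypothesis KvE : forall x, Kv x <-> K0v (dn x).
Variables (mu : {ffun 'I_n -> int}) (s1 rho : nat).
Hypothesis s1_gt0 : (0 < s1)%N.
Hypothesis mu_strict : forall a b : 'I_n.*2.+1, (a < b)%N -> cochar_exp mu b < cochar_exp mu a.
Hypothesis mu_lo : forall a : 'I_n.*2.+1, (a < n)%N -> s1%:Z <= cochar_exp mu a.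
Hypothesis mu_hi : forall a : 'I_n.*2.+1, (n <= a)%N -> cochar_exp mu a <= 0.
Hypothesis mu_m1 : cochar_exp mu n.-1 = s1%:Z.
Hypothesis mu_p1 : cochar_exp mu n.+1 = - s1%:Z.
Hypothesis rhoE : two_rho mu = rho%:Z.
Hypothesis rho_s1 : (s1 <= rho)%N.
Variables (R : comUnitRingType) (Om : closedFieldType) (iota : {rmorphism R -> Om}) (sq : R).
Hypothesis iota_inj : injective iota.
Hypothesis Om0 : forall m, m.+1%:R != 0 :> Om.
Hypotheses (sq_unit : sq \is a GRing.unit) (sq_sqrt : sq ^+ 2 = q%:R).
Variables (N : nat) (r : 'M[Om]_n.*2 -> 'M[Om]_N).
Hypothesis r_mu : irrep_highest_weight r mu.
Variable A : nat -> {malg R[dcoset Phi Kv]}.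
Hypothesis A_hecke : hecke_polynomial B pi iota sq mu r A.

Lemma mu_dom (a b : 'I_n.*2.+1) : (a <= b)%N -> cochar_exp mu b <= cochar_exp mu a.
Proof.
rewrite leq_eqVlt => /orP[/eqP/val_inj -> //|ab]; exact: ltW (mu_strict ab).
Qed.

Lemma cu i : vunt vv (c i).
Proof. exact: (cc_unit D0 n0 Phi_sym Phi_unit two_unit lb). Qed.
Lemma cr i : c (rev_ord i) = c i.
Proof. exact: (cc_rev D0 n0 Phi_sym Phi_unit two_unit lb). Qed.
Lemma cnz i : c i != 0. Proof. exact: vunt_neq0 (cu i). Qed.
Lemma Bu : B \in unitmx.
Proof. exact: (B_unit D0 n0 Phi_sym Phi_unit two_unit lb). Qed.
Lemma epsu : vunt vv (comp_inj (Fw v) D * b0 eta ^+ 2).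
Proof. exact: (eps_unit D0 n0 Phi_sym Phi_unit two_unit lb). Qed.

Lemma dnK (x : T) : un (dn x) = x.
Proof. by rewrite !mulmxA mulmxV ?Bu // mul1mx -mulmxA mulmxV ?Bu // mulmx1. Qed.
Lemma unK (X : T) : dn (un X) = X.
Proof. by rewrite !mulmxA mulVmx ?Bu // mul1mx -mulmxA mulVmx ?Bu // mulmx1. Qed.
Lemma unM (X Y : T) : un (X *m Y) = un X *m un Y.
Proof. by rewrite -!mulmxA (mulKmx Bu). Qed.
Lemma dnM (x y : T) : dn (x *m y) = dn x *m dn y.
Proof. by rewrite -!mulmxA (mulKVmx Bu). Qed.
Lemma dn1 : dn (1%:M : T) = 1%:M.
Proof. by rewrite mulmx1 mulVmx ?Bu. Qed.
Lemma un1 : un (1%:M : T) = 1%:M.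
Proof. by rewrite mulmx1 mulmxV ?Bu. Qed.

Lemma dn_SO (x : T) : SOw Phi x <-> SOJ c (dn x).
Proof. exact: (SOw_SOJ D0 n0 Phi_sym Phi_unit two_unit lb). Qed.
Lemma un_SO (X : T) : SOJ c X <-> SOw Phi (un X).
Proof. by have h := dn_SO (un X); rewrite unK in h; split=> hx; apply/h. Qed.

Lemma k01 : K0v 1. Proof. by split; [exact: SOJ1|exact: mxint1]. Qed.
Lemma k0M (x y : T) : K0v x -> K0v y -> K0v (x * y).
Proof. by move=> [a b] [e f]; split; [exact: SOJM|exact: mxintM]. Qed.
Lemma SOJu (x : T) : SOJ c x -> x \in unitmx.
Proof. by move=> [o _]; exact: (orth_unit cnz cr o). Qed.
Lemma k0V (x : T) : K0v x -> x \is a GRing.unit /\ K0v x^-1.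
Proof.
move=> [a b]; split; first exact: (SOJu a).
split; first exact: (SOJV cu cr a).
by apply: (mxintV cu cr _ b); case: a.
Qed.

Lemma Kv_SO (x : T) : Kv x -> SOw Phi x.
Proof. by move=> /KvE[h _]; apply/dn_SO. Qed.
Lemma Kv_un (X : T) : K0v X -> Kv (un X).
Proof. by move=> h; apply/KvE; rewrite unK. Qed.
Lemma Kv1 : Kv (1%:M : T).
Proof. by apply/KvE; rewrite dn1; exact: k01. Qed.
Lemma KvM (x y : T) : Kv x -> Kv y -> Kv (x *m y).
Proof. by move=> /KvE hx /KvE hy; apply/KvE; rewrite dnM; exact: k0M. Qed.
Lemma KvV (x : T) : Kv x -> x \in unitmx /\ Kv (invmx x).
Proof.
move=> Kx; have ux : x \in unitmx by apply: SOw_unit; exact: Kv_SO Kx.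
split=> //; apply/KvE; move/KvE: Kx => /k0V[u h].
suff -> : dn (invmx x) = (dn x)^-1 by [].
apply: (mulIr u); rewrite mulVr //.
by change (dn (invmx x) *m dn x = 1%:M); rewrite -dnM mulVmx // dn1.
Qed.

Lemma dc_SO (C : dcoset Phi Kv) (x : T) : dcset C x -> SOw Phi x.
Proof.
have [x0 S0 e] := dcset_class C; rewrite e => -[k1 [k2 [h1 h2 ->]]].
by apply: SOwM; [apply: SOwM => //; exact: Kv_SO|exact: Kv_SO].
Qed.
Lemma dc_mul (C : dcoset Phi Kv) (x k1 k2 : T) : Kv k1 -> Kv k2 -> dcset C x -> dcset C (k1 *m x *m k2).
Proof.
move=> h1 h2; have [x0 S0 e] := dcset_class C; rewrite e => -[k3 [k4 [h3 h4 ->]]].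
exists (k1 *m k3), (k4 *m k2); split; [exact: KvM|exact: KvM|by rewrite !mulmxA].
Qed.
Lemma dc_mulr (C : dcoset Phi Kv) (x k2 : T) : Kv k2 -> dcset C x -> dcset C (x *m k2).
Proof. by move=> h2 h; have := dc_mul Kv1 h2 h; rewrite mul1mx. Qed.
Lemma dc_mull (C : dcoset Phi Kv) (x k2 : T) : Kv k2 -> dcset C x -> dcset C (k2 *m x).
Proof. by move=> h2 h; have := dc_mul h2 Kv1 h; rewrite mulmx1. Qed.

Definition dcJ (C : dcoset Phi Kv) : set T := [set X | dcset C (un X)].

Lemma dcJ_SO C X : dcJ C X -> SOJ c X.
Proof. by move=> h; apply/un_SO; exact: dc_SO h. Qed.
Lemma dcJ_mull C X b : K0v b -> dcJ C X -> dcJ C (b * X).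
Proof.
move=> Kb h; have := dc_mull (Kv_un Kb) h; rewrite -unM; exact.
Qed.
Lemma dcJ_mulr C X b : K0v b -> dcJ C X -> dcJ C (X * b).
Proof.
move=> Kb h; have := dc_mulr (Kv_un Kb) h; rewrite -unM; exact.
Qed.

Lemma mx_bounded (x : T) : exists bb : nat, forall i j, x i j \in vpow vv (- bb%:Z).
Proof.
pose h (p : 'I_n.*2.+1 * 'I_n.*2.+1) : nat := absz (vv (x p.1 p.2)).
exists (\max_p h p)%N => i j; have [->|nz] := eqVneq (x i j) 0; first exact: rpred0.
have hb : (h (i, j) <= \max_p h p)%N by exact: leq_bigmax.
rewrite vpow_val //; move: hb; rewrite /h /=; move: (vv (x i j)) (\max_p _)%N; clear; lia.
Qed.

Lemma dc_reps C : exists t, coset_reps K0v (dcJ C) t.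
Proof.
have [x0 S0 e] := dcset_class C; have [bb hb] := mx_bounded (dn x0).
apply: (finite_reps k01 k0M k0V).
apply: (bounded_cosets cu cr pi1 q_w (b := bb)); first by move=> X; exact: dcJ_SO.
move=> X; rewrite /dcJ /= e => -[k1 [k2 [h1 h2 eX]]] i j.
have XE : X = dn k1 *m dn x0 *m dn k2 by rewrite -[LHS]unK eX !dnM.
move/KvE: h1 => [_ i1]; move/KvE: h2 => [_ i2].
rewrite XE mxE; apply: rpred_sum => a _; apply: vpowMr; last exact: i2.
rewrite mxE; apply: rpred_sum => a' _; apply: vpowMl; [exact: i1|exact: hb].
Qed.

Lemma lcoset_refl (x : T) : lcoset Kv x x.
Proof. by exists 1%:M; [exact: Kv1|rewrite mulmx1]. Qed.
Lemma lcoset_eq (x y : T) : lcoset Kv x y -> lcoset Kv x = lcoset Kv y.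
Proof.
move=> [k1 h1 ->]; have [u1 hV] := KvV h1; apply/seteqP; split=> z [k2 h2 ->].
  by exists (invmx k1 *m k2); [exact: KvM|rewrite -mulmxA mulKVmx].
by exists (k1 *m k2); [exact: KvM|rewrite mulmxA].
Qed.

Lemma lcosets_sum (M : nmodType) (S : set T) (t : seq T) (f : T -> M) :
  coset_reps K0v [set X | S (un X)] t -> (forall x kk, S x -> Kv kk -> f (x *m kk) = f x) ->
  \sum_(c0 \in lcosets Kv S) f (xget 1%:M c0) = \sum_(X <- t) f (un X).
Proof.
move=> [us sA As si] fK; rewrite [RHS]fsbig_seq //.
transitivity (\sum_(X \in [set` t]) f (xget 1%:M (lcoset Kv (un X)))); last first.
  apply: eq_fsbigr => X /set_mem /= Xt.
  have [kk Kk ->] : lcoset Kv (un X) (xget 1%:M (lcoset Kv (un X))).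
    by apply: (xgetPex 1%:M); exists (un X); exact: lcoset_refl.
  by apply: fK => //; exact: sA.
apply: (@reindex_fsbig _ _ _ _ _ (fun X => lcoset Kv (un X)) [set` t] (lcosets Kv S)); split.
- by move=> X /= Xt; exists (un X) => //; exact: sA.
- move=> X Y /set_mem /= Xt /set_mem /= Yt e; apply: si => //.
  have [kk Kk eY] : lcoset Kv (un X) (un Y) by rewrite e; exact: lcoset_refl.
  exists (dn kk); first by apply/KvE.
  by rewrite -[LHS]unK eY dnM unK.
- move=> _ [a Sa <-]; have Sa' : S (un (dn a)) by rewrite dnK.
  have [X Xt [kk Kk eX]] := As _ Sa'; exists X => //=; apply: lcoset_eq.
  exists (un kk); first exact: Kv_un.
  by rewrite -unM -[LHS]dnK eX.
Qed.

Lemma coset_sum_mull (M : nmodType) (S : set T) (t : seq T) (f : T -> M) (b : T) :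
  b \is a GRing.unit -> [set b * x | x in S] = S -> coset_reps K0v S t -> rinvar K0v f ->
  \sum_(x <- t) f (b * x) = \sum_(x <- t) f x.
Proof.
move=> bu e tS fK; have tb := coset_reps_mull bu tS; rewrite e in tb.
by rewrite -(csum_reps k01 k0M k0V tS fK) (csum_reps k01 k0M k0V tb fK) big_map.
Qed.

Lemma KG : K `<=` Gad Phi. Proof. by case: K_compact_open. Qed.
Lemma K1 : K (@Gone F Fw n). Proof. by case: K_compact_open => _ []. Qed.
Lemma KD x y : K x -> K y -> K (Gldiv x y).
Proof. by case: K_compact_open => _ [_ h _ _]; exact: h. Qed.

Lemma zmulr (y kk : T) : SOw Phi y -> Kv kk -> zc (y *m kk) = zc y.
Proof.
move=> Sy Kk; exact: (zc_mulr W KG K1 KD K_product v_S g_G Sy (Kv_SO Kk) Kk).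
Qed.

(** The cycle of y X as a function of X in frame coordinates. The value 0 off the special orthogonal
    group only makes [zf y] right K-invariant on all matrices. *)
Definition zf (y X : T) : {malg R[ZK W K]} :=
  if pselect (SOJ c X) then Zbasis R (zc (y *m un X)) else 0.

Lemma zfE y X : SOJ c X -> zf y X = Zbasis R (zc (y *m un X)).
Proof. by rewrite /zf; case: pselect. Qed.

Lemma zf_rinvar y : SOw Phi y -> rinvar K0v (zf y).
Proof.
move=> Sy X b Kb; have [ub [Sb' _]] := k0V Kb; have [Sb _] := Kb.
have h : SOJ c (X * b) <-> SOJ c X.
  split=> h; last exact: SOJM.
  have := SOJM h Sb'; change (SOJ c (X * b * b^-1) -> SOJ c X); by rewrite mulrK.
case: (pselect (SOJ c X)) => hX.
  have hXb : SOJ c (X * b) by apply/h.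
  rewrite (zfE _ hX) (zfE _ hXb); congr (Zbasis R _).
  have -> : un (X * b) = un X *m un b by rewrite -unM.
  rewrite (mulmxA y (un X) (un b)); apply: zmulr; last exact: Kv_un.
  by apply: SOwM => //; apply/un_SO.
rewrite /zf; case: pselect => hXb /=; first by case: hX; apply/h.
by case: pselect.
Qed.

(** The twist kap of [Zcyc_rep] permutes the left cosets of the double coset and so disappears from
    the sum. *)
Lemma hecke_basis_reps (C : dcoset Phi Kv) (y : T) t : SOw Phi y -> coset_reps K0v (dcJ C) t ->
  hecke_basis R (zc y) C = \sum_(d <- t) zf y d.
Proof.
move=> Sy tC; have [kap [Kk Sk] H] := Zcyc_rep W KG K1 KD K_product v_S g_G Sy.
pose f d := Zbasis R (zc (y *m (kap *m d))).
have [_ tS _ _] := tC.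
rewrite /hecke_basis /=.
transitivity (\sum_(c0 \in lcosets Kv (dcset C)) f (xget 1%:M c0)).
  apply: eq_fsbigr => c0 /set_mem [x Cx <-].
  have [kk Kkk e] : lcoset Kv x (xget 1%:M (lcoset Kv x)).
    by apply: (xgetPex 1%:M); exists x; exact: lcoset_refl.
  have Sx : SOw Phi (xget 1%:M (lcoset Kv x)).
    by rewrite e; apply: SOwM; [exact: dc_SO Cx|exact: Kv_SO].
  by rewrite /f; congr (Zbasis R _); exact: (H _ Sx).
rewrite (lcosets_sum (f := f) tC); last first.
  move=> x kk Cx Kkk; rewrite /f; congr (Zbasis R _).
  rewrite (mulmxA kap x kk) (mulmxA y (kap *m x) kk); apply: zmulr => //.
  by apply: SOwM => //; apply: SOwM => //; exact: dc_SO Cx.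
have Kd : K0v (dn kap) by apply/KvE.
have [ud KdV] := k0V Kd.
have e : [set dn kap * x | x in dcJ C] = dcJ C.
  apply/seteqP; split=> x; first by move=> [z Cz <-]; exact: dcJ_mull.
  by move=> Cx; exists ((dn kap)^-1 * x); [exact: dcJ_mull|rewrite mulrA mulrV ?mul1r].
rewrite -(coset_sum_mull ud e tC (zf_rinvar Sy)); apply: eq_big_seq => X Xt.
have SX := dcJ_SO (tS _ Xt).
rewrite zfE; last by apply: SOJM => //; case: Kd.
have -> : un (dn kap * X) = un (dn kap) *m un X by rewrite -unM.
by rewrite dnK.
Qed.

Lemma unip_half l l' d : unip_cell vv c pi l d -> unip_cell vv c pi l' d ->
  height l <= height l' /\ (height l = height l' -> l = l').
Proof.
move=> [u [b [Su ut [Sb ib] e]]] [u' [b' [Su' ut' [Sb' ib'] e']]].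
have [o1 _] : SOJ c (1%:M : T) by exact: SOJ1.
have i1 : iwahori vv (1%:M : T) by exact: iwahori1.
have ut2 : unitriangular (invmx u *m u') by apply: unitriangularM => //; exact: unitriangularV.
have E : 1%:M *m cv l *m b = invmx u *m u' *m cv l' *m b'.
  rewrite mul1mx -!mulmxA [u' *m (_ *m b')]mulmxA -e' e -!mulmxA mulKmx //; exact: SOJu.
exact: (iwahori_iwasawa cu cr pi1 o1 i1 Sb.1 ib ut2 Sb'.1 ib' E).
Qed.
Lemma unip_uniq l l' d : unip_cell vv c pi l d -> unip_cell vv c pi l' d -> l = l'.
Proof.
move=> h h'; have [a1 a2] := unip_half h h'; have [b1 _] := unip_half h' h.
by apply: a2; apply/eqP; rewrite eq_le a1 b1.
Qed.

Lemma iwasawaE l X : @iwasawa F Fw n Phi v Kv B pi l (un X) <-> unip_cell vv c pi l X.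
Proof.
split.
  move=> [u [kk [Su ut Kk e]]]; exists (dn u), (dn kk); split=> //.
  - by apply/dn_SO.
  - by apply/KvE.
  - have eC : dn (cocharV B pi l) = cv l by exact: unK.
    by rewrite -[LHS]unK e (dnM (u *m cocharV B pi l) kk) (dnM u) eC.
move=> [u [b [Su ut Kb e]]]; exists (un u), (un b); split.
- by apply/un_SO.
- by rewrite unK.
- exact: Kv_un.
- by rewrite e !unM.
Qed.

Lemma satake_dcE (C : dcoset Phi Kv) t l : coset_reps K0v (dcJ C) t ->
  satake_dc B pi iota sq C l = iota sq ^ (- two_rho l) *
    (count (fun d => `[< unip_cell vv c pi l d >]) t)%:R.
Proof.
move=> tC; rewrite /satake_dc; congr (_ * _); have [_ tS _ _] := tC.
pose S := dcset C `&` @iwasawa F Fw n Phi v Kv B pi l.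
have hU : rinvar K0v (unip_cell vv c pi l).
  by have hcu := cu; have hcr := cr; eapply unip_cell_rinvar; eassumption.
have inv : rinvar K0v [set X | S (un X)].
  have H X b : K0v b -> S (un X) -> S (un (X * b)).
    move=> Kb [h1 h2]; split; first exact: (dcJ_mulr Kb h1).
    by apply/iwasawaE; rewrite hU //; apply/iwasawaE.
  move=> X b Kb; apply/propext; split=> /=; last exact: H.
  have [bu bV] := k0V Kb; by move=> /(H _ _ bV); rewrite mulrK.
have sub : [set X | S (un X)] `<=` dcJ C by move=> X [].
have t' := coset_reps_sub tC sub inv.
have := lcosets_sum (f := fun _ => 1 : Om) t' => -> //.
set t2 := [seq _ <- _ | _].
have -> : \sum_(X <- t2) (1 : Om) = (size t2)%:R by rewrite -sum1_size natr_sum.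
rewrite size_filter; congr (_%:R); apply: eq_in_count => X Xt.
apply/asbool_equiv_eq; split; first by move=> [_ h]; apply/iwasawaE.
by move=> h; split; [exact: (tS _ Xt)|apply/iwasawaE].
Qed.

Lemma two_rhoB nu i : two_rho (nu - mu *+ i) = two_rho nu - (rho * i)%N%:Z.
Proof.
have -> : (rho * i)%N%:Z = two_rho mu *+ i by rewrite rhoE -mulr_natr natz PoszM.
rewrite /two_rho -sumrMnl -sumrB; apply: eq_bigr => j _.
by rewrite !ffunE ffunMnE mulrBr mulrnAr.
Qed.

Lemma iota_sq0 : iota sq != 0.
Proof.
apply/eqP; rewrite -(rmorph0 iota) => /iota_inj e; move: sq_unit; rewrite e unitr0.
by [].
Qed.

Lemma char_poly_vanish (t : 'I_n -> Om) : (forall j, t j != 0) ->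
  \sum_(i < N.+1) (\sum_(l \in [set: {ffun 'I_n -> int}]) satake B pi iota sq (A i) l * charac t l)
    * (iota sq ^ two_rho mu * charac t mu) ^+ i = 0.
Proof.
move=> t0; set e := iota sq ^ two_rho mu; set M := e *: r (dual_torus t).
have [u u0 [_ hw]] := rep_hw r_mu.
have hu : M *m u = (e * charac t mu) *: u by rewrite /M -scalemxAl hw // scalerA.
(* [eigenvalue] is about row vectors, whereas the highest weight vector is a column. *)
have tr : char_poly M^T = char_poly M.
  rewrite /char_poly -[in RHS]det_tr; congr (\det _); apply/matrixP => i j.
  by rewrite !mxE eq_sym.
have ev : eigenvalue M^T (e * charac t mu).
  apply/eigenvalueP; exists u^T; first by rewrite -trmx_mul hu linearZ.
  by apply: contraNneq u0 => /(congr1 trmx); rewrite trmxK trmx0 => ->.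
move: ev; rewrite eigenvalue_root_char tr => /rootP; rewrite horner_coef size_char_poly => h0; rewrite -[RHS]h0.
by apply: eq_bigr => i _; congr (_ * _); exact: (A_hecke t0 i).
Qed.

Section Lists.
Variables (tl : dcoset Phi Kv -> seq T).
Hypothesis tlP : forall C, coset_reps K0v (dcJ C) (tl C).
Local Notation iotaN := (seq.iota 0 N.+1).

Definition lam (d : T) : {ffun 'I_n -> int} := xget 0 [set l | unip_cell vv c pi l d].

Definition wts : seq {ffun 'I_n -> int} :=
  flatten [seq flatten [seq [seq lam d | d <- tl C] | C <- enum_fset (msupp (A i))] | i <- iotaN].

Lemma satake_support i l : (i < N.+1)%N -> satake B pi iota sq (A i) l != 0 -> l \in wts.
Proof.
move=> iN; apply: contraNT => lS; rewrite /satake big1_seq // => C /= CA.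
rewrite (satake_dcE l (tlP C)).
suff -> : count (fun d => `[< unip_cell vv c pi l d >]) (tl C) = 0%N by rewrite !mulr0.
apply/eqP; rewrite -leqn0 leqNgt -has_count; apply/hasP => -[d dt /asboolP hd].
case/negP: lS; apply/flattenP.
exists (flatten [seq [seq lam d | d <- tl C] | C <- enum_fset (msupp (A i))]).
  by apply/mapP; exists i; rewrite ?mem_iota.
apply/flattenP; exists [seq lam d | d <- tl C]; first by apply/mapP; exists C.
apply/mapP; exists d => //; apply: (unip_uniq hd).
by apply: (xgetPex 0 (P := [set l | unip_cell vv c pi l d])); exists l.
Qed.

Definition pairs : seq (nat * dcoset Phi Kv) := [seq (i, C) | i <- iotaN, C <- enum_fset (msupp (A i))].

Lemma sum_pairs (M : nmodType) (f : nat * dcoset Phi Kv -> M) :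
  \sum_(j <- pairs) f j = \sum_(i < N.+1) \sum_(C <- enum_fset (msupp (A i))) f (nat_of_ord i, C).
Proof.
rewrite /pairs big_allpairs_dep -[iotaN]/(index_iota 0 N.+1) big_mkord.
by [].
Qed.

(** The ith power of the root contributes sq^(i <2 rho, mu>), and delta^(1/2) at nu - i mu
    contributes the same power besides the common factor sq^(- <2 rho, nu>); together they make q^(i
    <2 rho, mu>). *)
Lemma satake_zero nu : \sum_(j <- pairs) iota (A j.1)@_(j.2) *
   ((q ^ (j.1 * `|two_rho mu|))%N%:R *
    (count (fun d => `[< unip_cell vv c pi (nu - mu *+ j.1) d >]) (tl j.2))%:R) = 0.
Proof.
have H := satake_extract Om0 satake_support char_poly_vanish nu.
rewrite sum_pairs; have s0 := iota_sq0.
have u0 : iota sq ^ (- two_rho nu) != 0 by rewrite expfz_eq0 (negbTE s0) andbF.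
apply: (mulfI u0); rewrite mulr0 -[RHS]H mulr_sumr; apply: eq_bigr => i _ /=.
rewrite /satake mulr_suml mulr_sumr; apply: eq_bigr => C _.
rewrite (satake_dcE _ (tlP C)) two_rhoB rhoE absz_nat -exprnP -exprM.
have -> : - (two_rho nu - (rho * i)%N%:Z) = - two_rho nu + (rho * i)%N%:Z by rewrite opprB addrC.
rewrite (expfzDr _ _ s0) -exprnP.
have hq : q%:R = iota sq ^+ 2 :> Om by rewrite -rmorphXn /= sq_sqrt rmorph_nat.
rewrite natrX hq -exprM [(2 * _)%N](_ : _ = (rho * i + rho * i)%N); last by move: (nat_of_ord i); clear; lia.
rewrite exprD.
have E (a b x y : Om) : a * (b * (x * x * y)) = b * (a * x * y) * x by ring.
exact: E.
Qed.

End Lists.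

Lemma hecke_side (y : T) (s : nat -> seq T) (x : nat -> {malg R[ZK W K]}) : SOw Phi y ->
  (forall i, coset_reps K0v (iwahori_cell vv c pi mu i) (s i)) ->
  (forall i, size (s i) = (q ^ (i * `|two_rho mu|))%N) ->
  (forall i a, a \in s i -> exists u,
        [/\ SOJ c u, unitriangular u, mxint vv u & a = u *m cv (mu *+ i)]) ->
  (forall i, (i < N.+1)%N -> x i = \sum_(a <- s i) zf y a) ->
  \sum_(i < N.+1) hecke (x i) (A i) = 0.
Proof.
move=> Sy sP s_size s_unip xE; have [tl tlP] := choice dc_reps.
have sS i a : a \in s i -> SOJ c a.
  move=> /s_unip[u [Su _ _ ->]]; apply: SOJM => //; exact: (cochar_SOJ c pi1).
pose cf (j : nat * dcoset Phi Kv) : R := (A j.1)@_(j.2).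
pose ix (j : nat * dcoset Phi Kv) := j.1.
pose tj (j : nat * dcoset Phi Kv) := tl j.2.
transitivity (\sum_(j <- pairs) cf j *: \sum_(a <- s (ix j)) \sum_(d <- tj j) zf y (a * d)).
  rewrite (sum_pairs tlP); apply: eq_bigr => i _; rewrite hecke_hop; apply: eq_bigr => C _.
  rewrite /cf /ix /tj /=; congr (_ *: _).
  have -> : x i = \sum_(a <- s i) (1 : R) *: Zbasis R (zc (y *m un a)).
    rewrite xE //; apply: eq_big_seq => a /sS Sa; by rewrite scale1r zfE.
  rewrite (hop_sum C (s i) (fun=> 1) (fun a => zc (y *m un a))); apply: eq_big_seq => a /sS Sa.
  have Sya : SOw Phi (y *m un a) by apply: SOwM => //; apply/un_SO.
  rewrite scale1r (hecke_basis_reps Sya (tlP C)); apply: eq_big_seq => d dt.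
  have [_ tS _ _] := tlP C; have Sd := dcJ_SO (tS _ dt).
  rewrite (zfE _ Sd) zfE; last exact: SOJM.
  have -> : un (a * d) = un a *m un d by rewrite -unM.
  by rewrite (mulmxA y (un a) (un d)).
have tP j : coset_reps K0v ((fun j => dcJ j.2) j) (tj j) by exact: tlP.
have CS j X : (fun j : nat * dcoset Phi Kv => dcJ j.2) j X -> SOJ c X by exact: dcJ_SO.
have CK j X b : K0v b -> (fun j : nat * dcoset Phi Kv => dcJ j.2) j X ->
  (fun j : nat * dcoset Phi Kv => dcJ j.2) j (b * X) by exact: dcJ_mull.
exact: (hecke_vanish_list cu cr pi1 iota_inj Om0 tP CS CK (satake_zero tlP) sP s_size s_unip (zf_rinvar Sy)).
Qed.

Local Notation Ul k := (Ulevel S1 US k).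
Local Notation km m := (fun w : place F => if w == v then (m * s1)%N else 0%N).
Local Notation EE m := (fixed_field fplus art art1 (Ul (km m))).
Local Notation ta m := (un (cv (mu *+ m))).
Local Notation ttv := (@tt F D Fw v (b0 eta)).
Local Notation rt y := (rot n (eps eta) (@al F D Fw v (b0 eta) y) (@be F D Fw v (b0 eta) y)).

Definition ut (t : Ew Fw D v) : Efam Fw D := dfwith (@Eone F D Fw) v t.
Lemma ut_v t : ut t v = t. Proof. exact: dfwith_in. Qed.
Lemma ut_ne t w : w <> v -> ut t w = 1.
Proof. move=> ne; change (dfwith (@Eone F D Fw) v t w = @Eone F D Fw w).
by apply: dfwith_out; apply/eqP => e; apply: ne. Qed.

Lemma ut_Ul m t : U1 (m * s1) t -> Ul (km m) (ut t).
Proof.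
move=> Ut; split.
- split=> [w|].
    case: (pselect (w = v)) => [e|ne]; last by rewrite ut_ne // rmorph1 mulr1.
    by subst w; rewrite ut_v; exact: (U1_norm1 Ut).
  apply: (@sub_finite_set _ _ set0) => // w /= h; apply: h.
  case: (pselect (w = v)) => [e|ne].
    by subst w; rewrite ut_v; apply/OEP; apply: U1_int Ut.
  by rewrite ut_ne //; apply/OEP; exact: rpred1.
- have -> : Etrunc S1 (ut t) = @Eone F D Fw.
    apply: functional_extensionality_dep => w; rewrite /Etrunc; case: pselect => // Sw /=.
    by rewrite ut_ne // => e; rewrite e in Sw.
  by case: US_compact_open => _ [].
- move=> w nS; case: (pselect (w = v)) => [e|ne].
    by subst w; rewrite ut_v eqxx.
  have -> : (w == v) = false by apply/eqP.
  by rewrite ut_ne //; exact: U1_1.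
Qed.

Lemma Ul_0 kk u : Ul kk u -> Ul (fun=> 0%N) u.
Proof. by move=> h; eapply Ul_le; try eassumption; move=> w; rewrite leq0n. Qed.
Lemma Ul_v m u : Ul (km m) u -> U1 (m * s1) (u v).
Proof. by move=> [_ _ h]; have := h v v_S; rewrite eqxx. Qed.

Lemma ta_SO m : SOw Phi (ta m).
Proof. by apply/un_SO; exact: (cochar_SOJ c pi1). Qed.
Lemma cvKV l : cv l *m cv (- l) = 1%:M.
Proof. by have := cochar_mxV pi1 (- l); rewrite opprK. Qed.

Lemma cv_tconj l (X : T) : cv l *m tconj pi l X = X *m cv l.
Proof. by rewrite /tconj !mulmxA cvKV mul1mx. Qed.

(** [US_det] supplies s in H(A_f) with determinant u that is absorbed away from v. Its v-component
    may be replaced by any unitary x of the same determinant, since the Galois action sees s only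
    through its determinant. *)
Lemma gact_point (sg : {rmorphism algC -> algC}) u (y x : T) h : GalE fplus sg -> Ul (fun=> 0%N) u ->
  (forall a, Einfty fplus art a -> art1 u a = sg a) -> SOw Phi y -> Upt W x h -> \det h = u v ->
  gact sg (zc y) = zc (x *m y).
Proof.
move=> Gr Uu e Sy Ux dx; have [s [Gs Hs] Ks] := US_det Uu.
have Sx : SOw Phi x by case: Ux.
have Hs' : Hdet W (updv s x) u.
  split; first exact: updv_Gad.
  move=> w; case: (pselect (w = v)) => [ew|ne]; last by rewrite updv_ne //; exact: Hs.
  by subst w; rewrite updv_v; exists h.
rewrite (gact_galois Gr Hs' (updv_Gad g_G Sy) e).
exact: (zc_gact W KG K1 KD K_product v_S g_G Gs Ks Sy Sx).
Qed.

Lemma cochar_muMn m a : cochar_exp (mu *+ m) a = cochar_exp mu a *+ m.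
Proof.
elim: m => [|m IH]; first by rewrite !mulr0n cochar_exp0.
by rewrite !mulrS cochar_expD IH.
Qed.
Lemma s1Mn m : s1%:Z *+ m = (m * s1)%N%:Z.
Proof. by rewrite -mulr_natr natz -PoszM mulnC. Qed.

Lemma rot_pt m y : (0 < m)%N -> y \in vpow vv (m * s1)%N%:Z -> exists h,
  [/\ Upt W (un (rt y)) h, \det h = ttv y, Iw vv c (tconj pi (mu *+ m) (rt y))
    & un (rt y) *m ta m = ta m *m un (tconj pi (mu *+ m) (rt y))].
Proof.
move=> m0 hy; have ms : (0 < m * s1)%N by rewrite muln_gt0 m0.
have hy1 : y \in vpow vv 1 by apply: vpow_le hy; move: ms; clear; lia.
have [h [S U d]] := rotation D0 n0 Phi_sym Phi_unit two_unit lb hy1.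
exists h; split=> //.
  apply: (rot_tconj D0 n0 Phi_sym Phi_unit two_unit lb pi1 ms hy).
  - by move=> a b ab; rewrite !cochar_muMn lerMn2r mu_dom ?orbT.
  - by rewrite cochar_exp_mid.
  - by rewrite cochar_muMn mu_m1 s1Mn.
  - by rewrite !cochar_muMn mu_m1 mu_p1 mulNrn.
by rewrite -(unM (rt y)) -(unM (cv (mu *+ m))) cv_tconj.
Qed.

(** x is the rotation of the line of w_1 by t, which tau^-m conjugates into K by [rot_pt]. *)
Lemma fix_level m t : (0 < m)%N -> U1 (m * s1) t -> exists x h,
  [/\ Upt W x h, \det h = t & forall y, SOw Phi y -> zc (y *m x *m ta m) = zc (y *m ta m)].
Proof.
move=> m0 Ut; have ms : (0 < m * s1)%N by rewrite muln_gt0 m0.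
have [y hy ->] := U1_ex_tt D0 two_unit epsu ms Ut.
have [h [U d [S [ii _]] e]] := rot_pt m0 hy.
exists (un (rt y)), h; split=> // y0 Sy0.
rewrite -(mulmxA y0 (un (rt y)) (ta m)) e (mulmxA y0 (ta m) (un (tconj pi (mu *+ m) (rt y)))); apply: zmulr.
  by apply: SOwM => //; exact: ta_SO.
by apply: Kv_un; split.
Qed.

Lemma level_fixed m (sg : {rmorphism algC -> algC}) : (0 < m)%N -> galfix (EE m) sg ->
  gact sg (zc (ta m)) = zc (ta m).
Proof.
move=> m0 fx.
have [l0 Hl e] := galois_lift D0 art_artin art1_artin S1_prime US_compact_open Phi_sym Phi_unit K_compact_open g_G US_det fx.
have Gr : GalE fplus sg by eapply rho_gal; eassumption.
have [x [h [Ux dx fx']]] := fix_level m0 (Ul_v Hl).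
rewrite (gact_point Gr (Ul_0 Hl) e (ta_SO m) Ux dx).
by have := fx' _ (SOw1 Fw Phi v); rewrite !mul1mx.
Qed.

(** In Cayley coordinates the quotient of the levels m and m + i is pi^(m s_1) O modulo pi^((m + i)
    s_1), with representatives pi^(m s_1) rr a. The fixed translate dl leaves room for the
    determinant of the unitary approximation in [near_pt]. *)
Lemma trace_reps m i (J : finType) (rr : J -> k) dl : (0 < m)%N ->
  (forall a, rr a \in vint vv) ->
  (forall a b, rr a - rr b \in vpow vv (i * s1)%N%:Z -> a = b) ->
  (forall x, x \in vint vv -> exists a, x - rr a \in vpow vv (i * s1)%N%:Z) ->
  U1 (m * s1) dl ->
  gal_trace R gact (EE (m + i)%N) (EE m) (zc (ta (m + i)%N)) =
  \sum_a Zbasis R (gact (art1 (ut (ttv (pi ^ (m * s1)%N%:Z * rr a) * dl))) (zc (ta (m + i)%N))).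
Proof.
move=> m0 rint rsep rcov Ud.
have ms : (0 < m * s1)%N by rewrite muln_gt0 m0.
have ms' : (0 < (m + i) * s1)%N by rewrite muln_gt0 addn_gt0 m0.
have mi0 : (0 < m + i)%N by rewrite addn_gt0 m0.
have p0 := pi_neq0 pi1.
pose yy a := pi ^ (m * s1)%N%:Z * rr a; pose uf a := ut (ttv (yy a) * dl).
have yv a : yy a \in vpow vv (m * s1)%N%:Z by apply: vpowMr => //; exact: (vpow_pi pi1).
have y1 a : yy a \in vpow vv 1 by apply: vpow_le (yv a); move: ms; clear; lia.
have ud : dl \is a GRing.unit by apply: qunit_norm1; exact: (U1_norm1 Ud).
have utt a : ttv (yy a) \is a GRing.unit.
  by apply: qunit_norm1; exact: (tt_norm1 D0 two_unit epsu (y1 a)).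
have ufU a : Ul (km m) (uf a).
  by apply: ut_Ul; apply: U1M => //; exact: (U1_tt D0 two_unit epsu ms (yv a)).
have kmM w : (km m w <= km (m + i)%N w)%N.
  by case: ifP => // _; rewrite leq_mul2r leq_addr orbT.
have cover u : Ul (km m) u -> exists a, Ul (km (m + i)%N) (Emul (fun w => (uf a w)^-1) u).
  move=> Uu; have Uv := Ul_v Uu.
  have U2 : U1 (m * s1) (dl^-1 * u v) by apply: U1M => //; exact: U1V.
  have [y hy ey] := U1_ex_tt D0 two_unit epsu ms U2.
  have hy1 : y \in vpow vv 1 by apply: vpow_le hy; move: ms; clear; lia.
  pose y' := pi ^ (- (m * s1)%N%:Z) * y.
  have y'i : y' \in vint vv by rewrite /y' -(vpow_vintE pi1).
  have [a ha] := rcov _ y'i; exists a.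
  have Ua : Ul (km m) (Emul (fun w => (uf a w)^-1) u) by apply: UlM => //; exact: UlV.
  have [a1 a2 a3] := Ua; split=> // w nS; case: (pselect (w = v)) => [ew|ne]; last first.
    by have := a3 w nS; have -> : (w == v) = false by apply/eqP.
  subst w; rewrite eqxx /Emul /uf ut_v.
  have -> : (ttv (yy a) * dl)^-1 * u v = (ttv (yy a))^-1 * ttv y.
    by rewrite -ey invrM // mulrAC mulrC.
  have [y3 [e3 h3 h3']] := tt_ldiv D0 two_unit epsu (y1 a) hy1.
  rewrite e3; apply: (U1_tt D0 two_unit epsu ms'); rewrite h3'.
  have -> : y - yy a = pi ^ (m * s1)%N%:Z * (y' - rr a).
    by rewrite mulrBr /y' mulrA -expfzDr // subrr expr0z mul1r.
  by have := vpowM (vpow_pi pi1 (m * s1)%N%:Z) ha; rewrite -PoszD -mulnDl.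
have sep a b : Ul (km (m + i)%N) (Emul (fun w => (uf a w)^-1) (uf b)) -> a = b.
  move=> Uab; have := Ul_v Uab; rewrite /Emul /uf !ut_v.
  have -> : (ttv (yy a) * dl)^-1 * (ttv (yy b) * dl) = (ttv (yy a))^-1 * ttv (yy b).
    by rewrite invrM // [ttv (yy b) * dl]mulrC mulrACA mulVr // mul1r.
  have [y3 [e3 y31 h3]] := tt_ldiv D0 two_unit epsu (y1 a) (y1 b).
  rewrite e3 => U3; have [y4 h4 e4] := U1_ex_tt D0 two_unit epsu ms' U3.
  have h41 : y4 \in vpow vv 1 by apply: vpow_le h4; move: ms'; clear; lia.
  have e5 := tt_inj D0 two_unit epsu y31 h41 e4.
  move: h4; rewrite -e5 h3 /yy -mulrBr (vpowE pi1) mulnDl PoszD addrAC subrr add0r.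
  by move=> /rsep.
have Hz1 (sg : {rmorphism algC -> algC}) u : GalE fplus sg -> Ul (km m) u ->
  (forall x, Einfty fplus art x -> art1 u x = sg x) ->
  gact sg (zc (ta (m + i)%N)) = gact (art1 u) (zc (ta (m + i)%N)).
  move=> Gr Uu e; have [s Hs Ks] := US_det (Ul_0 Uu).
  have Tu : T1ad u by case: Uu.
  have Gu := artin1_gal art1_artin Tu; have gy := updv_Gad g_G (ta_SO (m + i)%N).
  rewrite (gact_galois Gr Hs gy e).
  by rewrite (gact_galois Gu Hs gy (fun _ _ => erefl)).
have Hz2 u t : Ul (km m) u -> Ul (km (m + i)%N) t ->
  gact (art1 (Emul u t)) (zc (ta (m + i)%N)) = gact (art1 u) (zc (ta (m + i)%N)).
  move=> Uu Ut; have [x [h [Ux dx fx]]] := fix_level mi0 (Ul_v Ut).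
  have [s [Gs Hs] Ks] := US_det (Ul_0 Uu); have [hs Us ds] := Hs v.
  have Ut0 := Ul_0 Ut; have Uu0 := Ul_0 Uu.
  have Uut : Ul (fun=> 0%N) (Emul u t) by apply: UlM.
  have Gu : GalE fplus (art1 u) by apply: (artin1_gal art1_artin); case: Uu.
  have Gut : GalE fplus (art1 (Emul u t)) by apply: (artin1_gal art1_artin); case: Uut.
  rewrite (gact_point Gu Uu0 (fun _ _ => erefl) (ta_SO _) Us (esym ds)).
  have dd : \det (hs *m h) = Emul u t v by rewrite det_mulmx -ds dx.
  rewrite (gact_point Gut Uut (fun _ _ => erefl) (ta_SO _) (UptM Us Ux) dd).
  by apply: fx; case: Us.
by eapply gal_trace_reps with (uf := uf); eassumption.
Qed.

(** With u' = tau^m u tau^-m, which is near 1, and u' b = X from [unitary_near], one gets tau^m a =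
    X tau^(m + i) kk, where kk is b^-1 conjugated by tau^(m + i). As b^-1 is lower triangular and mu
    dominant, kk is integral and disappears in K. *)
Lemma near_pt m i (a : T) : (0 < m)%N ->
  (exists u, [/\ SOJ c u, unitriangular u, mxint vv u & a = u *m cv (mu *+ i)]) ->
  exists x h, [/\ Upt W x h, U1 (m * s1) (\det h) &
    forall y, SOw Phi y -> zc (y *m (ta m *m un a)) = zc (y *m x *m ta (m + i)%N)].
Proof.
move=> m0 [u [Su ut' ui ea]]; have ms : (0 < m * s1)%N by rewrite muln_gt0 m0.
pose l := mu *+ m; pose u' := cv l *m u *m cv (- l).
have Su' : SOJ c u'.
  by apply: SOJM; [apply: SOJM => //|]; exact: (cochar_SOJ c pi1).
have u'E a1 b1 : u' a1 b1 = pi ^ (cochar_exp l a1 - cochar_exp l b1) * u a1 b1.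
  have -> : u' = tconj pi (- l) u by rewrite /tconj opprK.
  by rewrite (tconjE pi1) !cochar_expN opprK addrC.
have u1 a1 b1 : u' a1 b1 - (a1 == b1)%:R \in vpow vv 1.
  rewrite u'E; case: (ltngtP a1 b1) => [ab|ba|/val_inj ->].
  - have -> : (a1 == b1) = false by apply/eqP => e; rewrite e ltnn in ab.
    rewrite subr0; apply: vpowMr; last exact: ui.
    apply: vpow_le (vpow_pi pi1 _); rewrite !cochar_muMn -mulrnBl.
    have lt0 : 0 < cochar_exp mu a1 - cochar_exp mu b1 by rewrite subr_gt0 mu_strict.
    by have := int_mulrn_gt m lt0; move: m0; move: (_ *+ m); clear; lia.
  - have -> : (a1 == b1) = false by apply/eqP => e; rewrite e ltnn in ba.
    by rewrite ut'.1 // mulr0 subr0 rpred0.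
  - by rewrite ut'.2 subrr expr0z mul1r eqxx subrr rpred0.
have [X [oX XT Xn X1 [b [ob bi bl eX]]]] := unitary_near cu cr two_unit
  (eps_unit D0 n0 Phi_sym Phi_unit two_unit lb) (nu_eps D0 n0 Phi_sym Phi_unit two_unit lb) Su'.1 u1.
have dX := orth_near_det D0 n0 Phi_sym Phi_unit two_unit lb oX X1.
have SX : SOJ c X by split.
have [h [hU _ hP]] := unitary_point D0 n0 Phi_sym Phi_unit two_unit lb SX XT Xn.
have [_ hh _ _] := hU; have nh := unitary_norm1 D0 n0 Phi_sym Phi_unit two_unit lb hh.
(* As b is lower triangular, only columns of u' from n + i' on contribute. There the exponent of mu
   is at most 0, while in the row of e_(l' + 1) it is at least s_1. *)
have XC (l' i' : 'I_n) : X (topi l') (inord (n + i')) \in vpow vv (m * s1)%N%:Z.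
  have n1 : (n - l'.+1 < n.*2.+1)%N by move: n0; clear; lia.
  have n2 : (n + i' < n.*2.+1)%N by have := ltn_ord i'; clear; lia.
  rewrite eX mxE; apply: rpred_sum => a1 _.
  have [lt|ge] := ltnP a1 (n + i'); first by rewrite bl ?inordK // mulr0 rpred0.
  apply: vpowMr; last exact: bi.
  rewrite u'E; apply: vpowMr; last exact: ui.
  apply: vpow_le (vpow_pi pi1 _); rewrite !cochar_muMn -mulrnBl.
  have e1 : s1%:Z <= cochar_exp mu (topi l') by apply: mu_lo; rewrite /topi inordK //; move: n0 (ltn_ord l'); clear; lia.
  have e2 : cochar_exp mu a1 <= 0 by apply: mu_hi; move: ge; clear; lia.
  have : 0 <= (cochar_exp mu (topi l') - cochar_exp mu a1 - s1%:Z) *+ m.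
    by apply: mulrn_wge0; move: e1 e2; clear; lia.
  by rewrite [X in 0 <= X]mulrnBl s1Mn subr_ge0.
exists (un X), h; split=> //.
  exact: (unitary_det D0 n0 Phi_sym Phi_unit two_unit lb ms oX Xn X1 XC hP nh).
move=> y Sy; pose L := mu *+ (m + i).
have db : \det b = 1 by have := dX; rewrite eX det_mulmx Su'.2 mul1r.
have Sb : SOJ c b by split.
have ub := SOJu Sb.
have bV (i1 j1 : 'I_n.*2.+1) : (i1 < j1)%N -> invmx b i1 j1 = 0.
  move=> ij; rewrite (orth_inv_entry cnz cr _ _ ob) bl ?mulr0 ?mul0r //=.
  by have := ltn_ord j1; move: ij; clear; lia.
have bVi : mxint vv (invmx b) by exact: (mxintV cu cr ob bi).
pose kk := tconj pi L (invmx b).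
have Kk : K0v kk.
  split; last exact: (lower_tconj pi1 mu_dom (m + i) bVi bV).
  by apply: SOJM; [apply: SOJM => //; [exact: (cochar_SOJ c pi1)|exact: (SOJV cu cr Sb)]|exact: (cochar_SOJ c pi1)].
have e1 : cv l *m a = X *m cv L *m kk.
  have -> : X *m cv L *m kk = u' *m cv L.
    rewrite /kk /tconj eX -!mulmxA [cv L *m (cv (- L) *m _)]mulmxA cvKV mul1mx.
    by rewrite [b *m _]mulmxA mulmxV // mul1mx.
  rewrite ea /u' /L mulrnDr (cochar_mxD pi1) -/l -!mulmxA [cv (- l) *m _]mulmxA.
  by rewrite (cochar_mxV pi1) mul1mx.
have -> : y *m (ta m *m un a) = y *m un X *m ta (m + i)%N *m un kk.
  by rewrite -unM e1 !unM !mulmxA.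
apply: zmulr; last exact: Kv_un.
by apply: SOwM (ta_SO _); apply: SOwM => //; apply/un_SO.
Qed.

(** Double counting over the q^(i s_1) rotations and the q^(i rho) cosets. For a fixed rotation the
    sum over cosets is unchanged, since tau^-m conjugates the rotation into the Iwahori subgroup;
    for a fixed coset the sum over rotations is the trace. Then q^(i s_1), a unit, is cancelled. *)
Lemma trace_side m i (s : seq T) : (0 < m)%N ->
  coset_reps K0v (iwahori_cell vv c pi mu i) s -> size s = (q ^ (i * rho))%N ->
  (forall a, a \in s -> exists u,
        [/\ SOJ c u, unitriangular u, mxint vv u & a = u *m cv (mu *+ i)]) ->
  \sum_(a <- s) zf (ta m) a = q%:R ^+ (i * (rho - s1)) *:
    gal_trace R gact (EE (m + i)%N) (EE m) (zc (ta (m + i)%N)).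
Proof.
move=> m0 sP s_size s_unip.
set Tr := gal_trace _ _ _ _ _; set Sm := \sum_(a <- s) _.
have qu : q%:R \is a @GRing.unit R by rewrite -sq_sqrt unitrX.
have hinj (X Y : {malg R[ZK W K]}) : q%:R ^+ (i * s1) *: X = q%:R ^+ (i * s1) *: Y -> X = Y.
  by move=> h; rewrite -[X]scale1r -[Y]scale1r -(mulVr (unitrX (i * s1) qu)) -!scalerA h.
apply: hinj; rewrite scalerA -exprD -mulnDr subnKC //.
have [J [rr [cJ rint rsep rcov]]] := residue_reps pi1 q_w (i * s1)%N.
have sS a : a \in s -> SOJ c a.
  move=> /s_unip[u [Su _ _ ->]]; apply: SOJM => //; exact: (cochar_SOJ c pi1).
pose yy a := pi ^ (m * s1)%N%:Z * rr a.
have yv a : yy a \in vpow vv (m * s1)%N%:Z by apply: vpowMr => //; exact: (vpow_pi pi1).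
have ms : (0 < m * s1)%N by rewrite muln_gt0 m0.
have stepA j : Sm = \sum_(a <- s) Zbasis R (zc (un (rt (yy j)) *m (ta m *m un a))).
  have [h [U d Ib e]] := rot_pt m0 (yv j).
  have bu : tconj pi (mu *+ m) (rt (yy j)) \is a GRing.unit by apply: SOJu; case: Ib.
  have cell : [set tconj pi (mu *+ m) (rt (yy j)) * x | x in iwahori_cell vv c pi mu i] = iwahori_cell vv c pi mu i.
    by have hcu := cu; have hcr := cr; eapply iwahori_cell_mull; eassumption.
  rewrite /Sm -(coset_sum_mull bu cell sP (zf_rinvar (ta_SO m))); apply: eq_big_seq => a /sS Sa.
  rewrite zfE; last by apply: SOJM => //; case: Ib.
  have -> : un (tconj pi (mu *+ m) (rt (yy j)) * a) = un (tconj pi (mu *+ m) (rt (yy j))) *m un a by rewrite -unM.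
  by rewrite (mulmxA (ta m) (un (tconj pi (mu *+ m) (rt (yy j)))) (un a)) -e -(mulmxA (un (rt (yy j))) (ta m) (un a)).
have stepB a : a \in s -> \sum_j Zbasis R (zc (un (rt (yy j)) *m (ta m *m un a))) = Tr.
  move=> /s_unip ha; have [x [h [Ux Ud fx]]] := near_pt m0 ha.
  rewrite /Tr (trace_reps m0 rint rsep rcov Ud); apply: eq_bigr => j _; congr (Zbasis R _).
  have [hj [Uj dj _ _]] := rot_pt m0 (yv j).
  have Sj : SOw Phi (un (rt (yy j))) by case: Uj.
  have Utt : Ul (km m) (ut (ttv (yy j) * \det h)).
    by apply: ut_Ul; apply: U1M => //; exact: (U1_tt D0 two_unit epsu ms (yv j)).
  have G : GalE fplus (art1 (ut (ttv (yy j) * \det h))).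
    by apply: (artin1_gal art1_artin); case: Utt.
  have dd : \det (hj *m h) = ut (ttv (yy j) * \det h) v by rewrite ut_v det_mulmx dj.
  rewrite (fx _ Sj).
  by rewrite (gact_point G (Ul_0 Utt) (fun _ _ => erefl) (ta_SO _) (UptM Uj Ux) dd).
have eL : q%:R ^+ (i * s1) *: Sm = \sum_(j : J) Sm.
  by rewrite sumr_const cJ -natrX scaler_nat.
have eR : q%:R ^+ (i * rho) *: Tr = \sum_(a <- s) Tr.
  by rewrite big_const_seq count_predT iter_addr_0 s_size -natrX scaler_nat.
rewrite eL eR; transitivity (\sum_(j : J) \sum_(a <- s) Zbasis R (zc (un (rt (yy j)) *m (ta m *m un a)))).
  by apply: eq_bigr => j _; exact: stepA.
by rewrite exchange_big; apply: eq_big_seq => a /stepB.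
Qed.

Lemma norm_relation m : (0 < m)%N ->
  \sum_(i < N.+1) q%:R ^+ (i * (rho - s1)) *: hecke
     (gal_trace R gact (EE (m + i)%N) (EE m) (zc (ta (m + i)%N))) (A i) = 0.
Proof.
move=> m0.
have /choice[s sP] i := iwahori_cell_reps cu cr two_unit pi1 q_w mu_dom i.
have sP1 i : coset_reps K0v (iwahori_cell vv c pi mu i) (s i) by case: (sP i).
have sP2 i : size (s i) = (q ^ (i * `|two_rho mu|))%N by case: (sP i).
have sP3 i a : a \in s i -> exists u,
        [/\ SOJ c u, unitriangular u, mxint vv u & a = u *m cv (mu *+ i)].
  by case: (sP i) => _ _ h /h.
pose x i := \sum_(a <- s i) zf (ta m) a.
rewrite -[RHS](hecke_side (ta_SO m) sP1 sP2 sP3 (x := x)) //.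
apply: eq_bigr => i _; rewrite hecke_scale; congr (hecke _ _).
rewrite /x (trace_side m0 (sP1 i)) //; last exact: sP3.
by rewrite sP2 rhoE absz_nat.
Qed.

Lemma tau_pow m : cocharV B pi mu ^+ m = ta m.
Proof.
elim: m => [|m IH]; first by rewrite expr0 mulr0n (cochar_mx0 n pi) un1.
rewrite exprS IH mulrS (cochar_mxD pi1) unM.
by [].
Qed.

End Assembly.
Unset Default Proof Using.

Lemma signature_unit (F : fieldType) (D : F) (fplus : {rmorphism quad D -> algC}) m
  (Phi : 'M[F]_m) a b : signature (fun x => fplus (qin D x)) Phi a b -> Phi \in unitmx.
Proof.
case=> _ [P [_ uP e]]; pose f : {rmorphism F -> algC} := fplus \o qin D.
have eM : map_mx (fun x => fplus (qin D x)) Phi = map_mx f Phi by [].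
have := congr1 determinant e; rewrite !det_mulmx det_tr det_diag eM det_map_mx => e2.
rewrite unitmxE unitfE; apply/eqP => d0; move: e2; rewrite d0 rmorph0 mulr0 mul0r => e2.
move/esym/eqP: e2; apply/negP/prodf_neq0 => i _.
by rewrite mxE; case: ifP => _; rewrite ?oppr_eq0 oner_eq0.
Qed.

Section CompletionAt.
Variables (F : fieldExtType rat) (Fw : completions F) (v : place F).
Local Notation vv := (comp_val (Fw v)).

Lemma vunt2 (S1 : seq nat) : 2%N \in S1 -> ~ Sabove S1 v -> vunt vv 2%:R.
Proof.
move=> S2 vS; have nz : 2%:R != 0 :> Fw v.
  by rewrite -(rmorph_nat (comp_inj (Fw v))) fmorph_eq0; exact: (fieldExt_char0 F 1).
have i2 : 2%:R \in vpow vv 0.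
  have : 1 + 1 \in vint vv by apply: rpredD; exact: vint1.
  exact.
have e : vv 2%:R = v 2%:R by rewrite -(comp_valE (Fw v)) rmorph_nat.
rewrite /vunt nz /= eq_le; rewrite vpow_val // in i2; rewrite i2 andbT leNgt.
by apply/negP => h; apply: vS; exists 2%N; rewrite // -e.
Qed.

Lemma comp_residue_card q : residue_card v q -> residue_card vv q.
Proof.
move=> [r [r1 r2 r3]]; exists (fun i => comp_inj (Fw v) (r i)).
have E j a : vge vv j (comp_inj (Fw v) a) <-> vge v j a.
  split=> -[h|h].
  - by left; apply/eqP; rewrite -(fmorph_eq0 (comp_inj (Fw v))) h.
  - by right; rewrite -(comp_valE (Fw v)).
  - by left; rewrite h rmorph0.
  - by right; rewrite comp_valE.
split=> [i|i j h|x hx]; first by apply/E.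
  by apply: r2; apply/E; rewrite rmorphB.
have [a ha] := @comp_dense _ _ (Fw v) x 1.
have /r3[i hi] : vge v 0 a.
  apply/E; apply/vpowP; rewrite -[comp_inj _ a](subKr x); apply: rpredB; first exact/vpowP.
  by apply: (@vpow_le _ _ 0 1) => //; exact/vpowP.
exists i; apply/vpowP; rewrite -[x](subrK (comp_inj (Fw v) a)) -addrA -rmorphB.
by apply: rpredD; apply/vpowP => //; apply/E.
Qed.
End CompletionAt.

Set Default Proof Using "All".

(** * The exponents of the cocharacter mu *)

Section Weight.
Variables (n : nat) (s : nat -> nat).
Hypotheses (n0 : (0 < n)%N) (s1_gt0 : (0 < s 1)%N).
Hypothesis s_incr : forall j, (0 < j < n)%N -> (s j < s j.+1)%N.
Local Notation mu := [ffun k : 'I_n => (s (n - k)%N)%:Z].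

Lemma s_mono i j : (0 < i)%N -> (i < j)%N -> (j <= n)%N -> (s i < s j)%N.
Proof.
move=> i0; elim: j => [|j IH] // ij jn; have [e|lt] := eqVneq i j.
  by rewrite e; apply: s_incr; rewrite -e i0 e.
have ij' : (i < j)%N by move: ij lt; clear; lia.
apply: (ltn_trans (IH ij' (ltnW jn))); apply: s_incr; move: ij' jn; clear; lia.
Qed.
Lemma s_ge i : (0 < i <= n)%N -> (s 1 <= s i)%N.
Proof.
move=> /andP[i0 ii]; have [->//|ne] := eqVneq i 1%N.
by apply: ltnW; apply: s_mono => //; move: i0 ne; clear; lia.
Qed.

Lemma muE (a : 'I_n.*2.+1) : cochar_exp mu a =
  if (a < n)%N then (s (n - a)%N)%:Z else if a == n :> nat then 0 else - (s (a - n)%N)%:Z.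
Proof.
case: (ord_half a) => [[i ->]|->|[i ->]].
- by rewrite cochar_exp_lt ffunE ltn_ord.
- by rewrite cochar_exp_mid ltnn eqxx.
- have hi := ltn_ord i; rewrite cochar_exp_gt ffunE.
  have -> : (n.*2 - i < n)%N = false by move: hi; clear; lia.
  have -> : (n.*2 - i == n)%N = false by apply/eqP; move: hi; clear; lia.
  by have -> : (n.*2 - i - n = n - i)%N by move: hi; clear; lia.
Qed.

Lemma mu_lt (a b : 'I_n.*2.+1) : (a < b)%N -> cochar_exp mu b < cochar_exp mu a.
Proof.
move=> ab; rewrite !muE; have ha := ltn_ord a; have hb := ltn_ord b.
have pos i : (0 < i <= n)%N -> (0 < s i)%N by move=> /s_ge; apply: leq_trans.
have [an|an|an] := ltngtP a n; have [bn|bn|bn] := ltngtP b n.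
- rewrite ltz_nat; apply: s_mono; move: ab an bn; clear; lia.
- have h1 : (0 < s (n - a))%N by apply: pos; move: an; clear; lia.
  by move: h1; clear; lia.
- have h1 : (0 < s (n - a))%N by apply: pos; move: an; clear; lia.
  by move: h1; clear; lia.
- by move: ab an bn; clear; lia.
- rewrite ltrN2 ltz_nat; apply: s_mono; move: ab an bn hb; clear; lia.
- by move: ab an bn; clear; lia.
- by move: ab an bn; clear; lia.
- have h1 : (0 < s (b - n))%N by apply: pos; move: bn hb; clear; lia.
  by move: h1; clear; lia.
- by move: ab an bn; clear; lia.
Qed.

Lemma mu_low (a : 'I_n.*2.+1) : (a < n)%N -> (s 1)%:Z <= cochar_exp mu a.
Proof. by move=> an; rewrite muE an lez_nat; apply: s_ge; move: an; clear; lia. Qed.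
Lemma mu_high (a : 'I_n.*2.+1) : (n <= a)%N -> cochar_exp mu a <= 0.
Proof. by move=> an; rewrite muE ltnNge an /=; case: ifP => // _; rewrite oppr_le0. Qed.
Lemma mu_pred : cochar_exp mu n.-1 = (s 1)%:Z.
Proof.
have h : (n.-1 < n.*2.+1)%N by move: n0; clear; lia.
have := muE (Ordinal h); rewrite /= => ->.
have -> : (n.-1 < n)%N by move: n0; clear; lia.
by have -> : (n - n.-1 = 1)%N by move: n0; clear; lia.
Qed.
Lemma mu_succ : cochar_exp mu n.+1 = - (s 1)%:Z.
Proof.
have h : (n.+1 < n.*2.+1)%N by move: n0; clear; lia.
have := muE (Ordinal h); rewrite /= => ->.
have -> : (n.+1 < n)%N = false by clear; lia.
have -> : (n.+1 == n)%N = false by apply/eqP; clear; lia.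
by have -> : (n.+1 - n = 1)%N by clear; lia.
Qed.
Lemma mu_two_rho : two_rho mu = (\sum_(1 <= j < n.+1) (n.*2 - j.*2 + 1) * s (n.+1 - j))%N%:Z.
Proof.
rewrite (big_morph Posz PoszD (erefl _)) big_add1 big_mkord /two_rho; apply: eq_bigr => i _.
have hi := ltn_ord i; rewrite ffunE PoszM subSS; congr (_%:Z * _).
by move: (nat_of_ord i) hi; clear; move=> j; rewrite -!muln2; lia.
Qed.
(** The last term of the sum is s_1 itself; hence the truncated subtraction in the exponent of [C]
    is a true one. *)
Lemma s1_two_rho : (s 1 <= \sum_(1 <= j < n.+1) (n.*2 - j.*2 + 1) * s (n.+1 - j))%N.
Proof.
rewrite big_nat_recr //= subSnn; apply: leq_trans (leq_addl _ _).
by rewrite subnn mul1n.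
Qed.
End Weight.
Unset Default Proof Using.

Theorem mainTheorem11
  (F : fieldExtType rat) (D : F) (fplus : {rmorphism quad D -> algC})
  (F_totally_real : forall (h : {rmorphism F -> algC}) a, h a \is Num.real)
  (E_quadratic : forall a : F, a ^+ 2 != D)
  (E_totally_imaginary : forall h : {rmorphism quad D -> algC},
     exists a, h a \isn't Num.real)
  (n : nat) (n_gt0 : (0 < n)%N)
  (Phi : 'M[F]_n.*2.+1) (Phi_sym : Phi^T = Phi)
  (sign_f : signature (fun a => fplus (qin D a)) Phi n.*2.-1 2)
  (sign_other : forall h : {rmorphism F -> algC},
     (exists a, h a <> fplus (qin D a)) -> signature h Phi n.*2.+1 0)
  (W : hermitian_hyperplane D Phi)
  (Fw : completions F)
  (art art1 : Efam Fw D -> autC)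
  (art_artin : artin_map fplus art) (art1_artin : artin1_map fplus art art1)
  (S1 : seq nat) (l : nat)
  (S1_prime : forall t, t \in S1 -> prime t)
  (S1_2 : 2%N \in S1) (S1_l : l \in S1)
  (E_unramified : forall (t : nat) (u : place (quad D)),
     prime t -> t \notin S1 -> 0 < u t%:R -> u t%:R = 1)
  (K : set (Gfam Fw n)) (Kloc : forall w, set 'M[Fw w]_n.*2.+1)
  (K_compact_open : compact_open_G Phi K)
  (K_product : level_product S1 Phi K Kloc)
  (K_hyperspecial : forall w : place F, ~ Sabove S1 w ->
     hyperspecialG Phi (Kloc w) /\ hyperspecialH W (Kloc w))
  (g : Gfam Fw n) (g_G : Gad Phi g)
  (g_K : forall w : place F, ~ Sabove S1 w -> Kloc w (g w))
  (US : set (Efam Fw D))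
  (US_compact_open : compact_open_T1S S1 US)
  (US_small : forall e : quad D,
     Ulevel S1 US (fun=> 0%N) (Ediag Fw e) -> e = 1)
  (US_det : forall t, Ulevel S1 US (fun=> 0%N) t ->
     exists2 s, Hdet W s t & K (Gldiv g (Gmul s g)))
  (gact : autC -> ZK W K -> ZK W K)
  (gact_galois : galois_action fplus art art1 gact)
  (v : place F) (v_S : ~ Sabove S1 v) (v_inert : inert D v)
  (v_discV : prime_to_discV Phi v) (v_discW : prime_to_discW W v)
  (pi : Fw v) (pi_unif : comp_val (Fw v) pi = 1)
  (q : nat) (q_v : residue_card v q)
  (eta : Ew Fw D v) (ws vs : nat -> 'cV[Fw v]_n.*2.+1)
  (w_v_basis : local_basis W eta ws vs)
  (K_v : Kloc v = stab_lattice Phi (frame ws vs))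
  (g_v : g v = 1%:M)
  (s : nat -> nat) (s1_gt0 : (0 < s 1)%N)
  (s_incr : forall j, (0 < j < n)%N -> (s j < s j.+1)%N)
  (lam : place rat) (lam_l : 0 < lam l%:R) (Ql : completion lam)
  (L : fieldExtType Ql) (R : comUnitRingType) (inc : {rmorphism R -> L})
  (R_integers : is_integer_ring inc)
  (sq : R) (sq_unit : sq \is a GRing.unit) (sq_sqrt : sq ^+ 2 = q%:R)
  (Om : closedFieldType) (iota : {rmorphism L -> Om})
  (N : nat) (r : 'M[Om]_n.*2 -> 'M[Om]_N)
  (r_mu : irrep_highest_weight r [ffun k : 'I_n => (s (n - k)%N)%:Z])
  (A : nat -> {malg R[dcoset Phi (Kloc v)]})
  (A_hecke : hecke_polynomial (frame ws vs) pi (iota \o inc) sq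
               [ffun k : 'I_n => (s (n - k)%N)%:Z] r A) :
  let tau := cocharV (frame ws vs) pi [ffun k : 'I_n => (s (n - k)%N)%:Z] in
  let z := Zcyc W K g in
  let z_cy m := Zcyc W K (updv g (tau ^+ m)) in
  let Etilde m := fixed_field fplus art art1
    (Ulevel S1 US (fun w => if w == v then (m * s 1)%N else 0%N)) in
  let C i : R := q%:R ^+
    (i * (\sum_(1 <= j < n.+1) (n.*2 - j.*2 + 1) * s (n.+1 - j) - s 1))%N in
  [/\ z_cy 0%N = z,
      forall m, (0 < m)%N ->
        forall rho : {rmorphism algC -> algC}, galfix (Etilde m) rho ->
          gact rho (z_cy m) = z_cy m &
      forall m, (0 < m)%N ->
        \sum_(i < N.+1) C i *: hecke
           (gal_trace R gact (Etilde (m + i)%N) (Etilde m) (z_cy (m + i)%N))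
           (A i) = 0].
Proof.
move=> tau z z_cy Etilde C.
have D0 : D != 0 by have := E_quadratic 0; rewrite expr0n /= eq_sym.
have Phi_unit := signature_unit sign_f.
have two_unit := vunt2 Fw S1_2 v_S.
have q_w := comp_residue_card Fw q_v.
have KvE x : Kloc v x <-> K0 (comp_val (Fw v)) (cc Phi eta ws)
    (invmx (frame ws vs) *m x *m frame ws vs).
  rewrite K_v; split=> -[h1 h2].
    split; first by apply/(SOw_SOJ D0 n_gt0 Phi_sym Phi_unit two_unit w_v_basis).
    by move=> i j; apply/vpowP; exact: h2.
  split; first by apply/(SOw_SOJ D0 n_gt0 Phi_sym Phi_unit two_unit w_v_basis).
  by move=> i j; apply/vpowP; exact: h2.
have [inc_inj _] := R_integers.
have iota_inj : injective (iota \o inc) by move=> x y /= /fmorph_inj /inc_inj.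
have Om0 m : m.+1%:R != 0 :> Om.
  rewrite -(rmorph_nat iota) fmorph_eq0 -(rmorph_nat (in_alg L)) fmorph_eq0.
  by rewrite -(rmorph_nat (comp_inj Ql)) fmorph_eq0 pnatr_eq0.
have h1 := mu_lt n_gt0 s1_gt0 s_incr; have h2 := mu_low n_gt0 s1_gt0 s_incr.
have h3 := mu_high n_gt0 s1_gt0 s_incr; have h4 := mu_pred n_gt0 s1_gt0 s_incr.
have h5 := mu_succ n_gt0 s1_gt0 s_incr; have h6 := mu_two_rho n_gt0 s1_gt0 s_incr.
have h7 := s1_two_rho n_gt0 s1_gt0 s_incr.
pose rh := (\sum_(1 <= j < n.+1) (n.*2 - j.*2 + 1) * s (n.+1 - j))%N.
have tp m : tau ^+ m = frame ws vs *m cochar_mx pi ([ffun k : 'I_n => (s (n - k)%N)%:Z] *+ m) *m invmx (frame ws vs).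
  by eapply tau_pow with (s1 := s 1%N) (rho := rh); eassumption.
split.
- rewrite /z_cy /z expr0; congr (Zcyc W K _); apply: functional_extensionality_dep => w.
  case: (pselect (w = v)) => [e|ne]; last by rewrite updv_ne.
  by subst w; rewrite updv_v g_v.
- move=> m m0 sg fx; rewrite /z_cy tp; rewrite /Etilde in fx.
  by eapply level_fixed with (s1 := s 1%N) (rho := rh); eassumption.
- move=> m m0.
  transitivity (\sum_(i < N.+1) q%:R ^+ (i * (rh - s 1%N)) *: hecke (gal_trace R gact (Etilde (m + i)%N) (Etilde m)
     (Zcyc W K (updv g (frame ws vs *m cochar_mx pi ([ffun k : 'I_n => (s (n - k)%N)%:Z] *+ (m + i)) *m invmx (frame ws vs))))) (A i)).
    by apply: eq_bigr => i _; rewrite /z_cy tp.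
  rewrite /Etilde.
  by eapply norm_relation with (s1 := s 1%N) (rho := rh); eassumption.
Qed.
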